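(* Let $\Omega\subset\mathbb{R}^N$ be a bounded domain, $1<p<\infty$, $h\in W^{-1,p'}(\Omega)$, and let $f:\Omega\times\mathbb{R}\to\mathbb{R}$ be a Carathéodory function such that $\sup_{|s|\le R}|f(\cdot,s)|\in L^1(\Omega)$ for all $R>0$. Put $F(x,s)=\int_0^s f(x,t)\,dt$, $G(x,s)=F(x,s)-\frac{\lambda_1}{p}|s|^p$ and $G_1^{\pm}(x)=\limsup_{s\to\pm\infty}\frac{G(x,s)}{|s|}$. Suppose that (1) $G_1^{\pm}\le\eta$ a.e. uniformly in $\Omega$ for some $\eta\in Y_1$; (2) $\int_\Omega G_1^-(x)\varphi_1(x)\,dx<\langle h,\varphi_1\rangle<-\int_\Omega G_1^+(x)\varphi_1(x)\,dx$. Then the functional $\Phi(u)=\frac1p\int_\Omega|\nabla u|^p\,dx-\int_\Omega F(x,u)\,dx-\langle h,u\rangle$ achieves its minimum over $W^{1,p}_0(\Omega)$ at a point $u\in W_0^{1,p}(\Omega)$ with $\int_\Omega F(x,u)\,dx\in\mathbb{R}$, and hence $u$ is a weak solution of the problem $-\Delta_p u=f(x,u)+h$ in $\Omega$, $u=0$ on $\partial\Omega$.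
   Context: Notation: $p'$ is the conjugate exponent of $p$; $p^*=Np/(N-p)$ if $p<N$; $\langle\cdot,\cdot\rangle$ is the duality pairing between $W^{-1,p'}(\Omega)$ and $W^{1,p}_0(\Omega)$; $\|\cdot\|_{1,p}$ is the usual norm of $W^{1,p}_0(\Omega)$; $\Delta_p u=\operatorname{div}(|\nabla u|^{p-2}\nabla u)$, viewed as a map $W^{1,p}_0(\Omega)\to W^{-1,p'}(\Omega)$. The first eigenvalue of $-\Delta_p$ is $\lambda_1=\min\{\int_\Omega|\nabla u|^p\,dx/\int_\Omega|u|^p\,dx:\ u\in W_0^{1,p}(\Omega)\setminus\{0\}\}$; it is simple, and $\varphi_1$ denotes the associated normalized eigenfunction with $\varphi_1>0$ a.e. $Y_1$ is the set of measurable functions $\eta$ on $\Omega$ such that $\eta\in L^1(\Omega)$ if $p>N$; $\eta\in L^q(\Omega)$ for some $q>1$ if $p=N$; $\eta\in L^{(p^* )'}(\Omega)$ if $p<N$ (here $(p^* )'$ is the conjugate exponent of $p^*$). ''$G_1^\pm\le\eta$ a.e. uniformly in $\Omega$'' means: for every $\varepsilon>0$ there is $R>0$ such that $G(x,s)\le(\eta(x)+\varepsilon)|s|$ for a.e. $x\in\Omega$ and all $|s|\ge R$. Convention: if $\int_\Omega F(x,u)^+\,dx=\int_\Omega F(x,u)^-\,dx=+\infty$, then $\int_\Omega(-F(x,u))\,dx$ is taken to be $+\infty$, so $\Phi(u)=+\infty$; $\Phi$ takes values in $\overline{\mathbb{R}}$. Weak solutions: let $L^\infty_0(\Omega)$ be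 the set of $v\in L^\infty(\Omega)$ vanishing a.e. outside a compact subset of $\Omega$. For $u\in W^{1,p}_0(\Omega)$ let $V_u=\{v\in W^{1,p}_0(\Omega)\cap L^\infty_0(\Omega):\ u\in L^\infty(\{x\in\Omega: v(x)\ne0\})\}$ and $A_u=\{v\in W_0^{1,p}(\Omega):\ f(x,u)v\in L^1(\Omega)\}$. Both are dense linear subspaces of $W^{1,p}_0(\Omega)$ and $V_u\subset A_u$. One says $f(x,u)\in W^{-1,p'}(\Omega)$ if $\sup\{\int_\Omega f(x,u)v\,dx:\ v\in A_u,\ \|v\|_{1,p}\le1\}<+\infty$ (the supremum over $V_u$ has the same value); then $f(x,u)$ is identified with the unique continuous linear extension to $W_0^{1,p}(\Omega)$ of $v\mapsto\int_\Omega f(x,u)v\,dx$, $v\in V_u$. A function $u\in W_0^{1,p}(\Omega)$ is a weak solution of the problem if $f(x,u)\in W^{-1,p'}(\Omega)$ in this sense and $-\Delta_pu=f(x,u)+h$ holds in $W^{-1,p'}(\Omega)$; in particular $\int_\Omega|\nabla u|^{p-2}\nabla u\cdot\nabla v\,dx=\int_\Omega f(x,u)v\,dx+\langle h,v\rangle$ for all $v\in A_u$. *)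

(* Defs.v *)
From HB Require Import structures.
From mathcomp Require Import all_boot all_order all_algebra.
From mathcomp Require Import all_classical all_reals all_analysis.

Set Implicit Arguments.
Unset Strict Implicit.
Unset Printing Implicit Defensive.
Import Order.TTheory GRing.Theory Num.Theory.
Import numFieldNormedType.Exports.

Local Open Scope classical_set_scope.
Local Open Scope ring_scope.

Section lebesgue_tuple.
Variable R : realType.
Local Notation Rt := (measurableTypeR R).

Section cons_measure.
Variables (n : nat) (m : {sigma_finite_measure set (n.-tuple Rt) -> \bar R}).

Definition cons_pair (z : Rt * n.-tuple Rt) : n.+1.-tuple Rt :=
  [the n.+1.-tuple Rt of z.1 :: z.2].

Let measurable_cons_pair : measurable_fun setT cons_pair.
Proof. exact: measurable_cons. Qed.

Definition cons_measure : set (n.+1.-tuple Rt) -> \bar R :=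
  pushforward (@lebesgue_measure R \x m)%E cons_pair.

Let cons_measure0 : cons_measure set0 = 0%E.
Proof. by rewrite /cons_measure /pushforward preimage_set0 measure0. Qed.

Let cons_measure_ge0 A : (0 <= cons_measure A)%E.
Proof. exact: measure_ge0. Qed.

Let cons_measure_sigma_additive : semi_sigma_additive cons_measure.
Proof.
move=> F mF tF mUF; rewrite /cons_measure /pushforward preimage_bigcup.
apply: measure_semi_sigma_additive.
- by move=> k; rewrite -[X in measurable X]setTI; exact: measurable_cons_pair.
- apply/trivIsetP => i j _ _ ij; rewrite -preimage_setI.
  by move/trivIsetP : tF => /(_ _ _ _ _ ij) ->//; rewrite preimage_set0.
- rewrite -preimage_bigcup -[X in measurable X]setTI.
  exact: measurable_cons_pair.
Qed.

HB.instance Definition _ := isMeasure.Build _ _ _ cons_measure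
  cons_measure0 cons_measure_ge0 cons_measure_sigma_additive.

Let cons_measure_sigma_finite : sigma_finite setT cons_measure.
Proof.
have /sigma_finiteP[F [TF ndF Foo]] := sigma_finiteT (@lebesgue_measure R).
have /sigma_finiteP[G [TG ndG Goo]] := sigma_finiteT m.
pose tl (t : n.+1.-tuple Rt) : n.-tuple Rt := [tuple of behead t].
exists (fun k => (fun t => tnth t ord0) @^-1` F k `&` tl @^-1` G k).
  rewrite predeqE => t; split => // _.
  have [i _ Fi] : (\bigcup_i F i) (tnth t ord0) by rewrite -TF.
  have [j _ Gj] : (\bigcup_i G i) (tl t) by rewrite -TG.
  exists (maxn i j) => //; split => /=.
    by move: Fi; exact/subsetPset/ndF/leq_maxl.
  by move: Gj; exact/subsetPset/ndG/leq_maxr.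
move=> k; have [mF Fk] := Foo k; have [mG Gk] := Goo k; split.
  apply: measurableI; rewrite -[X in measurable X]setTI.
    exact: measurable_tnth.
  exact: measurable_behead.
rewrite /cons_measure /pushforward.
rewrite (_ : _ @^-1` _ = F k `*` G k).
  by rewrite product_measure1E// lte_mul_pinfty// ge0_fin_numE.
have tlK x t : tl (cons_pair (x, t)) = t by apply: val_inj.
by rewrite predeqE => -[x t]; split=> -[/= Fx]; rewrite ?tlK => Gt; split; rewrite //= tlK.
Qed.

HB.instance Definition _ :=
  Measure_isSigmaFinite.Build _ _ _ cons_measure cons_measure_sigma_finite.

End cons_measure.

Fixpoint lebesgue_tuple (n : nat) :
    {sigma_finite_measure set (n.-tuple Rt) -> \bar R} :=
  match n with
  | 0 => [the {sigma_finite_measure set (0.-tuple Rt) -> \bar R}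
          of \d_([tuple] : 0.-tuple Rt)]
  | k.+1 => [the {sigma_finite_measure set (k.+1.-tuple Rt) -> \bar R}
             of cons_measure (lebesgue_tuple k)]
  end.

End lebesgue_tuple.

(* Lebesgue measure on R^N, in the Caratheodory construction: the sets that
   are measurable in 'rV[R]_N are all the Lebesgue-measurable ones, not only
   the Borel ones. *)
Section lebesgue_rV.
Variables (R : realType) (N : nat).

Definition lebesgue_outer (A : set 'rV[R]_N) : \bar R :=
  mu_ext (lebesgue_tuple R N) [set t | A (\row_i tnth t i)].

Let lebesgue_outer0 : lebesgue_outer set0 = 0%E.
Proof. exact: (outer_measure0 (mu_ext (lebesgue_tuple R N))). Qed.

Let lebesgue_outer_ge0 A : (0 <= lebesgue_outer A)%E.
Proof. exact: (outer_measure_ge0 (mu_ext (lebesgue_tuple R N))). Qed.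

Let le_lebesgue_outer : {homo lebesgue_outer : A B / A `<=` B >-> (A <= B)%E}.
Proof. by move=> A B AB; apply: le_outer_measure => t; exact: AB. Qed.

Let lebesgue_outer_sigma_subadditive : sigma_subadditive lebesgue_outer.
Proof.
move=> F.
exact: (outer_measure_sigma_subadditive (mu_ext (lebesgue_tuple R N))).
Qed.

HB.instance Definition _ := isOuterMeasure.Build R 'rV[R]_N lebesgue_outer
  lebesgue_outer0 lebesgue_outer_ge0 le_lebesgue_outer
  lebesgue_outer_sigma_subadditive.

HB.instance Definition _ :=
  @isMeasurable.Build (caratheodory_display lebesgue_outer) 'rV[R]_N
    (caratheodory_measurable lebesgue_outer)
    (caratheodory_measurable_set0 lebesgue_outer)
    (@caratheodory_measurable_setC _ _ lebesgue_outer)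
    (@caratheodory_measurable_bigcup _ _ lebesgue_outer).

Definition lebesgue_rV : set 'rV[R]_N -> \bar R := lebesgue_outer.

Let caratheodory_meas (mu : {outer_measure set 'rV[R]_N -> \bar R}) :
    {measure set (caratheodory_type mu) -> \bar R} :=
  (mu : set (caratheodory_type mu) -> \bar R).

Let U := caratheodory_meas lebesgue_outer.

HB.instance Definition _ := isMeasure.Build _ 'rV[R]_N R lebesgue_rV
  (measure0 U) (measure_ge0 U) (@measure_semi_sigma_additive _ _ _ U).

End lebesgue_rV.
Arguments lebesgue_rV {R N}.

Section sobolev.
Variables (R : realType) (N : nat).
Implicit Types (E Omega : set 'rV[R]_N) (u v : 'rV[R]_N -> R)
  (g : 'rV[R]_N -> 'rV[R]_N).
Local Notation mu := (@lebesgue_rV R N).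

Definition dotv (a b : 'rV[R]_N) : R := \sum_i a 0 i * b 0 i.

(* The library norm of 'rV[R]_N is the sup norm; gradients are measured with
   the Euclidean one. *)
Definition enorm (a : 'rV[R]_N) : R := Num.sqrt (dotv a a).

Definition domain Omega : Prop :=
  [/\ Omega !=set0, open Omega & connected Omega].

Definition inLp E (q : \bar R) u : Prop :=
  measurable_fun E u /\ ('N[mu]_q[EFin \o (u \_ E)] < +oo)%E.

Definition partials (s : seq 'I_N) u : 'rV[R]_N -> R :=
  foldr (fun i w => 'D_(delta_mx 0 i) w) u s.

Definition smooth u : Prop := forall s : seq 'I_N,
  continuous (partials s u) /\
  forall i x, derivable (partials s u) x (delta_mx 0 i).

Definition test_function Omega u : Prop :=
  smooth u /\ exists K : set 'rV[R]_N,
    [/\ compact K, K `<=` Omega & forall x, ~ K x -> u x = 0].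

Definition locally_integrable_in Omega u : Prop :=
  forall K : set 'rV[R]_N, compact K -> K `<=` Omega ->
    mu.-integrable K (EFin \o u).

Definition weak_gradient Omega u g : Prop :=
  locally_integrable_in Omega u /\
  forall i : 'I_N, locally_integrable_in Omega (fun x => g x 0 i) /\
    forall phi, test_function Omega phi ->
      \int[mu]_(x in Omega) (u x * 'D_(delta_mx 0 i) phi x) =
      - \int[mu]_(x in Omega) (g x 0 i * phi x).

(* Weak gradients are unique up to null sets; this selects a representative
   (and is 0 when there is none). *)
Definition grad Omega u : 'rV[R]_N -> 'rV[R]_N :=
  xget (fun=> 0) [set g | weak_gradient Omega u g].

(* Elements of Sobolev spaces are represented by functions on R^N, of which
   only the values a.e. on Omega matter. *)
Definition W1p Omega (p : R) : set ('rV[R]_N -> R) :=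
  [set u | inLp Omega p%:E u /\
    exists g, weak_gradient Omega u g /\
      forall i, inLp Omega p%:E (fun x => g x 0 i)].

Definition norm1p Omega (p : R) u : R :=
  (\int[mu]_(x in Omega) (`|u x| `^ p + enorm (grad Omega u x) `^ p)) `^ p^-1.

Definition W01p Omega (p : R) : set ('rV[R]_N -> R) :=
  [set u | W1p Omega p u /\
    forall e : R, 0 < e ->
      exists2 phi, test_function Omega phi & norm1p Omega p (u \- phi) < e].

(* W^{-1,p'}: the bound by the norm makes T constant on classes modulo a.e.
   equality. *)
Definition dualW01p Omega (p : R) (T : ('rV[R]_N -> R) -> R) : Prop :=
  (forall (a : R) u v, W01p Omega p u -> W01p Omega p v ->
     T (fun x => a * u x + v x) = a * T u + T v) /\
  exists C : R, forall u, W01p Omega p u -> `|T u| <= C * norm1p Omega p u.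

(* The pairing of - Delta_p u with v. *)
Definition neg_plaplacian Omega (p : R) u v : R :=
  \int[mu]_(x in Omega)
    (enorm (grad Omega u x) `^ (p - 2) *
     dotv (grad Omega u x) (grad Omega v x)).

Definition rayleigh Omega (p : R) u : R :=
  (\int[mu]_(x in Omega) (enorm (grad Omega u x) `^ p)) /
  (\int[mu]_(x in Omega) (`|u x| `^ p)).

Definition first_eigenvalue Omega (p lambda : R) : Prop :=
  let S := [set rayleigh Omega p u | u in
    [set u | W01p Omega p u /\ ~ {ae mu, forall x, Omega x -> u x = 0}]] in
  S lambda /\ lbound S lambda.

(* The eigenfunction is normalized in L^p; `|u| `^ (p - 2) * u is 0 where u is 0. *)
Definition normalized_positive_eigenfunction Omega (p lambda : R) u : Prop :=
  [/\ W01p Omega p u,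
      {ae mu, forall x, Omega x -> 0 < u x},
      \int[mu]_(x in Omega) (`|u x| `^ p) = 1 &
      forall v, W01p Omega p v -> neg_plaplacian Omega p u v =
        lambda * \int[mu]_(x in Omega) (`|u x| `^ (p - 2) * u x * v x)].

Definition pstar (p : R) : R := N%:R * p / (N%:R - p).

Definition inY1 Omega (p : R) (eta : 'rV[R]_N -> R) : Prop :=
  [/\ N%:R < p -> inLp Omega 1 eta,
      p = N%:R -> exists2 q : R, 1 < q & inLp Omega q%:E eta &
      p < N%:R -> inLp Omega (hoelder_conjugate (pstar p)%:E) eta].

End sobolev.

Section nonlinearity.
Variables (R : realType) (N : nat).
Implicit Types (Omega : set 'rV[R]_N) (f : 'rV[R]_N -> R -> R)
  (u v : 'rV[R]_N -> R).
Local Notation mu := (@lebesgue_rV R N).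

Definition caratheodory_function Omega f : Prop :=
  (forall s, measurable_fun Omega (f ^~ s)) /\
  {ae mu, forall x, Omega x -> continuous (f x)}.

Definition primitive f (x : 'rV[R]_N) (s : R) : R :=
  if 0 <= s then \int[lebesgue_measure]_(t in `[0, s]) f x t
  else - \int[lebesgue_measure]_(t in `[s, 0]) f x t.

Definition resonant_primitive f (p lambda : R) (x : 'rV[R]_N) (s : R) : R :=
  primitive f x s - lambda / p * `|s| `^ p.

Definition G1plus (G : 'rV[R]_N -> R -> R) (x : 'rV[R]_N) : \bar R :=
  limf_esup (fun s => (G x s / `|s|)%:E) (pinfty_nbhs R).

Definition G1minus (G : 'rV[R]_N -> R -> R) (x : 'rV[R]_N) : \bar R :=
  limf_esup (fun s => (G x s / `|s|)%:E) (ninfty_nbhs R).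

Definition G1_le_unif Omega (G : 'rV[R]_N -> R -> R) (eta : 'rV[R]_N -> R) :
    Prop :=
  forall e : R, 0 < e -> exists2 r : R, 0 < r &
    {ae mu, forall x, Omega x ->
      forall s, r <= `|s| -> G x s <= (eta x + e) * `|s|}.

(* The integral of -w, equal to +oo when the integrals of both w^+ and w^-
   are +oo (the library integral would be -oo). *)
Definition integralN_cvt Omega (w : 'rV[R]_N -> R) : \bar R :=
  let wp := (\int[mu]_(x in Omega) (Num.max (w x) 0)%:E)%E in
  let wm := (\int[mu]_(x in Omega) (Num.max (- w x) 0)%:E)%E in
  if (wp == +oo)%E && (wm == +oo)%E then +oo%E else (wm - wp)%E.

Definition energy Omega (p : R) f (h : ('rV[R]_N -> R) -> R) u : \bar R :=
  ((p^-1 * \int[mu]_(x in Omega) (enorm (grad Omega u x) `^ p))%:E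
   + integralN_cvt Omega (fun x => primitive f x (u x)) - (h u)%:E)%E.

Definition Linfty0 Omega v : Prop :=
  inLp Omega +oo%E v /\ exists K : set 'rV[R]_N,
    [/\ compact K, K `<=` Omega &
        {ae mu, forall x, Omega x -> ~ K x -> v x = 0}].

Definition Vspace Omega (p : R) u : set ('rV[R]_N -> R) :=
  [set v | [/\ W01p Omega p v, Linfty0 Omega v &
               inLp (Omega `&` [set x | v x != 0]) +oo%E u]].

Definition Aspace Omega (p : R) f u : set ('rV[R]_N -> R) :=
  [set v | W01p Omega p v /\
           mu.-integrable Omega (fun x => (f x (u x) * v x)%:E)].

Definition nemytskii_in_dual Omega (p : R) f u : Prop :=
  (ereal_sup [set (\int[mu]_(x in Omega) (f x (u x) * v x))%:E | v in
     [set v | Aspace Omega p f u v /\ (norm1p Omega p v <= 1)%R]] < +oo)%E.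

(* T is the element of W^{-1,p'} with which f(x,u) is identified. *)
Definition nemytskii_ext Omega (p : R) f u (T : ('rV[R]_N -> R) -> R) : Prop :=
  dualW01p Omega p T /\ forall v, Vspace Omega p u v ->
    T v = \int[mu]_(x in Omega) (f x (u x) * v x).

Definition weak_solution Omega (p : R) f (h : ('rV[R]_N -> R) -> R) u : Prop :=
  [/\ W01p Omega p u, nemytskii_in_dual Omega p f u &
      exists2 T, nemytskii_ext Omega p f u T &
        forall v, W01p Omega p v -> neg_plaplacian Omega p u v = T v + h v].

End nonlinearity.

(* Main.v *)
(** Elements of W_0^{1,p} are handled as pairs (u, g) that are limits of pairs
    (phi, grad phi) of test functions; chain rules, lattice operations and the
    embeddings (Rellich, Morrey, Sobolev) are proved on test functions and pass
    to such limits. The embeddings compare phi with its averages over nested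
    dyadic boxes, Doob's inequality replacing the Hardy-Littlewood one; weak
    lower semicontinuity comes from the uniform convexity of the L^p norm of
    gradients, which makes suitable convex combinations converge strongly.

    Coercivity: if a sequence u_n of bounded energy had norms t_n tending to
    infinity, then u_n / t_n would converge to a minimizer of the Rayleigh
    quotient, which by Picone's identity is c phi_1 with c <> 0. The inequality
    J(u_n) >= lambda_1 |u_n|^p then bounds the integral of G(x, u_n) / t_n from
    below, whereas Fatou's lemma, with (1) as uniformly integrable majorant,
    bounds its upper limit by |c| times the integral of G_1^{+-} phi_1: this
    contradicts (2). A minimizer exists by compactness and Fatou's lemma.

    The Euler-Lagrange equation is obtained against bounded v such that u is
    bounded on {v <> 0}, the convexity of J giving the one-sided estimate. A
    nonnegative v in A_u is the limit of max(min(v, m - |u|), 0), which is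
    bounded in W_0^{1,p} and dominated by v. *)

Require Import Defs.
From mathcomp Require Import all_boot all_order all_algebra.
From mathcomp Require Import all_classical all_reals all_analysis.
From mathcomp Require Import measurable_realfun ess_sup_inf ring lra.
Set Implicit Arguments.
Unset Strict Implicit.
Unset Printing Implicit Defensive.
Import Order.TTheory GRing.Theory Num.Theory.
Import numFieldNormedType.Exports.
Local Open Scope classical_set_scope.
Local Open Scope ring_scope.

(** * Integration *)

(** Simplicity of the first eigenvalue is the delicate point. Equality in Picone's identity says
    formally that v/phi_1 has zero gradient, but v/phi_1 is not known to be weakly differentiable,
    as nothing bounds phi_1 from below on compact sets. The nonnegative Picone integrand also gives
    a Hardy inequality: psi grad phi_1/phi_1 is in L^p for each test function psi. This suffices to
    show that w = v - c phi_1, with c making the integral of w zero, has constant sign: w_+/(w_+ +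
    e) tends to the indicator of {w > 0} while its gradients tend to 0 on compact sets.

    The boxes have their sides halved one at a time, so volumes are halved at each level and sides
    decay at least like 2^(-l/d) for every d >= N. Keeping d free turns the case p = N into a case p
    < d.

    In the blow-up G_1^+ and G_1^- may be -oo. They enter only through a pointwise comparison with
    an integrable function produced by Fatou's lemma. *)

Section real_integral.
Context d (T : measurableType d) (R : realType).
Variables (mu : {measure set T -> \bar R}) (D : set T).
Hypothesis mD : measurable D.
Implicit Types f g h : T -> R.
Local Notation I f := (\int[mu]_(x in D) f x).
Local Notation intg f := (mu.-integrable D (EFin \o f)).
Local Notation ae P := {ae mu, forall x, D x -> P x}.

Lemma intg_meas f : intg f -> measurable_fun D f.
Proof. by move=> /measurable_int /measurable_EFinP. Qed.

Lemma intg_fin f : intg f -> (\int[mu]_(x in D) (f x)%:E = (I f)%:E)%E.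
Proof. by move=> fi; rewrite /Rintegral fineK//; exact: integrable_fin_num. Qed.

Lemma intg_add f g : intg f -> intg g -> intg (fun x => f x + g x).
Proof.
move=> fi gi; have := integrableD mD fi gi.
by apply: eq_integrable => // x _ /=; rewrite EFinD.
Qed.

Lemma intg_scale c f : intg f -> intg (fun x => c * f x).
Proof.
move=> fi; have := integrableZl mD c fi.
by apply: eq_integrable => // x _ /=; rewrite EFinM.
Qed.

Lemma intg_opp f : intg f -> intg (fun x => - f x).
Proof.
move=> fi; have := integrableN fi.
by apply: eq_integrable => // x _ /=; rewrite EFinN.
Qed.

Lemma intg_sub f g : intg f -> intg g -> intg (fun x => f x - g x).
Proof. by move=> fi gi; apply: intg_add fi _; exact: intg_opp. Qed.

Lemma intg_abs f : intg f -> intg (fun x => `|f x|).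
Proof. by move=> fi; have := integrable_abse fi. Qed.

Lemma intg_le f g : measurable_fun D f -> (forall x, D x -> `|f x| <= g x) ->
  intg g -> intg f.
Proof.
move=> mf fg gi; apply: le_integrable gi => //; first exact/measurable_EFinP.
by move=> x Dx /=; rewrite lee_fin (le_trans (fg x Dx))// ler_norm.
Qed.

Lemma intg_le_ae f g : measurable_fun D f -> ae (fun x => `|f x| <= g x) ->
  intg g -> intg f.
Proof.
move=> mf fg gi; apply/integrableP; split; first exact/measurable_EFinP.
have /integrableP[mg goo] := intg_abs gi.
apply: le_lt_trans goo; apply: ae_ge0_le_integral => //.
- by apply: measurableT_comp => //; exact/measurable_EFinP.
- by apply: measurableT_comp.
- apply: filterS fg => x fg Dx /=; rewrite lee_fin normr_id.
  by rewrite (le_trans (fg Dx))// ler_norm.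
Qed.

Lemma intg_eq f g : (forall x, D x -> f x = g x) -> intg f -> intg g.
Proof.
by move=> fg; apply: eq_integrable => // x; rewrite inE => Dx /=; rewrite fg.
Qed.

Lemma I_add f g : intg f -> intg g -> I (fun x => f x + g x) = I f + I g.
Proof. by move=> fi gi; exact: RintegralD. Qed.

Lemma I_sub f g : intg f -> intg g -> I (fun x => f x - g x) = I f - I g.
Proof. by move=> fi gi; exact: RintegralB. Qed.

Lemma I_scale c f : intg f -> I (fun x => c * f x) = c * I f.
Proof. by move=> fi; exact: RintegralZl. Qed.

Lemma I_opp f : intg f -> I (fun x => - f x) = - I f.
Proof.
move=> fi; rewrite -mulN1r -I_scale//.
by apply: eq_Rintegral => x _; rewrite mulN1r.
Qed.

Lemma I_eq f g : (forall x, D x -> f x = g x) -> I f = I g.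
Proof. by move=> fg; apply: eq_Rintegral => x; rewrite inE => /fg. Qed.

Lemma I_0 : I (fun=> 0) = 0.
Proof. by rewrite /Rintegral integral0. Qed.

Lemma I_ge0 f : (forall x, D x -> 0 <= f x) -> 0 <= I f.
Proof. by move=> f0; exact: Rintegral_ge0. Qed.

Lemma I_le f g : intg f -> intg g -> (forall x, D x -> f x <= g x) ->
  I f <= I g.
Proof. by move=> fi gi fg; exact: le_Rintegral. Qed.

Lemma I_abs f : intg f -> `|I f| <= I (fun x => `|f x|).
Proof. by move=> fi; exact: le_normr_Rintegral. Qed.

Lemma I_abs_le f g : measurable_fun D f -> intg g ->
  (forall x, D x -> `|f x| <= g x) -> `|I f| <= I g.
Proof.
move=> mf gi fg; have fi : intg f by exact: intg_le gi.
by apply: (le_trans (I_abs fi)); apply: I_le => //; exact: intg_abs.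
Qed.

Lemma I_eq_ae f g : measurable_fun D f -> measurable_fun D g ->
  ae (fun x => f x = g x) -> I f = I g.
Proof.
move=> mf mg fg; rewrite /Rintegral; congr fine.
apply: ae_eq_integral => //; try exact/measurable_EFinP.
by apply: filterS fg => x fg Dx /=; rewrite fg.
Qed.

Lemma intg_eq_ae f g : measurable_fun D g -> ae (fun x => f x = g x) ->
  intg f -> intg g.
Proof.
move=> mg fg fi; apply: (intg_le_ae mg _ (intg_abs fi)).
by apply: filterS fg => x fg Dx; rewrite fg.
Qed.

Lemma I_le_ae f g : intg f -> intg g -> ae (fun x => f x <= g x) -> I f <= I g.
Proof.
move=> fi gi fg; rewrite -subr_ge0 -I_sub//.
have hi : intg (fun x => g x - f x) by exact: intg_sub.
rewrite (@I_eq_ae _ (fun x => `|g x - f x|)).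
- by apply: I_ge0 => x _.
- exact: intg_meas.
- exact: intg_meas (intg_abs hi).
- by apply: filterS fg => x fg Dx; rewrite ger0_norm// subr_ge0 fg.
Qed.

Lemma I_eq0 f : intg f -> (forall x, D x -> 0 <= f x) -> I f <= 0 ->
  ae (fun x => f x = 0).
Proof.
move=> fi f0 If; have If0 : I f = 0 by apply/eqP; rewrite eq_le If I_ge0.
have mf := measurable_int mu fi.
have /(ae_eq_integral_abs mu mD mf) h : (\int[mu]_(x in D) `|(EFin \o f) x| = 0)%E.
  under eq_integral => x do
    [rewrite inE => Dx; rewrite /= ger0_norm ?f0//].
  by rewrite intg_fin// If0.
by apply: filterS h => x h Dx; have /= := h Dx => -[].
Qed.

Lemma I_dct (fn : (T -> R)^nat) f g :
  (forall n, measurable_fun D (fn n)) -> measurable_fun D f -> intg g ->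
  ae (fun x => fn n x @[n --> \oo] --> f x) ->
  (forall n, ae (fun x => `|fn n x| <= g x)) ->
  [/\ intg f, I (fun x => `|fn n x - f x|) @[n --> \oo] --> 0 &
      I (fn n) @[n --> \oo] --> I f].
Proof.
move=> mfn mf gi fnf fng.
have := @dominated_convergence _ _ R mu D mD (fun n => EFin \o fn n) (EFin \o f)
  (EFin \o g).
case.
- by move=> n; exact/measurable_EFinP.
- exact/measurable_EFinP.
- apply: filterS fnf => x h Dx; apply: cvg_EFin; first by near=> n.
  exact: h.
- exact: gi.
- have : {ae mu, forall x, forall n, D x -> `|fn n x| <= g x}.
    by apply: ae_foralln => n; apply: fng.
  by apply: filterS => x h n Dx /=; rewrite lee_fin h.
move=> fi h1 h2; split=> //.
- have fnfi n : intg (fun x => `|fn n x - f x|).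
    apply: intg_abs; apply: intg_sub => //.
    exact: (intg_le_ae (mfn n) (fng n) gi).
  exact: (fine_cvg (h1 : _ --> 0%:E)).
- by apply: (@fine_cvg _ _ _ _ (fun n => \int[mu]_(x in D) (fn n x)%:E)%E);
    rewrite -intg_fin.
Unshelve. all: by end_near. Qed.

Lemma I_fatou (fn : (T -> R)^nat) f c :
  (forall n, intg (fn n)) -> (forall n x, D x -> 0 <= fn n x) ->
  measurable_fun D f -> ae (fun x => fn n x @[n --> \oo] --> f x) ->
  (forall n, I (fn n) <= c) -> intg f /\ I f <= c.
Proof.
move=> fni fn0 mf fnf Ifc.
have f0 : ae (fun x => 0 <= f x).
  apply: filterS fnf => x h Dx; have /= := h Dx => {}h.
  have cv : cvgn (fun n => fn n x) by apply/cvg_ex; exists (f x).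
  rewrite -(cvg_lim (@Rhausdorff R) h).
  by apply: limr_ge => //; near=> n; exact: fn0.
have le : (\int[mu]_(x in D) `|f x|%:E <= c%:E)%E.
  have -> : (\int[mu]_(x in D) `|f x|%:E =
      \int[mu]_(x in D) limn_einf (fun n => (fn n x)%:E))%E.
    apply: ae_eq_integral => //.
    - by apply/measurable_EFinP; apply: measurableT_comp.
    (* Measurability of the lower limit comes from that of an upper limit, after a change of
       sign. *)
    - have -> : (fun x => limn_einf (fun n => (fn n x)%:E)) =
          (fun x => - limn_esup (fun n => (- fn n x)%:E))%E.
        apply/funext => x; rewrite -limn_einfN; congr limn_einf.
        by apply/funext => n /=; rewrite opprK.
      apply: measurableT_comp => //; apply: measurable_fun_limn_esup => n.
      by apply/measurable_EFinP; apply: measurableT_comp => //; exact: intg_meas.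
    - apply: filterS2 fnf f0 => x h f0 Dx.
      rewrite ger0_norm ?f0//; apply/esym.
      have hE : (fn n x)%:E @[n --> \oo] --> (f x)%:E.
        by apply: cvg_EFin; [near=> n|exact: h].
      by case: (cvg_limn_einf_sup hE).
  apply: le_trans (fatou mu mD _ _) _.
  - by move=> n; exact: measurable_int (fni n).
  - by move=> n x Dx /=; rewrite lee_fin fn0.
  - rewrite limn_einf_lim; apply: lime_le.
      by apply: ereal_nondecreasing_is_cvgn; exact: nondecreasing_einfs.
    near=> n; apply: (@le_trans _ _ (\int[mu]_(x in D) (fn n x)%:E)%E).
      by apply: ereal_inf_lbound; exists n => /=.
    by rewrite intg_fin// lee_fin.
have fi : intg f.
  apply/integrableP; split; first exact/measurable_EFinP.
  by apply: le_lt_trans le _; rewrite ltry.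
split=> //; apply: (le_trans (ler_norm _)); apply: (le_trans (I_abs fi)).
by rewrite -lee_fin -intg_fin//; exact: intg_abs.
Unshelve. all: by end_near. Qed.

End real_integral.

#[global] Opaque Rintegral.


(** * Lebesgue spaces *)

Lemma subseq_ge (k : nat -> nat) : (forall n, (k n < k n.+1)%N) ->
  forall n, (n <= k n)%N.
Proof. by move=> h; elim=> // n IH; apply: leq_ltn_trans (h n). Qed.

Lemma subseq_cvg (X : topologicalType) (u : nat -> X) (k : nat -> nat) (l : X) :
  (forall n, (n <= k n)%N) -> u n @[n --> \oo] --> l ->
  u (k n) @[n --> \oo] --> l.
Proof.
move=> kn ul; apply: (cvg_comp _ _ _ ul) => A [N _ NA].
by exists N => // n /= Nn; apply: NA; exact: leq_trans (kn n).
Qed.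

(** The bounds 2^-n have a finite sum: along this subsequence a Cauchy sequence has absolutely
    summable increments, which is what a.e. convergence needs. *)
Lemma fast_subseq (R : realType) (dist : nat -> nat -> R) :
  (forall e, 0 < e -> exists N, forall m n, (N <= m)%N -> (N <= n)%N ->
    dist m n <= e) ->
  exists k : nat -> nat, (forall n, (k n < k n.+1)%N) /\
    forall n m, (k n <= m)%N -> dist m (k n) <= 2 ^- n /\ dist (k n) m <= 2 ^- n.
Proof.
move=> h; have [N NP] : exists N : nat -> nat, forall j m n, (N j <= m)%N ->
    (N j <= n)%N -> dist m n <= 2 ^- j.
  suff /choice[N NP] : forall j, exists N, forall m n, (N <= m)%N ->
    (N <= n)%N -> dist m n <= 2 ^- j by exists N.
  by move=> j; apply: h; rewrite invr_gt0 exprn_gt0.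
pose k := fix k n := if n is m.+1 then maxn (k m).+1 (N n) else N 0%N.
have kN n : (N n <= k n)%N by case: n => //= n; exact: leq_maxr.
exists k; split=> [n|n m km] /=; first exact: leq_maxl.
by split; apply: NP => //; exact: leq_trans km.
Qed.

Section abs_series.
Context d (T : measurableType d) (R : realType).
Variables (mu : {measure set T -> \bar R}) (D : set T).
Hypothesis mD : measurable D.
Local Notation I f := (\int[mu]_(x in D) f x).
Local Notation intg f := (mu.-integrable D (EFin \o f)).
Local Notation ae P := {ae mu, forall x, D x -> P x}.

(** By monotone convergence the sum of the series has integral at most [C], hence is finite a.e.,
    and it bounds the increasing partial sums. *)
Lemma ae_cvg_series (f : (T -> R)^nat) (C : R) : (forall n, intg (f n)) ->
  (forall n x, D x -> 0 <= f n x) -> (forall n, \sum_(k < n) I (f k) <= C) ->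
  ae (fun x => cvgn (series (f ^~ x))).
Proof.
move=> fi f0 fC.
have mf n : measurable_fun D (EFin \o f n) by exact: measurable_int (fi n).
have S : (\int[mu]_(x in D) (\sum_(0 <= k <oo) (f k x)%:E) <= C%:E)%E.
  rewrite integral_nneseries//.
  apply: lime_le.
    apply: is_cvg_nneseries => n _ _; apply: integral_ge0 => x Dx.
    by rewrite lee_fin f0.
  near=> n; rewrite big_mkord.
  under eq_bigr => k _ do rewrite (intg_fin mD (fi k)).
  by rewrite sumEFin lee_fin.
have Si : mu.-integrable D (fun x => \sum_(0 <= k <oo) (f k x)%:E)%E.
  apply/integrableP; split.
    apply: (@ge0_emeasurable_sum _ _ _ D (fun k x => (f k x)%:E) xpredT) => //.
      by move=> k x Dx _; rewrite lee_fin f0.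
    by move=> k _; exact: mf.
  under eq_integral => x do [rewrite inE => Dx; rewrite gee0_abs; last
    by apply: nneseries_ge0 => n _ _; rewrite lee_fin f0].
  by apply: le_lt_trans S _; rewrite ltry.
have := integrable_ae mD Si; apply: filterS => x h Dx.
have {h} /fineK h := h Dx.
apply: nondecreasing_is_cvgn.
  apply/nondecreasing_seqP => n; rewrite /series/= big_nat_recr//= lerDl.
  exact: f0.
exists (fine (\sum_(0 <= k <oo) (f k x)%:E)%E) => _ [n _ <-].
rewrite -lee_fin h /series/= -sumEFin; apply: nneseries_lim_ge => k _ _.
by rewrite lee_fin f0.
Unshelve. all: by end_near. Qed.

Lemma ae_cvg_abs (u : (T -> R)^nat) (C : R) : (forall n, intg (u n)) ->
  (forall n, \sum_(k < n) I (fun x => `|u k.+1 x - u k x|) <= C) ->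
  ae (fun x => cvgn (u ^~ x)).
Proof.
move=> ui uC.
have : ae (fun x => cvgn (series (fun k => `|u k.+1 x - u k x|))).
  apply: (@ae_cvg_series (fun k x => `|u k.+1 x - u k x|) C) => // n.
  by apply: intg_abs => //; exact: intg_sub.
apply: filterS => x h Dx; have {}h := h Dx.
have {h} /cvg_ex[l hl] : cvgn (series (fun k => u k.+1 x - u k x)).
    exact: normed_cvg.
  apply/cvg_ex; exists (l + u 0%N x).
  have -> : u ^~ x = (fun n => series (fun k => u k.+1 x - u k x) n + u 0%N x).
    by apply/funext => n; rewrite /series/= telescope_sumr// subrK.
  by apply: cvgD => //; exact: cvg_cst.
Qed.

Lemma ae_lim_measurable (u : (T -> R)^nat) : (forall n, measurable_fun D (u n)) ->
  ae (fun x => cvgn (u ^~ x)) ->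
  exists2 l : T -> R, measurable_fun D l &
    ae (fun x => u n x @[n --> \oo] --> l x).
Proof.
(* This upper limit is measurable, and equals the limit at the points where there is one. *)
move=> mu_ cu; exists (fun x => fine (limn_esup (fun n => (u n x)%:E))).
  apply: measurableT_comp => //; apply: measurable_fun_limn_esup => n.
  exact/measurable_EFinP.
apply: filterS cu => x h Dx; have /cvg_ex[l hl] := h Dx.
have hE : (u n x)%:E @[n --> \oo] --> l%:E by apply: cvg_EFin; [near=> n|].
by have [_ ->] := cvg_limn_einf_sup hE.
Unshelve. all: by end_near. Qed.

End abs_series.

Section powR_aux.
Variable R : realType.
Implicit Types a b r p : R.

Lemma powR_le r a b : 0 <= r -> 0 <= a -> a <= b -> a `^ r <= b `^ r.
Proof.
by move=> r0 a0 ab; apply: ge0_ler_powR => //; rewrite nnegrE// (le_trans a0).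
Qed.

Lemma powRK p a : p != 0 -> 0 <= a -> (a `^ p) `^ p^-1 = a.
Proof. by move=> p0 a0; rewrite -powRrM mulfV// powRr1. Qed.

Lemma powRVK p a : p != 0 -> 0 <= a -> (a `^ p^-1) `^ p = a.
Proof. by move=> p0 a0; rewrite -powRrM mulVf// powRr1. Qed.

End powR_aux.

Section Lp.
Context d (T : measurableType d) (R : realType).
Variables (mu : {measure set T -> \bar R}) (D : set T).
Hypothesis mD : measurable D.
Implicit Types (u v w : T -> R) (p q : R).
Local Notation I f := (\int[mu]_(x in D) f x).
Local Notation intg f := (mu.-integrable D (EFin \o f)).
Local Notation ae P := {ae mu, forall x, D x -> P x}.

Definition Lp p u := measurable_fun D u /\ intg (fun x => `|u x| `^ p).

(** An infinite integral counts as 0 here, so [nrm] has meaning only together with [Lp]. *)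
Definition nrm p u := (I (fun x => `|u x| `^ p)) `^ p^-1.

Lemma mpow p u : measurable_fun D u -> measurable_fun D (fun x => `|u x| `^ p).
Proof.
move=> mu_; apply: (@measurableT_comp _ _ _ _ _ _ (fun t => t `^ p)).
  exact: measurable_powR.
exact: measurableT_comp.
Qed.

Lemma Ipow_ge0 p u : 0 <= I (fun x => `|u x| `^ p).
Proof. by apply: I_ge0 => x _; exact: powR_ge0. Qed.

Lemma nrm_ge0 p u : 0 <= nrm p u. Proof. exact: powR_ge0. Qed.

Lemma nrm_powR p u : 0 < p -> nrm p u `^ p = I (fun x => `|u x| `^ p).
Proof.
by move=> p0; rewrite /nrm -powRrM mulVf ?gt_eqF// powRr1// Ipow_ge0.
Qed.

Lemma nrm_le p u (c : R) : 0 < p -> 0 <= c -> I (fun x => `|u x| `^ p) <= c `^ p ->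
  nrm p u <= c.
Proof.
move=> p0 c0 h; rewrite -[leRHS](powRK (lt0r_neq0 p0) c0).
by apply: powR_le h; [rewrite invr_ge0 ltW|exact: Ipow_ge0].
Qed.

(** Minkowski's and Hölder's inequalities are applied on the whole space; the function extended by 0
    outside [D] carries them over to [D]. *)
Lemma Lnorm_restrict p u : 0 < p -> 'N[mu]_p%:E[EFin \o (u \_ D)]%E =
  ((\int[mu]_(x in D) (`|u x| `^ p)%:E) `^ p^-1)%E.
Proof.
move=> p0; rewrite unlock /Lnorm [in RHS]integral_mkcond; rewrite /nrm; congr (_ `^ _)%E.
apply: eq_integral => x _ /=; rewrite /patch; case: ifPn => //= _.
by rewrite normr0 powR0 ?gt_eqF.
Qed.

Lemma measurable_restrictR u : measurable_fun D u <->
  measurable_fun setT (u \_ D).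
Proof. by split=> [/(measurable_restrictT _ mD)|/(measurable_restrictT _ mD)]. Qed.

Lemma Lnorm_nrm p u : 0 < p -> Lp p u ->
  'N[mu]_p%:E[EFin \o (u \_ D)]%E = (nrm p u)%:E.
Proof.
by move=> p0 [mu_ ui]; rewrite Lnorm_restrict// intg_fin// poweR_EFin.
Qed.

Lemma Lnorm_Lp p u : 0 < p -> measurable_fun D u ->
  ('N[mu]_p%:E[EFin \o (u \_ D)] < +oo)%E -> Lp p u.
Proof.
move=> p0 mu_; rewrite Lnorm_restrict// => h; split=> //.
apply/integrableP; split; first by apply/measurable_EFinP; exact: mpow.
under eq_integral => x _ do rewrite /= ger0_norm ?powR_ge0//.
rewrite ltey; apply/eqP => E; move: h.
by rewrite E poweRyr ?ltxx// invr_neq0// gt_eqF.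
Qed.

Lemma Lp_le p u v : 0 <= p -> measurable_fun D u ->
  (forall x, D x -> `|u x| <= `|v x|) -> Lp p v ->
  Lp p u /\ nrm p u <= nrm p v.
Proof.
move=> p0 mu_ uv [mv vi].
have le x : D x -> `|u x| `^ p <= `|v x| `^ p.
  by move=> Dx; apply: powR_le => //; exact: uv.
have ui : intg (fun x => `|u x| `^ p).
  apply: intg_le vi => //; first exact: mpow.
  by move=> x Dx; rewrite ger0_norm ?powR_ge0 ?le.
split; first by split.
apply: powR_le; [by rewrite invr_ge0|exact: Ipow_ge0|exact: I_le].
Qed.

Lemma Lp_eq p u v : (forall x, D x -> u x = v x) -> Lp p u -> Lp p v.
Proof.
move=> uv [mu_ ui]; split.
  by apply: eq_measurable_fun mu_ => x; rewrite inE => /uv.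
by apply: intg_eq ui => // x Dx; rewrite uv.
Qed.

Lemma nrm_eq p u v : (forall x, D x -> u x = v x) -> nrm p u = nrm p v.
Proof.
move=> uv; apply: (congr1 (fun t : R => t `^ p^-1)).
by apply: I_eq => x Dx; rewrite uv.
Qed.

Lemma Lp_ae p u v : measurable_fun D v -> ae (fun x => u x = v x) -> Lp p u ->
  Lp p v.
Proof.
move=> mv uv [mu_ ui]; split=> //; apply: intg_eq_ae ui => //; first exact: mpow.
by apply: filterS uv => x uv Dx; rewrite uv.
Qed.

Lemma nrm_ae p u v : measurable_fun D u -> measurable_fun D v ->
  ae (fun x => u x = v x) -> nrm p u = nrm p v.
Proof.
move=> mu_ mv uv; apply: (congr1 (fun t : R => t `^ p^-1)); apply: I_eq_ae => //; try exact: mpow.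
by apply: filterS uv => x uv Dx; rewrite uv.
Qed.

Lemma Lp0 p : p != 0 -> Lp p (fun=> 0).
Proof.
move=> p0; split=> //; apply: (@eq_integrable _ _ _ mu D mD (cst 0%E)).
  by move=> x _ /=; rewrite normr0 powR0.
exact: integrable0.
Qed.

Lemma nrm0 p : p != 0 -> nrm p (fun=> 0) = 0.
Proof.
move=> p0; rewrite /nrm (@I_eq _ _ _ mu D _ (fun=> 0)).
  by rewrite I_0 powR0// invr_neq0.
by move=> x _; rewrite normr0 powR0.
Qed.

Lemma Lp_scale p c u : Lp p u -> Lp p (fun x => c * u x).
Proof.
move=> [mu_ ui]; split; first exact: measurable_funM.
have := intg_scale mD (`|c| `^ p) ui; apply: intg_eq => // x Dx.
by rewrite normrM powRM.
Qed.

Lemma nrm_scale p c u : p != 0 -> Lp p u ->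
  nrm p (fun x => c * u x) = `|c| * nrm p u.
Proof.
move=> p0 [mu_ ui]; rewrite /nrm.
rewrite (@I_eq _ _ _ mu D _ (fun x => `|c| `^ p * `|u x| `^ p)); last first.
  by move=> x Dx; rewrite normrM powRM.
rewrite I_scale// powRM ?powR_ge0 ?Ipow_ge0// -powRrM mulfV// powRr1//.
Qed.

Lemma Lp_opp p u : Lp p u -> Lp p (fun x => - u x).
Proof.
by move=> /(Lp_scale (-1)); apply: Lp_eq => x _; rewrite mulN1r.
Qed.

Lemma nrm_opp p u : nrm p (fun x => - u x) = nrm p u.
Proof.
apply: (congr1 (fun t : R => t `^ p^-1)).
by apply: I_eq => x _; rewrite normrN.
Qed.

Lemma nrmC p u v : nrm p (fun x => u x - v x) = nrm p (fun x => v x - u x).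
Proof.
apply: (congr1 (fun t : R => t `^ p^-1)); apply: I_eq => x _.
by rewrite distrC.
Qed.

Lemma nrm1E u : nrm 1 u = I (fun x => `|u x|).
Proof.
rewrite /nrm invr1 powRr1; last exact: Ipow_ge0.
by apply: I_eq => x _; rewrite powRr1.
Qed.

#[local] Opaque nrm.

Section p_ge1.
Variable p : R.
Hypothesis p1 : 1 <= p.
Let p0 : 0 < p. Proof. exact: lt_le_trans p1. Qed.

Lemma Lp_add_nrm u v : Lp p u -> Lp p v -> Lp p (fun x => u x + v x) /\
  nrm p (fun x => u x + v x) <= nrm p u + nrm p v.
Proof.
move=> Lu Lv; have [mu_ _] := Lu; have [mv _] := Lv.
have mw : measurable_fun D (fun x => u x + v x) by exact: measurable_funD.
have := minkowski_EFin mu (proj1 (measurable_restrictR u) mu_)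
  (proj1 (measurable_restrictR v) mv) p1.
rewrite Lnorm_nrm// Lnorm_nrm//.
have -> : (u \_ D) \+ (v \_ D) = (fun x => u x + v x) \_ D.
  apply/funext => x; rewrite /patch /=; case: ifPn => //= _; exact: addr0.
move=> h; have Lw : Lp p (fun x => u x + v x).
  by apply: Lnorm_Lp => //; apply: le_lt_trans h _; rewrite -EFinD ltry.
by split=> //; move: h; rewrite Lnorm_nrm// -EFinD lee_fin.
Qed.

Lemma Lp_add u v : Lp p u -> Lp p v -> Lp p (fun x => u x + v x).
Proof. by move=> Lu Lv; case: (Lp_add_nrm Lu Lv). Qed.

Lemma nrm_add u v : Lp p u -> Lp p v ->
  nrm p (fun x => u x + v x) <= nrm p u + nrm p v.
Proof. by move=> Lu Lv; case: (Lp_add_nrm Lu Lv). Qed.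

Lemma Lp_sub u v : Lp p u -> Lp p v -> Lp p (fun x => u x - v x).
Proof. by move=> Lu Lv; apply: Lp_add => //; exact: Lp_opp. Qed.

Lemma nrm_sub u v : Lp p u -> Lp p v ->
  nrm p (fun x => u x - v x) <= nrm p u + nrm p v.
Proof.
by move=> Lu Lv; rewrite -(nrm_opp p v); apply: nrm_add => //; exact: Lp_opp.
Qed.

Lemma nrm_dist u v w : Lp p u -> Lp p v -> Lp p w ->
  nrm p (fun x => u x - w x) <=
  nrm p (fun x => u x - v x) + nrm p (fun x => v x - w x).
Proof.
move=> Lu Lv Lw; rewrite (@nrm_eq _ _ (fun x => (u x - v x) + (v x - w x))).
  by apply: nrm_add; exact: Lp_sub.
by move=> x _; rewrite addrA subrK.
Qed.

Lemma nrm_le_sub u v : Lp p u -> Lp p v ->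
  nrm p u <= nrm p v + nrm p (fun x => u x - v x).
Proof.
move=> Lu Lv; rewrite (@nrm_eq _ _ (fun x => v x + (u x - v x))).
  by apply: nrm_add => //; exact: Lp_sub.
by move=> x _; rewrite addrC subrK.
Qed.

Lemma nrm_subxx u : nrm p (fun x => u x - u x) = 0.
Proof.
rewrite -[RHS](nrm0 (lt0r_neq0 p0)); apply: nrm_eq => x _; exact: subrr.
Qed.

Lemma nrm_sub_add u v a b : Lp p u -> Lp p v -> Lp p a -> Lp p b ->
  nrm p (fun x => u x + v x - (a x + b x)) <=
  nrm p (fun x => u x - a x) + nrm p (fun x => v x - b x).
Proof.
move=> Lu Lv La Lb; apply: le_trans (nrm_add (Lp_sub Lu La) (Lp_sub Lv Lb)).
by rewrite le_eqVlt; apply/orP; left; apply/eqP/nrm_eq => x _; ring.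
Qed.

Lemma nrm_sub_scale c u a : Lp p u -> Lp p a ->
  nrm p (fun x => c * u x - c * a x) = `|c| * nrm p (fun x => u x - a x).
Proof.
move=> Lu La; rewrite -(nrm_scale c (lt0r_neq0 p0) (Lp_sub Lu La)).
by apply: nrm_eq => x _; rewrite mulrBr.
Qed.

Lemma nrm_cvg (un : (T -> R)^nat) u : (forall n, Lp p (un n)) -> Lp p u ->
  nrm p (fun x => un n x - u x) @[n --> \oo] --> 0 ->
  nrm p (un n) @[n --> \oo] --> nrm p u.
Proof.
move=> Lun Lu h; apply/cvgrPdist_le => e e0.
move/cvgrPdist_le: h => /(_ e e0); apply: filterS => n.
rewrite sub0r normrN ger0_norm ?nrm_ge0// => h.
rewrite ler_distlC; apply/andP; split.
  rewrite lerBlDr (le_trans (nrm_le_sub Lu (Lun n)))// lerD2l nrmC//.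
by rewrite (le_trans (nrm_le_sub (Lun n) Lu))// lerD2l.
Qed.

Lemma nrm_eq0 u : Lp p u -> nrm p u = 0 -> ae (fun x => u x = 0).
Proof.
move=> [mu_ ui] h; have : ae (fun x => `|u x| `^ p = 0).
  apply: (I_eq0 mD ui); first by move=> x _; exact: powR_ge0.
  by rewrite -nrm_powR// h powR0 ?gt_eqF.
by apply: filterS => x h' Dx; apply/eqP; rewrite -normr_eq0 (powR_eq0_eq0 (h' Dx)).
Qed.

Lemma nrm_dct (un : (T -> R)^nat) u g : (forall n, measurable_fun D (un n)) ->
  measurable_fun D u -> Lp p g ->
  ae (fun x => un n x @[n --> \oo] --> u x) ->
  (forall n, ae (fun x => `|un n x - u x| <= `|g x|)) ->
  nrm p (fun x => un n x - u x) @[n --> \oo] --> 0.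
Proof.
move=> mun mu_ [mg gi] cu ug.
have [|||||_ _ h] := @I_dct _ _ _ mu D mD
  (fun n x => `|un n x - u x| `^ p) (fun=> 0) (fun x => `|g x| `^ p).
- by move=> n; apply: mpow; exact: measurable_funB.
- by [].
- exact: gi.
- apply: filterS cu => x h Dx; have {}h := h Dx.
  have h1 : `|un n x - u x| @[n --> \oo] --> (0 : R).
    rewrite -(normr0 R) -(subrr (u x)); apply: cvg_norm; apply: cvgB => //.
    exact: cvg_cst.
  apply/cvgrPdist_le => e e0.
  have e1 : 0 < e `^ p^-1 by exact: powR_gt0.
  move/cvgrPdist_le: h1 => /(_ _ e1); apply: filterS => n.
  rewrite !sub0r !normrN normr_id (ger0_norm (powR_ge0 _ _)) => h2.
  rewrite -[leRHS](powRVK (lt0r_neq0 p0) (ltW e0)).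
  by apply: powR_le h2 => //; exact: ltW.
- move=> n; apply: filterS (ug n) => x h Dx; rewrite ger0_norm ?powR_ge0//.
  by apply: powR_le; [exact: ltW| |exact: h].
- rewrite I_0 in h; apply/cvgrPdist_le => e e0.
  have e1 : 0 < e `^ p by exact: powR_gt0.
  move/cvgrPdist_le: h => /(_ _ e1); apply: filterS => n.
  rewrite !sub0r !normrN ger0_norm ?Ipow_ge0// => h2.
  by rewrite ger0_norm ?nrm_ge0//; apply: nrm_le => //; exact: ltW.
Qed.

Lemma nrm_fatou (un : (T -> R)^nat) u (c : R) : (forall n, Lp p (un n)) ->
  measurable_fun D u -> ae (fun x => un n x @[n --> \oo] --> u x) ->
  (forall n, nrm p (un n) <= c) -> Lp p u /\ nrm p u <= c.
Proof.
move=> Lun mu_ cu uc; have c0 : 0 <= c by exact: le_trans (nrm_ge0 _ _) (uc 0%N).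
have [|||||ui uic] := @I_fatou _ _ _ mu D mD (fun n x => `|un n x| `^ p)
  (fun x => `|u x| `^ p) (c `^ p).
- by move=> n; case: (Lun n).
- by move=> n x _; exact: powR_ge0.
- exact: mpow.
- apply: filterS cu => x h Dx; have {}h := h Dx.
  (* Away from 0 the power is continuous because it is differentiable; at 0 the limit is checked
     directly. *)
  have [ux0|ux0] := eqVneq (u x) 0.
    rewrite ux0 normr0 powR0 ?gt_eqF//; apply/cvgrPdist_le => e e0.
    have e1 : 0 < e `^ p^-1 by exact: powR_gt0.
    rewrite ux0 in h; move/cvgrPdist_le: h => /(_ _ e1); apply: filterS => n.
    rewrite !sub0r !normrN => h2; rewrite ger0_norm ?powR_ge0//.
    rewrite -[leRHS](powRVK (lt0r_neq0 p0) (ltW e0)).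
    by apply: powR_le h2 => //; exact: ltW.
  apply: (@continuous_cvg _ _ _ _ _ _ (fun t : R => t `^ p)).
    apply: differentiable_continuous; apply/derivable1_diffP.
    by apply: derivable_powR; rewrite in_itv/= andbT normr_gt0.
  exact: cvg_norm.
- move=> n; rewrite -nrm_powR//.
  by apply: powR_le; [exact: ltW|exact: nrm_ge0|exact: uc].
- by split; [split|apply: nrm_le].
Qed.

Lemma mul_hoelder q u v : 1 <= q -> p^-1 + q^-1 = 1 -> Lp p u -> Lp q v ->
  intg (fun x => u x * v x) /\ I (fun x => `|u x * v x|) <= nrm p u * nrm q v.
Proof.
move=> q1 pq Lu Lv; have q0 : 0 < q by exact: lt_le_trans q1.
have [mu_ _] := Lu; have [mv _] := Lv.
have mw : measurable_fun D (fun x => u x * v x) by exact: measurable_funM.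
have := hoelder mu (proj1 (measurable_restrictR u) mu_)
  (proj1 (measurable_restrictR v) mv) p0 q0 pq.
rewrite Lnorm_nrm// (Lnorm_nrm q0)//.
have -> : (u \_ D) \* (v \_ D) = (fun x => u x * v x) \_ D.
  apply/funext => x; rewrite /patch /=; case: ifPn => //= _; exact: mul0r.
move=> h; have Lw : Lp 1 (fun x => u x * v x).
  by apply: Lnorm_Lp => //; apply: le_lt_trans h _; rewrite -EFinM ltry.
split.
  have [_ i1] := Lw; apply: intg_le i1 => //.
  by move=> x _; rewrite powRr1.
by move: h; rewrite Lnorm_nrm// -EFinM lee_fin nrm1E.
Qed.

End p_ge1.

Section finite.
Variable p : R.
Hypothesis p1 : 1 <= p.
Hypothesis fD : (mu D < +oo)%E.
Let p0 : 0 < p. Proof. exact: lt_le_trans p1. Qed.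

Lemma intg_cst c : intg (fun=> c).
Proof.
apply/integrableP; split; first exact/measurable_EFinP.
have -> : (\int[mu]_(x in D) `|(EFin \o (fun=> c)) x| = `|c|%:E * mu D)%E.
  by rewrite -integral_cst.
by rewrite lte_mul_pinfty// lee_fin.
Qed.

Lemma Lp_bounded (c : R) u : measurable_fun D u -> (forall x, D x -> `|u x| <= c) ->
  Lp p u.
Proof.
move=> mu_ uc; split=> //; apply: intg_le (intg_cst (c `^ p)) => //.
  exact: mpow.
move=> x Dx; rewrite ger0_norm ?powR_ge0//.
by apply: powR_le; [exact: ltW| |exact: uc].
Qed.

Lemma nrm_bounded (c : R) u : 0 <= c -> measurable_fun D u ->
  (forall x, D x -> `|u x| <= c) -> nrm p u <= c * nrm p (fun=> 1).
Proof.
move=> c0 mu_ uc.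
have L1 : Lp p (fun=> 1) by apply: (@Lp_bounded 1) => // x _; rewrite normr1.
rewrite -[X in X * _](ger0_norm c0) -(nrm_scale c (lt0r_neq0 p0) L1).
apply: (Lp_le (ltW p0) mu_ _ (Lp_scale c L1)).2 => x Dx.
by rewrite mulr1 (ger0_norm c0) uc.
Qed.

Lemma Lp_intg u : Lp p u -> intg u.
Proof.
move=> [mu_ ui]; apply: intg_le (intg_add mD (intg_cst 1) ui) => // x Dx.
have [u1|u1] := leP `|u x| 1; first by rewrite (le_trans u1)// lerDl powR_ge0.
by rewrite (le_trans (le1r_powR (ltW u1) p1))// lerDr.
Qed.

(** Hölder's inequality against the constant 1. For p = 1, where the conjugate exponent would be
    infinite, the two sides agree. *)
Lemma I_nrm : exists2 C : R, 0 <= C & forall u, Lp p u ->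
  I (fun x => `|u x|) <= C * nrm p u.
Proof.
have [pE|pN] := eqVneq p 1.
  by exists 1 => // u Lu; rewrite mul1r pE nrm1E.
have p1' : 1 < p by rewrite lt_neqAle eq_sym pN.
pose q := (1 - p^-1)^-1.
have q0 : 0 < 1 - p^-1 by rewrite subr_gt0 invf_lt1.
have q1 : 1 <= q by rewrite invf_ge1// lerBlDr lerDl invr_ge0 ltW.
have L1 : Lp q (fun=> 1).
  split=> //; apply: intg_eq (intg_cst 1) => //.
  by move=> x _; rewrite normr1 powR1.
exists (nrm q (fun=> 1)); first exact: nrm_ge0.
move=> u Lu; have pq : p^-1 + q^-1 = 1 by rewrite invrK addrC subrK.
have [_ h] := mul_hoelder p1 q1 pq Lu L1.
rewrite (I_eq mu (fun x _ => congr1 Num.norm (mulr1 (u x)))) in h.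
by move: h; rewrite [X in _ <= X -> _]mulrC.
Qed.

Lemma Lp_complete (un : (T -> R)^nat) : (forall n, Lp p (un n)) ->
  (forall e, 0 < e -> exists N, forall m n, (N <= m)%N -> (N <= n)%N ->
    nrm p (fun x => un m x - un n x) <= e) ->
  exists u, exists k : nat -> nat, [/\ Lp p u, (forall n, (k n < k n.+1)%N),
    nrm p (fun x => un n x - u x) @[n --> \oo] --> 0 &
    ae (fun x => un (k n) x @[n --> \oo] --> u x)].
Proof.
move=> Lun Cu; have [k [kS kP]] := fast_subseq Cu.
have [C C0 CP] := I_nrm.
have cv : ae (fun x => cvgn (fun n => un (k n) x)).
  apply: (@ae_cvg_abs _ _ _ mu D mD (fun n => un (k n)) (C * 2)).
    by move=> n; exact: Lp_intg.
  move=> n; apply: (@le_trans _ _ (\sum_(j < n) C * 2 ^- j)).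
    apply: ler_sum => j _; apply: (le_trans (CP _ (Lp_sub p1 (Lun _) (Lun _)))).
    apply: ler_wpM2l => //.
    exact: (kP j (k j.+1) (ltnW (kS j))).1.
  rewrite -mulr_sumr; apply: ler_wpM2l => //.
  have -> : \sum_(j < n) 2 ^- j = 2 - 2 * 2 ^- n :> R.
    elim: n => [|n IH]; first by rewrite big_ord0 expr0 invr1 mulr1 subrr.
    rewrite big_ord_recr/= IH exprS invfM mulrA divff// mul1r mulr_natl mulr2n.
    by rewrite opprD addrA subrK.
  by rewrite lerBlDr lerDl mulr_ge0// invr_ge0 exprn_ge0.
have [u mu_ cu] := ae_lim_measurable (fun n => (Lun (k n)).1) cv.
(* Fatou's lemma along the a.e. convergent subsequence turns a Cauchy bound into a bound on the
   distance to the limit. This gives both the membership of [u] in L^p and the convergence. *)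
have step n e : (forall m, (n <= m)%N -> nrm p (fun x => un n x - un m x) <= e) ->
    Lp p (fun x => un n x - u x) /\ nrm p (fun x => un n x - u x) <= e.
  move=> ne; apply: (@nrm_fatou _ p1 (fun m x => un n x - un (k (m + n)%N) x)).
  - by move=> m; exact: Lp_sub.
  - by apply: measurable_funB => //; case: (Lun n).
  - apply: filterS cu => x h Dx; have {}h := h Dx.
    apply: cvgB; first exact: cvg_cst.
    exact: (subseq_cvg (fun m => leq_addr n m) h).
  - move=> m; apply: ne; apply: leq_trans (subseq_ge kS _).
    exact: leq_addl.
exists u, k; split=> //.
- have [N NP] := Cu 1 ltr01.
  have [|L _] := step N 1; first by move=> m Nm; exact: NP.
  by apply: Lp_eq (Lp_sub p1 (Lun N) L) => x _; rewrite opprB addrC subrK.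
- apply/cvgrPdist_le => e e0; have [N NP] := Cu e e0.
  exists N => // n /= Nn; rewrite sub0r normrN ger0_norm ?nrm_ge0//.
  by apply: (step n e _).2 => m nm; apply: NP => //; exact: leq_trans nm.
Qed.

(** Completeness provides an a.e. convergent subsequence with some limit [v]; uniqueness of limits
    in L^p shows that [v] is [u] a.e. *)
Lemma Lp_subseq_ae (un : (T -> R)^nat) u : (forall n, Lp p (un n)) -> Lp p u ->
  nrm p (fun x => un n x - u x) @[n --> \oo] --> 0 ->
  exists2 k : nat -> nat, (forall n, (k n < k n.+1)%N) &
    ae (fun x => un (k n) x @[n --> \oo] --> u x).
Proof.
move=> Lun Lu /cvgrPdist_le h.
have [|v [k [Lv kS cv ck]]] := Lp_complete Lun.
  move=> e e0; have e2 : 0 < e / 2 by rewrite divr_gt0.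
  have [N _ NP] := h _ e2; exists N => m n Nm Nn.
  rewrite (splitr e); apply: le_trans (nrm_dist p1 (Lun m) Lu (Lun n)) _.
  apply: lerD.
    by have := NP m Nm; rewrite sub0r normrN ger0_norm ?nrm_ge0.
  by rewrite nrmC; have := NP n Nn; rewrite sub0r normrN ger0_norm ?nrm_ge0.
exists k => //.
have uv : ae (fun x => u x - v x = 0).
  apply: (nrm_eq0 p1); first exact: Lp_sub.
  apply/eqP; rewrite eq_le nrm_ge0 andbT; apply/ler_addgt0Pl => e e0.
  rewrite addr0 (splitr e); have e2 : 0 < e / 2 by rewrite divr_gt0.
  have [N _ NP] := h _ e2.
  move/cvgrPdist_le : cv => /(_ _ e2)[M _ MP].
  pose n := maxn N M.
  apply: le_trans (nrm_dist p1 Lu (Lun n) Lv) _; apply: lerD.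
    rewrite nrmC; have := NP n (leq_maxl _ _).
    by rewrite sub0r normrN ger0_norm ?nrm_ge0.
  have := MP n (leq_maxr _ _).
  by rewrite sub0r normrN ger0_norm ?nrm_ge0.
apply: filterS2 ck uv => x h1 h2 Dx.
by have /eqP := h2 Dx; rewrite subr_eq0 => /eqP ->; exact: h1.
Qed.

End finite.

(** Made opaque below, so that later proofs go through the laws of a pseudometric. *)
Definition dist p u v := nrm p (fun x => u x - v x).

Section dist.
Variable p : R.
Hypothesis p1 : 1 <= p.
Let p0 : 0 < p. Proof. exact: lt_le_trans p1. Qed.

Lemma dist_ge0 u v : 0 <= dist p u v. Proof. exact: nrm_ge0. Qed.

Lemma dist_sym u v : dist p u v = dist p v u. Proof. exact: nrmC. Qed.

Lemma dist_xx u : dist p u u = 0. Proof. exact: nrm_subxx. Qed.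

Lemma dist_tri u v w : Lp p u -> Lp p v -> Lp p w ->
  dist p u w <= dist p u v + dist p v w.
Proof. exact: nrm_dist. Qed.

Lemma dist_add u v a b : Lp p u -> Lp p v -> Lp p a -> Lp p b ->
  dist p (fun x => u x + v x) (fun x => a x + b x) <= dist p u a + dist p v b.
Proof. exact: nrm_sub_add. Qed.

Lemma dist_scale c u a : Lp p u -> Lp p a ->
  dist p (fun x => c * u x) (fun x => c * a x) = `|c| * dist p u a.
Proof. exact: nrm_sub_scale. Qed.

Lemma nrm_le_dist u v : Lp p u -> Lp p v -> nrm p u <= nrm p v + dist p u v.
Proof. exact: nrm_le_sub. Qed.

Lemma dist_le_nrm u v : Lp p u -> Lp p v -> dist p u v <= nrm p u + nrm p v.
Proof. exact: nrm_sub. Qed.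

Lemma dist_ae u v u' v' : measurable_fun D u -> measurable_fun D v ->
  measurable_fun D u' -> measurable_fun D v' -> ae (fun x => u x = u' x) ->
  ae (fun x => v x = v' x) -> dist p u v = dist p u' v'.
Proof.
move=> mu_ mv mu' mv' uu vv; apply: nrm_ae; try exact: measurable_funB.
by apply: filterS2 uu vv => x uu vv Dx; rewrite uu ?vv.
Qed.

Lemma dist_eq u v u' v' : (forall x, D x -> u x = u' x) ->
  (forall x, D x -> v x = v' x) -> dist p u v = dist p u' v'.
Proof. by move=> uu vv; apply: nrm_eq => x Dx; rewrite uu ?vv. Qed.

Lemma dist_eq0 u v : Lp p u -> Lp p v -> dist p u v = 0 -> ae (fun x => u x = v x).
Proof.
move=> Lu Lv /(nrm_eq0 p1 (Lp_sub p1 Lu Lv)); apply: filterS => x h Dx.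
by apply/eqP; rewrite -subr_eq0; apply/eqP; exact: h.
Qed.

Lemma dist_le_bounded (e : R) u v : (mu D < +oo)%E -> 0 <= e ->
  measurable_fun D u -> measurable_fun D v ->
  (forall x, D x -> `|u x - v x| <= e) -> dist p u v <= e * nrm p (fun=> 1).
Proof. by move=> fD e0 mu_ mv uv; apply: nrm_bounded => //; exact: measurable_funB. Qed.

Lemma dist_mono u v u' v' : Lp p u -> Lp p v -> Lp p u' -> Lp p v' ->
  (forall x, D x -> `|u x - v x| <= `|u' x - v' x|) -> dist p u v <= dist p u' v'.
Proof.
move=> Lu Lv Lu' Lv' h; apply: (Lp_le (ltW p0) _ h (Lp_sub p1 Lu' Lv')).2.
exact: measurable_funB Lu.1 Lv.1.
Qed.

Lemma dist_dct (un : (T -> R)^nat) u g : (forall n, measurable_fun D (un n)) ->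
  measurable_fun D u -> Lp p g ->
  ae (fun x => un n x @[n --> \oo] --> u x) ->
  (forall n, ae (fun x => `|un n x - u x| <= `|g x|)) ->
  dist p (un n) u @[n --> \oo] --> 0.
Proof. exact: nrm_dct. Qed.

Lemma dist_nrm_cvg (un : (T -> R)^nat) u : (forall n, Lp p (un n)) -> Lp p u ->
  dist p (un n) u @[n --> \oo] --> 0 -> nrm p (un n) @[n --> \oo] --> nrm p u.
Proof. exact: nrm_cvg. Qed.

Lemma dist_complete (un : (T -> R)^nat) : (mu D < +oo)%E -> (forall n, Lp p (un n)) ->
  (forall e, 0 < e -> exists N, forall m n, (N <= m)%N -> (N <= n)%N ->
    dist p (un m) (un n) <= e) ->
  exists u, exists k : nat -> nat, [/\ Lp p u, (forall n, (k n < k n.+1)%N),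
    dist p (un n) u @[n --> \oo] --> 0 &
    ae (fun x => un (k n) x @[n --> \oo] --> u x)].
Proof. by move=> fD; exact: Lp_complete. Qed.

Lemma dist_subseq_ae (un : (T -> R)^nat) u : (mu D < +oo)%E ->
  (forall n, Lp p (un n)) -> Lp p u -> dist p (un n) u @[n --> \oo] --> 0 ->
  exists2 k : nat -> nat, (forall n, (k n < k n.+1)%N) &
    ae (fun x => un (k n) x @[n --> \oo] --> u x).
Proof. by move=> fD; exact: Lp_subseq_ae. Qed.

Lemma I_dist : (mu D < +oo)%E -> exists2 C : R, 0 <= C & forall u v, Lp p u ->
  Lp p v -> I (fun x => `|u x - v x|) <= C * dist p u v.
Proof.
move=> fD; have [C C0 CP] := I_nrm p1 fD; exists C => // u v Lu Lv.
exact: CP (Lp_sub p1 Lu Lv).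
Qed.

End dist.
End Lp.
#[global] Opaque dist.

#[global] Opaque nrm.


(** * Lebesgue measure *)

(** A measure known only by its values, to which uniqueness theorems apply without its construction
    being unfolded. *)
Lemma pushforward_ex d1 d2 (T1 : measurableType d1) (T2 : measurableType d2)
    (R : realType) (m : {measure set T1 -> \bar R}) (f : T1 -> T2) :
  measurable_fun setT f ->
  exists m' : {measure set T2 -> \bar R}, forall A, m' A = m (f @^-1` A).
Proof.
move=> mf.
by exists (measure_function_pushforward__canonical__measure_function_Measure m mf).
Qed.

Section lebesgue_tuple_facts.
Variable R : realType.
Local Notation Rt := (measurableTypeR R).

Lemma lebesgue_oc (a b : R) : a < b -> lebesgue_measure `]a, b]%classic = (b - a)%:E.
Proof. by move=> ab; rewrite lebesgue_measure_itv /= lte_fin ab EFinB. Qed.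

Lemma lebesgue_co (a b : R) : a <= b -> lebesgue_measure `[a, b[%classic = (b - a)%:E.
Proof.
rewrite le_eqVlt lebesgue_measure_itv /= lte_fin => /orP[/eqP ->|->].
  by rewrite ltxx subrr.
by rewrite EFinB.
Qed.

(** The translated measure takes the values of Lebesgue measure on the intervals ]a, b], which
    determine it. *)
Lemma lebesgue_shift (v : R) (A : set Rt) : measurable A ->
  lebesgue_measure ((fun x : Rt => x + v : Rt) @^-1` A) = lebesgue_measure A.
Proof.
move=> mA.
have ms : measurable_fun setT (fun x : Rt => x + v : Rt).
  exact: measurable_funD.
have [m' m'E] := pushforward_ex (@lebesgue_measure R) ms.
rewrite -m'E; apply/esym; apply: (@lebesgue_measure_unique _ m') => //.
move=> X /ocitvP[->|[[a b] /= ab ->]]; first by rewrite !measure0.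
rewrite m'E (_ : _ @^-1` _ = `]a - v, b - v]%classic).
  have ab' : a - v < b - v by rewrite ltrD2r.
  apply: (etrans (lebesgue_oc ab)); apply: (etrans _ (esym (lebesgue_oc ab'))).
  by congr EFin; ring.
by apply/seteqP; split=> x /=; rewrite !in_itv /= ltrBlDr lerBrDr.
Qed.

(** The vector is indexed by [nat], so that removing the first coordinate merely shifts the index in
    inductions on the dimension. The same device serves in [tuple_box]. *)
Definition tshift n (v : nat -> R) (t : n.-tuple Rt) : n.-tuple Rt :=
  [tuple tnth t i + v i | i < n].

Lemma measurable_tshift n v : measurable_fun setT (@tshift n v).
Proof.
apply/measurable_fun_tnthP => i.
rewrite (_ : _ \o _ = fun t : n.-tuple Rt => tnth t i + v i).
  by apply: measurable_funD => //; exact: measurable_tnth.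
by apply/funext => t /=; rewrite tnth_mktuple.
Qed.

Lemma measurable_cons_pair n : measurable_fun setT (@cons_pair R n).
Proof. exact: measurable_cons. Qed.

(** A product measure is determined by its values on rectangles, where a translation acts factor by
    factor. *)
Lemma tuple_shift n v (A : set (n.-tuple Rt)) : measurable A ->
  lebesgue_tuple R n (tshift v @^-1` A) = lebesgue_tuple R n A.
Proof.
elim: n v A => [|n IH] v A mA.
  congr (lebesgue_tuple _ _ _); apply/seteqP.
  by split=> t /=; rewrite (tuple0 (tshift v t)) (tuple0 t).
have mA' : measurable (@cons_pair R n @^-1` A).
  by rewrite -[X in measurable X]setTI; exact: measurable_cons_pair.
rewrite /= /cons_measure /pushforward.
pose sg (z : Rt * n.-tuple Rt) : Rt * n.-tuple Rt :=
  (z.1 + v 0%N, tshift (fun i => v i.+1) z.2).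
have msg : measurable_fun setT sg.
  apply/measurable_fun_pairP; split.
    by apply: measurable_funD => //; exact: measurable_fst.
  by apply: (measurableT_comp (@measurable_tshift n _)); exact: measurable_snd.
have -> : (@cons_pair R n) @^-1` (tshift v @^-1` A) =
    sg @^-1` ((@cons_pair R n) @^-1` A).
  apply/seteqP; split=> -[x t] /=;
    suff -> : tshift v (cons_pair (x, t)) = cons_pair (sg (x, t)) by [].
    apply: eq_from_tnth => i; rewrite tnth_mktuple.
    case: (unliftP ord0 i) => [j ->|->]; last by rewrite !tnth0.
    by rewrite !tnthS tnth_mktuple.
  apply: eq_from_tnth => i; rewrite tnth_mktuple.
  case: (unliftP ord0 i) => [j ->|->]; last by rewrite !tnth0.
  by rewrite !tnthS tnth_mktuple.
have [m' m'E] := pushforward_ex (@lebesgue_measure R \x lebesgue_tuple R n)%E msg.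
rewrite -m'E; apply/esym; apply: product_measure_unique => // B C mB mC.
rewrite m'E (_ : _ @^-1` _ = ((fun x : Rt => x + v 0%N : Rt) @^-1` B) `*`
   (tshift (fun i => v i.+1) @^-1` C)).
  apply: etrans (product_measure1E _ _ _ _) _.
  - by rewrite -[X in measurable X]setTI; exact: measurable_funD.
  - by rewrite -[X in measurable X]setTI; exact: measurable_tshift.
  - by congr (_ * _)%E; [exact: lebesgue_shift|exact: IH].
by apply/seteqP; split=> -[x t].
Qed.

Lemma measurable_tbox n (P : 'I_n -> set Rt) : (forall i, measurable (P i)) ->
  measurable [set t : n.-tuple Rt | forall i, P i (tnth t i)].
Proof.
move=> mP; rewrite (_ : [set _ | _] = \bigcap_(i : 'I_n) ((@tnth n Rt)^~ i @^-1` P i)).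
  apply: fin_bigcap_measurable => // i _.
  by rewrite -[X in measurable X]setTI; exact: measurable_tnth.
by apply/seteqP; split=> t h i; [move=> _; exact: h|exact: h].
Qed.

Lemma tuple_box n (c e : nat -> R) : (forall i, c i <= e i) ->
  lebesgue_tuple R n [set t | forall i : 'I_n, c i <= tnth t i < e i] =
  (\prod_(i < n) (e i - c i))%:E.
Proof.
elim: n c e => [|n IH] c e ce.
  rewrite big_ord0 /= diracE mem_set//.
  by case.
rewrite /= /cons_measure /pushforward.
rewrite (_ : _ @^-1` _ = `[c 0%N, e 0%N[%classic `*`
    [set t | forall i : 'I_n, c i.+1 <= tnth t i < e i.+1]).
  rewrite product_measure1E//; last first.
    rewrite (_ : [set _ | _] = [set t : n.-tuple Rt | forall i,
       (fun i : 'I_n => `[c i.+1, e i.+1[%classic : set Rt) i (tnth t i)]).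
      apply: (@measurable_tbox n (fun i : 'I_n => `[c i.+1, e i.+1[%classic : set Rt)).
      by move=> i; exact: measurable_itv.
    by apply/seteqP; split=> t h i; have /= := h i; rewrite in_itv.
  rewrite (IH (fun i => c i.+1) (fun i => e i.+1))// big_ord_recl EFinM.
  by congr (_ * _)%E; apply: lebesgue_co.
apply/seteqP; split=> -[x t] /= h.
  split=> [|i]; first by have := h ord0; rewrite tnth0 in_itv.
  by have := h (lift ord0 i); rewrite tnthS.
move=> i; case: h; rewrite in_itv /= => h1 h2.
case: (unliftP ord0 i) => [j ->|->]; last by rewrite tnth0.
by rewrite tnthS; exact: h2.
Qed.

End lebesgue_tuple_facts.

Section lebesgue_rV_facts.
Variables (R : realType) (N : nat).
Local Notation Rt := (measurableTypeR R).
Local Notation V := 'rV[R]_N.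
Local Notation mu := (@lebesgue_rV R N).

Definition rowt (t : N.-tuple Rt) : V := \row_i tnth t i.
Definition trow (x : V) : N.-tuple Rt := [tuple x 0 i | i < N].

Lemma trowK : cancel trow rowt.
Proof. by move=> x; apply/rowP => i; rewrite mxE tnth_mktuple. Qed.

Lemma rowtK : cancel rowt trow.
Proof. by move=> t; apply: eq_from_tnth => i; rewrite tnth_mktuple mxE. Qed.

(** The outer measure on row vectors is that on tuples read through [rowt], so the Caratheodory
    criterion for a set is the one for its preimage. *)
Lemma measurable_rowt (A : set V) : measurable (rowt @^-1` A) -> measurable A.
Proof.
move=> mA; change (caratheodory_measurable (@lebesgue_outer R N) A) => X.
have h := caratheodory_measurable_mu_ext (lebesgue_tuple R N) mA.
exact: h (rowt @^-1` X).
Qed.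

Lemma measurable_trow (A : set (N.-tuple Rt)) : measurable A ->
  measurable (trow @^-1` A).
Proof.
move=> mA; apply: measurable_rowt.
by rewrite (_ : _ @^-1` _ = A)//; apply/seteqP; split=> t /=; rewrite rowtK.
Qed.

Lemma lebesgue_rowt (A : set V) : measurable (rowt @^-1` A) ->
  mu A = lebesgue_tuple R N (rowt @^-1` A).
Proof. exact: measurable_mu_extE. Qed.

Lemma lebesgue_trow (A : set (N.-tuple Rt)) : measurable A ->
  mu (trow @^-1` A) = lebesgue_tuple R N A.
Proof.
move=> mA; have E : rowt @^-1` (trow @^-1` A) = A.
  by apply/seteqP; split=> t /=; rewrite rowtK.
by rewrite lebesgue_rowt E.
Qed.

Lemma measurable_coord (i : 'I_N) : measurable_fun setT (fun x : V => x 0 i : R).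
Proof.
move=> _ B mB; rewrite setTI; apply: measurable_rowt.
rewrite (_ : _ @^-1` _ = (@tnth N Rt)^~ i @^-1` B).
  by rewrite -[X in measurable X]setTI; exact: measurable_tnth.
by apply/seteqP; split=> t /=; rewrite mxE.
Qed.

Lemma measurable_rbox (P : 'I_N -> set R) : (forall i, measurable (P i)) ->
  measurable [set x : V | forall i, P i (x 0 i)].
Proof.
move=> mP; apply: measurable_rowt.
rewrite (_ : _ @^-1` _ = [set t : N.-tuple Rt | forall i, P i (tnth t i)]).
  exact: measurable_tbox.
by apply/seteqP; split=> t h i; have := h i; rewrite mxE.
Qed.

Lemma rV_nbhs (x : V) (U : set V) : nbhs x U <->
  exists2 e : R, 0 < e & forall y : V, (forall i, `|x 0 i - y 0 i| < e) -> U y.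
Proof.
split=> [/nbhs_ballP[e /= e0 h]|[e e0 h]].
  exists e => // y xy; apply: h; split=> // i j.
  by rewrite [i]ord1; exact: xy.
apply/nbhs_ballP; exists e => //= y xy; apply: h => i; exact: xy.2.
Qed.

(** Rational cubes are countably many: this gives the measurability of open sets, and later lets
    a.e. statements pass from cubes to an open set. *)
Lemma open_rbox (U : set V) : open U -> forall x, U x ->
  exists (q : 'rV[rat]_N) (r : rat), 0 < r /\
  (forall i, `|x 0 i - ratr (q 0 i)| < ratr r) /\
  [set y : V | forall i, `|y 0 i - ratr (q 0 i)| <= ratr r] `<=` U.
Proof.
move=> oU x Ux; have /rV_nbhs[e e0 h] : nbhs x U by exact: open_nbhs_nbhs.
have e3 : 0 < e / 3 by rewrite divr_gt0.
have [r] := rat_in_itvoo e3; rewrite in_itv /= => /andP[r0 re].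
have : forall i, exists q : rat, `|x 0 i - ratr q| < ratr r.
  move=> i; have [|q] := @rat_in_itvoo R (x 0 i - ratr r) (x 0 i + ratr r).
    by rewrite ltrBlDr -addrA ltrDl addr_gt0.
  by rewrite in_itv /= => xq; exists q; rewrite ltr_distlC.
move=> /choice[q qP]; exists (\row_i q i), r; split; first by rewrite -(@ltr0q R).
split=> [i|y yq]; first by rewrite mxE.
apply: h => i; have := qP i; have := yq i; rewrite mxE => h1 h2.
rewrite (_ : x 0 i - y 0 i = (x 0 i - ratr (q i)) - (y 0 i - ratr (q i))); last by ring.
apply: le_lt_trans (ler_normB _ _) _; lra.
Qed.

Lemma open_measurable_rV (U : set V) : open U -> measurable U.
Proof.
move=> oU.
pose B (z : 'rV[rat]_N * rat) := [set y : V | forall i, `|y 0 i - ratr (z.1 0 i)| <= ratr z.2].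
rewrite (_ : U = \bigcup_(z in [set z | B z `<=` U]) B z).
  rewrite bigcup_mkcond; apply: countable_bigcupT_measurable; first exact: countableP.
  move=> z; case: ifP => // _; apply: (@measurable_rbox (fun i => [set t | `|t - ratr (z.1 0 i)| <= ratr z.2])).
  move=> i; rewrite (_ : [set _ | _] = `[ratr (z.1 0 i) - ratr z.2, ratr (z.1 0 i) + ratr z.2]%classic).
    exact: measurable_itv.
  by apply/seteqP; split=> t /=; rewrite in_itv/= ler_distl.
apply/seteqP; split=> [x Ux|x [z zU]]; last exact: zU.
have [q [r [r0 [xq qU]]]] := open_rbox oU Ux.
by exists (q, r) => //= i; exact: ltW.
Qed.

Lemma continuous_measurable_rV (D : set V) (f : V -> R) : measurable D ->
  continuous f -> measurable_fun D f.
Proof.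
move=> mD cf; apply: measurability; first exact: RGenOpens.measurableE.
move=> _ [_ [x [y ->]] <-]; apply: measurableI => //.
by apply: open_measurable_rV; move/continuousP: cf; apply; exact: interval_open.
Qed.

Lemma lebesgue_rbox (c e : V) : (forall i, c 0 i <= e 0 i) ->
  mu [set x : V | forall i, c 0 i <= x 0 i < e 0 i] =
  (\prod_i (e 0 i - c 0 i))%:E.
Proof.
move=> ce; pose f (w : V) n := if insub n is Some i then w 0 i else 0.
have fE w (i : 'I_N) : f w i = w 0 i by rewrite /f valK.
rewrite (eq_bigr (fun i : 'I_N => f e i - f c i)); last first.
  by move=> i _; rewrite !fE.
rewrite -tuple_box; last by move=> n; rewrite /f; case: insubP.
rewrite -lebesgue_trow.
  congr (mu _); apply/seteqP.
  by split=> x /= h i; have := h i; rewrite tnth_mktuple !fE.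
apply: (@measurable_tbox R N (fun i => `[f c i, f e i[%classic)).
by move=> i; exact: measurable_itv.
Qed.

(** Covers by measurable sets are translated into covers of the same total measure, so the
    invariance holds for every set. One inequality, used for a translation and for its inverse,
    gives the equality. *)
Lemma lebesgue_outer_shift (v : V) (A : set V) :
  mu ((fun x => x + v) @^-1` A) = mu A.
Proof.
suff le w (B : set V) : (mu ((fun x => x + w)%R @^-1` B) <= mu B)%E.
  apply/eqP; rewrite eq_le le /=.
  have := le (- v) ((fun x => x + v) @^-1` A).
  by under [X in mu X]eq_set => x do rewrite /= addrNK.
pose f n := if insub n is Some i then w 0 i else 0.
have fE (i : 'I_N) : f i = w 0 i by rewrite /f valK.
apply: le_ereal_inf_tmp => _ [F [mF BF] <-].
apply: ereal_inf_lbound; exists (fun k => tshift f @^-1` F k).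
  split=> [k|t /= Bt].
    by rewrite -[X in measurable X]setTI; exact: measurable_tshift.
  have /BF[k _ Fk] : [set t | B (rowt t)] (tshift f t).
    move: Bt; congr B; apply/rowP => i.
    by rewrite !mxE tnth_mktuple fE.
  by exists k.
by apply: eq_eseriesr => k _; rewrite tuple_shift.
Qed.

Lemma measurable_shift (v : V) (A : set V) : measurable A ->
  measurable ((fun x => x + v) @^-1` A).
Proof.
move=> mA; change (caratheodory_measurable (@lebesgue_outer R N)
  ((fun x => x + v) @^-1` A)) => X.
have h Y : (fun x => x + v) @^-1` ((fun x => x - v) @^-1` Y) = Y.
  by apply/seteqP; split=> x /=; rewrite addrK.
have sh Y : lebesgue_outer Y = lebesgue_outer ((fun x => x - v) @^-1` Y).
  exact/esym/(lebesgue_outer_shift (- v)).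
rewrite sh (sh (X `&` _)) (sh (X `&` ~` _)) (mA ((fun x => x - v) @^-1` X)).
have E C : (fun x => x - v) @^-1` (X `&` C) =
    (fun x => x - v) @^-1` X `&` (fun x => x - v) @^-1` C by [].
rewrite !E (_ : (fun x => x - v) @^-1` (~` _) = ~` A).
  rewrite (_ : (fun x => x - v) @^-1` ((fun x => x + v) @^-1` A) = A)//.
  by apply/seteqP; split=> x /=; rewrite subrK.
by apply/seteqP; split=> x /=; rewrite subrK.
Qed.

Lemma negligible_measurable (A : set V) : mu.-negligible A -> measurable A.
Proof.
move=> [B [mB B0 AB]]; apply: le_caratheodory_measurable => X.
change (lebesgue_outer (X `&` A) + lebesgue_outer (X `&` ~` A) <=
  lebesgue_outer X)%E.
have -> : lebesgue_outer (X `&` A) = 0%E.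
  apply/eqP; rewrite eq_le outer_measure_ge0 andbT -B0.
  by apply: le_outer_measure => x [_ /AB].
by rewrite add0e; apply: le_outer_measure => x [].
Qed.

(** Completeness of the measure: every part of the exceptional set [Z] is measurable, whatever [g]
    does there. *)
Lemma measurable_ae d (T : measurableType d) (D : set V) (f g : V -> T) :
  measurable D -> measurable_fun D f ->
  {ae mu, forall x, D x -> f x = g x} -> measurable_fun D g.
Proof.
move=> mD mf fg _ B mB.
pose Z := ~` [set x | D x -> f x = g x].
have mZ (C : set V) : measurable (Z `&` C).
  by apply: negligible_measurable; apply: negligibleS fg => x [].
rewrite (_ : D `&` g @^-1` B = (D `&` f @^-1` B) `\` Z `|` Z `&` (D `&` g @^-1` B)).
  apply: measurableU => //; apply: measurableD; first exact: mf.
  by rewrite -[Z]setIT.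
apply/seteqP; split=> x /=.
  move=> [Dx gB]; have [h|h] := pselect (D x -> f x = g x).
    by left; split; [split=> //; rewrite h|move=> Zx; exact: Zx].
  by right.
move=> [[[Dx fB] nZ]|[_ []//]]; split=> //.
by have /contrapT/(_ Dx) <- := nZ.
Qed.

End lebesgue_rV_facts.


(* Sealed, so that unification does not unfold the Caratheodory construction. *)
Lemma lebm_ex (R : realType) (N : nat) :
  {m : {measure set 'rV[R]_N -> \bar R} | m = lebesgue_rV}.
Proof. by exists lebesgue_rV. Qed.

Definition lebm (R : realType) (N : nat) := sval (lebm_ex R N).

Section lebm_facts.
Variables (R : realType) (N : nat).
Local Notation Rt := (measurableTypeR R).
Local Notation V := 'rV[R]_N.
Local Notation mu := (lebm R N).

Lemma lebmE : mu = lebesgue_rV. Proof. exact: (svalP (lebm_ex R N)). Qed.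

Lemma lebm_shift (v : V) (A : set V) : mu ((fun x => x + v) @^-1` A) = mu A.
Proof. by rewrite lebmE; exact: lebesgue_outer_shift. Qed.

Lemma lebm_box (c e : V) : (forall i, c 0 i <= e 0 i) ->
  mu [set x : V | forall i, c 0 i <= x 0 i < e 0 i] =
  (\prod_i (e 0 i - c 0 i))%:E.
Proof. by rewrite lebmE; exact: lebesgue_rbox. Qed.

Lemma lebm_ae_measurable d (T : measurableType d) (D : set V) (f g : V -> T) :
  measurable D -> measurable_fun D f ->
  {ae mu, forall x, D x -> f x = g x} -> measurable_fun D g.
Proof. by rewrite lebmE; exact: measurable_ae. Qed.

Lemma measurable_shiftf (v : V) : measurable_fun setT (fun x : V => x + v).
Proof. by move=> _ B mB; rewrite setTI; exact: measurable_shift. Qed.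

Lemma ge0_integral_shift (v : V) (D : set V) (f : V -> \bar R) : measurable D ->
  measurable_fun D f -> (forall x, D x -> (0 <= f x)%E) ->
  (\int[mu]_(x in (fun x => x + v)%R @^-1` D) f (x + v)%R = \int[mu]_(x in D) f x)%E.
Proof.
move=> mD mf f0; have [m' m'E] := pushforward_ex mu (measurable_shiftf v).
have E A : m' A = mu A by rewrite m'E lebm_shift.
have := ge0_integral_pushforward (measurable_shiftf v) mu mD mf.
rewrite /comp => <-; last by move=> x; rewrite inE => /f0.
apply: eq_measure_integral; first exact: measurable_shiftf.
by move=> ? A mA _; exact: lebm_shift.
Qed.

Lemma intg_shift (v : V) (D : set V) (f : V -> R) : measurable D ->
  mu.-integrable D (EFin \o f) ->
  mu.-integrable ((fun x => x + v) @^-1` D) (fun x => (f (x + v))%:E).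
Proof.
move=> mD /integrableP[/measurable_EFinP mf fi]; apply/integrableP; split.
  apply/measurable_EFinP.
  have mD' := measurable_shift v mD.
  move=> _ B mB.
  rewrite (_ : _ `&` _ = (fun x => x + v) @^-1` (D `&` f @^-1` B)) //.
  by apply: measurable_shift; exact: mf.
have mDf : measurable_fun D (fun x => `|(f x)%:E|%E).
  by apply: measurableT_comp => //; exact/measurable_EFinP.
by rewrite (ge0_integral_shift v mD mDf).
Qed.

Lemma I_shift (v : V) (D : set V) (f : V -> R) : measurable D ->
  mu.-integrable D (EFin \o f) ->
  \int[mu]_(x in (fun x => x + v) @^-1` D) f (x + v) = \int[mu]_(x in D) f x.
Proof.
move=> mD fi; have mD' := measurable_shift v mD; have mf := intg_meas fi.
have abs0 (g : V -> R) (E : set V) : measurable E -> mu.-integrable E (EFin \o g) ->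
   (forall x, E x -> 0 <= g x) ->
   \int[mu]_(x in (fun x => x + v) @^-1` E) g (x + v) = \int[mu]_(x in E) g x.
  move=> mE gi g0; apply: EFin_inj.
  rewrite -(intg_fin (measurable_shift v mE) (intg_shift v mE gi)) -(intg_fin mE gi).
  apply: (ge0_integral_shift v mE (f := EFin \o g)) => //.
  by apply/measurable_EFinP; exact: intg_meas gi.
(* f = |f| - (|f| - f) is a difference of two nonnegative integrable functions, to which the change
   of variables applies. *)
have h1 : mu.-integrable D (EFin \o (fun x => `|f x| - f x)).
  by apply: intg_sub => //; exact: intg_abs.
have := abs0 _ _ mD h1; have := abs0 _ _ mD (intg_abs fi).
rewrite (I_sub mD (intg_abs fi) fi).
rewrite (I_sub mD' (intg_shift v mD (intg_abs fi)) (intg_shift v mD fi)).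
move=> /(_ (fun x _ => normr_ge0 _)) ->.
have g0 x : D x -> 0 <= `|f x| - f x by move=> _; rewrite subr_ge0 ler_norm.
by move=> /(_ g0) /addrI /oppr_inj.
Qed.

(** The intersection of countable covers whose total measures exceed that of [E] by less than
    1/(n+1). It replaces a Caratheodory measurable set by a Borel one, the only kind reached by
    generation from boxes. *)
Lemma borel_hull (E : set V) : (mu E < +oo)%E -> exists B : set (N.-tuple Rt),
  [/\ measurable B, E `<=` @trow R N @^-1` B & mu (@trow R N @^-1` B) = mu E].
Proof.
rewrite !lebmE => Efin.
have Ef : lebesgue_rV E \is a fin_num.
  by rewrite ge0_fin_numE//; exact: outer_measure_ge0.
have cov n : exists F : (set (N.-tuple Rt))^nat, [/\ (forall k, measurable (F k)),
    @rowt R N @^-1` E `<=` \bigcup_k F k &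
    (\sum_(0 <= k <oo) lebesgue_tuple R N (F k) < lebesgue_rV E + (n.+1%:R^-1)%:E)%E].
  have n0 : 0 < n.+1%:R^-1 :> R by rewrite invr_gt0.
  have [_ [F [mF EF] <-] Flt] := lb_ereal_inf_adherent n0 Ef.
  by exists F; split.
have /choice[F FP] := cov.
pose B := \bigcap_n \bigcup_k F n k.
have mB : measurable B.
  by apply: bigcapT_measurable => n; apply: bigcup_measurable => k _; case: (FP n).
have EB : E `<=` @trow R N @^-1` B.
  move=> x Ex n _; have [_ h _] := FP n; apply: h.
  by rewrite /preimage /= trowK.
exists B; split=> //.
apply/eqP; rewrite eq_le; apply/andP; split; last exact: le_outer_measure.
apply: (@le_trans _ _ (lebesgue_tuple R N B)).
  by rewrite le_eqVlt; apply/orP; left; apply/eqP; exact: lebesgue_trow.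
apply/lee_addgt0Pr => e e0.
have [n ne] : exists n, n.+1%:R^-1 < e.
  have [n _ h] := near_infty_natSinv_lt (PosNum e0).
  by exists n; apply: (h n) => /=.
have [mF _ h] := FP n.
apply: (@le_trans _ _ (lebesgue_rV E + (n.+1%:R^-1)%:E)%E); last first.
  by rewrite leeD2lE// lee_fin ltW.
apply: le_trans (ltW h).
apply: (@le_trans _ _ (lebesgue_tuple R N (\bigcup_k F n k))).
  apply: le_measure; rewrite ?inE//.
    by apply: bigcup_measurable => k _; exact: mF.
  exact: bigcap_inf.
by apply: measure_sigma_subadditive => //; apply: bigcup_measurable.
Qed.

End lebm_facts.

(** * Functions with zero integral over all boxes *)

Section boxes.
Variables (R : realType) (N : nat).
Local Notation Rt := (measurableTypeR R).
Local Notation V := 'rV[R]_N.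
Local Notation mu := (lebm R N).

Definition obox (c e : V) : set V := [set x | forall i, c 0 i < x 0 i < e 0 i].

Definition tobox (c e : V) : set (N.-tuple Rt) :=
  [set t | forall i, c 0 i < tnth t i < e 0 i].

Lemma measurable_tobox c e : measurable (tobox c e).
Proof.
rewrite (_ : tobox c e = [set t : N.-tuple Rt | forall i,
    (fun i : 'I_N => `]c 0 i, e 0 i[%classic : set Rt) i (tnth t i)]).
  apply: (@measurable_tbox R N (fun i => `]c 0 i, e 0 i[%classic : set Rt)).
  by move=> i; exact: measurable_itv.
by apply/seteqP; split=> t h i; have /= := h i; rewrite in_itv.
Qed.

Lemma trow_tobox c e : @trow R N @^-1` tobox c e = obox c e.
Proof. by apply/seteqP; split=> x /= h i; have := h i; rewrite tnth_mktuple. Qed.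

Lemma measurable_obox c e : measurable (obox c e).
Proof. rewrite -trow_tobox; apply: measurable_trow; exact: measurable_tobox. Qed.

Definition toboxes : set (set (N.-tuple Rt)) :=
  [set A | exists c e, A = tobox c e].

Lemma toboxesI : setI_closed toboxes.
Proof.
move=> _ _ [c [e ->]] [c' [e' ->]].
exists (\row_i Num.max (c 0 i) (c' 0 i)), (\row_i Num.min (e 0 i) (e' 0 i)).
apply/seteqP; split=> t /=.
  move=> [h h'] i; rewrite !mxE gt_max lt_min.
  by have /andP[-> ->] := h i; have /andP[-> ->] := h' i.
move=> h; split=> i; have := h i; rewrite !mxE gt_max lt_min;
  by move=> /andP[/andP[h1 h2] /andP[h3 h4]]; apply/andP.
Qed.

Lemma sigma_toboxes (A : set (N.-tuple Rt)) : measurable A -> <<s toboxes >> A.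
Proof.
have sT : sigma_algebra setT <<s toboxes >> by exact: smallest_sigma_algebra.
have [s0 sC sU] := sT.
apply: smallest_sub => // B.
rewrite -bigcup_seq => -[i _ [S mS <-]]; rewrite setTI.
suff : measurable `<=` [set S : set Rt | <<s toboxes >> ((@tnth N Rt)^~ i @^-1` S)].
  exact.
rewrite [X in X `<=` _](RGenOpens.measurableE R); apply: smallest_sub.
  split=> /=.
  - by rewrite preimage_set0.
  - move=> C hC; rewrite setTD preimage_setC.
    by have := sC _ hC; rewrite setTD.
  - by move=> F hF; rewrite preimage_bigcup; exact: sU.
move=> _ [x [y ->]] /=.
(* A slab in the coordinate i is the union of the boxes bounded by k in the other coordinates. *)
rewrite (_ : _ @^-1` _ = \bigcup_k tobox (\row_j if j == i then x else - k%:R)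
   (\row_j if j == i then y else k%:R)).
  by apply: sU => k; apply: sub_sigma_algebra; eexists; eexists.
apply/seteqP; split=> t /=.
  rewrite in_itv /= => txy.
  pose M := \big[Num.max/0]_j `|tnth t j|.
  exists (Num.truncn M).+1 => // j; rewrite !mxE.
  case: ifP => [/eqP -> //|_].
  rewrite -ltr_norml; apply: le_lt_trans (truncnS_gt M).
  exact: le_bigmax_cond.
by move=> [k _ /(_ i)]; rewrite !mxE eqxx in_itv.
Qed.

(** Dynkin's argument: the Borel sets on which [g] has zero integral form a lambda-system containing
    the boxes, a family stable under intersection. A Borel hull of {g > 0} is such a set and differs
    from it by a null set, so the integral of [g] over {g > 0} is 0. *)
Lemma boxes_le0 (a b : V) (g : V -> R) : (mu (obox a b) < +oo)%E ->
  mu.-integrable (obox a b) (EFin \o g) ->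
  (forall c e, obox c e `<=` obox a b -> \int[mu]_(x in obox c e) g x = 0) ->
  {ae mu, forall x, obox a b x -> g x <= 0}.
Proof.
move=> Qfin gi g0; set Q := obox a b.
have mQ : measurable Q by exact: measurable_obox.
pose X (A : set (N.-tuple Rt)) := @trow R N @^-1` A.
have mX A : measurable A -> measurable (X A) by exact: measurable_trow.
pose h (A : set (N.-tuple Rt)) (x : V) := \1_(X A) x * g x.
have mh A : measurable A -> measurable_fun Q (h A).
  move=> mA; apply: measurable_funM; last exact: intg_meas gi.
  by apply: measurable_indic; exact: mX.
have hle A x : `|h A x| <= `|g x|.
  rewrite normrM ler_piMl// indicE; case: (_ \in _) => /=.
    by rewrite normr1.
  by rewrite normr0.
have hi A : measurable A -> mu.-integrable Q (EFin \o h A).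
  by move=> mA; apply: (intg_le mQ (mh A mA) _ (intg_abs gi)) => x _; exact: hle.
have H A : measurable A -> \int[mu]_(x in Q) h A x = 0.
  move=> mA; have /= := @lambda_system_subset _ _ toboxesI setT
    [set A | measurable A /\ \int[mu]_(x in Q) h A x = 0].
  suff L : lambda_system setT
      [set A : set (N.-tuple Rt) | measurable A /\ \int[mu]_(x in Q) h A x = 0].
    move=> /(_ L); case/(_ _ _ A) => //; last exact: sigma_toboxes.
    move=> _ [c [e ->]]; split; first exact: measurable_tobox.
    rewrite /h /X trow_tobox.
    have := toboxesI (ex_intro _ a (ex_intro _ b erefl)) (ex_intro _ c (ex_intro _ e erefl)).
    move=> [c' [e' ce]].
    have QE : Q `&` obox c e = obox c' e'.
      by rewrite /Q -!trow_tobox -ce -preimage_setI.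
    transitivity (\int[mu]_(x in Q `&` obox c e) g x).
      rewrite Rintegral_mkcondr; apply: eq_Rintegral => x _.
      by rewrite /patch indicE; case: (_ \in _); rewrite ?mul1r ?mul0r.
    by rewrite QE; apply: g0; rewrite -QE; exact: subIsetl.
  split=> //.
  - split=> //; transitivity (\int[mu]_(x in Q) g x); last first.
      by apply: g0.
    by apply: I_eq => x Qx; rewrite /h indicE mem_set// mul1r.
  - move=> A' B' BA [mA' hA] [mB' hB]; split; first exact: measurableD.
    transitivity (\int[mu]_(x in Q) (h A' x - h B' x)).
      apply: I_eq => x Qx; rewrite /h -mulrBl; congr (_ * _).
      rewrite !indicE.
      case: (boolP (x \in X B')) => xB.
        have xA : x \in X A' := mem_set (BA _ (set_mem xB)).
        rewrite xA (_ : x \in X (A' `\` B') = false) ?subrr//.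
        by apply/negbTE/negP => /set_mem[_ nB]; apply: nB; exact: set_mem.
      rewrite subr0; congr (nat_of_bool _)%:R; apply/idP/idP => /set_mem.
        by move=> [xA _]; exact: mem_set.
      by move=> xA; apply: mem_set; split=> // xB'; move/negP: xB; apply; exact: mem_set.
    by rewrite (I_sub mQ (hi _ mA') (hi _ mB')) hA hB subrr.
  - move=> F ndF FP; split.
      by apply: bigcup_measurable => k _; case: (FP k).
    have mU : measurable (\bigcup_i F i) by apply: bigcup_measurable => k _; case: (FP k).
    have [|||||_ _] := @I_dct _ _ _ mu Q mQ (fun n => h (F n)) (h (\bigcup_i F i)) (fun x => `|g x|).
    + by move=> n; apply: mh; case: (FP n).
    + exact: mh.
    + exact: intg_abs.
    + apply: nearW => x _; apply: cvg_near_cst.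
      have [xU|xU] := pselect (X (\bigcup_i F i) x).
        have [k _ xk] := xU; exists k => // n /= kn.
        rewrite /h !indicE !mem_set//.
        by have /subsetPset := ndF _ _ kn; apply.
      apply: nearW => n; rewrite /h !indicE !memNset// => xn; apply: xU.
      by exists n.
    + by move=> n; apply: nearW => x _; exact: hle.
    + under eq_fun => n do rewrite (FP n).2.
      by move=> /(cvg_lim (@Rhausdorff R)); rewrite lim_cst.
pose E := Q `&` [set x | 0 < g x].
have mE : measurable E.
  rewrite (_ : E = Q `&` g @^-1` `]0, +oo[%classic).
    by apply: (intg_meas gi) => //; exact: measurable_itv.
  by apply/seteqP; split=> x /= [Qx]; rewrite in_itv/= andbT.
have Efin : (mu E < +oo)%E.
  by apply: le_lt_trans Qfin; apply: le_measure; rewrite ?inE//; exact: subIsetl.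
have [B [mB EB BE]] := borel_hull Efin.
have XBE : mu (X B) = mu E by exact: BE.
have null : mu (X B `\` E) = 0%E.
  rewrite measureD//; last 2 first.
  - exact: mX.
  - by apply: le_lt_trans Efin; rewrite le_eqVlt; apply/orP; left; apply/eqP.
  transitivity (mu E - mu E)%E; last by rewrite subee// ge0_fin_numE.
  by congr (_ - _)%E; [exact: XBE|rewrite setIidr].
have hE : {ae mu, forall x, Q x -> h B x = \1_E x * g x}.
  exists (X B `\` E); split; [|exact: null|].
    by apply: measurableD => //; exact: mX.
  move=> x /= /not_implyP[Qx hx]; split.
    apply: contrapT => nB; apply: hx; rewrite /h !indicE !memNset//.
    by move=> Ex; apply: nB; exact: EB.
  move=> Ex; apply: hx; rewrite /h !indicE !mem_set//; exact: EB.
have gp : {ae mu, forall x, Q x -> \1_E x * g x = 0}.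
  have hie := intg_eq_ae mQ _ hE (hi _ mB).
  have mEg : measurable_fun Q (fun x => \1_E x * g x).
    by apply: measurable_funM; [exact: measurable_indic|exact: intg_meas gi].
  apply: (I_eq0 mQ (hie mEg)).
    move=> x Qx; rewrite indicE; case: (boolP (x \in E)) => [/set_mem[_ /ltW]|_].
      by rewrite mul1r.
    by rewrite mul0r.
  by rewrite -(I_eq_ae mQ (mh _ mB) mEg hE) H.
apply: filterS gp => x h' Qx; have := h' Qx; rewrite leNgt; apply: contra_eqN => gx.
by rewrite indicE mem_set// mul1r gt_eqF.
Qed.

Lemma boxes_eq0 (a b : V) (g : V -> R) : (mu (obox a b) < +oo)%E ->
  mu.-integrable (obox a b) (EFin \o g) ->
  (forall c e, obox c e `<=` obox a b -> \int[mu]_(x in obox c e) g x = 0) ->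
  {ae mu, forall x, obox a b x -> g x = 0}.
Proof.
move=> Qfin gi g0; have mQ := measurable_obox a b.
have h1 := boxes_le0 Qfin gi g0.
have h2 := @boxes_le0 a b (fun x => - g x) Qfin (intg_opp mQ gi).
have {}h2 : {ae mu, forall x, obox a b x -> - g x <= 0}.
  apply: h2 => c e ce; have gi' : mu.-integrable (obox c e) (EFin \o g).
    by apply: integrableS gi => //; exact: measurable_obox.
  by rewrite (I_opp (measurable_obox c e) gi') g0// oppr0.
apply: filterS2 h1 h2 => x h1 h2 Qx; apply/eqP; rewrite eq_le h1//=.
by rewrite -oppr_le0 h2.
Qed.

End boxes.


(** * Test functions *)

Section difference_quotient.
Variables (R : realType) (V : normedModType R).
Implicit Types (f : V -> R) (x v : V).

Lemma is_derive_cvgP f x v l : is_derive x v f l <->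
  h^-1 * (f (h *: v + x) - f x) @[h --> 0^'] --> l.
Proof.
split=> [[df <-]|h]; first exact: df.
by split; [exact: cvgP h|exact: cvg_lim h].
Qed.

End difference_quotient.

Section line_derivative.
Variables (R : realType) (V : normedModType R).
Implicit Types (f : V -> R) (x v : V).

Lemma line_derive f x v s l : is_derive (s *: v + x) v f l <->
  is_derive (s : R) 1 (fun h : R => f (h *: v + x)) l.
Proof.
rewrite (is_derive_cvgP f) (is_derive_cvgP (fun h : R => f (h *: v + x)) s).
suff -> : (fun h : R => h^-1 * (f (h *: v + (s *: v + x)) - f (s *: v + x))) =
  (fun h => h^-1 * (f ((h *: (1 : R) + s) *: v + x) - f (s *: v + x))) by [].
by apply/funext => h; rewrite [h *: 1]mulr1 scalerDl addrA.
Qed.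

End line_derivative.

Section flat.
Variable R : realType.

Lemma is_derive_etrans (f : R -> R) (y a b : R) :
  is_derive y 1 f a -> a = b -> is_derive y 1 f b.
Proof. by move=> + <-. Qed.

Lemma is_derive_mulR (f g : R -> R) (y a b : R) : is_derive y 1 f a ->
  is_derive y 1 g b -> is_derive y 1 (fun t => f t * g t) (f y * b + g y * a).
Proof. by move=> [da <-] [db <-]; split; [exact: derivableM|exact: deriveM]. Qed.

Lemma is_derive_pow k (y : R) :
  is_derive y 1 (fun t : R => t ^+ k) (k%:R * y ^+ k.-1).
Proof.
elim: k => [|k IH]; first by rewrite mul0r; exact: is_derive_cst.
rewrite (_ : (fun t => _) = (fun t : R => t * t ^+ k)); last first.
  by apply/funext => t; rewrite exprS.
apply: (is_derive_etrans (is_derive_mulR (is_derive_id y 1) IH)).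
rewrite mulr1; case: k {IH} => [|k] /=; rewrite ?expr0 ?exprS; ring.
Qed.

(* All the functions t^-k exp(-1/t) at once: the family is stable under
   differentiation. *)
Definition flat (k : nat) (t : R) : R :=
  if 0 < t then t^-1 ^+ k * expR (- t^-1) else 0.

Lemma flat_ge0 k t : 0 <= flat k t.
Proof.
rewrite /flat; case: ifP => // t0.
by rewrite mulr_ge0 ?expR_ge0// exprn_ge0// invr_ge0 ltW.
Qed.

(** From e^y >= y^(k+1)/(k+1)! at y = 1/t. For h > 0 the difference quotient of [flat k] at 0 is
    [flat k.+1 h], so this linear bound gives all these functions the derivative 0 at the origin. *)
Lemma flat_le k t : flat k t <= k.+1`!%:R * `|t|.
Proof.
rewrite /flat; case: ifPn => t0; last by rewrite mulr_ge0.
rewrite (gtr0_norm t0); have y0 : 0 <= t^-1 by rewrite invr_ge0 ltW.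
have := expR_ge1Dxn k y0.
rewrite expRN ler_pdivrMr ?expR_gt0// => h.
rewrite -mulrA mulrC -ler_pdivrMr; last by rewrite ltr0n fact_gt0.
rewrite -ler_pdivrMl// (le_trans _ h)//.
by rewrite exprS mulrA ler_wpDl.
Qed.

Lemma is_derive_flat k (t : R) :
  is_derive t 1 (flat k) (flat k.+2 t - k%:R * flat k.+1 t).
Proof.
have [t0|t0|t0] := ltgtP 0 t.
- have der : is_derive t 1 (fun s : R => s^-1 ^+ k * expR (- s^-1))
      (flat k.+2 t - k%:R * flat k.+1 t).
    have tn0 : t != 0 by rewrite gt_eqF.
    have dV : is_derive t 1 (fun s : R => s^-1) (- t^-1 ^+ 2).
      apply: is_derive_eq; first exact: (@is_deriveV _ id t 1 1 tn0).
      by rewrite scaler1 exprVn.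
    have dF : is_derive t^-1 1 (fun y : R => y ^+ k * expR (- y))
        (k%:R * t^-1 ^+ k.-1 * expR (- t^-1) - t^-1 ^+ k * expR (- t^-1)).
      have dN : is_derive t^-1 1 (fun y : R => expR (- y)) (- expR (- t^-1)).
        change (is_derive t^-1 1 (expR \o -%R) (- expR (- t^-1))).
        by apply: is_derive_eq; rewrite mulrN1.
      have dX : is_derive t^-1 1 (fun y : R => y ^+ k) (k%:R * t^-1 ^+ k.-1).
        exact: is_derive_pow.
      by apply: (is_derive_etrans (is_derive_mulR dX dN)); ring.
    change (is_derive t 1 ((fun y : R => y ^+ k * expR (- y)) \o
      (fun s : R => s^-1)) (flat k.+2 t - k%:R * flat k.+1 t)).
    apply: (is_derive_etrans (@is_derive1_comp R (fun y : R => y ^+ k * expR (- y))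
      (fun s : R => s^-1) t _ _ dF dV)).
    rewrite /flat t0; case: k {dF} => [|k] /=; rewrite !exprS; ring.
  apply/is_derive_cvgP; move/is_derive_cvgP: der; apply: cvg_trans.
  apply: near_eq_cvg; near=> h.
  have h0 : 0 < h *: 1 + t.
    rewrite /GRing.scale /= mulr1 -ltrBlDr sub0r.
    have : `|h| < t by near: h; exact: dnbhs0_lt.
    by rewrite ltr_norml => /andP[].
  by rewrite /flat h0 t0.
- rewrite /flat !ltNge (ltW t0) /= mulr0 subrr.
  apply/is_derive_cvgP; apply: cvg_near_cst; near=> h.
  have h2 : h *: 1 + t <= 0.
    have : `|h| <= - t by near: h; apply: dnbhs0_le; rewrite oppr_gt0.
    by rewrite ler_norml [h *: 1]mulr1 -lerBrDr sub0r => /andP[].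
  by rewrite (ltNge 0 (h *: 1 + t)) h2 (ltNge 0 t) (ltW t0) /= subrr mulr0.
- rewrite -t0 /flat !ltxx mulr0 subrr.
  apply/is_derive_cvgP; apply/cvgrPdist_le => e e0.
  pose C : R := k.+2`!%:R.
  have C0 : 0 < C by rewrite ltr0n fact_gt0.
  near=> h; rewrite sub0r normrN ltxx subr0 addr0 /GRing.scale /= mulr1.
  have hC : `|h| <= e / C.
    by near: h; apply: dnbhs0_le; rewrite divr_gt0.
  case: ifPn => h0; last by rewrite mulr0 normr0 ltW.
  have := flat_le k.+1 h; rewrite /flat h0 => hh.
  rewrite mulrA -exprS ger0_norm; last first.
    by rewrite mulr_ge0 ?expR_ge0// exprn_ge0// invr_ge0 ltW.
  apply: (le_trans hh); rewrite mulrC -ler_pdivlMr//.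
Unshelve. all: by end_near. Qed.

Lemma continuous_flat k : continuous (flat k).
Proof.
move=> t; apply: differentiable_continuous; apply/derivable1_diffP.
by have [] := is_derive_flat k t.
Qed.

End flat.

Section Ck.
Variables (R : realType) (N : nat).
Local Notation V := 'rV[R]_N.
Implicit Types (u v : V -> R).

Definition evec (i : 'I_N) : V := delta_mx 0 i.
Local Notation pd i u := ('D_(evec i) u).

(** An index on which Leibniz' rule can be iterated by induction; [smooth] is membership at every
    order. *)
Fixpoint Ck (k : nat) (u : V -> R) : Prop :=
  [/\ continuous u, (forall i x, derivable u x (evec i)) &
      if k is k'.+1 then forall i, Ck k' (pd i u) else True].

Lemma Ck_pred k u : Ck k.+1 u -> Ck k u.
Proof.
elim: k u => [|k IH] u [cu du h]; split=> //.
by move=> i; apply: IH; exact: h.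
Qed.

Lemma pd_add u v i x : derivable u x (evec i) -> derivable v x (evec i) ->
  pd i (fun y => u y + v y) x = pd i u x + pd i v x.
Proof. by move=> du dv; exact: deriveD. Qed.

Lemma pd_mul u v i x : derivable u x (evec i) -> derivable v x (evec i) ->
  pd i (fun y => u y * v y) x = u x * pd i v x + v x * pd i u x.
Proof. by move=> du dv; exact: deriveM. Qed.

Lemma pd_cst (c : R) i x : pd i (fun=> c) x = 0.
Proof. exact: derive_cst. Qed.

Lemma pd_scale (c : R) u i x : derivable u x (evec i) ->
  pd i (fun y => c * u y) x = c * pd i u x.
Proof.
by move=> du; exact: (deriveZ c du).
Qed.

Lemma Ck_cst k (c : R) : Ck k (fun=> c).
Proof.
elim: k c => [|k IH] c; split; try by move=> *; exact: cst_continuous.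
- by move=> *; exact: derivable_cst.
- by [].
- by move=> *; exact: derivable_cst.
- by move=> i; rewrite (_ : pd i _ = fun=> 0)//; apply/funext => x; rewrite pd_cst.
Qed.

Lemma Ck_add k u v : Ck k u -> Ck k v -> Ck k (fun x => u x + v x).
Proof.
elim: k u v => [|k IH] u v [cu du hu] [cv dv hv]; split.
- by move=> x; exact: (continuousD (cu x) (cv x)).
- by move=> i x; apply: derivableD.
- by [].
- by move=> x; exact: (continuousD (cu x) (cv x)).
- by move=> i x; apply: derivableD.
- move=> i; rewrite (_ : pd i _ = fun x => pd i u x + pd i v x).
    by apply: IH; [exact: hu|exact: hv].
  by apply/funext => x; rewrite pd_add.
Qed.

Lemma Ck_mul k u v : Ck k u -> Ck k v -> Ck k (fun x => u x * v x).
Proof.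
elim: k u v => [|k IH] u v Cu Cv; have [cu du hu] := Cu; have [cv dv hv] := Cv.
  split=> //; first by move=> x; exact: (continuousM (cu x) (cv x)).
  by move=> i x; apply: derivableM.
split; first by move=> x; exact: (continuousM (cu x) (cv x)).
  by move=> i x; apply: derivableM.
move=> i; rewrite (_ : pd i _ = fun x => u x * pd i v x + v x * pd i u x).
  by apply: Ck_add; apply: IH; [exact: Ck_pred|exact: hv|exact: Ck_pred|exact: hu].
by apply/funext => x; rewrite pd_mul.
Qed.

Lemma Ck_scale k (c : R) u : Ck k u -> Ck k (fun x => c * u x).
Proof. by apply: Ck_mul; exact: Ck_cst. Qed.

Lemma Ck_pow k n u : Ck k u -> Ck k (fun x => u x ^+ n).
Proof.
move=> Cu; elim: n => [|n IH].
  rewrite (_ : (fun x => _) = fun=> 1); first exact: Ck_cst.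
  by apply/funext => x; rewrite expr0.
rewrite (_ : (fun x => _) = fun x => u x * u x ^+ n); first exact: Ck_mul.
by apply/funext => x; rewrite exprS.
Qed.

Lemma Ck_prod k (I : Type) (s : seq I) (u : I -> V -> R) :
  (forall i, Ck k (u i)) -> Ck k (fun x => \prod_(i <- s) u i x).
Proof.
move=> Cu; elim: s => [|i s IH].
  rewrite (_ : (fun x => _) = fun=> 1); first exact: Ck_cst.
  by apply/funext => x; rewrite big_nil.
rewrite (_ : (fun x => _) = fun x => u i x * \prod_(j <- s) u j x).
  exact: Ck_mul.
by apply/funext => x; rewrite big_cons.
Qed.

Lemma is_derive_coord (f : R -> R) (s c l : R) i j (x : V) :
  is_derive (s * x 0 i + c) 1 f l ->
  is_derive x (evec j) (fun y => f (s * y 0 i + c)) ((i == j)%:R * s * l).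
Proof.
move=> df; rewrite -[x in is_derive x]add0r -[X in is_derive (X + x)](scale0r (evec j)).
apply/line_derive.
rewrite (_ : (fun h => _) = f \o (fun h => ((i == j)%:R * s) * h + (s * x 0 i + c))); last first.
  apply/funext => h /=; congr f; rewrite !mxE /=; ring.
set k := _ * s; set c' := _ + c.
have dk : is_derive (0 : R) 1 (fun h : R => k * h + c') k.
  apply/is_derive_cvgP; apply: cvg_near_cst; near=> h.
  have h0 : h != 0 by near: h; exact: nbhs_dnbhs_neq.
  by rewrite mulr0 add0r addr0 [h *: 1]mulr1 addrK mulrCA mulVf// mulr1.
have df' : is_derive (k * 0 + c') 1 f l by rewrite mulr0 add0r.
have H := @is_derive1_comp R f (fun h => k * h + c') 0 l k df' dk.
exact: (is_derive_etrans H (mulrC l k)).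
Unshelve. all: by end_near.
Qed.

Lemma Ck_flat n k (s c : R) i : Ck n (fun x : V => flat k (s * x 0 i + c)).
Proof.
have cont m : continuous (fun x : V => flat m (s * x 0 i + c)).
  move=> x; apply: (@continuous_comp _ _ _ (fun y : V => s * y 0 i + c) (@flat R m)).
    apply: continuousD; last exact: cst_continuous.
    by apply: continuousM; [exact: cst_continuous|exact: coord_continuous].
  exact: continuous_flat.
have der m j x := @is_derive_coord (@flat R m) s c _ i j x (is_derive_flat m (s * x 0 i + c)).
elim: n k => [|n IH] k; split=> //.
move=> j.
rewrite (_ : pd j _ = fun x : V => (i == j)%:R * s *
   (flat k.+2 (s * x 0 i + c) + - k%:R * flat k.+1 (s * x 0 i + c))).
  by apply: Ck_scale; apply: Ck_add => //; apply: Ck_scale.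
by apply/funext => x; have [_ ->] := der k j x; rewrite mulNr.
Qed.

Lemma smooth_pd u i : smooth u -> smooth (pd i u).
Proof. by move=> su s; have := su (rcons s i); rewrite /partials foldr_rcons. Qed.

Lemma smooth_Ck k u : smooth u -> Ck k u.
Proof.
elim: k u => [|k IH] u su; have [cu du] := su [::]; split=> //.
by move=> i; apply: IH; exact: smooth_pd.
Qed.

Lemma Ck_smooth u : (forall k, Ck k u) -> smooth u.
Proof.
move=> h s; have {h} := h (size s).
elim/last_ind: s u => [|s i IH] u; first by case.
rewrite size_rcons => -[cu du hu]; rewrite /partials foldr_rcons.
exact: (IH _ (hu i)).
Qed.

End Ck.


(** * Test functions and the fundamental lemma of the calculus of variations *)

Section tests.
Variables (R : realType) (N : nat).
Local Notation V := 'rV[R]_N.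
Local Notation mu := (lebm R N).
Local Notation pd i u := ('D_(evec R i) u).
Implicit Types (u v phi psi : V -> R) (Om K : set V).

Lemma compact_bounded_fun K u : compact K -> continuous u ->
  exists2 M : R, 0 <= M & forall x, K x -> `|u x| <= M.
Proof.
move=> cK cu; have /compact_bounded[M [_ MP]] : compact (u @` K).
  by apply: continuous_compact => //; exact: continuous_subspaceT.
exists (Num.max M 0 + 1).
  by rewrite addr_ge0// le_max lexx orbT.
move=> x Kx; apply: (MP (Num.max M 0 + 1)); last by exists x.
by rewrite ltr_pwDr// le_max lexx.
Qed.

Lemma test_cont Om u : test_function Om u -> continuous u.
Proof. by move=> [/(_ [::])[]]. Qed.

Lemma test_derivable Om u i x : test_function Om u -> derivable u x (evec R i).
Proof. by move=> [/(_ [::])[_ d] _]; exact: d. Qed.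

Lemma test_bounded Om u : test_function Om u ->
  exists2 M : R, 0 <= M & forall x, `|u x| <= M.
Proof.
move=> tu; have cu := test_cont tu; have [_ [K [cK _ K0]]] := tu.
have [M M0 MP] := compact_bounded_fun cK cu; exists M => // x.
by have [/MP//|/K0 ->] := pselect (K x); rewrite normr0.
Qed.

Lemma test0 Om : test_function Om (fun=> 0).
Proof.
split; first by apply: Ck_smooth => k; exact: Ck_cst.
by exists set0; split=> //; exact: compact0.
Qed.

Lemma test_add Om u v : test_function Om u -> test_function Om v ->
  test_function Om (fun x => u x + v x).
Proof.
move=> [su [K [cK KO K0]]] [sv [L [cL LO L0]]]; split.
  by apply: Ck_smooth => k; apply: Ck_add; exact: smooth_Ck.
exists (K `|` L); split; [exact: compactU|by move=> x []; [exact: KO|exact: LO]|].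
by move=> x /not_orP[/K0 -> /L0 ->]; rewrite addr0.
Qed.

Lemma test_smul Om u v : test_function Om u -> smooth v ->
  test_function Om (fun x => v x * u x).
Proof.
move=> [su [K [cK KO K0]]] sv; split.
  by apply: Ck_smooth => k; apply: Ck_mul; exact: smooth_Ck.
by exists K; split=> // x /K0 ->; rewrite mulr0.
Qed.

Lemma test_mul Om u v : test_function Om u -> test_function Om v ->
  test_function Om (fun x => u x * v x).
Proof. by move=> [su _] tv; exact: test_smul. Qed.

Lemma test_scale Om c u : test_function Om u -> test_function Om (fun x => c * u x).
Proof.
by move=> tu; apply: test_smul => //; apply: Ck_smooth => k; exact: Ck_cst.
Qed.

Lemma rV_hausdorff : hausdorff_space V.
Proof. exact: norm_hausdorff. Qed.

Lemma pd_supp K u i x : compact K -> (forall x, ~ K x -> u x = 0) -> ~ K x ->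
  pd i u x = 0.
Proof.
move=> cK K0 nKx; have oK : open (~` K).
  by apply: closed_openC; exact: compact_closed rV_hausdorff cK.
rewrite -(pd_cst 0 i x); apply: near_eq_derive.
by near=> y; apply: K0; near: y; exact: open_nbhs_nbhs.
Unshelve. all: by end_near. Qed.

Lemma test_pd Om u i : test_function Om u -> test_function Om (pd i u).
Proof.
move=> [su [K [cK KO K0]]]; split; first exact: smooth_pd.
by exists K; split=> // x; exact: (pd_supp _ cK K0).
Qed.

Lemma test_meas Om D u : measurable D -> test_function Om u -> measurable_fun D u.
Proof. by move=> mD /test_cont; exact: continuous_measurable_rV. Qed.

Definition cbox (a b : V) : set V := [set x | forall i, a 0 i <= x 0 i <= b 0 i].

Lemma compact_cbox a b : compact (cbox a b).
Proof.
rewrite (_ : cbox a b = [set v : V | forall i,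
  (fun i => `[a 0 i, b 0 i]%classic) i (v ord0 i)]).
  apply: (@rV_compact R N (fun i => `[a 0 i, b 0 i]%classic)) => i.
  exact: segment_compact.
by apply/seteqP; split=> x h i; have := h i; rewrite /= in_itv.
Qed.

Lemma measurable_cbox a b : measurable (cbox a b).
Proof.
rewrite (_ : cbox a b = [set v : V | forall i,
  (fun i => `[a 0 i, b 0 i]%classic) i (v 0 i)]).
  apply: (@measurable_rbox R N (fun i => `[a 0 i, b 0 i]%classic)) => i.
  exact: measurable_itv.
by apply/seteqP; split=> x h i; have := h i; rewrite /= in_itv.
Qed.

Lemma obox_cbox a b : obox a b `<=` cbox a b.
Proof. by move=> x h i; have /andP[/ltW -> /ltW ->] := h i. Qed.

Lemma coord_le_norm (x : V) i : `|x 0 i| <= `|x|.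
Proof.
rewrite [leRHS]/Num.norm /= mx_normrE.
exact: (le_bigmax _ (fun ij : 'I_1 * 'I_N => `|x ij.1 ij.2|) (0, i)).
Qed.

Lemma lebm_bounded (A : set V) : bounded_set A -> (mu A < +oo)%E.
Proof.
move=> [M [_ MP]]; pose M' := Num.max M 0 + 1.
have MM' : M < M' by rewrite ltr_pwDr// le_max lexx.
have M0 : 0 <= M' by rewrite addr_ge0// le_max lexx orbT.
apply: (@le_lt_trans _ _ (mu [set x : V | forall i,
   (const_mx (- M') : V) 0 i <= x 0 i < (const_mx (M' + 1) : V) 0 i])).
  rewrite lebmE; apply: le_outer_measure => x Ax i; rewrite !mxE.
  have h : `|x 0 i| <= M'.
    exact: le_trans (coord_le_norm x i) (MP M' MM' x Ax).
  move: h; rewrite ler_norml => /andP[-> /= h].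
  by rewrite (le_lt_trans h)// ltrDl.
rewrite lebm_box ?ltry// => i; rewrite !mxE.
by rewrite (le_trans _ (ler_wpDr _ M0))// ?oppr_le0// ler_wpDr//.
Qed.

Lemma lebm_compact K : compact K -> (mu K < +oo)%E.
Proof. by move=> /compact_bounded; exact: lebm_bounded. Qed.

Lemma compact_measurable K : compact K -> measurable K.
Proof.
move=> cK; rewrite -(setCK K); apply: measurableC; apply: open_measurable_rV.
by apply: closed_openC; exact: compact_closed rV_hausdorff cK.
Qed.

Lemma test_integrable Om D u : measurable D -> test_function Om u ->
  mu.-integrable D (EFin \o u).
Proof.
move=> mD tu; have [M M0 MP] := test_bounded tu.
have [_ [K [cK _ K0]]] := tu; have mK := compact_measurable cK.
have iK : mu.-integrable setT (EFin \o (fun x => M * \1_K x)).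
  apply: intg_scale => //; apply/integrableP; split.
    by apply/measurable_EFinP; exact: measurable_indic.
  under eq_integral => x _ do rewrite /= ger0_norm//.
  by rewrite integral_indic// setIT; exact: lebm_compact.
apply: (@intg_le _ _ _ mu D mD u (fun x => M * \1_K x)); first exact: test_meas tu.
  move=> x _; rewrite indicE; have [Kx|Kx] := pselect (K x).
    by rewrite mem_set// mulr1.
  by rewrite memNset// mulr0 K0// normr0.
by apply: integrableS iK => //; exact: measurableT.
Qed.

Lemma I_supp D u : measurable D -> (forall x, ~ D x -> u x = 0) ->
  \int[mu]_(x in D) u x = \int[mu]_x u x.
Proof.
move=> mD u0; rewrite Rintegral_mkcond; apply: eq_Rintegral => x _.
rewrite /patch; case: ifPn => // nD; rewrite u0// => Dx.
by move/negP: nD; apply; exact: mem_set.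
Qed.

(* 1 - (1 - bump)^n increases to the indicator of the open box. *)
Definition bump (a b x : V) : R :=
  \prod_i (flat 0 (1 * x 0 i + - a 0 i) * flat 0 (-1 * x 0 i + b 0 i)).

Lemma flat0_le1 (t : R) : flat 0 t <= 1.
Proof.
rewrite /flat; case: ifP => // t0.
by rewrite expr0 mul1r -expR0 ler_expR oppr_le0 invr_ge0 ltW.
Qed.

Lemma flat0_gt0 (t : R) : 0 < t -> 0 < flat 0 t.
Proof. by move=> t0; rewrite /flat t0 expr0 mul1r expR_gt0. Qed.

Lemma bump_itv a b x : 0 <= bump a b x <= 1.
Proof.
apply/andP; split; first by apply: prodr_ge0 => i _; rewrite mulr_ge0 ?flat_ge0.
apply: prodr_ile1 => i _; rewrite mulr_ge0 ?flat_ge0//=.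
by rewrite mulr_ile1 ?flat_ge0 ?flat0_le1.
Qed.

Lemma bump_gt0 a b x : obox a b x -> 0 < bump a b x.
Proof.
move=> h; apply: prodr_gt0 => i _; have /andP[h1 h2] := h i.
by rewrite mulr_gt0// flat0_gt0// ?mul1r ?mulN1r ?subr_gt0// addrC subr_gt0.
Qed.

Lemma bump_out a b x : ~ obox a b x -> bump a b x = 0.
Proof.
move=> nx; have [i hi] : exists i, ~ (a 0 i < x 0 i < b 0 i).
  by apply: contrapT => h; apply: nx => i; apply: contrapT => h'; apply: h; exists i.
rewrite /bump (bigD1 i)//=.
suff -> : flat 0 (1 * x 0 i + - a 0 i) * flat 0 (-1 * x 0 i + b 0 i) = 0.
  by rewrite mul0r.
have -> : -1 * x 0 i + b 0 i = b 0 i - x 0 i by ring.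
rewrite /flat mul1r !subr_gt0.
case: ifP => h1; last by rewrite mul0r.
by case: ifP => h2; [exfalso; apply: hi; rewrite h1 h2|rewrite mulr0].
Qed.

Lemma smooth_bump a b : smooth (bump a b).
Proof.
by apply: Ck_smooth => k; apply: Ck_prod => i; apply: Ck_mul; exact: Ck_flat.
Qed.

Definition plateau a b n x : R := 1 - (1 - bump a b x) ^+ n.

Lemma test_plateau Om a b K n : compact K -> K `<=` Om -> obox a b `<=` K ->
  test_function Om (plateau a b n).
Proof.
move=> cK KO abK; split.
  apply: Ck_smooth => k; apply: Ck_add; first exact: Ck_cst.
  rewrite (_ : (fun x => _) = fun x => (-1) * (1 + (-1) * bump a b x) ^+ n).
    apply: Ck_scale; apply: Ck_pow; apply: Ck_add; first exact: Ck_cst.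
    by apply: Ck_scale; apply: smooth_Ck; exact: smooth_bump.
  by apply/funext => x; rewrite !mulN1r.
exists K; split=> // x nK; rewrite /plateau bump_out ?subr0 ?expr1n ?subrr//.
by move=> /abK.
Qed.

Lemma plateau_itv a b n x : 0 <= plateau a b n x <= \1_(obox a b) x.
Proof.
rewrite /plateau indicE; have [abx|abx] := pselect (obox a b x).
  have /andP[h1 h2] := bump_itv a b x; rewrite mem_set// subr_ge0.
  rewrite exprn_ile1 ?subr_ge0// ?lerBlDr ?lerDl//=.
  by rewrite exprn_ge0// subr_ge0.
by rewrite memNset// bump_out// subr0 expr1n subrr lexx.
Qed.

Lemma plateau_cvg a b x : plateau a b n x @[n --> \oo] --> (\1_(obox a b) x : R).
Proof.
rewrite indicE; have [abx|abx] := pselect (obox a b x).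
  rewrite mem_set//= -[X in _ --> X]subr0; apply: cvgB; first exact: cvg_cst.
  have /andP[h1 h2] := bump_itv a b x; have h3 := bump_gt0 abx.
  by apply: cvg_expr; rewrite ger0_norm ?subr_ge0// ltrBlDr ltrDl.
rewrite memNset//=; apply: cvg_near_cst; apply: nearW => n.
by rewrite /plateau bump_out// subr0 expr1n subrr.
Qed.

Definition locint Om u := forall K, compact K -> K `<=` Om ->
  mu.-integrable K (EFin \o u).

(** Rational cubes contained in [Om] cover it. They are enumerated through [unpickle], so that their
    exceptional sets can be united countably. *)
Lemma open_cover_cubes Om (P : V -> Prop) : open Om ->
  (forall (a b : V) (r : R), 0 < r -> (forall i, b 0 i = a 0 i + r) -> cbox a b `<=` Om ->
    {ae mu, forall x, obox a b x -> P x}) ->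
  {ae mu, forall x, Om x -> P x}.
Proof.
move=> oO h.
pose A (z : 'rV[rat]_N * rat) : V := \row_i (ratr (z.1 0 i) - ratr z.2).
pose B (z : 'rV[rat]_N * rat) : V := \row_i (ratr (z.1 0 i) + ratr z.2).
have : {ae mu, forall x, forall n : nat, forall z : 'rV[rat]_N * rat,
    unpickle n = Some z ->
    0 < z.2 -> cbox (A z) (B z) `<=` Om -> obox (A z) (B z) x -> P x}.
  apply: ae_foralln => n; case E : (unpickle n) => [z|]; last by apply: nearW.
  have [z0|z0] := boolP (0 < z.2); last first.
    by apply: nearW => x z' [<-] z0'; rewrite z0' in z0.
  have [zO|zO] := pselect (cbox (A z) (B z) `<=` Om); last first.
    by apply: nearW => x z' [<-] _ /zO.
  apply: filterS (h (A z) (B z) (2 * ratr z.2) _ _ zO) => [x hx z' [<-] _ _ //||i].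
    by rewrite mulr_gt0// ltr0q.
  by rewrite !mxE; ring.
apply: filterS => x hx Ox; have [q [r [r0 [xq qO]]]] := open_rbox oO Ox.
have cE y i : (`|y 0 i - ratr (q 0 i)| <= ratr r) =
    (A (q, r) 0 i <= y 0 i <= B (q, r) 0 i :> bool) by rewrite !mxE ler_distl.
apply: (hx (pickle (q, r)) (q, r)) => //.
- by rewrite pickleK.
- by move=> y hy; apply: qO => i; rewrite cE; exact: hy.
- by move=> i; rewrite !mxE -ltr_distl; exact: xq.
Qed.

(** Testing against functions that tend to the indicator of a box shows that [u] has zero integral
    over every box inside a given cube, and [boxes_eq0] concludes. *)
Lemma locint_test_eq0 Om u : open Om -> locint Om u ->
  (forall phi, test_function Om phi -> \int[mu]_(x in Om) (u x * phi x) = 0) ->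
  {ae mu, forall x, Om x -> u x = 0}.
Proof.
move=> oO lu h; have mO := open_measurable_rV oO.
apply: open_cover_cubes => // a b r r0 abr abO.
have ab i : a 0 i < b 0 i by rewrite abr ltrDl.
have cK : compact (cbox a b) by exact: compact_cbox.
have mK := measurable_cbox a b.
have iK := lu _ cK abO.
have mQ := measurable_obox a b.
apply: boxes_eq0.
- apply: le_lt_trans (lebm_compact cK); apply: le_measure; rewrite ?inE//.
  exact: obox_cbox.
- by apply: integrableS iK => //; exact: obox_cbox.
move=> c e ce; have ceK : obox c e `<=` cbox a b by apply: subset_trans ce (@obox_cbox _ _).
have mC := measurable_obox c e.
have E n : \int[mu]_(x in cbox a b) (u x * plateau c e n x) = 0.
  rewrite -(h (plateau c e n)); last exact: (test_plateau n cK abO ceK).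
  have z x : ~ obox c e x -> u x * plateau c e n x = 0.
    move=> nx; have := plateau_itv c e n x; rewrite indicE memNset// => h0.
    by rewrite (_ : plateau _ _ _ _ = 0) ?mulr0//; apply/eqP; rewrite eq_sym eq_le.
  transitivity (\int[mu]_x (u x * plateau c e n x)).
    by apply: I_supp => // x nx; apply: z => /ceK.
  by apply/esym; apply: I_supp => // x nx; apply: z => /ceK/abO.
have mu_ := intg_meas iK.
have [|||||_ _ H] := @I_dct _ _ _ mu (cbox a b) mK (fun n x => u x * plateau c e n x)
   (fun x => u x * \1_(obox c e) x) (fun x => `|u x|).
- move=> n; apply: measurable_funM => //.
  exact: (test_meas mK (test_plateau n cK abO ceK)).
- by apply: measurable_funM => //; exact: measurable_indic.
- exact: intg_abs.
- apply: nearW => x _; apply: cvgM; [exact: cvg_cst|exact: plateau_cvg].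
- move=> n; apply: nearW => x _; rewrite normrM ler_piMr//.
  have /andP[h1 h2] := plateau_itv c e n x; rewrite ger0_norm//.
  by apply: (le_trans h2); rewrite indicE; case: (_ \in _).
have H0 : \int[mu]_(x in cbox a b) (u x * \1_(obox c e) x) = 0.
  move: H; under eq_fun => n do rewrite E.
  by move=> /(cvg_lim (@Rhausdorff R)); rewrite lim_cst.
rewrite -H0 (_ : obox c e = cbox a b `&` obox c e); last by rewrite setIidr.
rewrite Rintegral_mkcondr; apply: eq_Rintegral => x _.
rewrite /patch ?(setIidr ceK) indicE; case: (_ \in _); by rewrite ?mulr1 ?mulr0.
Qed.

End tests.
Arguments test_derivable {R N Om u} i x _.


(** * Weak gradients *)

Section integration_by_parts.
Variables (R : realType) (N : nat).
Local Notation V := 'rV[R]_N.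
Local Notation mu := (lebm R N).
Local Notation pd i u := ('D_(evec R i) u).
Implicit Types (u v phi psi : V -> R) (g : V -> V) (Om K : set V).

Lemma line_pd Om u i (x : V) (s : R) : test_function Om u ->
  is_derive s 1 (fun h : R => u (h *: evec R i + x)) (pd i u (s *: evec R i + x)).
Proof.
move=> tu; have d := derivableP (test_derivable i (s *: evec R i + x) tu).
exact: (proj1 (line_derive _ _ _ _ _) d).
Qed.

Lemma test_line_lip Om u i (x : V) (t M : R) : test_function Om u ->
  (forall y, `|pd i u y| <= M) -> `|u (t *: evec R i + x) - u x| <= `|t| * M.
Proof.
move=> tu uM.
suff pos (y : V) (s : R) : 0 <= s -> `|u (s *: evec R i + y) - u y| <= s * M.
  have [t0|t0] := leP 0 t; first by rewrite (ger0_norm t0); exact: (pos x t t0).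
  have := pos (t *: evec R i + x) (- t); rewrite addrA -scalerDl addNr scale0r add0r.
  rewrite oppr_ge0 (ltW t0) (ltr0_norm t0) => /(_ isT) h.
  by apply: (le_trans _ h); rewrite le_eqVlt; apply/orP; left; apply/eqP/distrC.
move=> s0; pose F (h : R) := u (h *: evec R i + y).
have dF (h : R) : is_derive h 1 F (pd i u (h *: evec R i + y)) by exact: line_pd tu.
have [|c _] := @MVT_segment R F (fun h => pd i u (h *: evec R i + y)) 0 s s0.
  apply: continuous_subspaceT => h; apply: differentiable_continuous.
  by apply/derivable1_diffP; have [] := dF h.
rewrite /F scale0r add0r subr0 => ->; rewrite normrM (ger0_norm s0) mulrC.
by rewrite ler_wpM2l.
Qed.

Definition bbox (m : R) : set V := [set x | forall i, `|x 0 i| <= m].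

Lemma bbox_cbox m : bbox m = cbox (const_mx (- m)) (const_mx m).
Proof.
by apply/seteqP; split=> x h i; have := h i; rewrite !mxE ler_norml.
Qed.

Lemma compact_bbox m : compact (bbox m).
Proof. by rewrite bbox_cbox; exact: compact_cbox. Qed.

Lemma compact_sub_bbox K : compact K -> exists2 m, 0 <= m & K `<=` bbox m.
Proof.
move=> /compact_bounded[M [_ MP]]; exists (Num.max M 0 + 1).
  by rewrite addr_ge0// le_max lexx orbT.
move=> x Kx i; apply: le_trans (coord_le_norm x i) (MP _ _ x Kx).
by rewrite ltr_pwDr// le_max lexx.
Qed.

(** The difference quotients of [u] have zero integral by translation invariance, and dominated
    convergence passes to the derivative. *)
Lemma I_pd0 Om u i : test_function Om u -> \int[mu]_x pd i u x = 0.
Proof.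
move=> tu; have [M M0 MP] := test_bounded (test_pd i tu).
have [_ [K [cK _ K0]]] := tu; have [m m0 Km] := compact_sub_bbox cK.
(* The steps [t n] are at most 1, so all the quotients vanish outside this box. *)
pose B := bbox (m + 1); have cB : compact B by exact: compact_bbox.
have mB := compact_measurable cB.
pose t n : R := n.+1%:R^-1.
have t0 n : 0 < t n by rewrite invr_gt0.
have t1 n : t n <= 1 by rewrite invf_le1// ler1n.
pose q n x := (t n)^-1 * (u (x + t n *: evec R i) - u x).
have ui : mu.-integrable setT (EFin \o u) by apply: test_integrable tu.
have ui' n : mu.-integrable setT (EFin \o (fun x => u (x + t n *: evec R i))).
  have := @intg_shift R N (t n *: evec R i) setT u measurableT ui.
  by rewrite preimage_setT.
have qi n : mu.-integrable setT (EFin \o q n).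
  by apply: intg_scale => //; exact: intg_sub.
have q0 n : \int[mu]_x q n x = 0.
  have di := intg_sub measurableT (ui' n) ui.
  rewrite (I_scale measurableT _ di) (I_sub measurableT (ui' n) ui).
  have := @I_shift R N (t n *: evec R i) setT u measurableT ui.
  by rewrite preimage_setT => ->; rewrite subrr mulr0.
have Bi : mu.-integrable setT (EFin \o (fun x => M * \1_B x)).
  apply: intg_scale => //; apply/integrableP; split.
    by apply/measurable_EFinP; exact: measurable_indic.
  under eq_integral => x _ do rewrite /= ger0_norm//.
  by rewrite integral_indic// setIT; exact: lebm_compact.
have [|||||_ _ H] := @I_dct _ _ _ mu setT measurableT q (pd i u) (fun x => M * \1_B x).
- by move=> n; exact: intg_meas (qi n).
- exact: test_meas (test_pd i tu).
- exact: Bi.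
- apply: nearW => x _.
  have d := line_pd i x 0 tu; rewrite scale0r add0r in d.
  move/is_derive_cvgP : d => d.
  have tc : t n @[n --> \oo] --> (0 : R)^'.
    move=> A hA; have tc0 : t n @[n --> \oo] --> (0 : R) by exact: cvg_harmonic.
    have hA' : nbhs (0 : R) (fun y => y != 0 -> A y) by exact: hA.
    by have [n0 _ hn0] := tc0 _ hA'; exists n0 => // n /hn0; apply; exact: lt0r_neq0.
  have := cvg_comp _ _ tc d; apply: cvg_trans; apply: near_eq_cvg.
  apply: nearW => n; rewrite /q /= scale0r add0r addr0 [t n *: 1]mulr1.
  by rewrite (addrC x).
- move=> n; apply: nearW => x _; rewrite /q indicE.
  have [xB|xB] := pselect (B x).
    rewrite mem_set// mulr1 normrM gtr0_norm ?invr_gt0// mulrC.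
    rewrite ler_pdivrMr// (mulrC M) -[X in X * M](gtr0_norm (t0 n)) (addrC x).
    exact: test_line_lip tu MP.
  rewrite memNset// mulr0.
  have nK (y : V) : (forall j, `|y 0 j - (x : V) 0 j| <= 1) -> ~ K y.
    move=> xy /Km Ky; apply: xB => j.
    rewrite (_ : (x : V) 0 j = y 0 j - (y 0 j - (x : V) 0 j)); last by rewrite opprB addrC subrK.
    by rewrite (le_trans (ler_normB _ _))// lerD// Ky.
  rewrite !K0 ?subrr ?mulr0 ?normr0//.
    by apply: nK => j; rewrite subrr normr0.
  apply: nK => j; rewrite !mxE addrAC subrr add0r eqxx /=.
  case: (_ == _); rewrite ?mulr0 ?normr0// mulr1 gtr0_norm//.
move: H; under eq_fun => n do rewrite q0.
by move=> /(cvg_lim (@Rhausdorff R)); rewrite lim_cst.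
Qed.

Lemma test_out Om u x : test_function Om u -> ~ Om x -> u x = 0.
Proof. by move=> [_ [K [_ KO K0]]] nO; apply: K0 => /KO. Qed.

Lemma ibp Om phi psi i : measurable Om -> test_function Om phi ->
  test_function Om psi ->
  \int[mu]_(x in Om) (phi x * pd i psi x) = - \int[mu]_(x in Om) (pd i phi x * psi x).
Proof.
move=> mO tphi tpsi.
have t1 := test_mul tphi (test_pd i tpsi); have t2 := test_mul (test_pd i tphi) tpsi.
have i1 := test_integrable mO t1; have i2 := test_integrable mO t2.
apply/eqP; rewrite -addr_eq0 -(I_add mO i1 i2) -(I_pd0 i (test_mul tphi tpsi)).
rewrite -(@I_supp R N Om (pd i (fun x => phi x * psi x)) mO); last first.
  by move=> x; exact: test_out (test_pd i (test_mul tphi tpsi)).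
apply/eqP/eq_Rintegral => x _; rewrite pd_mul ?(mulrC (psi x))//.
  exact: (test_derivable _ _ tphi).
exact: (test_derivable _ _ tpsi).
Qed.

Definition wgrad Om u g := locint Om u /\ forall i : 'I_N,
  locint Om (fun x => g x 0 i) /\ forall phi, test_function Om phi ->
    \int[mu]_(x in Om) (u x * pd i phi x) = - \int[mu]_(x in Om) (g x 0 i * phi x).

Lemma wgradE Om u g : weak_gradient Om u g <-> wgrad Om u g.
Proof. by rewrite /wgrad /locint lebmE. Qed.

Lemma locint_mul_test Om u phi : measurable Om -> locint Om u ->
  test_function Om phi -> mu.-integrable Om (EFin \o (fun x => u x * phi x)).
Proof.
move=> mO lu tphi; have [M M0 MP] := test_bounded tphi.
have [_ [K [cK KO K0]]] := tphi; have mK := compact_measurable cK.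
have uK := lu K cK KO.
have iK : mu.-integrable K (EFin \o (fun x => u x * phi x)).
  apply: (@intg_le _ _ _ mu K mK _ (fun x => M * `|u x|)).
  - apply: measurable_funM; [exact: intg_meas uK|exact: test_meas tphi].
  - by move=> x _; rewrite normrM mulrC ler_wpM2r.
  - by apply: intg_scale => //; exact: intg_abs.
have := proj1 (integrable_mkcond _ mK) iK.
move=> /(integrableS measurableT mO (@subsetT _ _)).
apply: eq_integrable => // x _; rewrite /patch; case: ifPn => // nK.
rewrite /= K0 ?mulr0// => Kx; by move/negP: nK; apply; exact: mem_set.
Qed.

Lemma locint_sub Om u v : locint Om u -> locint Om v -> locint Om (fun x => u x - v x).
Proof.
move=> lu lv K cK KO; have mK := compact_measurable cK.
by apply: intg_sub => //; [exact: lu|exact: lv].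
Qed.

Lemma locint_test Om u : test_function Om u -> locint Om u.
Proof.
by move=> tu K cK KO; apply: test_integrable tu; exact: compact_measurable.
Qed.

Definition tgrad u : V -> V := fun x => \row_i pd i u x.

Lemma wgrad_test Om u : measurable Om -> test_function Om u -> wgrad Om u (tgrad u).
Proof.
move=> mO tu; split; first exact: locint_test.
move=> i; rewrite /tgrad (_ : (fun x => _) = pd i u); last first.
  by apply/funext => x; rewrite mxE.
split; first by apply: locint_test; exact: test_pd.
move=> phi tphi; rewrite (ibp i mO tu tphi); congr (- _).
by apply: eq_Rintegral => x _; rewrite mxE.
Qed.

Lemma wgrad_sub Om u v g k : measurable Om -> wgrad Om u g -> wgrad Om v k ->
  wgrad Om (fun x => u x - v x) (fun x => g x - k x).
Proof.
move=> mO [lu ug] [lv vk]; split; first exact: locint_sub.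
move=> i; have [lgi ugi] := ug i; have [lki vki] := vk i.
have E : (fun x => (g x - k x) 0 i) = (fun x => g x 0 i - k x 0 i).
  by apply/funext => x; rewrite !mxE.
split; first by rewrite E; exact: locint_sub.
move=> phi tphi.
have d := test_pd i tphi.
transitivity (\int[mu]_(x in Om) (u x * pd i phi x - v x * pd i phi x)).
  by apply: eq_Rintegral => x _; rewrite mulrBl.
rewrite (I_sub mO (locint_mul_test mO lu d) (locint_mul_test mO lv d)) ugi// vki//.
rewrite -opprD; congr (- _).
rewrite -(I_sub mO (locint_mul_test mO lgi tphi) (locint_mul_test mO lki tphi)).
by apply: eq_Rintegral => x _; rewrite !mxE mulrBl.
Qed.

Lemma wgrad_unique Om u v g k : open Om -> wgrad Om u g -> wgrad Om v k ->
  {ae mu, forall x, Om x -> u x = v x} -> {ae mu, forall x, Om x -> g x = k x}.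
Proof.
move=> oO [lu ug] [lv vk] uv; have mO := open_measurable_rV oO.
have : {ae mu, forall x, forall n : nat, forall i : 'I_N, n = i :> nat -> Om x -> g x 0 i = k x 0 i}.
  apply: ae_foralln => n; have [nN|nN] := ltnP n N; last first.
    by apply: nearW => x i ni; have := ltn_ord i; rewrite -ni ltnNge nN.
  pose i := Ordinal nN.
  have [lgi ugi] := ug i; have [lki vki] := vk i.
  have : {ae mu, forall x, Om x -> g x 0 i - k x 0 i = 0}.
    apply: (locint_test_eq0 oO (locint_sub lgi lki)) => phi tphi.
    have d := test_pd i tphi.
    transitivity (\int[mu]_(x in Om) (g x 0 i * phi x - k x 0 i * phi x)).
      by apply: eq_Rintegral => x _; rewrite mulrBl.
    rewrite (I_sub mO (locint_mul_test mO lgi tphi) (locint_mul_test mO lki tphi)).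
    apply/eqP; rewrite subr_eq0 -eqr_opp -ugi// -vki//; apply/eqP.
    apply: (I_eq_ae mO).
    - exact: intg_meas (locint_mul_test mO lu d).
    - exact: intg_meas (locint_mul_test mO lv d).
    - by apply: filterS uv => x uv Ox; rewrite uv.
  apply: filterS => x hx j nj Ox.
  have -> : j = i by apply: val_inj.
  by apply/eqP; rewrite -subr_eq0 hx.
by apply: filterS => x hx Ox; apply/rowP => i; exact: (hx i i).
Qed.

End integration_by_parts.


(** * Weierstrass approximation *)

Section weierstrass.
Variable R : realType.
Implicit Types (f w : nat -> R) (t s : R).

(* Mean of f under the law of the n-step walk on nat that moves up with
   probability X: the Bernstein polynomial of f. *)
Fixpoint bern (n : nat) f : {poly R} :=
  if n is m.+1 then 'X * bern m (fun k => f k.+1) + (1 - 'X) * bern m f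
  else (f 0%N)%:P.

(** One step of the walk is a convex combination of two values, so pointwise bounds pass to the
    mean. *)
Lemma bern_le n f w t (c : R) : 0 <= t <= 1 -> (forall k, `|f k - c| <= w k) ->
  `|(bern n f).[t] - c| <= (bern n w).[t].
Proof.
move=> /andP[t0 t1]; elim: n f w => [|n IH] f w fw /=.
  by rewrite !hornerC.
rewrite !hornerE; set a := (bern n (fun k => f k.+1)).[t]; set b := (bern n f).[t].
rewrite (_ : _ - c = t * (a - c) + (1 - t) * (b - c)); last by ring.
apply: (le_trans (ler_normD _ _)); rewrite !normrM (ger0_norm t0).
have t1' : 0 <= 1 - t by rewrite subr_ge0.
by rewrite (ger0_norm t1') lerD// ler_wpM2l// IH.
Qed.

(** The second moment of the binomial law about s: its variance n t (1 - t) plus the squared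
    distance from its mean n t to s. The shift s is left free because the induction changes it. *)
Lemma bern_quad n (a b s : R) t :
  (bern n (fun k => a + b * (k%:R - s) ^+ 2)).[t] =
  a + b * (n%:R * t * (1 - t) + (n%:R * t - s) ^+ 2).
Proof.
elim: n s => [|n IH] s /=; first by rewrite hornerC; ring.
rewrite !hornerE IH.
rewrite (_ : (fun k => _) = fun k : nat => a + b * (k%:R - (s - 1)) ^+ 2).
  by rewrite IH -natr1; ring.
by apply/funext => k; rewrite -natr1; ring.
Qed.

(** Counterexamples at the scales 1/(n+1) would have, by Bolzano-Weierstrass, a subsequence along
    which both points tend to the same limit, against continuity there. *)
Lemma itv_unif_continuous (k : R -> R) (a b e : R) : continuous k -> 0 < e ->
  exists2 d : R, 0 < d & forall x y, a <= x <= b -> a <= y <= b ->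
    `|x - y| <= d -> `|k x - k y| <= e.
Proof.
move=> ck e0; apply: contrapT => H.
have {}H n : exists xy : R * R, [/\ a <= xy.1 <= b, a <= xy.2 <= b,
    `|xy.1 - xy.2| <= n.+1%:R^-1 & e < `|k xy.1 - k xy.2|].
  apply: contrapT => nex; apply: H; exists n.+1%:R^-1; first by rewrite invr_gt0.
  move=> x y xab yab xy; rewrite leNgt; apply/negP => eK; apply: nex.
  by exists (x, y).
move/choice : H => [f fP].
have bnd : bounded_fun (fun n => (f n).1).
  exists (Num.max `|a| `|b|); split; first by rewrite num_real.
  move=> M hM n _ /=; have [/andP[h1 h2] _ _ _] := fP n.
  apply/ltW; apply: le_lt_trans hM; rewrite ler_norml; apply/andP; split.
    apply: le_trans h1; apply: (@le_trans _ _ (- `|a|)).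
      by rewrite lerN2 le_max lexx.
    by rewrite lerNl -normrN ler_norm.
  by rewrite (le_trans h2)// le_max ler_norm orbT.
have [g g_inc cg] := bolzano_weierstrass bnd.
have /cvg_ex[l hl] := cg.
have gn n : (n <= g n)%N.
  elim: n => // n IH; apply: (leq_ltn_trans IH).
  have h : (g n.+1 <= g n)%N = (n.+1 <= n)%N := g_inc n.+1 n.
  by rewrite ltnNge h ltnn.
have d0 : (f (g n)).1 - (f (g n)).2 @[n --> \oo] --> (0 : R).
  apply/cvgrPdist_le => d d0; near=> n; rewrite sub0r normrN.
  have [_ _ h _] := fP (g n); apply: (le_trans h).
  apply: (@le_trans _ _ n.+1%:R^-1).
    by rewrite lef_pV2 ?posrE// ler_nat ltnS.
  by apply: ltW; near: n; exact: (near_infty_natSinv_lt (PosNum d0)).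
have hl2 : (f (g n)).2 @[n --> \oo] --> l.
  rewrite (_ : (fun n => _) = (fun n => (f (g n)).1 - ((f (g n)).1 - (f (g n)).2))).
    by rewrite -[l]subr0; apply: cvgB.
  by apply/funext => n; ring.
have k1 : k (f (g n)).1 @[n --> \oo] --> k l by apply: continuous_cvg => //; exact: ck.
have k2 : k (f (g n)).2 @[n --> \oo] --> k l by apply: continuous_cvg => //; exact: ck.
have : k (f (g n)).1 - k (f (g n)).2 @[n --> \oo] --> (0 : R).
  by rewrite -(subrr (k l)); apply: cvgB.
move/cvgrPdist_le => /(_ e e0)[n _ /(_ n (leqnn n))] /=; rewrite sub0r normrN.
by have [_ _ _ h] := fP (g n); rewrite leNgt h.
Unshelve. all: by end_near. Qed.

Lemma weierstrass01 (k : R -> R) (e : R) : continuous k -> 0 < e ->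
  exists q : {poly R}, forall t, 0 <= t <= 1 -> `|q.[t] - k t| <= e.
Proof.
move=> ck e0; have e2 : 0 < e / 2 by rewrite divr_gt0.
have [d d0 dP] := itv_unif_continuous 0 1 ck e2.
have [K K0 KP] : exists2 K : R, 0 <= K & forall t, 0 <= t <= 1 -> `|k t| <= K.
  have [c _ hc] := @EVT_max R (fun t => `|k t|) 0 1 ler01
     (continuous_subspaceT (fun t => cvg_norm (ck t))).
  exists `|k c| => // t t01; apply: hc; by rewrite in_itv.
(* |k(j/n) - k t| is at most e/2 when j/n is within d of t, and at most 2K, hence
   at most 2K (j/n - t)^2/d^2, otherwise. *)
pose C : R := 2 * K / d ^+ 2.
have C0 : 0 <= C by rewrite divr_ge0 ?mulr_ge0 ?exprn_ge0// ltW.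
have [n nP] : exists n : nat, C / n.+1%:R <= e / 2.
  exists (Num.truncn (C / (e / 2))); rewrite ler_pdivrMr// mulrC -ler_pdivrMr//.
  exact/ltW/truncnS_gt.
pose m := n.+1.
(* [bern_le] asks for its hypothesis at every integer, hence the truncation at 1, although m steps
   do not lead beyond m. *)
pose f (j : nat) := k (Num.min 1 (j%:R / m%:R)).
exists (bern m f) => t t01; move/andP: (t01) => [t0 t1].
have m0 : 0 < m%:R :> R by rewrite ltr0n.
have h1 j : `|f j - k t| <= e / 2 + C / m%:R ^+ 2 * (j%:R - m%:R * t) ^+ 2.
  have s01 : 0 <= (Num.min 1 (j%:R / m%:R) : R) <= 1.
    by rewrite le_min ler01 divr_ge0//= ge_min lexx.
  have E : C / m%:R ^+ 2 * (j%:R - m%:R * t) ^+ 2 = C * (j%:R / m%:R - t) ^+ 2.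
    by field; rewrite gt_eqF.
  rewrite E.
  have dist : `|Num.min 1 (j%:R / m%:R) - t| <= `|j%:R / m%:R - t|.
    case: (leP 1 (j%:R / m%:R)) => // h.
    rewrite !ger0_norm ?subr_ge0//; last exact: le_trans h.
    by rewrite lerD2r.
  have [hd|hd] := leP `|Num.min 1 (j%:R / m%:R) - t| d.
    apply: le_trans (dP _ _ s01 t01 hd) _.
    by rewrite lerDl mulr_ge0// sqr_ge0.
  apply: (@le_trans _ _ (2 * K)).
    apply: (le_trans (ler_normB _ _)); rewrite mulr_natl mulr2n.
    by apply: lerD; apply: KP.
  rewrite ler_wpDl ?(ltW e2)// /C -mulrA ler_peMr ?mulr_ge0//.
  rewrite mulrC ler_pdivlMr ?exprn_gt0// mul1r -[leRHS]real_normK ?num_real//.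
  by rewrite lerXn2r ?nnegrE ?(ltW d0)// (le_trans (ltW hd)).
apply: le_trans (bern_le _ t01 h1) _; rewrite bern_quad subrr expr0n addr0.
rewrite [leRHS](splitr e) lerD2l.
apply: le_trans nP; rewrite (_ : _ * _ = C / m%:R * (t * (1 - t))); last first.
  by field; rewrite gt_eqF.
apply: ler_piMr; first by rewrite divr_ge0.
by rewrite mulr_ile1 ?subr_ge0// lerBlDr lerDl.
Qed.

Lemma weierstrass (k : R -> R) (M e : R) : continuous k -> 0 < e -> 0 < M ->
  exists q : {poly R}, forall t, `|t| <= M -> `|q.[t] - k t| <= e.
Proof.
move=> ck e0 M0.
have M2 : 2 * M != 0 by rewrite gt_eqF// mulr_gt0.
have ck' : continuous (fun t => k (2 * M * t - M)).
  move=> t; apply: (@continuous_comp _ _ _ (fun t => 2 * M * t - M) k); last exact: ck.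
  apply: continuousB; last exact: cst_continuous.
  by apply: continuousM; [exact: cst_continuous|exact: cvg_id].
have [q qP] := weierstrass01 ck' e0.
exists (q \Po ((2 * M)^-1 *: ('X + M%:P))) => t tM.
rewrite horner_comp !hornerE.
have /andP[h1 h2] : - M <= t <= M by rewrite -ler_norml.
rewrite [X in k X](_ : t = 2 * M * ((2 * M)^-1 * (t + M)) - M); last first.
  by rewrite mulrA mulfV// mul1r addrK.
apply: qP; rewrite mulr_ge0 ?invr_ge0 ?mulr_ge0 ?(ltW M0)//=; last by lra.
rewrite mulrC ler_pdivrMr ?mulr_gt0// mul1r; lra.
Qed.

Definition pint (q : {poly R}) : {poly R} :=
  \sum_(i < size q) (q`_i / i.+1%:R) *: 'X^(i.+1).

Lemma deriv_pint q : (pint q)^`() = q.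
Proof.
rewrite /pint raddf_sum -[RHS]coefK poly_def; apply: eq_bigr => i _.
rewrite -[LHS]/(((q`_i / i.+1%:R) *: 'X^(i.+1))^`()) derivZ derivXn.
by rewrite -scalerMnr scalerMnl -mulr_natr divfK// pnatr_eq0.
Qed.

Lemma pint0 q : (pint q).[0] = 0.
Proof.
rewrite /pint horner_sum big1// => i _.
by rewrite hornerZ hornerXn expr0n mulr0.
Qed.

(* Weierstrass for g and g' at once: approximate g' and integrate. *)
Lemma C1_weierstrass (g g' : R -> R) (M e : R) :
  (forall t : R, is_derive t 1 g (g' t)) -> continuous g' -> g 0 = 0 ->
  0 < e -> 0 < M ->
  exists2 q : {poly R}, q.[0] = 0 & forall t, `|t| <= M ->
    `|q.[t] - g t| <= e * M /\ `|q^`().[t] - g' t| <= e.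
Proof.
move=> dg cg' g0 e0 M0; have [q qP] := weierstrass cg' e0 M0.
exists (pint q); first exact: pint0.
move=> t tM; rewrite deriv_pint; split; last exact: qP.
pose F s := (pint q).[s] - g s.
have dF (s : R) : is_derive s 1 F (q.[s] - g' s).
  have d1 : is_derive s 1 (horner (pint q)) q.[s].
    by have := is_derive_poly (pint q) s; rewrite deriv_pint.
  by have := dg s => d2; exact: is_deriveB.
have F0 : F 0 = 0 by rewrite /F pint0 g0 subrr.
have cF a b : {within `[a, b], continuous F}.
  apply: continuous_subspaceT => s; apply: differentiable_continuous.
  by apply/derivable1_diffP; have [] := dF s.
have [t0|t0] := leP 0 t.
  have [c hc] := MVT_segment t0 (fun s _ => dF s) (cF 0 t).
  rewrite F0 !subr0 /F => ->; rewrite normrM; apply: ler_pM => //.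
  apply: qP; move: hc; rewrite in_itv/= => /andP[c0 ct].
  by rewrite (ger0_norm c0) (le_trans ct)// (le_trans (ler_norm _) tM).
have [c hc] := MVT_segment (ltW t0) (fun s _ => dF s) (cF t 0).
rewrite F0 !sub0r /F => /eqP; rewrite eqr_oppLR => /eqP ->.
rewrite normrN normrM normrN; apply: ler_pM => //.
apply: qP; move: hc; rewrite in_itv/= => /andP[ct c0].
by rewrite (ler0_norm c0) (le_trans _ tM)// (ltr0_norm t0) lerN2.
Qed.

End weierstrass.


(** * The space W_0^{1,p} *)

Section real_cvg.
Variable R : realType.

Lemma cvg0_near (f : nat -> R) (e : R) : f n @[n --> \oo] --> 0 -> 0 < e ->
  \forall n \near \oo, `|f n| < e.
Proof.
by move=> /cvgrPdist_lt/[swap] e0 /(_ e e0); apply: filterS => n; rewrite sub0r normrN.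
Qed.

Lemma cvg0_le (f g : nat -> R) : (forall n, `|f n| <= g n) ->
  g n @[n --> \oo] --> 0 -> f n @[n --> \oo] --> 0.
Proof.
move=> fg g0; apply/cvgrPdist_lt => e e0; have := cvg0_near g0 e0.
apply: filterS => n h; rewrite sub0r normrN; apply: le_lt_trans h.
exact: le_trans (fg n) (ler_norm _).
Qed.

Lemma cvg_bound (f g : nat -> R) (l : R) : (forall n, `|f n - l| <= g n) ->
  g n @[n --> \oo] --> 0 -> f n @[n --> \oo] --> l.
Proof.
move=> fg g0; apply/cvgrPdist_lt => e e0; have := cvg0_near g0 e0.
apply: filterS => n h; rewrite distrC; apply: le_lt_trans h.
exact: le_trans (fg n) (ler_norm _).
Qed.

Lemma C1_lip (k k' : R -> R) (L a b : R) : (forall t : R, is_derive t 1 k (k' t)) ->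
  (forall t, `|k' t| <= L) -> `|k a - k b| <= L * `|a - b|.
Proof.
move=> dk kL; wlog ab : a b / b <= a.
  by move=> H; have [/H//|/ltW/H] := leP b a; rewrite distrC (distrC b).
have [|c _ ->] := MVT_segment ab (fun s _ => dk s).
  apply: continuous_subspaceT => s; apply: differentiable_continuous.
  by apply/derivable1_diffP; have [] := dk s.
by rewrite normrM ler_wpM2r.
Qed.

Lemma cvg0Mr (f : nat -> R) (c : R) : f n @[n --> \oo] --> 0 -> f n * c @[n --> \oo] --> 0.
Proof. by move=> f0; rewrite -(mul0r c); apply: cvgM; [exact: f0|exact: cvg_cst]. Qed.

Lemma cvg0Ml (f : nat -> R) (c : R) : f n @[n --> \oo] --> 0 -> c * f n @[n --> \oo] --> 0.
Proof. by move=> f0; rewrite -(mulr0 c); apply: cvgM; [exact: cvg_cst|exact: f0]. Qed.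

End real_cvg.

Section horner_test.
Variables (R : realType) (N : nat).
Local Notation V := 'rV[R]_N.
Local Notation pd i u := ('D_(evec R i) u).
Implicit Types (u phi : V -> R) (Om : set V).

Lemma Ck_horner k (q : {poly R}) u : Ck k u -> Ck k (fun x => q.[u x]).
Proof.
move=> Cu; elim/poly_ind: q => [|q c IH].
  rewrite (_ : (fun x => _) = fun=> 0); first exact: Ck_cst.
  by apply/funext => x; rewrite horner0.
rewrite (_ : (fun x => _) = fun x => q.[u x] * u x + c).
  by apply: Ck_add; [exact: Ck_mul|exact: Ck_cst].
by apply/funext => x; rewrite !hornerE.
Qed.

Lemma test_horner Om (q : {poly R}) phi : q.[0] = 0 -> test_function Om phi ->
  test_function Om (fun x => q.[phi x]).
Proof.
move=> q0 [sphi [K [cK KO K0]]]; split.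
  by apply: Ck_smooth => k; apply: Ck_horner; exact: smooth_Ck.
by exists K; split=> // x /K0 ->.
Qed.

Lemma pd_horner i (q : {poly R}) u x : derivable u x (evec R i) ->
  derivable (fun x => q.[u x]) x (evec R i) /\
  pd i (fun x => q.[u x]) x = q^`().[u x] * pd i u x.
Proof.
move=> du; elim/poly_ind: q => [|q c [dq hq]].
  rewrite (_ : (fun x => _) = fun=> 0); last first.
    by apply/funext => y; rewrite horner0.
  by rewrite deriv0 horner0 mul0r; split; [exact: derivable_cst|exact: pd_cst].
rewrite (_ : (fun x => _) = fun x => q.[u x] * u x + c); last first.
  by apply/funext => y; rewrite !hornerE.
have d1 : derivable (fun x => q.[u x] * u x) x (evec R i) by exact: derivableM.
have d2 : derivable (fun=> c : R) x (evec R i) by exact: derivable_cst.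
split; first exact: derivableD.
rewrite (pd_add d1 d2) (pd_mul dq du) hq (pd_cst c) addr0 derivD derivC addr0.
by rewrite derivM derivX hornerD !hornerM hornerX hornerC; ring.
Qed.

End horner_test.

Lemma measurable_lim d (T : measurableType d) (R : realType) (D : set T)
    (f : nat -> T -> R) (h : T -> R) : (forall n, measurable_fun D (f n)) ->
  (forall x, D x -> f n x @[n --> \oo] --> h x) -> measurable_fun D h.
Proof.
move=> mf fh; apply/measurable_EFinP.
apply: (emeasurable_fun_cvg (fun n x => (f n x)%:E)) => [n|x Dx].
  by apply/measurable_EFinP; exact: mf.
by apply/fine_cvgP; split; [exact: nearW|exact: fh].
Qed.

Section sobolev_class.
Variables (R : realType) (N : nat) (Om : set 'rV[R]_N) (p : R).
Local Notation V := 'rV[R]_N.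
Local Notation mu := (lebm R N).
Local Notation pd i u := ('D_(evec R i) u).
Local Notation L u := (Lp mu Om p u).
Local Notation d u v := (dist mu Om p u v).
Local Notation ae P := {ae mu, forall x, Om x -> P x}.
Hypotheses (oO : open Om) (fO : (mu Om < +oo)%E) (p1 : 1 < p).
Implicit Types (u v phi psi : V -> R) (g G : V -> V).

Let mO : measurable Om. Proof. exact: open_measurable_rV. Qed.
Let p1' : 1 <= p. Proof. exact: ltW. Qed.
Let p0 : 0 < p. Proof. exact: lt_trans p1. Qed.

Definition gco (i : 'I_N) g : V -> R := fun x => g x 0 i.

Lemma gco_tgrad i u : gco i (tgrad u) = pd i u.
Proof. by apply/funext => x; rewrite /gco mxE. Qed.

(** The gradient is carried as a second component, so that each operation on [u] comes with an
    explicit formula for [g]; [Sob_unique] shows that [u] determines it a.e. *)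
Definition Sob u g := [/\ L u, (forall i, L (gco i g)) &
  forall e : R, 0 < e -> exists phi, [/\ test_function Om phi,
    d u phi < e & forall i, d (gco i g) (pd i phi) < e]].

Lemma Sob_Lp u g : Sob u g -> L u. Proof. by case. Qed.
Lemma Sob_Lpg u g i : Sob u g -> L (gco i g). Proof. by case. Qed.

Lemma test_Lp u : test_function Om u -> L u.
Proof.
move=> tu; have [M M0 MP] := test_bounded tu.
by apply: (Lp_bounded mO p1' fO (test_meas mO tu)) => x _; exact: MP.
Qed.

Lemma Sob_test phi : test_function Om phi -> Sob phi (tgrad phi).
Proof.
move=> tphi; split; first exact: test_Lp.
  by move=> i; rewrite gco_tgrad; apply: test_Lp; exact: test_pd.
move=> e e0; exists phi; split; [exact: tphi|by rewrite dist_xx|].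
by move=> i; rewrite gco_tgrad dist_xx.
Qed.

Lemma Sob_lim u g : L u -> (forall i, L (gco i g)) ->
  (forall e : R, 0 < e -> exists u' g', [/\ Sob u' g', d u u' < e &
    forall i, d (gco i g) (gco i g') < e]) -> Sob u g.
Proof.
move=> Lu Lg h; split; [exact: Lu|exact: Lg|] => e e0.
have e2 : 0 < e / 2 by rewrite divr_gt0.
have [u' [g' [Su' hu hg]]] := h _ e2; have [Lu' Lg' /(_ _ e2)[phi [tphi h1 h2]]] := Su'.
exists phi; split; [exact: tphi| |move=> i]; rewrite (splitr e).
  exact: le_lt_trans (dist_tri mO p1' Lu Lu' (test_Lp tphi)) (ltrD hu h1).
have Lp' := test_Lp (test_pd i tphi).
exact: le_lt_trans (dist_tri mO p1' (Lg i) (Lg' i) Lp') (ltrD (hg i) (h2 i)).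
Qed.

Lemma Sob_lim_seq (un : nat -> V -> R) (gn : nat -> V -> V) u g : L u ->
  (forall i, L (gco i g)) -> (forall n, Sob (un n) (gn n)) ->
  d (un n) u @[n --> \oo] --> 0 ->
  (forall i, d (gco i (gn n)) (gco i g) @[n --> \oo] --> 0) -> Sob u g.
Proof.
move=> Lu Lg Sn cu cg; apply: (Sob_lim Lu Lg) => e e0.
have h1 := cvg0_near cu e0.
have h2 : \forall n \near \oo, forall i, d (gco i (gn n)) (gco i g) < e.
  apply: filter_forall => i; have := cvg0_near (cg i) e0.
  by apply: filterS => n; rewrite (ger0_norm (dist_ge0 _ _ _ _ _)).
have [n [hn1 hn2]] := filter_ex (filterI h1 h2).
exists (un n), (gn n); split; [exact: Sn| |].
  by move: hn1; rewrite (ger0_norm (dist_ge0 _ _ _ _ _)) (dist_sym _ _ _ (un n) u).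
by move=> i; rewrite dist_sym; exact: hn2.
Qed.

Lemma Sob_seq u g : Sob u g -> exists phi : nat -> V -> R,
  [/\ forall n, test_function Om (phi n), d (phi n) u @[n --> \oo] --> 0,
      (forall i, d (pd i (phi n)) (gco i g) @[n --> \oo] --> 0) &
      ae (fun x => phi n x @[n --> \oo] --> u x)].
Proof.
move=> [Lu Lg h].
have /choice[phi phiP] : forall n : nat, exists phi, [/\ test_function Om phi,
    d u phi < n.+1%:R^-1 & forall i, d (gco i g) (pd i phi) < n.+1%:R^-1].
  by move=> n; apply: h; rewrite invr_gt0.
have t n : test_function Om (phi n) by case: (phiP n).
have c1 : d (phi n) u @[n --> \oo] --> 0.
  apply: (cvg0_le (g := fun n => n.+1%:R^-1)); last exact: cvg_harmonic.
  move=> n; rewrite (ger0_norm (dist_ge0 _ _ _ _ _)) dist_sym.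
  by have [_ h1 _] := phiP n; exact: ltW h1.
have c2 i : d (pd i (phi n)) (gco i g) @[n --> \oo] --> 0.
  apply: (cvg0_le (g := fun n => n.+1%:R^-1)); last exact: cvg_harmonic.
  move=> n; rewrite (ger0_norm (dist_ge0 _ _ _ _ _)) dist_sym.
  by have [_ _ h1] := phiP n; exact: ltW (h1 i).
have [k kS ck] := dist_subseq_ae mO p1' fO (fun n => test_Lp (t n)) Lu c1.
have kn := subseq_ge kS.
exists (fun n => phi (k n)); split.
- by move=> n; exact: t.
- exact: (subseq_cvg kn c1).
- by move=> i; exact: (subseq_cvg kn (c2 i)).
- exact: ck.
Qed.

Lemma Sob_add u v g G : Sob u g -> Sob v G ->
  Sob (fun x => u x + v x) (fun x => g x + G x).
Proof.
move=> [Lu Lg hu] [Lv LG hv].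
have E i : gco i (fun x => g x + G x) = (fun x => gco i g x + gco i G x).
  by apply/funext => x; rewrite /gco mxE.
split; first exact: Lp_add Lu Lv.
  by move=> i; rewrite E; exact: Lp_add (Lg i) (LG i).
move=> e e0; have e2 : 0 < e / 2 by rewrite divr_gt0.
have [phi [tphi h1 h2]] := hu _ e2; have [psi [tpsi h3 h4]] := hv _ e2.
exists (fun x => phi x + psi x); split; first exact: test_add.
  rewrite (splitr e); apply: le_lt_trans (ltrD h1 h3).
  exact: dist_add Lu Lv (test_Lp tphi) (test_Lp tpsi).
move=> i; have tp := test_Lp (test_pd i tphi); have tq := test_Lp (test_pd i tpsi).
rewrite (splitr e); apply: le_lt_trans (ltrD (h2 i) (h4 i)); rewrite E.
apply: le_trans (dist_add mO p1' (Lg i) (LG i) tp tq).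
rewrite le_eqVlt; apply/orP; left; apply/eqP/dist_eq => x _; first reflexivity.
exact: (pd_add (test_derivable i x tphi) (test_derivable i x tpsi)).
Qed.

Lemma Sob_scale c u g : Sob u g -> Sob (fun x => c * u x) (fun x => c *: g x).
Proof.
move=> [Lu Lg hu].
have E i : gco i (fun x => c *: g x) = (fun x => c * gco i g x).
  by apply/funext => x; rewrite /gco mxE.
split; first exact: Lp_scale Lu.
  by move=> i; rewrite E; exact: Lp_scale (Lg i).
have c1 : 0 < `|c| + 1 by rewrite ltr_wpDl.
move=> e e0; have e2 : 0 < e / (`|c| + 1) by rewrite divr_gt0.
have small x : 0 <= x -> x < e / (`|c| + 1) -> `|c| * x < e.
  move=> x0; rewrite ltr_pdivlMr// mulrDr mulr1 mulrC => h.
  by apply: le_lt_trans h; rewrite lerDl.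
have [phi [tphi h1 h2]] := hu _ e2.
exists (fun x => c * phi x); split; first exact: test_scale.
  rewrite (dist_scale mO p1' c Lu (test_Lp tphi)).
  exact: small (dist_ge0 _ _ _ _ _) h1.
move=> i; have tp := test_Lp (test_pd i tphi).
apply: le_lt_trans (small _ (dist_ge0 _ _ _ _ _) (h2 i)).
rewrite -(dist_scale mO p1' c (Lg i) tp) E.
rewrite le_eqVlt; apply/orP; left; apply/eqP/dist_eq => x _; first reflexivity.
exact: (pd_scale c (test_derivable i x tphi)).
Qed.

Lemma Sob_sub u v g G : Sob u g -> Sob v G ->
  Sob (fun x => u x - v x) (fun x => g x - G x).
Proof.
move=> Su Sv; have := Sob_add Su (Sob_scale (-1) Sv).
rewrite (_ : (fun x => u x + -1 * v x) = (fun x => u x - v x)); last first.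
  by apply/funext => x; rewrite mulN1r.
rewrite (_ : (fun x => g x + -1 *: G x) = (fun x => g x - G x))//.
by apply/funext => x; rewrite scaleN1r.
Qed.

Lemma Sob_ae u v g G : measurable_fun Om v ->
  (forall i, measurable_fun Om (gco i G)) ->
  ae (fun x => u x = v x) -> ae (fun x => g x = G x) -> Sob u g -> Sob v G.
Proof.
move=> mv mG uv gG [Lu Lg h].
have gGi i : ae (fun x => gco i g x = gco i G x).
  by apply: filterS gG => x gG Ox; rewrite /gco gG.
split; first exact: Lp_ae uv Lu.
  by move=> i; exact: Lp_ae (mG i) (gGi i) (Lg i).
move=> e /h[phi [tphi h1 h2]]; exists phi; split; [exact: tphi| |move=> i].
- have m1 := test_meas mO tphi.
  rewrite -(@dist_ae _ _ _ mu Om mO p u phi v phi); first exact: h1.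
  all: try exact: m1; try exact: mv; try exact: uv; try exact: Lu.1.
  exact: nearW.
- have m1 := test_meas mO (test_pd i tphi).
  rewrite -(@dist_ae _ _ _ mu Om mO p (gco i g) (pd i phi) (gco i G) (pd i phi)).
    exact: h2.
  all: try exact: m1; try exact: (mG i); try exact: (gGi i); try exact: (Lg i).1.
  exact: nearW.
Qed.

Lemma Lp_locint u : L u -> locint Om u.
Proof.
move=> Lu K cK KO; have := Lp_intg mO p1' fO Lu.
by apply: integrableS => //; exact: compact_measurable.
Qed.

Lemma I_mul_test u (un : nat -> V -> R) psi : L u -> (forall n, L (un n)) ->
  test_function Om psi -> d (un n) u @[n --> \oo] --> 0 ->
  \int[mu]_(x in Om) (un n x * psi x) @[n --> \oo] --> \int[mu]_(x in Om) (u x * psi x).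
Proof.
move=> Lu Lun tpsi cu; have [M M0 MP] := test_bounded tpsi.
have [C C0 CP] := I_dist mO p1' fO.
apply: (cvg_bound (g := fun n => M * C * d (un n) u)).
  move=> n.
  have i1 := locint_mul_test mO (Lp_locint (Lun n)) tpsi.
  have i2 := locint_mul_test mO (Lp_locint Lu) tpsi.
  rewrite -(I_sub mO i1 i2).
  have Ld := intg_abs (Lp_intg mO p1' fO (Lp_sub mO p1' (Lun n) Lu)).
  apply: (@le_trans _ _ (\int[mu]_(x in Om) (M * `|un n x - u x|))).
    apply: (I_abs_le mO _ (intg_scale mO M Ld)).
    - by apply: measurable_funB; [exact: intg_meas i1|exact: intg_meas i2].
    - by move=> x _; rewrite -mulrBl normrM mulrC ler_wpM2r.
  rewrite (I_scale mO M Ld) -mulrA; apply: (ler_wpM2l M0).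
  exact: CP (Lun n) Lu.
by rewrite -(mulr0 (M * C)); apply: cvgM; [exact: cvg_cst|exact: cu].
Qed.

Lemma Sob_wgrad u g : Sob u g -> wgrad Om u g.
Proof.
move=> Su; have [Lu Lg _] := Su; have [phi [tphi c1 c2 _]] := Sob_seq Su.
split; first exact: Lp_locint.
move=> i; split; first exact: Lp_locint (Lg i).
move=> psi tpsi.
have h1 := I_mul_test Lu (fun n => test_Lp (tphi n)) (test_pd i tpsi) c1.
have h2 := I_mul_test (Lg i) (fun n => test_Lp (test_pd i (tphi n))) tpsi (c2 i).
have h3 : (fun n => - \int[mu]_(x in Om) (pd i (phi n) x * psi x)) @ \oo -->
    - \int[mu]_(x in Om) (gco i g x * psi x) by apply: cvgN; exact: h2.
apply: (etrans (esym (cvg_lim (@Rhausdorff R) h1))).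
apply: (etrans _ (cvg_lim (@Rhausdorff R) h3)).
have -> // : (fun n => \int[mu]_(x in Om) (phi n x * pd i psi x)) =
    (fun n => - \int[mu]_(x in Om) (pd i (phi n) x * psi x)).
by apply/funext => n; exact: (ibp i mO (tphi n) tpsi).
Qed.

Lemma Sob_unique u v g G : Sob u g -> Sob v G -> ae (fun x => u x = v x) ->
  ae (fun x => g x = G x).
Proof. by move=> /Sob_wgrad Su /Sob_wgrad Sv; exact: wgrad_unique. Qed.

Definition C1 (k k' : R -> R) :=
  (forall t : R, is_derive t 1 k (k' t)) /\ continuous k'.

Lemma C1_cont (k k' : R -> R) : C1 k k' -> continuous k.
Proof.
move=> [dk _] t; apply: differentiable_continuous; apply/derivable1_diffP.
by have [] := dk t.
Qed.

Lemma cont_meas (k : R -> R) u : continuous k -> measurable_fun Om u ->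
  measurable_fun Om (fun x => k (u x)).
Proof.
move=> ck mu_; apply: (@measurableT_comp _ _ _ _ _ _ k) => //.
exact: continuous_measurable_fun.
Qed.

(** With [k] only of class C^1, [k (phi x)] need not be a test function, but a polynomial in [phi]
    without constant term is one. [C1_weierstrass] on the range of [phi] provides it. *)
Lemma test_comp_approx (k k' : R -> R) phi (e : R) : C1 k k' -> k 0 = 0 ->
  test_function Om phi -> 0 < e ->
  exists psi, [/\ test_function Om psi, (forall x, `|psi x - k (phi x)| <= e) &
    forall i x, `|pd i psi x - k' (phi x) * pd i phi x| <= e].
Proof.
move=> [dk ck] k0 tphi e0; have [M M0 MP] := test_bounded tphi.
have [B B0 BP] : exists2 B : R, 0 <= B & forall i x, `|pd i phi x| <= B.
  have /choice[F FP] : forall i : 'I_N, exists B : R, 0 <= B /\ forall x, `|pd i phi x| <= B.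
    by move=> i; have [B B0 BP] := test_bounded (test_pd i tphi); exists B.
  exists (\sum_i F i); first by apply: sumr_ge0 => i _; exact: (FP i).1.
  move=> i x; rewrite (bigD1 i)//=; apply: (le_trans ((FP i).2 x)).
  by rewrite lerDl sumr_ge0// => j _; exact: (FP j).1.
pose M' := M + 1; have M'0 : 0 < M' by rewrite ltr_wpDl.
(* [C] bounds both quantities that multiply e / C below: the radius M' for the values and B for the
   partial derivatives. *)
pose C := M' + B; have C0 : 0 < C by rewrite ltr_pwDl.
have eC : 0 < e / C by rewrite divr_gt0.
have [q q0 qP] := C1_weierstrass dk ck k0 eC M'0.
have bd x : `|phi x| <= M' by rewrite (le_trans (MP x))// lerDl.
have le1 (b : R) : b <= C -> e / C * b <= e.
  by move=> bC; rewrite mulrAC ler_pdivrMr// ler_wpM2l// ltW.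
exists (fun x => q.[phi x]); split; first exact: test_horner.
  by move=> x; have [h _] := qP _ (bd x); apply: (le_trans h); apply: le1; rewrite lerDl.
move=> i x; have [_ h] := qP _ (bd x).
have [_ ->] := pd_horner q (test_derivable i x tphi).
rewrite -mulrBl normrM; apply: (le_trans (ler_pM _ _ h (BP i x))) => //.
by apply: le1; rewrite lerDr ltW.
Qed.

Lemma near_uniform (u v : V -> R) (e : R) : 0 <= e -> L u -> L v ->
  (forall x, `|u x - v x| <= e) -> d u v <= e * nrm mu Om p (fun=> 1).
Proof.
by move=> e0 [mu_ _] [mv _] uv; apply: (dist_le_bounded mO p1' fO e0 mu_ mv) => x _.
Qed.

Lemma small_factor (e : R) : 0 < e -> exists2 e' : R, 0 < e' &
  e' * nrm mu Om p (fun=> 1) < e.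
Proof.
move=> e0; pose c := nrm mu Om p (fun=> 1).
have c0 : 0 <= c by exact: nrm_ge0.
have c1 : 0 < c + 1 by rewrite ltr_wpDl.
exists (e / (c + 1)); first by rewrite divr_gt0.
by rewrite mulrAC ltr_pdivrMr// ltr_pM2l// ltrDl.
Qed.

Lemma Sob_comp_test (k k' : R -> R) phi g : C1 k k' -> k 0 = 0 ->
  test_function Om phi -> (forall i, gco i g = fun x => k' (phi x) * pd i phi x) ->
  Sob (fun x => k (phi x)) g.
Proof.
move=> Ck k0 tphi gE; have [dk ck] := Ck; have [M M0 MP] := test_bounded tphi.
have bnd (f : R -> R) : continuous f -> exists2 B : R, 0 <= B & forall x, `|f (phi x)| <= B.
  move=> cf; have NM : - M <= M by rewrite (le_trans _ M0)// oppr_le0.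
  have [c _ hc] := @EVT_max R (fun t => `|f t|) (- M) M NM
     (continuous_subspaceT (fun t => cvg_norm (cf t))).
  exists `|f c| => // x; apply: hc; by rewrite in_itv/= -ler_norml.
have [B1 B10 B1P] := bnd k (C1_cont Ck); have [B2 B20 B2P] := bnd k' ck.
have mphi := test_meas mO tphi.
have Lk : L (fun x => k (phi x)).
  apply: (Lp_bounded mO p1' fO (cont_meas (C1_cont Ck) mphi)) => x _; exact: B1P.
have Lg i : L (gco i g).
  have [B B0 BP] := test_bounded (test_pd i tphi).
  rewrite gE; apply: (@Lp_bounded _ _ _ mu Om mO p p1' fO (B2 * B)).
    by apply: measurable_funM; [exact: cont_meas|exact: test_meas (test_pd i tphi)].
  by move=> x _; rewrite normrM ler_pM.
split; [exact: Lk|exact: Lg|] => e e0.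
have [e' e'0 he] := small_factor e0.
have [psi [tpsi h1 h2]] := test_comp_approx Ck k0 tphi e'0.
have Lpsi := test_Lp tpsi.
exists psi; split; first exact: tpsi.
  rewrite dist_sym; apply: le_lt_trans he.
  exact: (near_uniform (ltW e'0) Lpsi Lk h1).
move=> i; rewrite dist_sym; apply: le_lt_trans he.
apply: (near_uniform (ltW e'0) (test_Lp (test_pd i tpsi)) (Lg i)).
by move=> x; rewrite gE; exact: h2.
Qed.

Definition vec (w : 'I_N -> V -> R) : V -> V := fun x => \row_i w i x.

Lemma gco_vec i w : gco i (vec w) = w i.
Proof. by apply/funext => x; rewrite /gco mxE. Qed.

(** In the gradient, k'(phi_n) (d phi_n - g) is controlled by the bound on k', while (k'(phi_n) -
    k'(u)) g tends to 0 by dominated convergence, thanks to the a.e. convergence of phi_n. *)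
Lemma Sob_comp (k k' : R -> R) (B : R) u g : C1 k k' -> k 0 = 0 ->
  (forall t, `|k' t| <= B) -> Sob u g ->
  Sob (fun x => k (u x)) (fun x => k' (u x) *: g x).
Proof.
move=> Ck k0 kB Su; have [dk ck] := Ck; have [Lu Lg _] := Su.
have B0 : 0 <= B by exact: le_trans (normr_ge0 _) (kB 0).
have lip a b : `|k a - k b| <= B * `|a - b| by exact: C1_lip dk kB.
have E i : gco i (fun x => k' (u x) *: g x) = fun x => k' (u x) * gco i g x.
  by apply/funext => x; rewrite /gco mxE.
have mk v : measurable_fun Om v -> measurable_fun Om (fun x => k (v x)).
  exact: cont_meas (C1_cont Ck).
have mk' v : measurable_fun Om v -> measurable_fun Om (fun x => k' (v x)).
  exact: cont_meas.
have Lk v : L v -> L (fun x => k (v x)).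
  move=> Lv; apply: (Lp_le mO _ _ _ (Lp_scale mO B Lv)).1.
  - exact: ltW (lt_trans ltr01 p1).
  - exact: mk Lv.1.
  - move=> x _; have := lip (v x) 0; rewrite k0 !subr0 => h.
    by rewrite normrM (ger0_norm B0).
have Lm v w : measurable_fun Om v -> L w -> L (fun x => k' (v x) * w x).
  move=> mv Lw; apply: (Lp_le mO _ _ _ (Lp_scale mO B Lw)).1.
  - exact: ltW (lt_trans ltr01 p1).
  - apply: measurable_funM; [exact: mk' mv|exact: Lw.1].
  - by move=> x _; rewrite !normrM (ger0_norm B0) ler_wpM2r.
have [phi [tphi c1 c2 cae]] := Sob_seq Su.
have Lphi n : L (phi n) by exact: (test_Lp (tphi n)).
have Lpd n i : L (pd i (phi n)) by exact: (test_Lp (test_pd i (tphi n))).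
apply: (Sob_lim_seq (un := fun n x => k (phi n x))
    (gn := fun n => vec (fun i x => k' (phi n x) * pd i (phi n) x))).
- exact: Lk.
- by move=> i; rewrite E; exact: (Lm u _ Lu.1 (Lg i)).
- move=> n; apply: (Sob_comp_test Ck k0 (tphi n)) => i; exact: gco_vec.
- apply: (cvg0_le (g := fun n => B * d (phi n) u)); last first.
    by rewrite -(mulr0 B); apply: cvgM; [exact: cvg_cst|exact: c1].
  move=> n; rewrite (ger0_norm (dist_ge0 _ _ _ _ _)).
  rewrite -[X in X * _](ger0_norm B0) -(dist_scale mO p1' B (Lphi n) Lu).
  apply: (dist_mono mO p1' (Lk _ (Lphi n)) (Lk _ Lu) (Lp_scale mO B (Lphi n))
    (Lp_scale mO B Lu)) => x _.
  by rewrite -mulrBr normrM (ger0_norm B0).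
- move=> i; rewrite E.
  have L1 n : L (fun x => k' (phi n x) * pd i (phi n) x) by exact: Lm (Lphi n).1 (Lpd n i).
  have L2 n : L (fun x => k' (phi n x) * gco i g x) by exact: Lm (Lphi n).1 (Lg i).
  have L3 : L (fun x => k' (u x) * gco i g x) by exact: Lm Lu.1 (Lg i).
  have t2 : d (fun x => k' (phi n x) * gco i g x) (fun x => k' (u x) * gco i g x)
      @[n --> \oo] --> 0.
    apply: (@dist_dct _ _ _ mu Om mO p p1' _ _ (fun x => 2 * B * gco i g x)).
    + by move=> n; exact: (L2 n).1.
    + exact: L3.1.
    + exact: Lp_scale (Lg i).
    + apply: filterS cae => x h Ox; apply: cvgM; last exact: cvg_cst.
      by apply: continuous_cvg; [exact: ck|exact: h].
    + move=> n; apply: nearW => x _; rewrite -mulrBl !normrM (ger0_norm B0).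
      rewrite (ger0_norm (ler0n _ 2)) ler_wpM2r// (le_trans (ler_normB _ _))//.
      by rewrite mulr_natl mulr2n lerD.
  apply: (cvg0_le (g := fun n => B * d (pd i (phi n)) (gco i g) +
      d (fun x => k' (phi n x) * gco i g x) (fun x => k' (u x) * gco i g x))); last first.
    rewrite -[0]addr0; apply: cvgD; last exact: t2.
    by rewrite -(mulr0 B); apply: cvgM; [exact: cvg_cst|exact: c2].
  move=> n; rewrite (ger0_norm (dist_ge0 _ _ _ _ _)) gco_vec.
  apply: (le_trans (dist_tri mO p1' (L1 n) (L2 n) L3)); rewrite lerD2r.
  rewrite -[X in X * _](ger0_norm B0) -(dist_scale mO p1' B (Lpd n i) (Lg i)).
  apply: (dist_mono mO p1' (L1 n) (L2 n) (Lp_scale mO B (Lpd n i))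
    (Lp_scale mO B (Lg i))) => x _.
  by rewrite -!mulrBr !normrM (ger0_norm B0) ler_wpM2r.
Qed.

(** The convergence of [kn'] is only pointwise, so [k'] may be discontinuous. This admits the
    absolute value, with [Num.sg] as its derivative. *)
Lemma Sob_comp_lim (kn kn' : nat -> R -> R) (k k' : R -> R) (B : R) u g :
  (forall n, C1 (kn n) (kn' n)) -> (forall n, kn n 0 = 0) ->
  (forall n t, `|kn' n t| <= B) ->
  (forall t, kn n t @[n --> \oo] --> k t) ->
  (forall t, kn' n t @[n --> \oo] --> k' t) -> Sob u g ->
  Sob (fun x => k (u x)) (fun x => k' (u x) *: g x).
Proof.
move=> Ckn kn0 kB ckn ckn' Su; have [Lu Lg _] := Su.
have B0 : 0 <= B by exact: le_trans (normr_ge0 _) (kB 0%N 0).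
have lip n a : `|kn n a| <= B * `|a|.
  have [dk _] := Ckn n; have := C1_lip a 0 dk (kB n).
  by rewrite kn0 !subr0.
have S n := Sob_comp (Ckn n) (kn0 n) (kB n) Su.
have lim_bound (f : nat -> R) (l b : R) : f n @[n --> \oo] --> l ->
    (forall n, `|f n| <= b) -> `|l| <= b.
  move=> /cvg_norm fl fb; rewrite -(cvg_lim (@Rhausdorff R) fl).
  by apply: limr_le; [exact: cvgP fl|exact: nearW].
have lipk a : `|k a| <= B * `|a| by exact: (lim_bound _ _ _ (ckn a) (fun n => lip n a)).
have lipk' a : `|k' a| <= B by exact: (lim_bound _ _ _ (ckn' a) (fun n => kB n a)).
have mlim (f : nat -> V -> R) (h : V -> R) : (forall n, measurable_fun Om (f n)) ->
    (forall x, f n x @[n --> \oo] --> h x) -> measurable_fun Om h.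
  by move=> mf fh; apply: (measurable_lim mf) => x _; exact: fh.
have E (h : R -> R) i : gco i (fun x => h (u x) *: g x) = fun x => h (u x) * gco i g x.
  by apply/funext => x; rewrite /gco mxE.
have mk : measurable_fun Om (fun x => k (u x)).
  apply: (mlim (fun n x => kn n (u x)) _ (fun n => (Sob_Lp (S n)).1)) => x.
  exact: ckn.
have mk' : measurable_fun Om (fun x => k' (u x)).
  apply: (mlim (fun n x => kn' n (u x))) => [n|x]; last exact: ckn'.
  by apply: cont_meas Lu.1; have [] := Ckn n.
have Lk : L (fun x => k (u x)).
  apply: (Lp_le mO _ mk _ (Lp_scale mO B Lu)).1.
  - exact: ltW (lt_trans ltr01 p1).
  - by move=> x _; rewrite normrM (ger0_norm B0).
have Lgk i : L (fun x => k' (u x) * gco i g x).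
  apply: (Lp_le mO _ _ _ (Lp_scale mO B (Lg i))).1.
  - exact: ltW (lt_trans ltr01 p1).
  - by apply: measurable_funM; [exact: mk'|exact: (Lg i).1].
  - by move=> x _; rewrite !normrM (ger0_norm B0) ler_wpM2r.
apply: (Sob_lim_seq _ _ S).
- exact: Lk.
- by move=> i; rewrite E; exact: Lgk.
- apply: (@dist_dct _ _ _ mu Om mO p p1' _ _ (fun x => 2 * B * u x)).
  + by move=> n; exact: (Sob_Lp (S n)).1.
  + exact: mk.
  + exact: Lp_scale Lu.
  + by apply: nearW => x _; exact: ckn.
  + move=> n; apply: nearW => x _; rewrite (le_trans (ler_normB _ _))//.
    rewrite !normrM (ger0_norm B0) (ger0_norm (ler0n _ 2)) -mulrA mulr_natl mulr2n.
    by rewrite lerD.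
- move=> i; rewrite E; under eq_fun => n do rewrite E.
  apply: (@dist_dct _ _ _ mu Om mO p p1' _ _ (fun x => 2 * B * gco i g x)).
  + by move=> n; have := (Sob_Lpg i (S n)).1; rewrite E.
  + exact: (Lgk i).1.
  + exact: Lp_scale (Lg i).
  + by apply: nearW => x _; apply: cvgM; [exact: ckn'|exact: cvg_cst].
  + move=> n; apply: nearW => x _; rewrite -mulrBl !normrM (ger0_norm B0).
    rewrite (ger0_norm (ler0n _ 2)) ler_wpM2r// (le_trans (ler_normB _ _))//.
    by rewrite mulr_natl mulr2n lerD.
Qed.

(** A smooth approximation of |t - s|; its value at 0 is subtracted below, since compositions
    require functions vanishing at 0. *)
Let sq (s e t : R) : R := Num.sqrt ((t - s) ^+ 2 + e ^+ 2).

Let sq_gt0 (s e t : R) : 0 < e -> 0 < (t - s) ^+ 2 + e ^+ 2.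
Proof. by move=> e0; rewrite ltr_wpDl ?sqr_ge0// exprn_gt0. Qed.

Let sq_C1 (s e : R) : 0 < e -> C1 (fun t => sq s e t - sq s e 0) (fun t => (t - s) / sq s e t).
Proof.
move=> e0; split.
  move=> t; have h1 : is_derive t 1 (fun t : R => (t - s) ^+ 2 + e ^+ 2) (2 * (t - s)).
    by apply: is_derive_eq; rewrite /GRing.scale/=; ring.
  have h2 := @is_derive1_comp _ Num.sqrt (fun t : R => (t - s) ^+ 2 + e ^+ 2) _ _ _
    (is_derive1_sqrt (sq_gt0 s t e0)) h1.
  have h3 : is_derive t 1 (fun t0 : R => sq s e t0 - sq s e 0)
      ((2 * Num.sqrt ((t - s) ^+ 2 + e ^+ 2))^-1 * (2 * (t - s)) - 0).
    by apply: is_deriveB; exact: h2.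
  apply: (is_derive_eq h3).
  have := sq_gt0 s t e0; rewrite -sqrtr_gt0 => h.
  by rewrite /sq subr0; field; rewrite gt_eqF.
move=> t; apply: cvgM; first by apply: cvgB; [exact: cvg_id|exact: cvg_cst].
apply: cvgV; first by rewrite gt_eqF// sqrtr_gt0 sq_gt0.
apply: continuous_cvg; first exact: sqrt_continuous.
apply: cvgD; last exact: cvg_cst.
by apply: cvgM; (apply: cvgB; [exact: cvg_id|exact: cvg_cst]).
Qed.

Let sq_cvg (s t : R) : sq s n.+1%:R^-1 t @[n --> \oo] --> `|t - s|.
Proof.
rewrite -sqrtr_sqr; apply: continuous_cvg; first exact: sqrt_continuous.
rewrite -[X in _ --> X]addr0; apply: cvgD; first exact: cvg_cst.
rewrite -(mulr0 (0 : R)); apply: cvgM; exact: cvg_harmonic.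
Qed.

(** The constant |s| is subtracted so that the function of [u] vanishes at 0. With a positive s this
    gives access to minima with a constant. *)
Lemma Sob_abs_shift s u g : Sob u g ->
  Sob (fun x => `|u x - s| - `|s|) (fun x => Num.sg (u x - s) *: g x).
Proof.
have n0 n : 0 < n.+1%:R^-1 :> R by rewrite invr_gt0.
apply: (Sob_comp_lim (kn := fun n t => sq s n.+1%:R^-1 t - sq s n.+1%:R^-1 0)
  (kn' := fun n t => (t - s) / sq s n.+1%:R^-1 t)
  (k := fun t => `|t - s| - `|s|) (k' := fun t => Num.sg (t - s)) (B := 1)).
- by move=> n; exact: sq_C1.
- by move=> n; rewrite subrr.
- move=> n t; have h : 0 < sq s n.+1%:R^-1 t by rewrite sqrtr_gt0 sq_gt0.
  rewrite normrM normfV (gtr0_norm h) ler_pdivrMr// mul1r -sqrtr_sqr.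
  by apply: ler_wsqrtr; rewrite lerDl sqr_ge0.
- move=> t; have -> : `|s| = `|0 - s| by rewrite sub0r normrN.
  by apply: cvgB; exact: sq_cvg.
- move=> t; have [->|ts] := eqVneq (t - s) 0.
    by rewrite sgr0; apply: cvg_near_cst; apply: nearW => n; rewrite mul0r.
  have -> : Num.sg (t - s) = (t - s) / `|t - s|.
    by rewrite {2}(numEsg (t - s)) mulfK// normr_eq0.
  apply: cvgM; first exact: cvg_cst.
  by apply: cvgV; [rewrite normr_eq0|exact: sq_cvg].
Qed.

Lemma Sob_eq u v g G : (forall x, u x = v x) -> (forall x, g x = G x) ->
  Sob u g -> Sob v G.
Proof. by move=> /funext -> /funext ->. Qed.

Lemma Sob_abs u g : Sob u g -> Sob (fun x => `|u x|) (fun x => Num.sg (u x) *: g x).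
Proof.
by move=> /(Sob_abs_shift 0); apply: Sob_eq => x; rewrite ?normr0 !subr0.
Qed.

Lemma Sob_pos u g : Sob u g ->
  Sob (fun x => Num.max (u x) 0) (fun x => (2^-1 * (Num.sg (u x) + 1)) *: g x).
Proof.
move=> Su; have := Sob_scale 2^-1 (Sob_add (Sob_abs Su) Su).
apply: Sob_eq => x; last by rewrite -[X in _ + X]scale1r -scalerDl scalerA.
have [u0|u0] := leP (u x) 0; first by rewrite ler0_norm// addNr mulr0.
by rewrite gtr0_norm//; field.
Qed.

(** min(a, b) = (a + b - |a - b|)/2 with a = u and b = m - |v|; the constant m cancels against the
    one in [Sob_abs_shift]. The gradient bound does not involve m, as the truncations in the
    Euler-Lagrange equation require. *)
Lemma Sob_min_cap (m : R) u v g G : Sob u g -> Sob v G -> 0 <= m ->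
  (forall x, 0 <= u x) ->
  exists2 H, Sob (fun x => Num.max (Num.min (u x) (m - `|v x|)) 0) H &
    forall i x, `|gco i H x| <= `|gco i g x| + `|gco i G x|.
Proof.
move=> Su Sv m0 u0; have Sw := Sob_abs Sv.
have Sz := Sob_abs_shift m (Sob_add Su Sw).
have := Sob_scale 2^-1 (Sob_sub (Sob_sub Su Sw) Sz).
set H : V -> V := fun x => 2^-1 *: _; move=> h; have := Sob_pos h.
set H' : V -> V := fun x => (_ * _) *: _; move=> h'; exists H'.
  apply: Sob_eq h' => // x; congr (Num.max _ _); rewrite (ger0_norm m0).
  have [uv|uv] := leP (u x) (m - `|v x|).
    by rewrite (@ler0_norm _ (u x + `|v x| - m)); [field|lra].
  by rewrite (@gtr0_norm _ (u x + `|v x| - m)); [field|lra].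
have sgle (t : R) : `|Num.sg t| <= 1 by rewrite normr_sg; case: (_ != _).
move=> i x; rewrite /gco /H' /H !mxE; set s1 := Num.sg _.
set s2 := Num.sg _; set s3 := Num.sg _.
have h1 : `|s1| <= 1 := sgle _.
have h2 : `|s2| <= 1 := sgle _.
have h3 : `|s3| <= 1 := sgle _.
rewrite normrM -[leRHS]mul1r; apply: ler_pM => //.
  rewrite normrM ger0_norm ?invr_ge0// mulrC ler_pdivrMr// mul1r.
  by apply: le_trans (ler_normD _ _) _; rewrite normr1; lra.
rewrite (_ : _ * _ = 2^-1 * ((1 - s3) * g x 0 i - ((1 + s3) * s2) * G x 0 i)); last by ring.
rewrite normrM ger0_norm ?invr_ge0// mulrC ler_pdivrMr// [leRHS]mulrDl.
apply: le_trans (ler_normB _ _) _; rewrite !normrM.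
apply: lerD; rewrite mulrC; apply: ler_wpM2l => //.
  by apply: le_trans (ler_normB _ _) _; rewrite normr1; lra.
rewrite -[leRHS]mulr1; apply: ler_pM => //.
by apply: le_trans (ler_normD _ _) _; rewrite normr1; lra.
Qed.

Lemma Sob_mul_test phi u g : test_function Om phi -> Sob u g ->
  Sob (fun x => phi x * u x) (fun x => phi x *: g x + u x *: tgrad phi x).
Proof.
move=> tphi Su; have [Lu Lg _] := Su; have [pn [tpn c1 c2 _]] := Sob_seq Su.
have [M M0 MP] := test_bounded tphi.
have Lm w : L w -> L (fun x => phi x * w x).
  move=> Lw; apply: (Lp_le mO _ _ _ (Lp_scale mO M Lw)).1.
  - exact: ltW (lt_trans ltr01 p1).
  - by apply: measurable_funM; [exact: test_meas mO tphi|exact: Lw.1].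
  - by move=> x _; rewrite !normrM (ger0_norm M0) ler_wpM2r.
have Lm' i w : L w -> L (fun x => w x * pd i phi x).
  have [M' M'0 M'P] := test_bounded (test_pd i tphi).
  move=> Lw; apply: (Lp_le mO _ _ _ (Lp_scale mO M' Lw)).1.
  - exact: ltW (lt_trans ltr01 p1).
  - by apply: measurable_funM; [exact: Lw.1|exact: test_meas mO (test_pd i tphi)].
  - by move=> x _; rewrite !normrM (ger0_norm M'0) mulrC ler_wpM2r.
have E i : gco i (fun x => phi x *: g x + u x *: tgrad phi x) =
    fun x => phi x * gco i g x + u x * pd i phi x.
  by apply/funext => x; rewrite /gco !mxE.
have E' i n : gco i (tgrad (fun x => phi x * pn n x)) =
    fun x => phi x * pd i (pn n) x + pn n x * pd i phi x.
  rewrite gco_tgrad; apply/funext => x.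
  rewrite (pd_mul (test_derivable i x tphi) (test_derivable i x (tpn n))); ring.
have Lpn n : L (pn n) by exact: (test_Lp (tpn n)).
have Lpd n i : L (pd i (pn n)) by exact: (test_Lp (test_pd i (tpn n))).
have dm w w' : L w -> L w' -> d (fun x => phi x * w x) (fun x => phi x * w' x) <= M * d w w'.
  move=> Lw Lw'; rewrite -[X in X * _](ger0_norm M0) -(dist_scale mO p1' M Lw Lw').
  apply: (dist_mono mO p1' (Lm _ Lw) (Lm _ Lw') (Lp_scale mO M Lw) (Lp_scale mO M Lw')).
  by move=> x _; rewrite -!mulrBr !normrM (ger0_norm M0) ler_wpM2r.
apply: (Sob_lim_seq (un := fun n x => phi x * pn n x)
    (gn := fun n => tgrad (fun x => phi x * pn n x))).
- exact: Lm.
- by move=> i; rewrite E; exact: (Lp_add mO p1' (Lm _ (Lg i)) (Lm' i _ Lu)).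
- move=> n; apply: (Sob_test); exact: test_mul tphi (tpn n).
- apply: (cvg0_le (g := fun n => M * d (pn n) u)).
    by move=> n; rewrite (ger0_norm (dist_ge0 _ _ _ _ _)); exact: dm (Lpn n) Lu.
  by rewrite -(mulr0 M); apply: cvgM; [exact: cvg_cst|exact: c1].
- move=> i; have [M' M'0 M'P] := test_bounded (test_pd i tphi).
  apply: (cvg0_le (g := fun n => M * d (pd i (pn n)) (gco i g) + M' * d (pn n) u)).
    move=> n; rewrite (ger0_norm (dist_ge0 _ _ _ _ _)) E E'.
    apply: (le_trans (dist_add mO p1' (Lm _ (Lpd n i)) (Lm' i _ (Lpn n))
      (Lm _ (Lg i)) (Lm' i _ Lu))).
    apply: lerD; first exact: dm (Lpd n i) (Lg i).
    rewrite -[X in X * _](ger0_norm M'0) -(dist_scale mO p1' M' (Lpn n) Lu).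
    apply: (dist_mono mO p1' (Lm' i _ (Lpn n)) (Lm' i _ Lu) (Lp_scale mO M' (Lpn n))
      (Lp_scale mO M' Lu)) => x _.
    by rewrite -mulrBr -mulrBl !normrM (ger0_norm M'0) mulrC ler_wpM2r.
  rewrite -[0]addr0; apply: cvgD.
    by rewrite -(mulr0 M); apply: cvgM; [exact: cvg_cst|exact: c2].
  by rewrite -(mulr0 M'); apply: cvgM; [exact: cvg_cst|exact: c1].
Qed.

(** Only the bounded factor [k (phi x)] is approximated, uniformly with its partial derivatives; [u]
    is any element of the class. This is the shape of the function with which Picone's identity is
    tested. *)
Lemma Sob_mul_comp_test (k k' : R -> R) phi u g : C1 k k' -> k 0 = 0 ->
  test_function Om phi -> Sob u g ->
  Sob (fun x => k (phi x) * u x)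
    (fun x => k (phi x) *: g x + (u x * k' (phi x)) *: tgrad phi x).
Proof.
move=> Ck k0 tphi Su; have [Lu Lg _] := Su.
have [M M0 MP] := test_bounded tphi.
have e0 n : 0 < n.+1%:R^-1 :> R by rewrite invr_gt0.
have /choice[ps psP] := fun n => test_comp_approx Ck k0 tphi (e0 n).
have tps n : test_function Om (ps n) by case: (psP n).
have mphi := test_meas mO tphi.
(* The approximation of index 0 has error 1, whence bounds for [k (phi x)] and for its partial
   derivatives. *)
have [B B0 kB] : exists2 B : R, 0 <= B & forall x, `|k (phi x)| <= B.
  have [_ h _] := psP 0%N; have [B B0 BP] := test_bounded (tps 0%N).
  exists (B + 1); first by rewrite addr_ge0.
  move=> x; have := h x; rewrite invr1 => h1.
  have := BP x; have := ler_normB (ps 0%N x) (ps 0%N x - k (phi x)).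
  by rewrite subKr; lra.
have [B' B'0 kB'] : exists2 B : R, 0 <= B & forall i x, `|k' (phi x) * pd i phi x| <= B.
  have [_ _ h] := psP 0%N.
  have /choice[F FP] : forall i : 'I_N, exists B : R, 0 <= B /\ forall x, `|pd i (ps 0%N) x| <= B.
    by move=> i; have [B1 B10 BP] := test_bounded (test_pd i (tps 0%N)); exists B1.
  exists (\sum_i F i + 1); first by rewrite addr_ge0// sumr_ge0// => i _; exact: (FP i).1.
  move=> i x; have := h i x; rewrite invr1 => h1.
  have := (FP i).2 x; have : F i <= \sum_i F i.
    by rewrite (bigD1 i)//= lerDl sumr_ge0// => j _; exact: (FP j).1.
  have := ler_normB (pd i (ps 0%N) x) (pd i (ps 0%N) x - k' (phi x) * pd i phi x).
  by rewrite subKr; lra.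
have Lb (b : R) (h w : V -> R) : measurable_fun Om h -> 0 <= b -> (forall x, `|h x| <= b) -> L w ->
    L (fun x => h x * w x).
  move=> mh b0 hb Lw; apply: (Lp_le mO _ _ _ (Lp_scale mO b Lw)).1.
  - exact: ltW (lt_trans ltr01 p1).
  - by apply: measurable_funM; [exact: mh|exact: Lw.1].
  - by move=> x _; rewrite !normrM (ger0_norm b0) ler_wpM2r.
have mk : measurable_fun Om (fun x => k (phi x)) by exact: cont_meas (C1_cont Ck) mphi.
have mk' i : measurable_fun Om (fun x => k' (phi x) * pd i phi x).
  apply: measurable_funM; first exact: cont_meas Ck.2 mphi.
  exact: test_meas mO (test_pd i tphi).
have L1 w : L w -> L (fun x => k (phi x) * w x) by exact: Lb mk B0 kB.
have L2 i w : L w -> L (fun x => k' (phi x) * pd i phi x * w x).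
  exact: Lb (mk' i) B'0 (kB' i).
have L3 n w : L w -> L (fun x => ps n x * w x).
  have [b b0 bP] := test_bounded (tps n); exact: Lb (test_meas mO (tps n)) b0 bP.
have L4 n i w : L w -> L (fun x => pd i (ps n) x * w x).
  have [b b0 bP] := test_bounded (test_pd i (tps n)).
  exact: Lb (test_meas mO (test_pd i (tps n))) b0 bP.
have E i : gco i (fun x => k (phi x) *: g x + (u x * k' (phi x)) *: tgrad phi x) =
    fun x => k (phi x) * gco i g x + k' (phi x) * pd i phi x * u x.
  by apply/funext => x; rewrite /gco !mxE; ring.
have E' i n : gco i (fun x => ps n x *: g x + u x *: tgrad (ps n) x) =
    fun x => ps n x * gco i g x + pd i (ps n) x * u x.
  by apply/funext => x; rewrite /gco !mxE; ring.
have L0 : L (fun=> 0) by apply: Lp0; [exact: mO|rewrite gt_eqF// (lt_trans ltr01 p1)].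
have dd n (h1 h2 w : V -> R) : (forall w, L w -> L (fun x => h1 x * w x)) ->
    (forall w, L w -> L (fun x => h2 x * w x)) ->
    (forall x, `|h1 x - h2 x| <= n.+1%:R^-1) -> L w ->
    d (fun x => h1 x * w x) (fun x => h2 x * w x) <= n.+1%:R^-1 * d w (fun=> 0).
  move=> l1 l2 h12 Lw; rewrite -[X in X * _](ger0_norm (ltW (e0 n))).
  rewrite -(dist_scale mO p1' n.+1%:R^-1 Lw L0).
  apply: (dist_mono mO p1' (l1 w Lw) (l2 w Lw) (Lp_scale mO n.+1%:R^-1 Lw)
    (Lp_scale mO n.+1%:R^-1 L0)) => x _.
  by rewrite -mulrBl mulr0 subr0 !normrM (ger0_norm (ltW (e0 n))) ler_wpM2r.
have lim0 (c : R) : n.+1%:R^-1 * c @[n --> \oo] --> 0.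
  by rewrite -(mul0r c); apply: cvgM; [exact: cvg_harmonic|exact: cvg_cst].
apply: (Sob_lim_seq (un := fun n x => ps n x * u x)
    (gn := fun n x => ps n x *: g x + u x *: tgrad (ps n) x)).
- exact: L1.
- by move=> i; rewrite E; exact: (Lp_add mO p1' (L1 _ (Lg i)) (L2 i _ Lu)).
- by move=> n; exact: Sob_mul_test (tps n) Su.
- apply: (cvg0_le (g := fun n => n.+1%:R^-1 * d u (fun=> 0))) => [n|]; last exact: lim0.
  rewrite (ger0_norm (dist_ge0 _ _ _ _ _)).
  by have [_ h _] := psP n; exact: dd (L3 n) L1 h Lu.
- move=> i; apply: (cvg0_le (g := fun n => n.+1%:R^-1 * d (gco i g) (fun=> 0) +
    n.+1%:R^-1 * d u (fun=> 0))) => [n|]; last by rewrite -[0]addr0; apply: cvgD; exact: lim0.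
  rewrite (ger0_norm (dist_ge0 _ _ _ _ _)) E E'.
  apply: (le_trans (dist_add mO p1' (L3 n _ (Lg i)) (L4 n i _ Lu)
      (L1 _ (Lg i)) (L2 i _ Lu))).
  have [_ h h'] := psP n.
  exact: (lerD (dd n _ _ _ (L3 n) L1 h (Lg i)) (dd n _ _ _ (L4 n i) (L2 i) (h' i) Lu)).
Qed.

End sobolev_class.


(** * Averages over dyadic boxes *)

Section young.
Variables (R : realType) (p : R).
Hypothesis p1 : 1 < p.

Let p0 : 0 < p. Proof. exact: lt_trans p1. Qed.

Lemma powR_pred (a : R) : 0 <= a -> a `^ (p - 1) * a = a `^ p.
Proof.
move=> a0; have [->|an0] := eqVneq a 0; first by rewrite mulr0 powR0// gt_eqF.
by rewrite -[X in _ * X](powRr1 a0) -powRD ?subrK// an0 implybT.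
Qed.

(** The graph of t^p lies above its tangent at [b]; in this form Young's inequality serves as the
    convexity of the power throughout. *)
Lemma young_powR (a b : R) : 0 <= a -> 0 <= b ->
  p * (b `^ (p - 1) * a) <= a `^ p + (p - 1) * b `^ p.
Proof.
move=> a0 b0; pose q := p / (p - 1).
have p10 : 0 < p - 1 by rewrite subr_gt0.
have q0 : 0 < q by rewrite divr_gt0.
have pq : p^-1 + q^-1 = 1.
  by rewrite /q invf_div; field; rewrite (gt_eqF p0).
have := conjugate_powR a0 (powR_ge0 b (p - 1)) p0 q0 pq.
rewrite -powRrM (_ : (p - 1) * q = p); last first.
  by rewrite /q; field; rewrite gt_eqF.
rewrite mulrC => h; have := ler_wpM2l (ltW p0) h.
rewrite mulrDr [p * (a `^ p / p)]mulrC divfK ?gt_eqF// => h'.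
apply: (le_trans h'); rewrite lerD2l /q le_eqVlt; apply/orP; left; apply/eqP.
by field; rewrite !gt_eqF.
Qed.

End young.

Section dyadic_boxes.
Variables (R : realType) (N : nat).
Local Notation V := 'rV[R]_N.
Local Notation mu := (lebm R N).
Variables (hN : (0 < N)%N) (s0 : R).
Hypothesis s0p : 0 < s0.

Definition dir (l : nat) : 'I_N := Ordinal (ltn_pmod l hN).

(* The sides are halved one coordinate at a time, in cyclic order. *)
Definition side (l : nat) (i : 'I_N) : R := s0 / 2 ^+ (l %/ N + (i < l %% N)).

Lemma side0 i : side 0 i = s0.
Proof. by rewrite /side div0n mod0n expr0 divr1. Qed.

Lemma side_gt0 l i : 0 < side l i.
Proof. by rewrite divr_gt0// exprn_gt0. Qed.

Lemma side_dirE l : side l (dir l) = s0 / 2 ^+ (l %/ N).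
Proof. by rewrite /side /= ltnn addn0. Qed.

Lemma side_succ l i : side l.+1 i = if i == dir l then side l i / 2 else side l i.
Proof.
rewrite /side -val_eqE /=; set q := (l %/ N)%N; set r := (l %% N)%N.
have lE : l.+1 = (q * N + r.+1)%N by rewrite addnS -divn_eq.
have rN : (r < N)%N by rewrite ltn_pmod.
have iN := ltn_ord i.
have [r1|r1] := ltnP r.+1 N.
  rewrite lE divnMDl// modnMDl divn_small// modn_small// addn0 ltnS leq_eqVlt.
  by case: eqVneq => [->|_] //=; rewrite ltnn addn0 exprD expr1 invfM mulrA.
have rE : r.+1 = N by apply/eqP; rewrite eqn_leq rN.
rewrite lE rE divnMDl// modnMDl modnn divnn hN addn0.
have [ir|ir] := eqVneq (i : nat) r; first by rewrite ir ltnn addn0 exprD expr1 invfM mulrA.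
by rewrite (_ : (i < r)%N = true) //; apply/idP; rewrite ltn_neqAle ir -ltnS rE.
Qed.

Definition vol (l : nat) : R := s0 ^+ N / 2 ^+ l.

Lemma vol_gt0 l : 0 < vol l.
Proof. by rewrite divr_gt0// exprn_gt0. Qed.

Lemma vol_succ l : vol l = 2 * vol l.+1.
Proof. by rewrite /vol exprS; field; rewrite expf_neq0. Qed.

Lemma prod_side l : \prod_i side l i = vol l.
Proof.
elim: l => [|l IH].
  rewrite (eq_bigr (fun=> s0)) ?prodr_const ?card_ord ?/vol ?expr0 ?divr1//.
  by move=> i _; rewrite side0.
apply: (@mulfI _ 2) => //; rewrite -vol_succ -IH (bigD1 (dir l))//= [RHS](bigD1 (dir l))//=.
rewrite side_succ eqxx mulrA; congr (_ * _); first by rewrite mulrC divfK.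
by apply: eq_bigr => i ni; rewrite side_succ (negbTE ni).
Qed.

(** Half-open boxes, so that the two halves of a box partition it exactly. *)
Definition hb (l : nat) (a : V) : set V :=
  [set x | forall i, a 0 i <= x 0 i < a 0 i + side l i].

Definition up (l : nat) (a : V) : V := side l.+1 (dir l) *: evec R (dir l) + a.

Lemma measurable_hb l a : measurable (hb l a).
Proof.
apply: (measurable_rbox (P := fun i => `[a 0 i, a 0 i + side l i[%classic)) => i.
exact: measurable_itv.
Qed.

Lemma mu_hb l a : mu (hb l a) = (vol l)%:E.
Proof.
pose e : V := \row_i (a 0 i + side l i).
rewrite (_ : hb l a = [set x : V | forall i, a 0 i <= x 0 i < e 0 i]); last first.
  by apply/seteqP; split=> x h i; have := h i; rewrite mxE.
rewrite lebm_box; last by move=> i; rewrite mxE lerDl ltW// side_gt0.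
by congr EFin; rewrite -prod_side; apply: eq_bigr => i _; rewrite mxE addrC addKr.
Qed.

Lemma hb_fin l a : (mu (hb l a) < +oo)%E.
Proof. by rewrite mu_hb ltry. Qed.

Lemma upE l a i : up l a 0 i = if i == dir l then side l.+1 i + a 0 i else a 0 i.
Proof.
rewrite /up !mxE eqxx /=; case: eqVneq => [->|_]; first by rewrite mulr1.
by rewrite mulr0 add0r.
Qed.

Lemma side_half l i : i = dir l -> side l i = side l.+1 i + side l.+1 i.
Proof. by move=> ->; rewrite side_succ eqxx -splitr. Qed.

Lemma hb_left l a x : hb l.+1 a x <->
  hb l a x /\ x 0 (dir l) < a 0 (dir l) + side l.+1 (dir l).
Proof.
split=> [h|[h h1] i].
  split; last by have /andP[] := h (dir l).
  move=> i; have /andP[-> /=] := h i; rewrite side_succ; case: eqVneq => // _ h2.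
  by apply: (lt_le_trans h2); rewrite lerD2l; have := side_gt0 l i; lra.
have /andP[-> /=] := h i; have [->//|ni] := eqVneq i (dir l).
by rewrite side_succ (negbTE ni).
Qed.

Lemma hb_right l a x : hb l.+1 (up l a) x <->
  hb l a x /\ a 0 (dir l) + side l.+1 (dir l) <= x 0 (dir l).
Proof.
split=> [h|[h h1] i].
  split; last by have /andP[] := h (dir l); rewrite upE eqxx addrC.
  move=> i; have := h i; rewrite upE; case: eqVneq => [->|ni].
    rewrite (side_half (erefl (dir l))); have := side_gt0 l.+1 (dir l).
    by move=> h1 /andP[h2 h3]; apply/andP; split; lra.
  by rewrite side_succ (negbTE ni).
have := h i; rewrite upE; have [->|ni] := eqVneq i (dir l).
  rewrite (side_half (erefl (dir l))) => /andP[h2 h3].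
  by apply/andP; split; lra.
by rewrite side_succ (negbTE ni).
Qed.

Lemma hb_split l a : hb l a = hb l.+1 a `|` hb l.+1 (up l a).
Proof.
apply/seteqP; split=> x.
  move=> h; have [h1|h1] := ltP (x 0 (dir l)) (a 0 (dir l) + side l.+1 (dir l)).
    by left; apply/hb_left.
  by right; apply/hb_right.
by case=> [/hb_left[]|/hb_right[]].
Qed.

Lemma hb_disj l a : [disjoint hb l.+1 a & hb l.+1 (up l a)].
Proof.
apply/disj_setPS => x [/hb_left[_ h1] /hb_right[_ h2]].
by move: (lt_le_trans h1 h2); rewrite ltxx.
Qed.

(** A class stable under the operations below and integrable on every box; test functions and their
    partial derivatives belong to it. *)
Definition bm (f : V -> R) := measurable_fun setT f /\ exists M, forall x, `|f x| <= M.

Lemma bm_intg (D : set V) f : measurable D -> (mu D < +oo)%E -> bm f ->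
  mu.-integrable D (EFin \o f).
Proof.
move=> mD fD [mf [M fM]]; apply: (intg_le mD _ (g := fun=> M)).
- exact: measurable_funTS.
- by move=> x _; exact: fM.
- exact: intg_cst.
Qed.

Lemma bm_hb l a f : bm f -> mu.-integrable (hb l a) (EFin \o f).
Proof. exact: bm_intg (measurable_hb l a) (hb_fin l a). Qed.

Lemma I_hb_split l a f : bm f -> \int[mu]_(x in hb l a) f x =
  \int[mu]_(x in hb l.+1 a) f x + \int[mu]_(x in hb l.+1 (up l a)) f x.
Proof.
move=> bf; rewrite hb_split Rintegral_setU//.
- exact: measurable_hb.
- exact: measurable_hb.
- by rewrite -hb_split; exact: bm_hb.
- exact: hb_disj.
Qed.

Definition avg l a (f : V -> R) : R := (vol l)^-1 * \int[mu]_(x in hb l a) f x.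

Lemma avg_split l a f : bm f -> avg l a f = 2^-1 * (avg l.+1 a f + avg l.+1 (up l a) f).
Proof.
move=> bf; rewrite /avg I_hb_split// vol_succ invfM -mulrDr mulrA//.
Qed.

Lemma avg_cst l a c : avg l a (fun=> c) = c.
Proof.
rewrite /avg Rintegral_cst; last exact: measurable_hb.
by rewrite mu_hb /= mulrC mulfK// gt_eqF// vol_gt0.
Qed.

Lemma avg_le l a f g : bm f -> bm g -> (forall x, hb l a x -> f x <= g x) ->
  avg l a f <= avg l a g.
Proof.
move=> bf bg fg; apply: ler_wpM2l; first by rewrite invr_ge0 ltW// vol_gt0.
by apply: I_le; [exact: measurable_hb|exact: bm_hb|exact: bm_hb|exact: fg].
Qed.

Lemma avg_ge0 l a f : (forall x, 0 <= f x) -> 0 <= avg l a f.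
Proof.
move=> f0; rewrite mulr_ge0 ?invr_ge0 ?(ltW (vol_gt0 l))//.
by apply: I_ge0 => x _; exact: f0.
Qed.

Lemma avg_eq l a f g : (forall x, hb l a x -> f x = g x) -> avg l a f = avg l a g.
Proof. by move=> fg; congr (_ * _); exact: I_eq. Qed.

Lemma avg_sub l a f g : bm f -> bm g ->
  avg l a (fun x => f x - g x) = avg l a f - avg l a g.
Proof.
move=> bf bg; rewrite /avg (I_sub (measurable_hb l a) (bm_hb l a bf) (bm_hb l a bg)).
by rewrite mulrBr.
Qed.

Lemma avg_abs l a f : bm f -> `|avg l a f| <= avg l a (fun x => `|f x|).
Proof.
move=> bf; rewrite /avg normrM ger0_norm ?invr_ge0 ?(ltW (vol_gt0 l))//.
apply: ler_wpM2l; first by rewrite invr_ge0 ltW// vol_gt0.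
by apply: I_abs; [exact: measurable_hb|exact: bm_hb].
Qed.

Lemma bm_cst c : bm (fun=> c).
Proof. by split=> //; exists `|c|. Qed.

Lemma bm_add f g : bm f -> bm g -> bm (fun x => f x + g x).
Proof.
move=> [mf [M fM]] [mg [K gK]]; split; first exact: measurable_funD.
by exists (M + K) => x; exact: le_trans (ler_normD _ _) (lerD (fM x) (gK x)).
Qed.

Lemma bm_opp f : bm f -> bm (fun x => - f x).
Proof.
move=> [mf [M fM]]; split; first exact: measurableT_comp.
by exists M => x; rewrite normrN.
Qed.

Lemma bm_sub f g : bm f -> bm g -> bm (fun x => f x - g x).
Proof. by move=> bf bg; apply: bm_add bf (bm_opp bg). Qed.

Lemma bm_mul f g : bm f -> bm g -> bm (fun x => f x * g x).
Proof.
move=> [mf [M fM]] [mg [K gK]]; split; first exact: measurable_funM.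
exists (M * K) => x; rewrite normrM.
exact: (ler_pM (normr_ge0 _) (normr_ge0 _) (fM x) (gK x)).
Qed.

Lemma bm_abs f : bm f -> bm (fun x => `|f x|).
Proof.
move=> [mf [M fM]]; split; first exact: measurableT_comp.
by exists M => x; rewrite normr_id.
Qed.

Lemma bm_pow (r : R) f : 0 < r -> bm f -> bm (fun x => `|f x| `^ r).
Proof.
move=> r0 [mf [M fM]]; split; first exact: mpow.
exists (M `^ r) => x; rewrite ger0_norm ?powR_ge0//.
exact: powR_le (ltW r0) (normr_ge0 _) (fM x).
Qed.

Lemma bm_sum (F : 'I_N -> V -> R) : (forall i, bm (F i)) -> bm (fun x => \sum_i F i x).
Proof.
move=> bF; elim: (index_enum _) => [|i r IH].
  by under eq_fun do rewrite big_nil; exact: bm_cst.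
by under eq_fun do rewrite big_cons; exact: bm_add (bF i) IH.
Qed.

(** Jensen's inequality: the tangent inequality at the mean [m] is averaged. *)
Lemma avg_pow_le (p : R) l a f : 1 < p -> bm f -> (forall x, 0 <= f x) ->
  avg l a f `^ p <= avg l a (fun x => `|f x| `^ p).
Proof.
move=> p1 bf f0; set m := avg l a f.
have m0 : 0 <= m by exact: avg_ge0.
have bp : bm (fun x => `|f x| `^ p) by apply: bm_pow bf; exact: lt_trans p1.
have b1 : bm (fun x => p * m `^ (p - 1) * f x) by apply: bm_mul bf; exact: bm_cst.
have b2 : bm (fun x => (p - 1) * m `^ p : R) by exact: bm_cst.
have := @avg_le l a _ _ (bm_sub b1 b2) bp.
rewrite (avg_sub l a b1 b2) avg_cst.
have -> : avg l a (fun x => p * m `^ (p - 1) * f x) = p * m `^ p.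
  rewrite /avg (I_scale (measurable_hb l a) _ (bm_hb l a bf)) mulrCA -/(avg l a f) -/m.
  by rewrite -mulrA powR_pred.
move=> h; apply: (le_trans _ (h _)); first by rewrite le_eqVlt; apply/orP; left; apply/eqP; ring.
move=> x _; rewrite lerBlDr -mulrA (ger0_norm (f0 x)).
by apply: young_powR => //; exact: f0.
Qed.

(** The conditional expectation of [f] on the boxes [n] levels below, evaluated at [x]: the descent
    chooses the half that contains [x]. *)
Fixpoint avgs (n l : nat) (a : V) (f : V -> R) (x : V) : R :=
  if n is n'.+1 then
    if x 0 (dir l) < a 0 (dir l) + side l.+1 (dir l) then avgs n' l.+1 a f x
    else avgs n' l.+1 (up l a) f x
  else avg l a f.

(* Running maximum, started at [m], of the averages over the boxes containing [x]. *)
Fixpoint amax (n l : nat) (a : V) (m : R) (f : V -> R) (x : V) : R :=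
  let m' := Num.max m (avg l a f) in
  if n is n'.+1 then
    if x 0 (dir l) < a 0 (dir l) + side l.+1 (dir l) then amax n' l.+1 a m' f x
    else amax n' l.+1 (up l a) m' f x
  else m'.

Lemma amax_ge n l a m f x : m <= amax n l a m f x.
Proof.
elim: n l a m => [|n IH] l a m /=; first by rewrite le_max lexx.
by case: ifP => _; apply: (le_trans _ (IH _ _ _)); rewrite le_max lexx.
Qed.

Lemma amax_ge_avg n l a m f x : avg l a f <= amax n l a m f x.
Proof.
case: n => [|n] /=; first by rewrite le_max lexx orbT.
by case: ifP => _; apply: (le_trans _ (amax_ge _ _ _ _ _ _)); rewrite le_max lexx orbT.
Qed.

Lemma amax_mono n l a m f x : amax n l a m f x <= amax n.+1 l a m f x.
Proof.
elim: n l a m => [|n IH] l a m.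
  by rewrite /=; case: ifP => _; rewrite le_max lexx.
rewrite [in leLHS]/= [leRHS](_ : _ =
  if x 0 (dir l) < a 0 (dir l) + side l.+1 (dir l)
  then amax n.+1 l.+1 a (Num.max m (avg l a f)) f x
  else amax n.+1 l.+1 (up l a) (Num.max m (avg l a f)) f x)//.
by case: ifP => _; exact: IH.
Qed.

Lemma measurable_coord_lt (c : R) (i : 'I_N) : measurable_fun setT (fun x : V => x 0 i < c).
Proof.
by apply: measurable_fun_ltr; [exact: measurable_coord|exact: measurable_cst].
Qed.

Lemma bm_if (c : R) i f g : bm f -> bm g -> bm (fun x => if x 0 i < c then f x else g x).
Proof.
move=> [mf [M fM]] [mg [K gK]]; split.
  by apply: measurable_fun_ifT; [exact: measurable_coord_lt|exact: mf|exact: mg].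
exists (Num.max M K) => x; case: ifP => _; first by rewrite le_max fM.
by rewrite le_max gK orbT.
Qed.

Lemma bm_amax n l a m f : bm (amax n l a m f).
Proof.
elim: n l a m => [|n IH] l a m; first exact: bm_cst.
by rewrite /=; apply: bm_if; exact: IH.
Qed.

Lemma bm_avgs n l a f : bm (avgs n l a f).
Proof.
elim: n l a => [|n IH] l a; first exact: bm_cst.
by rewrite /=; apply: bm_if; exact: IH.
Qed.

Lemma hb_left_lt l a x : hb l.+1 a x -> (x 0 (dir l) < a 0 (dir l) + side l.+1 (dir l)) = true.
Proof. by move=> /hb_left[]. Qed.

Lemma hb_right_lt l a x : hb l.+1 (up l a) x ->
  (x 0 (dir l) < a 0 (dir l) + side l.+1 (dir l)) = false.
Proof. by move=> /hb_right[_]; rewrite leNgt => /negbTE. Qed.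

(* Doob's maximal inequality; [U f F m] is a Bellman function, linear in [f], [F]. *)
Lemma doob (p : R) : 1 < p -> exists2 C : R, 0 <= C &
  forall n l a f, bm f -> (forall x, 0 <= f x) ->
    avg l a (fun x => `|amax n l a 0 f x| `^ p) <= C * avg l a (fun x => `|f x| `^ p).
Proof.
move=> p1; have p0 : 0 < p by exact: lt_trans p1.
have p10 : 0 < p - 1 by rewrite subr_gt0.
(* The value with c (p - 1) = 2 p: replacing m by a larger f then decreases [U], which is exactly
   the tangent inequality [young_powR]. *)
pose c := 2 * p / (p - 1); have c0 : 0 < c by rewrite divr_gt0// mulr_gt0.
pose U (f F m : R) := 2 * m `^ p - c * (m `^ (p - 1) * f) + c `^ p * F.
(* The product c m^(p-1) f is at most m^p if c f <= m, and at most (c f)^p otherwise. *)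
have Ule f F m : 0 <= f -> 0 <= m -> f `^ p <= F -> m `^ p <= U f F m.
  move=> f0 m0 fF; rewrite /U.
  have h : c * (m `^ (p - 1) * f) <= m `^ p + c `^ p * f `^ p.
    rewrite mulrCA -powRM//; last exact: ltW.
    have cf0 : 0 <= c * f by rewrite mulr_ge0// ltW.
    have [cf|/ltW cf] := leP (c * f) m.
      apply: le_trans (_ : m `^ p <= _); last by rewrite lerDl powR_ge0.
      by rewrite -[leRHS](powR_pred p1 m0) ler_wpM2l ?powR_ge0.
    apply: le_trans (_ : (c * f) `^ p <= _); last by rewrite lerDr powR_ge0.
    rewrite -[leRHS](powR_pred p1 cf0) ler_wpM2r//.
    by apply: powR_le => //; exact: ltW.
  have h2 : c `^ p * f `^ p <= c `^ p * F by rewrite ler_wpM2l ?powR_ge0.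
  by lra.
have Umax f F m : 0 <= f -> 0 <= m -> U f F (Num.max m f) <= U f F m.
  move=> f0 m0; have [fm|mf] := leP f m; first exact: lexx.
  rewrite /U lerD2r powR_pred//.
  have h := young_powR p1 f0 m0.
  rewrite -(ler_pM2l p10) !mulrBr !(mulrA (p - 1) c) /c.
  rewrite (mulrC (p - 1) (2 * p / _)) divfK ?gt_eqF//.
  by rewrite -!mulrA; lra.
(* [U f F 0] is c^p F, whence the constant. *)
exists (c `^ p); first exact: powR_ge0.
suff H n l a m f : bm f -> (forall x, 0 <= f x) -> 0 <= m ->
    avg l a (fun x => `|amax n l a m f x| `^ p) <=
    U (avg l a f) (avg l a (fun x => `|f x| `^ p)) m.
  move=> n l a f bf f0; apply: (le_trans (H n l a 0 f bf f0 (lexx 0))).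
  by rewrite /U !powR0 ?gt_eqF// mul0r !mulr0 subrr add0r.
move=> bf f0; elim: n l a m => [|n IH] l a m m0.
  have a0 := avg_ge0 l a f0.
  rewrite /= avg_cst ger0_norm ?le_max ?m0//.
  apply: (le_trans _ (Umax _ _ _ a0 m0)); apply: Ule => //; first by rewrite le_max m0.
  exact: avg_pow_le.
have a0 := avg_ge0 l a f0.
apply: (le_trans _ (Umax _ _ _ a0 m0)).
have M0 : 0 <= Num.max m (avg l a f) by rewrite le_max m0.
have bp : bm (fun x => `|f x| `^ p) by exact: bm_pow.
rewrite (avg_split l a (bm_pow p0 (bm_amax n.+1 l a m f))).
rewrite [X in U X](avg_split l a bf) (avg_split l a bp).
rewrite (@avg_eq l.+1 a _ (fun x => `|amax n l.+1 a (Num.max m (avg l a f)) f x| `^ p)); last first.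
  by move=> x hx; rewrite /= hb_left_lt.
rewrite (@avg_eq l.+1 (up l a) _
  (fun x => `|amax n l.+1 (up l a) (Num.max m (avg l a f)) f x| `^ p)); last first.
  by move=> x hx; rewrite /= hb_right_lt.
have h1 := IH l.+1 a _ M0; have h2 := IH l.+1 (up l a) _ M0.
have -> (f1 f2 F1 F2 m' : R) : U (2^-1 * (f1 + f2)) (2^-1 * (F1 + F2)) m' =
    2^-1 * (U f1 F1 m' + U f2 F2 m') by rewrite /U; field.
by apply: ler_wpM2l; [rewrite invr_ge0|exact: lerD h1 h2].
Qed.

End dyadic_boxes.


(** * Increments of the averages and the gradient *)

Section dyadic_gradient.
Variables (R : realType) (N : nat).
Local Notation V := 'rV[R]_N.
Local Notation mu := (lebm R N).
Local Notation pd i u := ('D_(evec R i) u).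
Variables (hN : (0 < N)%N) (s0 : R) (Om : set V).
Hypothesis s0p : 0 < s0.
Implicit Types (phi f : V -> R) (a : V).

Lemma I_subset (D E : set V) f : measurable D -> measurable E -> D `<=` E ->
  mu.-integrable E (EFin \o f) -> (forall x, 0 <= f x) ->
  \int[mu]_(x in D) f x <= \int[mu]_(x in E) f x.
Proof.
move=> mD mE DE fi f0; rewrite -lee_fin.
have fiD : mu.-integrable D (EFin \o f) by exact: integrableS fi.
rewrite -(intg_fin mD fiD) -(intg_fin mE fi).
apply: ge0_subset_integral; [exact: mD|exact: mE|exact: measurable_int fi| |exact: DE].
by move=> x _; rewrite lee_fin.
Qed.

Lemma test_quotient_cvg phi i x (t : nat -> R) : test_function Om phi ->
  (forall n, 0 < t n) -> t n @[n --> \oo] --> 0 ->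
  (t n)^-1 * (phi (x + t n *: evec R i) - phi x) @[n --> \oo] --> pd i phi x.
Proof.
move=> tphi t0 tc0.
have d := line_pd i x 0 tphi; rewrite scale0r add0r in d.
move/is_derive_cvgP : d => d.
have tc : t n @[n --> \oo] --> (0 : R)^'.
  move=> A hA; have hA' : nbhs (0 : R) (fun y => y != 0 -> A y) by exact: hA.
  by have [n0 _ hn0] := tc0 _ hA'; exists n0 => // n /hn0; apply; exact: lt0r_neq0.
have := cvg_comp _ _ tc d; apply: cvg_trans; apply: near_eq_cvg.
apply: nearW => n; rewrite /= scale0r add0r addr0 [t n *: 1]mulr1.
by rewrite (addrC x).
Qed.

Lemma bm_test phi : test_function Om phi -> bm phi.
Proof.
move=> tphi; split; first exact: test_meas measurableT tphi.
by have [M _ MP] := test_bounded tphi; exists M.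
Qed.

Lemma bm_shift v phi : test_function Om phi -> bm (fun x => phi (x + v)).
Proof.
move=> tphi; split.
  by apply: (measurableT_comp (test_meas measurableT tphi)); exact: measurable_shiftf.
by have [M _ MP] := test_bounded tphi; exists M.
Qed.

Let hbE l a : measurable (hb s0 l a). Proof. exact: measurable_hb. Qed.

(** A translation by n t is cut into n translations by t. As long as n t is at most the side of the
    half box, each translate of it stays in the whole box. This replaces an integration along
    lines. *)
Lemma I_translate l a phi i (n : nat) (t : R) : test_function Om phi -> i = dir hN l ->
  0 <= t -> n%:R * t <= side s0 l.+1 i ->
  \int[mu]_(x in hb s0 l.+1 a) `|phi (x + (n%:R * t) *: evec R i) - phi x| <=
  n%:R * \int[mu]_(x in hb s0 l a) `|phi (x + t *: evec R i) - phi x|.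
Proof.
move=> tphi iE t0; have bphi := bm_test tphi.
have bd v : bm (fun x => `|phi (x + v) - phi x|).
  by apply: bm_abs; apply: bm_sub; [exact: bm_shift|exact: bphi].
elim: n => [|n IH] nt.
  rewrite mul0r [leRHS]mul0r (@I_eq _ _ _ mu (hb s0 l.+1 a) _ (fun=> 0)) ?I_0// => x _.
  by rewrite scale0r addr0 subrr normr0.
have nt' : n%:R * t <= side s0 l.+1 i.
  by apply: le_trans nt; rewrite ler_wpM2r// ler_nat.
pose v := (n%:R * t) *: evec R i; pose h x := `|phi (x + t *: evec R i) - phi x|.
pose D : set V := (fun x => x - v) @^-1` hb s0 l.+1 a.
have mD : measurable D by exact: measurable_shift.
have muD : (mu D < +oo)%E by rewrite lebm_shift; exact: (hb_fin hN s0p).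
have hi : mu.-integrable D (EFin \o h) by exact: bm_intg mD muD (bd _).
have preD : (fun x => x + v) @^-1` D = hb s0 l.+1 a.
  by apply/seteqP; split=> x; rewrite /D /= addrK.
have hi' := intg_shift v mD hi; have hI := I_shift v mD hi; rewrite preD in hi' hI.
have DE : D `<=` hb s0 l a.
  move=> x Dx j; have := Dx j; rewrite !mxE eqxx /=.
  have [->|nj] := eqVneq j (dir hN l); last first.
    by rewrite iE (negbTE nj) mulr0 subr0 (side_succ hN) (negbTE nj).
  rewrite -iE eqxx mulr1 (side_half s0 iE) => /andP[h1 h2].
  have nt0 : 0 <= n%:R * t by rewrite mulr_ge0.
  by apply/andP; split; lra.
have h0 x : 0 <= h x by exact: normr_ge0.
have step : \int[mu]_(x in hb s0 l.+1 a) h (x + v) <= \int[mu]_(x in hb s0 l a) h x.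
  by rewrite hI; exact: (I_subset mD (hbE l a) DE (bm_hb hN s0p l a (bd _)) h0).
have i1 := bm_hb hN s0p l.+1 a (bd v).
have mh := hbE l.+1 a.
apply: (@le_trans _ _ (\int[mu]_(x in hb s0 l.+1 a) (h (x + v) + `|phi (x + v) - phi x|))).
  apply: (I_le mh (bm_hb hN s0p l.+1 a (bd _)) (intg_add mh hi' i1)) => x _.
  rewrite /h (_ : x + _ = x + v + t *: evec R i); last first.
    by rewrite /v -addrA -scalerDl -natr1 mulrDl mul1r.
  rewrite -[X in `|X|](subrKA (phi (x + v))); exact: ler_normD.
rewrite (I_add mh hi' i1) -natr1 mulrDl mul1r addrC.
exact: lerD (IH nt') step.
Qed.

(** Steps of length s/(n+1) in [I_translate], with n tending to infinity. *)
Lemma I_translate_le l a phi i : test_function Om phi -> i = dir hN l ->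
  \int[mu]_(x in hb s0 l.+1 a) `|phi (x + side s0 l.+1 i *: evec R i) - phi x| <=
  side s0 l.+1 i * \int[mu]_(x in hb s0 l a) `|pd i phi x|.
Proof.
move=> tphi iE; set s := side s0 l.+1 i; have s_gt0 : 0 < s by exact: side_gt0.
pose t n : R := s * n.+1%:R^-1.
have t0 n : 0 < t n by rewrite mulr_gt0// invr_gt0.
have tc : t n @[n --> \oo] --> 0.
  by rewrite -(mulr0 s); apply: cvgM; [exact: cvg_cst|exact: cvg_harmonic].
pose q n x := `|(t n)^-1 * (phi (x + t n *: evec R i) - phi x)|.
have [M M0 MP] := test_bounded (test_pd i tphi).
have bphi := bm_test tphi; have bpd := bm_test (test_pd i tphi).
have mh := hbE l a.
have bd v : bm (fun x => `|phi (x + v) - phi x|).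
  by apply: bm_abs; apply: bm_sub; [exact: bm_shift|exact: bphi].
have bq n : bm (q n).
  apply: bm_abs; apply: bm_mul; first exact: bm_cst.
  by apply: bm_sub; [exact: bm_shift|exact: bphi].
have [|||||_ _ H] := @I_dct _ _ _ mu _ mh q (fun x => `|pd i phi x|) (fun=> M).
- by move=> n; exact: measurable_funTS (bq n).1.
- exact: measurable_funTS (bm_abs bpd).1.
- by apply: intg_cst; [exact: mh|exact: (hb_fin hN s0p)].
- apply: nearW => x _; apply: cvg_norm; exact: test_quotient_cvg.
- move=> n; apply: nearW => x _; rewrite /q normr_id normrM gtr0_norm ?invr_gt0// mulrC.
  rewrite ler_pdivrMr// (mulrC M) -[X in X * M](gtr0_norm (t0 n)) (addrC x).
  exact: test_line_lip tphi MP.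
have Hs : s * (\int[mu]_(x in hb s0 l a) q n x) @[n --> \oo] -->
    s * (\int[mu]_(x in hb s0 l a) `|pd i phi x|).
  by apply: cvgM; [exact: cvg_cst|exact: H].
rewrite -(cvg_lim (@Rhausdorff R) Hs); apply: limr_ge; first exact: cvgP Hs.
apply: nearW => n.
have nt : n.+1%:R * t n = s by rewrite /t mulrCA mulfV ?mulr1.
have := @I_translate l a phi i n.+1 (t n) tphi iE (ltW (t0 n)).
rewrite nt => /(_ (lexx _)) h; apply: (le_trans h).
rewrite le_eqVlt; apply/orP; left; apply/eqP.
have bt := bm_hb hN s0p l a (bd (t n *: evec R i)).
have e : \int[mu]_(x in hb s0 l a) q n x =
    (t n)^-1 * \int[mu]_(x in hb s0 l a) `|phi (x + t n *: evec R i) - phi x|.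
  rewrite -(I_scale mh _ bt); apply: I_eq => x _.
  by rewrite /q normrM gtr0_norm ?invr_gt0.
by rewrite e -[X in _ = X * _]nt mulrA mulfK// gt_eqF.
Qed.

Definition Gr phi : V -> R := fun x => \sum_i `|pd i phi x|.

Lemma Gr_ge0 phi x : 0 <= Gr phi x.
Proof. by apply: sumr_ge0 => i _; exact: normr_ge0. Qed.

Lemma bm_Gr phi : test_function Om phi -> bm (Gr phi).
Proof. by move=> tphi; apply: bm_sum => i; apply: bm_abs; exact: bm_test (test_pd i tphi). Qed.

(** The upper half is the translate of the lower one by its own side; the factor 2 is the ratio of
    the volumes of a box and of its half. *)
Lemma avg_translate l a phi : test_function Om phi ->
  `|avg s0 l.+1 (up hN s0 l a) phi - avg s0 l.+1 a phi| <=
  2 * side s0 l.+1 (dir hN l) * avg s0 l a (Gr phi).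
Proof.
move=> tphi; set i := dir hN l; set s := side s0 l.+1 i.
have bphi := bm_test tphi; have mh := hbE l.+1 a.
have preU : (fun x => x + s *: evec R i) @^-1` hb s0 l.+1 (up hN s0 l a) = hb s0 l.+1 a.
  apply/seteqP; split=> x h j; have := h j; rewrite upE !mxE eqxx /= -/i.
    by case: eqVneq => [->|_]; rewrite ?mulr0 ?addr0// mulr1 -/s => /andP[]; lra.
  by case: eqVneq => [->|_]; rewrite ?mulr0 ?addr0// mulr1 -/s => /andP[]; lra.
have mU := hbE l.+1 (up hN s0 l a).
have bU := bm_hb hN s0p l.+1 (up hN s0 l a) bphi.
have hI := I_shift (s *: evec R i) mU bU; rewrite preU in hI.
have bs := bm_hb hN s0p l.+1 a (bm_shift (s *: evec R i) tphi).
have b1 := bm_hb hN s0p l.+1 a bphi.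
rewrite /avg -mulrBr -hI -(I_sub mh bs b1) normrM gtr0_norm ?invr_gt0 ?vol_gt0//.
have v0 := vol_gt0 N s0p l.+1.
rewrite (vol_succ N s0 l); move: (vol N s0 l.+1) v0 => v v0.
set J := \int[mu]_(x in hb s0 l a) _.
have -> : 2 * s * ((2 * v)^-1 * J) = v^-1 * (s * J).
  by field; rewrite gt_eqF.
apply: ler_wpM2l; first by rewrite invr_ge0 ltW.
apply: (le_trans (I_abs mh (intg_sub mh bs b1))).
have hh : \int[mu]_(x in hb s0 l.+1 a) `|phi (x + s *: evec R i) - phi x| <=
    s * \int[mu]_(x in hb s0 l a) `|pd i phi x| by exact: I_translate_le.
apply: (le_trans hh).
apply: ler_wpM2l; first by rewrite ltW// side_gt0.
have bp : bm (fun x => `|pd i phi x|) by apply: bm_abs; exact: bm_test (test_pd i tphi).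
apply: (I_le (hbE l a) (bm_hb hN s0p l a bp) (bm_hb hN s0p l a (bm_Gr tphi))).
by move=> x _; rewrite /Gr (bigD1 i)//= lerDl sumr_ge0.
Qed.

(** The average over a half differs from that over the box by half of the difference between the two
    halves, and the average of [Gr phi] over a box on the way is at most the running maximum. *)
Lemma avgs_succ n l a phi m x : test_function Om phi ->
  `|avgs hN s0 n.+1 l a phi x - avgs hN s0 n l a phi x| <=
  s0 / 2 ^+ ((l + n) %/ N) * amax hN s0 n l a m (Gr phi) x.
Proof.
move=> tphi; elim: n l a m => [|n IH] l a m.
  have h := avg_translate l a tphi; rewrite addn0 -(side_dirE hN).
  have {h} h : 2^-1 * `|avg s0 l.+1 (up hN s0 l a) phi - avg s0 l.+1 a phi| <=
      side s0 l (dir hN l) * amax hN s0 0 l a m (Gr phi) x.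
    rewrite mulrC ler_pdivrMr//; apply: (le_trans h).
    have e := side_half s0 (erefl (dir hN l)).
    have s1 := side_gt0 s0p l.+1 (dir hN l).
    have A0 : 0 <= avg s0 l a (Gr phi) by apply: (avg_ge0 s0p) => y; exact: Gr_ge0.
    have hm := amax_ge_avg hN s0 0 l a m (Gr phi) x.
    have := ler_wpM2l (ltW s1) hm; have := mulr_ge0 (ltW s1) A0.
    rewrite e; move: (side s0 _ _) (avg s0 l a _) (amax hN _ _ _ _ _ _ _) => S A B.
    by move=> h1 h2; rewrite -!mulrA !mulrDl; lra.
  apply: (le_trans _ h); rewrite /= (avg_split hN s0p l a (bm_test tphi)).
  rewrite -[X in X * `|_|](@ger0_norm _ 2^-1) ?invr_ge0// -normrM.
  case: ifP => _; rewrite le_eqVlt; apply/orP; left; apply/eqP.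
    by rewrite -normrN; congr `|_|; field.
  by congr `|_|; field.
have E k : avgs hN s0 k.+1 l a phi x =
    if x 0 (dir hN l) < a 0 (dir hN l) + side s0 l.+1 (dir hN l)
    then avgs hN s0 k l.+1 a phi x else avgs hN s0 k l.+1 (up hN s0 l a) phi x by [].
rewrite !E -addSnnS [amax _ _ _ _ _ _ _ _]/=.
by case: ifP => _; exact: IH.
Qed.

End dyadic_gradient.


(** * Embeddings *)

Lemma powRX (R : realType) (x r : R) n : 0 <= x -> (x ^+ n) `^ r = (x `^ r) ^+ n.
Proof.
move=> x0; elim: n => [|n IH]; first by rewrite !expr0 powR1.
by rewrite !exprS powRM ?exprn_ge0// IH.
Qed.

Lemma powR_add_le (R : realType) (q x y : R) : 0 <= q -> 0 <= x -> 0 <= y ->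
  (x + y) `^ q <= 2 `^ q * (x `^ q + y `^ q).
Proof.
move=> q0 x0 y0; have b z : x <= z -> y <= z -> (x + y) `^ q <= 2 `^ q * z `^ q.
  move=> xz yz; rewrite -powRM//; last exact: le_trans xz.
  by apply: powR_le => //; [rewrite addr_ge0|lra].
rewrite mulrDr; have [xy|/ltW xy] := leP x y.
  by apply: (le_trans (b y xy (lexx _))); rewrite lerDr mulr_ge0 ?powR_ge0.
by apply: (le_trans (b x (lexx _) xy)); rewrite lerDl mulr_ge0 ?powR_ge0.
Qed.

Section dyadic_estimates.
Variables (R : realType) (N : nat).
Local Notation V := 'rV[R]_N.
Local Notation mu := (lebm R N).
Local Notation pd i u := ('D_(evec R i) u).
Variables (hN : (0 < N)%N) (s0 : R) (Om : set V) (a : V).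
Hypothesis s0p : 0 < s0.
Implicit Types (phi f : V -> R).
Local Notation Q := (hb s0 0 a).
Local Notation av n phi := (avgs hN s0 n 0 a phi).
Local Notation am n f := (amax hN s0 n 0 a 0 f).

(** Coordinates are changed one at a time: [z k] agrees with [x] on the first k of them and with [y]
    on the others. *)
Lemma test_lip phi (M : R) (x y : V) : test_function Om phi ->
  (forall i z, `|pd i phi z| <= M) -> `|phi x - phi y| <= M * \sum_i `|x 0 i - y 0 i|.
Proof.
move=> tphi MP; pose z k : V := \row_i (if (i < k)%N then x 0 i else y 0 i).
pose T k (i : 'I_N) : R := if (i < k)%N then `|x 0 i - y 0 i| else 0.
suff H k : `|phi (z k) - phi y| <= M * \sum_i T k i.
  have zx : z N = x by apply/rowP => i; rewrite mxE ltn_ord.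
  have := H N; rewrite zx => h; apply: (le_trans h); rewrite le_eqVlt; apply/orP; left.
  by apply/eqP; congr (_ * _); apply: eq_bigr => i _; rewrite /T ltn_ord.
elim: k => [|k IH].
  have -> : z 0%N = y by apply/rowP => i; rewrite mxE ltn0.
  by rewrite subrr normr0 big1 ?mulr0// => i _; rewrite /T ltn0.
have [kN|kN] := ltnP k N; last first.
  have ik (i : 'I_N) : ((i < k.+1) = (i < k))%N.
    by rewrite (leq_trans (ltn_ord i) kN) (leq_trans (ltn_ord i) (leqW kN)).
  have -> : z k.+1 = z k by apply/rowP => i; rewrite !mxE ik.
  rewrite (_ : \sum_i T k.+1 i = \sum_i T k i); first exact: IH.
  by apply: eq_bigr => i _; rewrite /T ik.
pose j := Ordinal kN.
have zE : z k.+1 = (x 0 j - y 0 j) *: evec R j + z k.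
  apply/rowP => i; rewrite !mxE eqxx /= ltnS leq_eqVlt.
  have [->|ij] := eqVneq i j; first by rewrite /= eqxx ltnn mulr1 subrK.
  by rewrite mulr0 add0r (_ : (i == k :> nat) = false) //; apply/negbTE.
have -> : \sum_i T k.+1 i = `|x 0 j - y 0 j| + \sum_i T k i.
  rewrite (bigD1 j)//= [in RHS](bigD1 j)//= {1 3}/T /= ltnS leqnn ltnn add0r.
  congr (_ + _); apply: eq_bigr => i ij; rewrite /T ltnS leq_eqVlt.
  by rewrite (_ : (i == k :> nat) = false) //; apply/negbTE.
have h := test_line_lip (z k) (x 0 j - y 0 j) tphi (MP j).
rewrite -zE in h; rewrite mulrDr -(subrKA (phi (z k))).
by apply: (le_trans (ler_normD _ _)); rewrite (mulrC M `|_|); exact: lerD.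
Qed.

Lemma avgs_near n l (b : V) phi (M : R) x : test_function Om phi ->
  (forall i z, `|pd i phi z| <= M) -> hb s0 l b x ->
  `|avgs hN s0 n l b phi x - phi x| <= M * \sum_(i < N) side s0 (l + n) i.
Proof.
move=> tphi MP; have bphi := bm_test tphi.
have M0 : 0 <= M by apply: le_trans (MP (dir hN 0) 0).
elim: n l b => [|n IH] l b hx; last first.
  rewrite /= -addSnnS; case: ifP => h; apply: IH; first by apply/hb_left.
  by apply/hb_right; [exact: s0p|split; [exact: hx|rewrite leNgt h]].
rewrite addn0 /= -{1}(avg_cst hN s0p l b (phi x)).
have bc : bm (fun _ : V => phi x) by exact: bm_cst.
rewrite -(avg_sub hN s0p l b bphi bc).
apply: (le_trans (avg_abs hN s0p l b (bm_sub bphi bc))).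
rewrite -[leRHS](avg_cst hN s0p l b).
apply: (avg_le hN s0p); [by apply: bm_abs; exact: bm_sub|exact: bm_cst|].
move=> y hy; apply: (le_trans (test_lip y x tphi MP)); apply: ler_wpM2l => //.
apply: ler_sum => i _; rewrite ler_norml; have := hx i; have := hy i.
by move=> /andP[h1 h2] /andP[h3 h4]; apply/andP; split; lra.
Qed.

Section rate.
Variable d : R.
Hypothesis dN : N%:R <= d.

Let d0 : 0 < d. Proof. by apply: lt_le_trans dN; rewrite ltr0n. Qed.

(** Decay of the sides per level, as if the dimension were [d]. A value of [d] above N is what
    handles the case p = N. *)
Definition rate : R := 2 `^ (- d^-1).

Lemma rate_gt0 : 0 < rate. Proof. by rewrite powR_gt0. Qed.

Lemma rate_lt1 : rate < 1.
Proof.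
rewrite /rate powRN invf_lt1 ?powR_gt0// ltNge; apply/negP => h.
have := powR_le (ltW d0) (powR_ge0 _ _) h.
by rewrite -powRrM mulVf ?gt_eqF// powRr1// powR1; lra.
Qed.

(** After k levels each side has been halved more than k/N - 1 times; the defect of one costs the
    factor 2. *)
Lemma half_pow_le k : (2 ^+ (k %/ N))^-1 <= 2 * rate ^+ k :> R.
Proof.
rewrite -(@powR_mulrn _ 2 (k %/ N))// -powRN /rate -(@powR_mulrn _ _ k) ?powR_ge0// -powRrM.
rewrite -[X in X * _](powRr1 (ler0n R 2)) -powRD; last by rewrite pnatr_eq0 implybT.
apply: ler_powR; first by rewrite ler1n.
have h : (k%:R : R) <= d * ((k %/ N).+1%:R).
  apply: le_trans (_ : (N * (k %/ N).+1)%:R <= _).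
    by rewrite ler_nat mulnC ltnW// ltn_ceil.
  by rewrite natrM ler_wpM2r.
have : d^-1 * k%:R <= (k %/ N).+1%:R by rewrite mulrC ler_pdivrMr// mulrC.
by rewrite -natr1; lra.
Qed.

Lemma side_le k (i : 'I_N) : side s0 k i <= 2 * s0 * rate ^+ k.
Proof.
rewrite -mulrA mulrCA; apply: ler_wpM2l; first exact: ltW.
apply: le_trans (half_pow_le k); rewrite lef_pV2 ?posrE ?exprn_gt0//.
by rewrite ler_eXn2l ?ltr1n// leq_addr.
Qed.

Lemma avgs_cvg_rate phi : test_function Om phi -> exists2 M : R, 0 <= M &
  forall n x, Q x -> `|av n phi x - phi x| <= M * rate ^+ n.
Proof.
move=> tphi.
have /choice[F FP] : forall i : 'I_N, exists B : R, 0 <= B /\ forall x, `|pd i phi x| <= B.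
  by move=> i; have [B B0 BP] := test_bounded (test_pd i tphi); exists B.
pose B := \sum_i F i; have FB i : F i <= B.
  by rewrite /B (bigD1 i)//= lerDl sumr_ge0// => j _; exact: (FP j).1.
have B0 : 0 <= B by apply: sumr_ge0 => i _; exact: (FP i).1.
exists (B * (N%:R * (2 * s0))); first by rewrite !mulr_ge0// ltW.
move=> n x Qx; have := @avgs_near n 0 a phi B x tphi _ Qx.
move=> /(_ (fun i z => le_trans ((FP i).2 z) (FB i))) h; apply: (le_trans h).
rewrite -mulrA; apply: ler_wpM2l => //.
apply: (@le_trans _ _ (\sum_(i < N) (2 * s0 * rate ^+ n))).
  by apply: ler_sum => i _; exact: side_le.
by rewrite sumr_const card_ord -[leLHS]mulr_natl mulrA.
Qed.

Lemma av_tail n m phi x : test_function Om phi -> (n <= m)%N ->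
  `|av m phi x - av n phi x| <= 2 * s0 / (1 - rate) * rate ^+ n * am m (Gr phi) x.
Proof.
move=> tphi /subnK <-; move: (m - n)%N => {m} k; rewrite addnC.
have r1 : 0 < 1 - rate by rewrite subr_gt0 rate_lt1.
have r0 := rate_gt0.
(* The difference rate^n - rate^(n + k) is the exact partial geometric sum, which lets the induction
   close. *)
suff h : `|av (n + k) phi x - av n phi x| <=
    2 * s0 / (1 - rate) * (rate ^+ n - rate ^+ (n + k)) * am (n + k) (Gr phi) x.
  apply: (le_trans h); apply: ler_wpM2r; first exact: amax_ge.
  apply: ler_wpM2l; first by rewrite divr_ge0// ?mulr_ge0 ?ltW.
  by rewrite gerBl exprn_ge0// ltW.
elim: k => [|k IH]; first by rewrite addn0 !subrr mulr0 mul0r normr0.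
rewrite -(subrKA (av (n + k) phi x)) addnS.
apply: (le_trans (ler_normD _ _)).
have am0 := amax_ge hN s0 (n + k) 0 a 0 (Gr phi) x.
have amm := amax_mono hN s0 (n + k) 0 a 0 (Gr phi) x.
have h1 := avgs_succ hN s0p (n + k) 0 a 0 x tphi; rewrite add0n in h1.
have c0 : 0 <= 2 * s0 / (1 - rate) * (rate ^+ n - rate ^+ (n + k)).
  apply: mulr_ge0; first by rewrite divr_ge0// ?mulr_ge0 ?ltW.
  rewrite subr_ge0 exprD ler_piMr ?exprn_ge0 ?(ltW r0)//.
  by rewrite exprn_ile1 ?(ltW r0)// ltW// rate_lt1.
have h2 : `|av (n + k).+1 phi x - av (n + k) phi x| <=
    2 * s0 * rate ^+ (n + k) * am (n + k).+1 (Gr phi) x.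
  apply: (le_trans h1); apply: ler_pM => //.
    by rewrite mulr_ge0 ?invr_ge0 ?exprn_ge0// ltW.
  rewrite -mulrA mulrCA; apply: ler_wpM2l; [exact: ltW|exact: half_pow_le].
apply: (le_trans (lerD h2 (le_trans IH (ler_wpM2l c0 amm)))).
rewrite -mulrDl le_eqVlt; apply/orP; left; apply/eqP; congr (_ * _).
by rewrite exprS; field; rewrite gt_eqF.
Qed.

Section norms.
Variable p : R.
Hypothesis p1 : 1 < p.
Let p0 : 0 < p. Proof. exact: lt_trans p1. Qed.
Let p1' : 1 <= p. Proof. exact: ltW. Qed.
Let mQ : measurable Q. Proof. exact: measurable_hb. Qed.
Let fQ : (mu Q < +oo)%E. Proof. exact: (hb_fin hN s0p). Qed.
Local Notation nQ f := (nrm mu Q p f).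
Local Notation dQ f g := (dist mu Q p f g).

Lemma bm_Lp f : bm f -> Lp mu Q p f.
Proof.
move=> [mf [M fM]]; apply: (Lp_bounded mQ p1' fQ (measurable_funTS mf)) => x _.
exact: fM.
Qed.

Lemma nrm_amax : exists2 C : R, 0 <= C & forall n phi, test_function Om phi ->
  nQ (am n (Gr phi)) <= C * nQ (Gr phi).
Proof.
have [C C0 CP] := doob hN s0p p1; exists (C `^ p^-1); first exact: powR_ge0.
move=> n phi tphi; have bG := bm_Gr tphi.
apply: nrm_le => //; first by rewrite mulr_ge0 ?powR_ge0.
rewrite powRM ?powR_ge0// powRVK ?gt_eqF// nrm_powR//.
have := CP n 0 a (Gr phi) bG (Gr_ge0 phi).
by rewrite /avg mulrCA ler_pM2l// invr_gt0 vol_gt0.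
Qed.

(** In [av_tail] let m tend to infinity: the averages tend uniformly to [phi] on the box, and Doob's
    inequality bounds the running maxima independently of m. *)
Lemma av_tail_nrm : exists2 C : R, 0 <= C & forall n phi, test_function Om phi ->
  dQ phi (av n phi) <= C * rate ^+ n * nQ (Gr phi).
Proof.
have [C C0 CP] := nrm_amax.
have r1 : 0 < 1 - rate by rewrite subr_gt0 rate_lt1.
pose K := 2 * s0 / (1 - rate); have K0 : 0 <= K by rewrite divr_ge0// ?mulr_ge0 ?ltW.
exists (K * C); first by rewrite mulr_ge0.
move=> n phi tphi; have [M M0 MP] := avgs_cvg_rate tphi.
have Lphi := bm_Lp (bm_test tphi); have Lav m := bm_Lp (bm_avgs hN s0 m 0 a phi).
have Lam m := bm_Lp (bm_amax hN s0 m 0 a 0 (Gr phi)).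
have L0 : Lp mu Q p (fun=> 0) by apply: bm_Lp; exact: bm_cst.
have r0 := rate_gt0.
have H m : (n <= m)%N -> dQ phi (av n phi) <=
    M * rate ^+ m * nQ (fun=> 1) + K * rate ^+ n * (C * nQ (Gr phi)).
  move=> nm; apply: (le_trans (dist_tri mQ p1' Lphi (Lav m) (Lav n))).
  apply: lerD.
    apply: (dist_le_bounded mQ p1' fQ) => //.
    - by rewrite mulr_ge0// exprn_ge0// ltW.
    - exact: Lphi.1.
    - exact: (Lav m).1.
    - by move=> x Qx; rewrite distrC; exact: MP.
  apply: (@le_trans _ _ (K * rate ^+ n * nQ (am m (Gr phi)))); last first.
    apply: ler_wpM2l; first by rewrite mulr_ge0// exprn_ge0// ltW.
    exact: CP.
  have c0 : 0 <= K * rate ^+ n by rewrite mulr_ge0// exprn_ge0// ltW.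
  rewrite -[X in X * _](ger0_norm c0) -(nrm_scale mQ _ (lt0r_neq0 p0) (Lam m)).
  apply: (@le_trans _ _ (dQ (fun x => K * rate ^+ n * am m (Gr phi) x) (fun=> 0))).
    apply: (dist_mono mQ p1' (Lav m) (Lav n) (Lp_scale mQ _ (Lam m)) L0) => x _.
    rewrite subr0; apply: (le_trans (av_tail x tphi nm)); exact: ler_norm.
  by apply: le_trans (dist_le_nrm mQ p1' (Lp_scale mQ _ (Lam m)) L0) _; rewrite nrm0 ?addr0 ?gt_eqF.
have lim : M * rate ^+ m * nQ (fun=> 1) + K * rate ^+ n * (C * nQ (Gr phi)) @[m --> \oo]
    --> M * 0 * nQ (fun=> 1) + K * rate ^+ n * (C * nQ (Gr phi)).
  apply: cvgD; last exact: cvg_cst.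
  apply: cvgM; last exact: cvg_cst.
  apply: cvgM; first exact: cvg_cst.
  by apply: cvg_expr; rewrite ger0_norm ?(ltW r0)// rate_lt1.
rewrite mulr0 mul0r add0r in lim.
have -> : K * C * rate ^+ n * nQ (Gr phi) = K * rate ^+ n * (C * nQ (Gr phi)) by ring.
rewrite -(cvg_lim (@Rhausdorff R) lim); apply: limr_ge; first exact: cvgP lim.
by exists n => // m /= nm; exact: H.
Qed.

Lemma nrm_Gr_le phi : test_function Om phi -> nQ (Gr phi) <= \sum_i nQ (pd i phi).
Proof.
move=> tphi; rewrite /Gr; elim: (index_enum _) => [|i r IH].
  by under eq_fun do rewrite big_nil; rewrite big_nil nrm0 ?gt_eqF.
under eq_fun do rewrite big_cons; rewrite big_cons.
have Lp' : Lp mu Q p (pd i phi) by apply: bm_Lp; exact: bm_test (test_pd i tphi).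
have La : Lp mu Q p (fun x => `|pd i phi x|).
  by apply: bm_Lp; apply: bm_abs; exact: bm_test (test_pd i tphi).
have Ls : Lp mu Q p (fun x => \sum_(j <- r) `|pd j phi x|).
  apply: bm_Lp; elim: (r) => [|j r' IHr].
    by under eq_fun do rewrite big_nil; exact: bm_cst.
  under eq_fun do rewrite big_cons; apply: bm_add IHr.
  by apply: bm_abs; exact: bm_test (test_pd j tphi).
apply: (le_trans (nrm_add mQ p1' La Ls)); apply: lerD; last exact: IH.
by apply: (Lp_le mQ (ltW p0) La.1 _ Lp').2 => x _; rewrite normr_id.
Qed.

(** [av_tail_nrm] at level 0 is Poincaré's inequality for the test functions; in the limit the
    distance from [u] to its average is 0. *)
Lemma poincare_cvg (phi : nat -> V -> R) u : (forall n, test_function Om (phi n)) ->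
  Lp mu Q p u -> dQ (phi n) u @[n --> \oo] --> 0 ->
  (forall i, nQ (pd i (phi n)) @[n --> \oo] --> 0) ->
  exists c : R, {ae mu, forall x, Q x -> u x = c}.
Proof.
move=> tphi Lu cu cg; have [C C0 CP] := av_tail_nrm.
have [I I0 IP] := I_dist mQ p1' fQ.
have Lphi n : Lp mu Q p (phi n) by apply: bm_Lp; exact: bm_test (tphi n).
have Lc (c : R) : Lp mu Q p (fun=> c) by apply: bm_Lp; exact: bm_cst.
exists (avg s0 0 a u); set c := avg s0 0 a u.
have v0 : 0 < (vol N s0 0)^-1 by rewrite invr_gt0 vol_gt0.
have avgd n : `|avg s0 0 a (phi n) - c| <= (vol N s0 0)^-1 * (I * dQ (phi n) u).
  have i1 := Lp_intg mQ p1' fQ (Lphi n); have i2 := Lp_intg mQ p1' fQ Lu.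
  rewrite /c /avg -mulrBr -(I_sub mQ i1 i2) normrM (gtr0_norm v0).
  apply: ler_wpM2l; first exact: ltW.
  by apply: (le_trans (I_abs mQ (intg_sub mQ i1 i2))); exact: IP.
have LG n : Lp mu Q p (Gr (phi n)) by apply: bm_Lp; exact: bm_Gr (tphi n).
have cG : nQ (Gr (phi n)) @[n --> \oo] --> 0.
  apply: (cvg0_le (g := fun n => \sum_i nQ (pd i (phi n)))).
    by move=> n; rewrite ger0_norm ?nrm_ge0//; exact: nrm_Gr_le (tphi n).
  have z : \sum_(i < N) (0 : R) = 0 by rewrite big1.
  rewrite -[X in _ --> X]z.
  elim: (index_enum _) => [|i r IHr].
    by under eq_fun do rewrite big_nil; rewrite big_nil; exact: cvg_cst.
  by under eq_fun do rewrite big_cons; rewrite big_cons; apply: cvgD; [exact: cg|exact: IHr].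
apply: (dist_eq0 mQ p1' Lu (Lc c)).
have lim : dQ (phi n) u + (C * rate ^+ 0 * nQ (Gr (phi n)) +
    (vol N s0 0)^-1 * (I * dQ (phi n) u) * nQ (fun=> 1)) @[n --> \oo] --> 0.
  rewrite -[X in _ --> X]addr0; apply: cvgD; first exact: cu.
  rewrite -[X in _ --> X]addr0; apply: cvgD.
    by rewrite -(mulr0 (C * rate ^+ 0)); apply: cvgM; [exact: cvg_cst|exact: cG].
  rewrite -(mul0r (nQ (fun=> 1))); apply: cvgM; last exact: cvg_cst.
  rewrite -(mulr0 (vol N s0 0)^-1); apply: cvgM; first exact: cvg_cst.
  by rewrite -(mulr0 I); apply: cvgM; [exact: cvg_cst|exact: cu].
apply/eqP; rewrite eq_le dist_ge0 andbT -(cvg_lim (@Rhausdorff R) lim).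
apply: limr_ge; first exact: cvgP lim.
apply: nearW => n; apply: (le_trans (dist_tri mQ p1' Lu (Lphi n) (Lc c))).
rewrite (dist_sym _ _ _ u (phi n)); apply: lerD; first exact: lexx.
apply: (le_trans (dist_tri mQ p1' (Lphi n) (Lc (avg s0 0 a (phi n))) (Lc c))).
apply: lerD; first exact: (CP 0%N _ (tphi n)).
apply: (dist_le_bounded mQ p1' fQ _ (Lc _).1 (Lc _).1) => [|x _]; last exact: avgd.
by apply: mulr_ge0; [exact: ltW|apply: mulr_ge0; [exact: I0|exact: dist_ge0]].
Qed.

Lemma ultra_cvg (U : set_system nat) (b : nat -> R) (M : R) : UltraFilter U ->
  (forall n, `|b n| <= M) -> exists l : R, forall e : R, 0 < e -> U [set n | `|b n - l| < e].
Proof.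
move=> UU bM; have PU : ProperFilter U by exact: ultra_proper.
have cK := @segment_compact R (- M) M.
have [l [_ cl]] : (`[- M, M] `&` cluster (b @ U) !=set0)%classic.
  apply: cK; have hU : U (b @^-1` `[- M, M]).
    by apply: (@filterS _ U _ setT) (filterT) => n _ /=; rewrite in_itv /= -ler_norml.
  exact: hU.
exists l => e e0; have [//|nU] := in_ultra_setVsetC [set n | `|b n - l| < e] UU.
have sub : ~` [set n | `|b n - l| < e] `<=` b @^-1` (~` ball l e).
  by move=> n /= h1 h2; apply: h1; rewrite distrC.
have h1 : (b @ U) (~` ball l e) by exact: (@filterS nat U _ _ _ sub nU).
have [y [h2 h3]] := cl (~` ball l e) (ball l e) h1 (nbhsx_ballx l e e0).
by case: (h2 h3).
Qed.

(** At a fixed level there are finitely many averages, each converging along [U]. A single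
    ultrafilter serves all levels and replaces a diagonal extraction. *)
Lemma ultra_avgs (U : set_system nat) (phi : nat -> V -> R) (A : R) : UltraFilter U ->
  (forall j, test_function Om (phi j)) -> (forall j, nQ (phi j) <= A) ->
  forall n l b (e : R), 0 < e -> hb s0 l b `<=` Q ->
  exists2 S, U S & forall j k, S j -> S k ->
    forall x, `|avgs hN s0 n l b (phi j) x - avgs hN s0 n l b (phi k) x| <= e.
Proof.
move=> UU tphi A_ n; have PU : ProperFilter U by exact: ultra_proper.
have [I I0 IP] := I_nrm mQ p1' fQ.
elim: n => [|n IH] l b e e0 bQ.
  have e2 : 0 < e / 2 by rewrite divr_gt0.
  have v0 : 0 < (vol N s0 l)^-1 by rewrite invr_gt0 vol_gt0.
  have [|c cP] := @ultra_cvg U (fun j => avg s0 l b (phi j)) ((vol N s0 l)^-1 * (I * A)) UU.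
    move=> j; have bj := bm_test (tphi j).
    apply: (le_trans (avg_abs hN s0p l b bj)); apply: ler_wpM2l; first exact: ltW.
    apply: (@le_trans _ _ (\int[mu]_(x in Q) `|phi j x|)).
      apply: I_subset => //; [exact: measurable_hb|].
      by apply: (bm_hb hN s0p); exact: bm_abs.
    apply: (le_trans (IP _ (bm_Lp bj))); exact: ler_wpM2l.
  exists [set j | `|avg s0 l b (phi j) - c| < e / 2]; first exact: cP.
  move=> j k /= hj hk x; rewrite (splitr e) -(subrKA c).
  by apply: (le_trans (ler_normD _ _)); apply: ltW; apply: ltrD => //; rewrite distrC.
have [q1 q2] : hb s0 l.+1 b `<=` Q /\ hb s0 l.+1 (up hN s0 l b) `<=` Q.
  by split=> x hx; apply: bQ; rewrite (hb_split hN s0p); [left|right].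
have [S1 US1 h1] := IH l.+1 b e e0 q1.
have [S2 US2 h2] := IH l.+1 (up hN s0 l b) e e0 q2.
exists (S1 `&` S2); first exact: filterI.
by move=> j k [j1 j2] [k1 k2] x /=; case: ifP => _; [exact: h1|exact: h2].
Qed.

Lemma rellich_test (phi : nat -> V -> R) (A : R) :
  (forall n, test_function Om (phi n)) -> (forall n, nQ (phi n) <= A) ->
  (forall n, nQ (Gr (phi n)) <= A) ->
  exists k : nat -> nat, (forall n, (k n < k n.+1)%N) /\
  exists2 u, Lp mu Q p u & dQ (phi (k n)) u @[n --> \oo] --> 0.
Proof.
move=> tphi hA hG; have [C C0 CP] := av_tail_nrm.
have [U [UU oU]] := @ultraFilterLemma nat \oo%classic _.
have PU : ProperFilter U by exact: ultra_proper.
have Lphi n : Lp mu Q p (phi n) by apply: bm_Lp; exact: bm_test (tphi n).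
have A0 : 0 <= A by exact: le_trans (nrm_ge0 _ _ _ _) (hA 0%N).
have /choice[S SP] : forall j : nat, exists S, U S /\ forall m n, S m -> S n ->
    dQ (phi m) (phi n) <= j.+1%:R^-1.
  move=> j; pose e : R := j.+1%:R^-1; have e0 : 0 < e by rewrite invr_gt0.
  have e3 : 0 < e / 3 by rewrite divr_gt0.
  have cr : C * rate ^+ n * A @[n --> \oo] --> 0.
    rewrite -(mul0r A) -(mulr0 C); apply: cvgM; last exact: cvg_cst.
    apply: cvgM; first exact: cvg_cst.
    by apply: cvg_expr; rewrite ger0_norm ?(ltW rate_gt0)// rate_lt1.
  have [n hn] := filter_ex (cvg0_near cr e3).
  have hn' : C * rate ^+ n * A <= e / 3 by apply: ltW; apply: le_lt_trans hn; exact: ler_norm.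
  have one0 : 0 <= nQ (fun=> 1) by exact: nrm_ge0.
  have e4 : 0 < e / 3 / (nQ (fun=> 1) + 1) by rewrite divr_gt0// ltr_wpDl.
  have [T UT hT] := ultra_avgs UU tphi hA n e4 (@subset_refl _ Q).
  exists T; split=> // m k Tm Tk.
  have Lav i := bm_Lp (bm_avgs hN s0 n 0 a (phi i)).
  have tail i : dQ (phi i) (av n (phi i)) <= e / 3.
    apply: (le_trans (CP n _ (tphi i))); apply: le_trans hn'; apply: ler_wpM2l (hG i).
    by rewrite mulr_ge0// exprn_ge0// ltW// rate_gt0.
  have -> : j.+1%:R^-1 = e / 3 + (e / 3 + e / 3) by rewrite -/e; field.
  apply: (le_trans (dist_tri mQ p1' (Lphi m) (Lav m) (Lphi k))); apply: lerD (tail m) _.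
  apply: (le_trans (dist_tri mQ p1' (Lav m) (Lav k) (Lphi k))); apply: lerD; last first.
    by rewrite dist_sym; exact: tail.
  apply: (@le_trans _ _ (e / 3 / (nQ (fun=> 1) + 1) * nQ (fun=> 1))).
    apply: (dist_le_bounded mQ p1' fQ (ltW e4) (Lav m).1 (Lav k).1) => x _; exact: hT.
  by rewrite mulrAC ler_pdivrMr ?ltr_wpDl// ler_wpM2l ?(ltW e3)// lerDl.
(* Finite intersections of the [S j] belong to [U], so they have arbitrarily large elements; from
   these an increasing sequence eventually in each [S j] is built. *)
have /choice[pick pickP] : forall nm : nat * nat, exists i, (nm.2 < i)%N /\
    forall j, (j <= nm.1)%N -> S j i.
  move=> [n m] /=.
  have h1 : U [set i | (m < i)%N] by apply: oU; exists m.+1.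
  have h2 : U [set i | forall j, (j <= n)%N -> S j i].
    elim: n => [|n IH].
      by apply: filterS (SP 0%N).1 => i Si j; rewrite leqn0 => /eqP ->.
    apply: filterS (filterI IH (SP n.+1).1) => i [hi Si] j.
    by rewrite leq_eqVlt => /orP[/eqP ->//|]; rewrite ltnS; exact: hi.
  have [i [i1 i2]] := filter_ex (filterI h1 h2); by exists i.
pose k := fix k n := if n is n'.+1 then pick (n, k n') else pick (0, 0)%N.
have kS n : (k n < k n.+1)%N by exact: (pickP (n.+1, k n)).1.
have kP n j : (j <= n)%N -> S j (k n) by case: n => [|n]; exact: (pickP (_, _)).2.
exists k; split=> //.
have [|u [_ [Lu _ cu _]]] := @dist_complete _ _ _ mu Q mQ p p1' (fun n => phi (k n)) fQ
  (fun n => Lphi (k n)).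
  move=> e e0; have [n hn] := filter_ex (cvg0_near (@cvg_harmonic R) e0).
  have {}hn : n.+1%:R^-1 < e by move: hn; rewrite ger0_norm ?invr_ge0.
  exists n => i j ni nj; apply: (le_trans _ (ltW hn)).
  by apply: (SP n).2; exact: kP.
by exists u.
Qed.

(** An average of f is at most the p-th root of the average of f^p, and among the boxes met the
    deepest ones have the smallest volume. *)
Lemma amax_le n l (b : V) (m : R) f x : bm f -> (forall y, 0 <= f y) ->
  amax hN s0 n l b m f x <= Num.max m
    (((vol N s0 (l + n))^-1 * \int[mu]_(y in hb s0 l b) (`|f y| `^ p)) `^ p^-1).
Proof.
move=> bf f0; have bp : bm (fun y => `|f y| `^ p) by exact: bm_pow.
have v0 k : 0 < vol N s0 k by exact: vol_gt0.
have I0 k (c : V) : 0 <= \int[mu]_(y in hb s0 k c) (`|f y| `^ p) by exact: Ipow_ge0.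
have pi0 : 0 <= p^-1 by rewrite invr_ge0 ltW.
have avg_le' k (c : V) : avg s0 k c f <=
    ((vol N s0 k)^-1 * \int[mu]_(y in hb s0 k c) (`|f y| `^ p)) `^ p^-1.
  have A0 := avg_ge0 s0p k c f0.
  rewrite -[leLHS](powRK (lt0r_neq0 p0) A0).
  by apply: powR_le; [exact: pi0|exact: powR_ge0|exact: (avg_pow_le hN s0p)].
elim: n l b m => [|n IH] l b m.
  by rewrite addn0 /= ge_max le_max lexx /= le_max avg_le' orbT.
have vle : (vol N s0 l)^-1 <= (vol N s0 (l + n.+1))^-1.
  rewrite lef_pV2 ?posrE// /vol; apply: ler_wpM2l; first by rewrite exprn_ge0// ltW.
  by rewrite lef_pV2 ?posrE ?exprn_gt0// ler_eXn2l ?ltr1n// leq_addr.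
have sub (c : V) : hb s0 l.+1 c `<=` hb s0 l b ->
    amax hN s0 n l.+1 c (Num.max m (avg s0 l b f)) f x <= Num.max m
    (((vol N s0 (l + n.+1))^-1 * \int[mu]_(y in hb s0 l b) (`|f y| `^ p)) `^ p^-1).
  move=> cb; apply: (le_trans (IH _ _ _)); rewrite addSnnS ge_max ge_max.
  apply/andP; split; [apply/andP; split|].
  - by rewrite le_max lexx.
  - rewrite le_max; apply/orP; right; apply: (le_trans (avg_le' l b)).
    apply: powR_le => //; first by rewrite mulr_ge0// invr_ge0 ltW.
    by apply: ler_wpM2r.
  - rewrite le_max; apply/orP; right; apply: powR_le => //.
      by rewrite mulr_ge0// invr_ge0 ltW.
    apply: ler_wpM2l; first by rewrite invr_ge0 ltW.
    apply: I_subset => //; [exact: measurable_hb|exact: measurable_hb|].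
    by apply: (bm_hb hN s0p).
by rewrite /=; case: ifP => _; apply: sub; rewrite (hb_split hN s0p l b) => y; [left|right].
Qed.

(** Growth per level of vol^(-1/p), hence of the bound on the averages of the gradient. *)
Let beta : R := 2 `^ p^-1.

Lemma am_le (A : R) : 0 < A -> exists2 B : R, 0 < B & forall m phi x,
  test_function Om phi -> nQ (Gr phi) <= A -> am m (Gr phi) x <= B * beta ^+ m.
Proof.
move=> A0; have s1 : 0 < s0 ^+ N by rewrite exprn_gt0.
have pi0 : 0 <= p^-1 by rewrite invr_ge0 ltW.
exists ((s0 ^+ N)^-1 `^ p^-1 * A); first by rewrite mulr_gt0// powR_gt0// invr_gt0.
move=> m phi x tphi hA; have bG := bm_Gr tphi.
have B0 : 0 <= (s0 ^+ N)^-1 `^ p^-1 * A * beta ^+ m.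
  by rewrite !mulr_ge0 ?powR_ge0 ?(ltW A0)// exprn_ge0// powR_ge0.
apply: (le_trans (amax_le _ _ _ _ _ bG (Gr_ge0 phi))); rewrite ge_max B0 /= add0n.
rewrite powRM ?invr_ge0 ?(ltW (vol_gt0 _ s0p _))// ?Ipow_ge0//.
have -> : (vol N s0 m)^-1 `^ p^-1 = (s0 ^+ N)^-1 `^ p^-1 * beta ^+ m.
  rewrite /vol invfM invrK powRM ?invr_ge0 ?(ltW s1)// ?exprn_ge0//; congr (_ * _).
  by rewrite /beta powRX.
rewrite -!mulrA; apply: ler_wpM2l; first exact: powR_ge0.
by rewrite mulrC; apply: ler_wpM2r; [rewrite exprn_ge0// powR_ge0|exact: hA].
Qed.

(** An increment of the averages is at most a side times an average of the gradient, that is a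
    multiple of ([rate * beta])^k. The ratio is 2^(1/p - 1/d), below 1 exactly when p > d. *)
Lemma av_le (A : R) : 0 < A -> exists c0 B : R, [/\ 0 <= c0, 0 <= B &
  forall m phi x, test_function Om phi -> nQ phi <= A -> nQ (Gr phi) <= A ->
    `|av m phi x| <= c0 + B * \sum_(k < m) (rate * beta) ^+ k].
Proof.
move=> A0; have [B B0 BP] := am_le A0; have [I I0 IP] := I_nrm mQ p1' fQ.
have v0 : 0 < (vol N s0 0)^-1 by rewrite invr_gt0 vol_gt0.
exists ((vol N s0 0)^-1 * (I * A)), (2 * s0 * B); split.
- by rewrite !mulr_ge0// ltW.
- by rewrite !mulr_ge0// ltW.
move=> m phi x tphi hA hG; have bphi := bm_test tphi.
elim: m => [|m IH].
  rewrite big_ord0 mulr0 addr0 /=; apply: (le_trans (avg_abs hN s0p 0 a bphi)).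
  apply: ler_wpM2l; first exact: ltW.
  exact: (le_trans (IP _ (bm_Lp bphi)) (ler_wpM2l I0 hA)).
rewrite big_ord_recr [X in _ <= X]/= mulrDr addrA -(subrK (av m phi x) (av m.+1 phi x)) [leRHS]addrC.
apply: (le_trans (ler_normD _ _)); apply: lerD; last exact: IH.
have h1 := avgs_succ hN s0p m 0 a 0 x tphi; rewrite add0n in h1.
apply: (le_trans h1).
have -> : 2 * s0 * B * (rate * beta) ^+ m = s0 * (2 * rate ^+ m) * (B * beta ^+ m).
  by rewrite exprMn; ring.
apply: ler_pM; [|exact: amax_ge| |exact: BP].
  by rewrite mulr_ge0 ?invr_ge0 ?exprn_ge0// ltW.
by apply: ler_wpM2l; [exact: ltW|exact: half_pow_le].
Qed.

Let beta_gt0 : 0 < beta. Proof. by rewrite powR_gt0. Qed.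

Let rbE : rate * beta = 2 `^ (p^-1 - d^-1).
Proof. by rewrite /rate /beta -powRD ?pnatr_eq0 ?implybT// addrC. Qed.

Lemma avgs_limit phi x : test_function Om phi -> Q x -> av n phi x @[n --> \oo] --> phi x.
Proof.
move=> tphi Qx; have [M M0 MP] := avgs_cvg_rate tphi.
apply: (cvg_bound (g := fun n => M * rate ^+ n)) => [n|]; first exact: MP.
rewrite -(mulr0 M); apply: cvgM; first exact: cvg_cst.
by apply: cvg_expr; rewrite ger0_norm ?(ltW rate_gt0)// rate_lt1.
Qed.

Lemma geom_sum (x : R) n : x != 1 -> \sum_(k < n) x ^+ k = (1 - x ^+ n) / (1 - x).
Proof.
move=> x1; have x10 : 1 - x != 0 by rewrite subr_eq0 eq_sym.
by apply: (mulIf x10); rewrite divfK// -[in RHS](expr1n _ n) subrXX mulrC; congr (_ * _); apply: eq_bigr => k _; rewrite expr1n mul1r.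
Qed.

(** The ratio [rate * beta] is below 1, so the increments of the averages are summable uniformly in
    [phi]. *)
Lemma morrey_test (A : R) : d < p -> 0 < A -> exists K : R, forall phi,
  test_function Om phi -> nQ phi <= A -> nQ (Gr phi) <= A -> forall x, Q x -> `|phi x| <= K.
Proof.
move=> dp A0; have [c0 [B [c00 B0 BP]]] := av_le A0.
set r := rate * beta in BP.
have r0 : 0 < r by rewrite mulr_gt0// rate_gt0.
have r1 : r < 1.
  have h : 0 < d^-1 - p^-1 by rewrite subr_gt0 ltf_pV2 ?posrE.
  rewrite /r rbE -opprB powRN invf_lt1 ?powR_gt0// ltNge; apply/negP => h2.
  have := powR_le (ltW (_ : 0 < (d^-1 - p^-1)^-1)) (powR_ge0 _ _) h2.
  rewrite -powRrM mulfV ?gt_eqF// powRr1// powR1 => h3.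
  have : (2 : R) <= 1 by apply: h3; rewrite invr_gt0.
  by lra.
exists (c0 + B / (1 - r)) => phi tphi hA hG x Qx.
have lim : `|av n phi x| @[n --> \oo] --> `|phi x|.
  by apply: cvg_norm; exact: avgs_limit.
rewrite -(cvg_lim (@Rhausdorff R) lim); apply: limr_le; first exact: cvgP lim.
apply: nearW => n; apply: (le_trans (BP n phi x tphi hA hG)); rewrite lerD2l.
apply: ler_wpM2l => //; rewrite geom_sum ?lt_eqF// -[leRHS]mul1r.
by apply: ler_wpM2r; rewrite ?invr_ge0 ?subr_ge0 ?(ltW r1)// gerBl exprn_ge0// ltW.
Qed.

(** Hedberg's splitting: with M the maximal average of the gradient at [x], use the energy bound up
    to the level n at which B1 beta^n reaches M, and M itself beyond. Both parts are at most of
    order r^n, hence of order 1 + M^th with th = 1 - p/d, and th q = p brings the q-th power back to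
    Doob's inequality. *)
Lemma sobolev_test (A : R) : p < d -> 0 < A -> exists K : R, forall phi,
  test_function Om phi -> nQ phi <= A -> nQ (Gr phi) <= A ->
  nrm mu Q (p * d / (d - p)) phi <= K.
Proof.
move=> pd_ A0; set q := p * d / (d - p).
have dp0 : 0 < d - p by rewrite subr_gt0.
have q0 : 0 < q by rewrite divr_gt0// mulr_gt0.
have [B1 B10 B1P] := am_le A0; have [c0 [B2 [c00 B20 B2P]]] := av_le A0.
have [C C0 CP] := nrm_amax.
set r := rate * beta in B2P.
have r00 := rate_gt0; have b0 := beta_gt0.
pose th : R := 1 - p / d.
have th0 : 0 < th by rewrite subr_gt0 ltr_pdivrMr// mul1r.
have rE : r = beta `^ th.
  rewrite /r rbE /beta -powRrM; congr (_ `^ _); rewrite /th.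
  by field; rewrite !gt_eqF.
have thq : th * q = p by rewrite /th /q; field; rewrite !gt_eqF.
have b1 : 1 < beta.
  rewrite ltNge; apply/negP => h.
  have := powR_le (ltW p0) (powR_ge0 _ _) h.
  by rewrite -powRrM mulVf ?gt_eqF// powRr1// powR1; lra.
have r1 : 1 < r.
  rewrite ltNge; apply/negP => h; have := powR_le (ltW q0) _ h.
  rewrite {1}rE powR_ge0 => /(_ isT).
  rewrite rE -powRrM thq /beta -powRrM mulVf ?gt_eqF// powRr1// powR1; lra.
have r0 : 0 < r by exact: lt_trans r1.
have rm : 0 < r - 1 by rewrite subr_gt0.
have ra1 : 0 < 1 - rate by rewrite subr_gt0 rate_lt1.
pose K0 := 2 * s0 / (1 - rate); have K00 : 0 <= K0 by rewrite divr_ge0// ?mulr_ge0 ?ltW.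
pose E := r * (B2 / (r - 1) + K0 * B1).
have E0 : 0 <= E.
  rewrite mulr_ge0 ?(ltW r0)// addr_ge0//; first by rewrite divr_ge0// ltW.
  by rewrite mulr_ge0// ltW.
have ptw phi m x : test_function Om phi -> nQ phi <= A -> nQ (Gr phi) <= A ->
    `|av m phi x| <= (c0 + E) + E * (am m (Gr phi) x / B1) `^ th.
  move=> tphi hA hG; set M := am m (Gr phi) x.
  have M0 : 0 <= M by exact: amax_ge.
  have Mm : M <= B1 * beta ^+ m by exact: B1P.
  (* Minimality gives B1 beta^(n-1) < M when n > 0, which bounds r^n by a multiple of (M / B1)^th;
     the case n = 0 costs the additive 1. *)
  have /ex_minnP[n hn nmin] : exists n, M <= B1 * beta ^+ n by exists m.
  have nm : (n <= m)%N by exact: nmin.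
  have rn : r ^+ n <= r * (1 + (M / B1) `^ th).
    case: n hn nmin {nm} => [|n] hn nmin.
      by rewrite expr0 mulrDr mulr1 ler_wpDr// ?(ltW r1)// mulr_ge0 ?powR_ge0 ?ltW.
    have : ~~ (M <= B1 * beta ^+ n).
      by apply/negP => /nmin; rewrite ltnn.
    rewrite -ltNge mulrC -ltr_pdivlMr// => /ltW h.
    rewrite exprS; apply: ler_wpM2l; first exact: ltW.
    rewrite [X in X ^+ _]rE -powRX ?(ltW b0)//; apply: ler_wpDl => //.
    by apply: powR_le; [exact: ltW|rewrite exprn_ge0// ltW|exact: h].
  have S : \sum_(k < n) r ^+ k <= r ^+ n / (r - 1).
    rewrite geom_sum ?gt_eqF// -[1 - r ^+ n]opprB -[1 - r]opprB invrN mulrNN.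
    by apply: ler_wpM2r; [rewrite invr_ge0 ltW|rewrite gerBl].
  have h1 := B2P n phi x tphi hA hG.
  have h2 := av_tail x tphi nm; rewrite -/K0 -/M in h2.
  have h3 : K0 * rate ^+ n * M <= K0 * B1 * r ^+ n.
    rewrite -[leLHS]mulrA -[leRHS]mulrA; apply: ler_wpM2l => //; rewrite /r exprMn mulrCA.
    by apply: ler_wpM2l => //; rewrite exprn_ge0// ltW.
  have h4 := ler_wpM2l B20 S.
  rewrite -(subrK (av n phi x) (av m phi x)); apply: (le_trans (ler_normD _ _)).
  have h5 : (B2 / (r - 1) + K0 * B1) * r ^+ n <=
      (B2 / (r - 1) + K0 * B1) * (r * (1 + (M / B1) `^ th)).
    apply: ler_wpM2l => //; rewrite addr_ge0//; first by rewrite divr_ge0// ltW.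
    by rewrite mulr_ge0// ltW.
  have e1 : B2 * (r ^+ n / (r - 1)) = B2 / (r - 1) * r ^+ n by rewrite -!mulrA (mulrC (r ^+ n)).
  have e2 : (B2 / (r - 1) + K0 * B1) * (r * (1 + (M / B1) `^ th)) =
      E + E * (M / B1) `^ th by rewrite /E; ring.
  rewrite e2 mulrDl in h5; rewrite e1 in h4.
  have h7 : `|av n phi x| <= c0 + B2 / (r - 1) * r ^+ n.
    by apply: (le_trans h1); rewrite lerD2l.
  apply: (le_trans (lerD (le_trans h2 h3) h7)).
  by rewrite addrCA -[leRHS]addrA lerD2l addrC.
pose K := 2 `^ q * ((c0 + E) `^ q * vol N s0 0 + E `^ q / B1 `^ p * (C * A) `^ p).
have c1 : 0 <= c0 + E by rewrite addr_ge0.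
exists (K `^ q^-1) => phi tphi hA hG; have bphi := bm_test tphi.
have bG := bm_Gr tphi.
have bav m : bm (fun x => `|av m phi x| `^ q) by apply: bm_pow => //; exact: bm_avgs.
have step m : \int[mu]_(x in Q) (`|av m phi x| `^ q) <= K.
  have bM : bm (fun x => `|am m (Gr phi) x| `^ p) by apply: bm_pow => //; exact: bm_amax.
  have iM := bm_hb hN s0p 0 a bM.
  have ic : mu.-integrable Q (EFin \o (fun=> (c0 + E) `^ q)).
    by apply: intg_cst; [exact: mQ|exact: fQ].
  have iS := intg_scale mQ (E `^ q / B1 `^ p) iM.
  apply: (@le_trans _ _ (\int[mu]_(x in Q) (2 `^ q * ((c0 + E) `^ q +
      E `^ q / B1 `^ p * `|am m (Gr phi) x| `^ p)))).
    apply: (I_le mQ (bm_hb hN s0p 0 a (bav m)) (intg_scale mQ _ (intg_add mQ ic iS))).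
    move=> x _; have M0 : 0 <= am m (Gr phi) x by exact: amax_ge.
    apply: (@le_trans _ _ ((c0 + E + E * (am m (Gr phi) x / B1) `^ th) `^ q)).
      by apply: powR_le; [exact: ltW|exact: normr_ge0|exact: ptw].
    apply: (le_trans (powR_add_le (ltW q0) c1 (mulr_ge0 E0 (powR_ge0 _ _)))).
    rewrite [(E * _) `^ q]powRM ?powR_ge0// -powRrM thq powRM ?invr_ge0 ?(ltW B10)//.
    rewrite (ger0_norm M0) -(powR_inv1 (ltW B10)) -powRrM mulN1r powRN.
    by rewrite le_eqVlt; apply/orP; left; apply/eqP; ring.
  rewrite (I_scale mQ _ (intg_add mQ ic iS)) (I_add mQ ic iS) (I_scale mQ _ iM).
  apply: ler_wpM2l; first exact: powR_ge0.
  apply: lerD.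
    by rewrite Rintegral_cst// mu_hb.
  apply: ler_wpM2l; first by rewrite divr_ge0// powR_ge0.
  rewrite -(nrm_powR mu Q _ p0); apply: powR_le; [exact: ltW|exact: nrm_ge0|].
  by apply: (le_trans (CP m phi tphi)); apply: ler_wpM2l.
have q1 : 1 <= q.
  rewrite /q ler_pdivlMr// mul1r; apply: (@le_trans _ _ d); first by rewrite gerBl ltW.
  by rewrite ler_peMl// ltW.
have LavQ m : Lp mu Q q (av m phi).
  have [mav [Mb MbP]] := bm_avgs hN s0 m 0 a phi.
  by apply: (Lp_bounded mQ q1 fQ (measurable_funTS mav)) => x _; exact: MbP.
have KK0 : 0 <= K by apply: le_trans (step 0%N); exact: Ipow_ge0.
apply: (nrm_fatou mQ q1 LavQ _ _ _).2.
- exact: measurable_funTS bphi.1.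
- by apply: nearW => x Qx; exact: avgs_limit.
- move=> m; apply: nrm_le; [exact: q0|exact: powR_ge0|].
  by rewrite powRVK ?gt_eqF//; exact: step.
Qed.

End norms.

End rate.

End dyadic_estimates.


Section restriction.
Variables (R : realType) (N : nat).
Local Notation V := 'rV[R]_N.
Local Notation mu := (lebm R N).
Variables (D E : set V) (p : R).
Hypotheses (mD : measurable D) (mE : measurable E) (DE : D `<=` E) (p0 : 0 < p).
Implicit Types (u v : V -> R).

Lemma Lp_subset u : Lp mu E p u -> Lp mu D p u.
Proof.
move=> [mu_ ui]; split; first exact: measurable_funS mu_.
exact: integrableS ui.
Qed.

Lemma nrm_subset u : Lp mu E p u -> nrm mu D p u <= nrm mu E p u.
Proof.
move=> [mu_ ui]; apply: nrm_le => //; first exact: nrm_ge0.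
by rewrite nrm_powR//; apply: I_subset.
Qed.

Lemma nrm_supp u : (forall x, ~ D x -> u x = 0) -> nrm mu D p u = nrm mu E p u.
Proof.
move=> u0; have z x : ~ D x -> `|u x| `^ p = 0.
  by move=> /u0 ->; rewrite normr0 powR0// gt_eqF.
have e : \int[mu]_(x in D) (`|u x| `^ p) = \int[mu]_(x in E) (`|u x| `^ p).
  rewrite (I_supp (u := fun x => `|u x| `^ p) mD z).
  rewrite (I_supp (u := fun x => `|u x| `^ p) mE)//.
  by move=> x nE; apply: z => /DE.
by apply: le_anti; apply/andP; split; apply: nrm_le => //; rewrite ?nrm_ge0// nrm_powR// e.
Qed.

End restriction.

Lemma bounded_in_hb (R : realType) (N : nat) (Om : set 'rV[R]_N) : bounded_set Om ->
  exists (s0 : R) (a : 'rV[R]_N), 0 < s0 /\ Om `<=` hb s0 0 a.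
Proof.
move=> [M [Mr bM]]; pose K : R := `|M| + 1.
have MK : M < K by rewrite /K (le_lt_trans (ler_norm M))// ltrDl.
have K0 : 0 < K by rewrite /K ltr_wpDl.
exists (2 * K + 1), (const_mx (- K)); split; first by rewrite addr_gt0// mulr_gt0.
move=> x /(bM _ MK) xK i; rewrite side0 mxE.
have : `|x 0 i| <= K by apply: (le_trans (coord_le_norm x i)); exact: xK.
by rewrite ler_norml => /andP[h1 h2]; apply/andP; split => //; lra.
Qed.

(** * Local constancy and connectedness *)

Section local_constancy.
Variables (R : realType) (N : nat) (Om : set 'rV[R]_N).
Local Notation V := 'rV[R]_N.
Local Notation mu := (lebm R N).
Hypotheses (hN : (0 < N)%N) (oO : open Om) (cO : connected Om) (nO : Om !=set0).
Implicit Types (a x : V) (r : R).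

Let bx a r : V := \row_i (a 0 i + r).

Lemma pos_lower (F : 'I_N -> R) : (forall i, 0 < F i) ->
  exists2 s : R, 0 < s & forall i, s <= F i.
Proof.
move=> F0; have [s s0 h] : exists2 s : R, 0 < s & forall i, i \in index_enum 'I_N -> s <= F i.
  elim: (index_enum _) => [|j l [s s0 h]]; first by exists 1.
  exists (Num.min s (F j)); first by rewrite lt_min s0 F0.
  move=> i; rewrite inE => /orP[/eqP ->|/h h']; first by rewrite ge_min lexx orbT.
  by rewrite ge_min h'.
by exists s => // i; apply: h; rewrite mem_index_enum.
Qed.

Lemma obox_hb a r : obox a (bx a r) `<=` hb r 0 a.
Proof. by move=> x h i; have := h i; rewrite mxE side0 => /andP[/ltW -> ->]. Qed.

Lemma hb_cbox a r : hb r 0 a `<=` cbox a (bx a r).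
Proof. by move=> x h i; have := h i; rewrite mxE side0 => /andP[-> /ltW ->]. Qed.

Lemma hb_overlap a r a' r' x : obox a (bx a r) x -> obox a' (bx a' r') x ->
  exists2 s : R, 0 < s & hb s 0 x `<=` hb r 0 a `&` hb r' 0 a'.
Proof.
move=> h h'; have [|s s0 hs] := pos_lower (F := fun i =>
    Num.min (a 0 i + r - x 0 i) (a' 0 i + r' - x 0 i)).
  move=> i; have := h i; have := h' i; rewrite !mxE => /andP[_ h2] /andP[_ h4].
  by rewrite lt_min !subr_gt0 h2 h4.
exists s => // y hy; split=> i; have := hs i; rewrite le_min => /andP[s1 s2].
  have := hy i; have := h i; rewrite !side0 !mxE => /andP[h1 h2] /andP[h3 h4].
  by apply/andP; split; lra.
have := hy i; have := h' i; rewrite !side0 !mxE => /andP[h1 h2] /andP[h3 h4].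
by apply/andP; split; lra.
Qed.

Lemma ae_const_uniq r a w c c' : 0 < r -> {ae mu, forall x, hb r 0 a x -> w x = c} ->
  {ae mu, forall x, hb r 0 a x -> w x = c'} -> c = c' :> R.
Proof.
move=> r0 h h'; apply/eqP/negP => /negP cc.
have : mu.-negligible (hb r 0 a).
  apply: negligibleS (filterI h h') => x hx [h1 h2].
  by move: cc; rewrite -(h1 hx) -(h2 hx) eqxx.
move=> /(measure_negligible (measurable_hb r 0 a)) z.
have /eqP : (vol N r 0)%:E = 0%E by exact: etrans (esym (mu_hb hN r0 0 a)) z.
rewrite eqe => /eqP v0.
by have := vol_gt0 N r0 0; rewrite v0 ltxx.
Qed.

Lemma point_cube x : Om x -> exists a r, [/\ 0 < r, cbox a (bx a r) `<=` Om & obox a (bx a r) x].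
Proof.
move=> Ox; have [q [r [r0 [xq qO]]]] := open_rbox oO Ox.
have r0' : 0 < ratr r :> R by rewrite ltr0q.
exists (\row_i (ratr (q 0 i) - ratr r)), (2 * ratr r); split.
- by rewrite mulr_gt0.
- move=> y hy; apply: qO => i; have := hy i; rewrite !mxE ler_distl => /andP[-> h].
  by apply: (le_trans h); rewrite le_eqVlt; apply/orP; left; apply/eqP; ring.
- move=> i; have := xq i; rewrite !mxE ltr_distl => /andP[-> h].
  by apply: (lt_le_trans h); rewrite le_eqVlt; apply/orP; left; apply/eqP; ring.
Qed.

Lemma open_obox a b : open (obox a b).
Proof.
rewrite openE => x ox; apply/rV_nbhs.
have [|s s0 hs] := pos_lower (F := fun i => Num.min (x 0 i - a 0 i) (b 0 i - x 0 i)).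
  by move=> i; have /andP[h1 h2] := ox i; rewrite lt_min !subr_gt0 h1.
exists s => // y xy i; have := hs i; rewrite le_min => /andP[h1 h2].
by have := xy i; rewrite ltr_norml => /andP[h3 h4]; apply/andP; split; lra.
Qed.

(** Two overlapping cubes share a cube of positive measure, so their constants agree. The points
    having a cube with constant [c] and those having one with another constant thus form two
    disjoint open sets covering [Om]. *)
Lemma locally_constant (w : V -> R) :
  (forall a r, 0 < r -> cbox a (bx a r) `<=` Om ->
    exists c : R, {ae mu, forall x, hb r 0 a x -> w x = c}) ->
  exists c : R, {ae mu, forall x, Om x -> w x = c}.
Proof.
move=> loc; have [x0 Ox0] := nO; have [a0 [r0 [r00 cO0 ox0]]] := point_cube Ox0.
have [c hc] := loc a0 r0 r00 cO0.
pose good (P : R -> Prop) x := exists a r k, [/\ 0 < r, cbox a (bx a r) `<=` Om,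
  obox a (bx a r) x, {ae mu, forall x, hb r 0 a x -> w x = k} & P k].
have good_open P : open (good P).
  rewrite openE => x [a [r [k [r1 aO ox h Pk]]]].
  have := @open_obox a (bx a r); rewrite openE => /(_ x ox); apply: filterS => y oy.
  by exists a, r, k.
have good_disj x : good (eq c) x -> good (fun k => k <> c) x -> False.
  move=> [a [r [k [r1 aO ox h Pk]]]] [a' [r' [k' [r1' aO' ox' h' Pk']]]].
  have [s s0 sub] := hb_overlap ox ox'; apply: Pk'; rewrite Pk.
  apply: (ae_const_uniq s0 (w := w)).
    by apply: filterS h' => y h2 /sub[_ /h2].
  by apply: filterS h => y h2 /sub[/h2].
have good_sub P x : good P x -> Om x.
  move=> [a [r [k [_ aO ox _ _]]]]; apply: aO; apply: hb_cbox; exact: obox_hb.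
have good_cover x : Om x -> good (eq c) x \/ good (fun k => k <> c) x.
  move=> Ox; have [a [r [r1 aO ox]]] := point_cube Ox; have [k hk] := loc a r r1 aO.
  by have [kc|kc] := pselect (k = c); [left|right]; exists a, r, k; split.
have all : good (eq c) = Om.
  apply: cO.
  - by exists x0, a0, r0, c; split.
  - exists (good (eq c)); first exact: good_open.
    by apply/seteqP; split=> x; [move=> h; split=> //; exact: good_sub h|case].
  - exists (~` good (fun k => k <> c)); first by apply: open_closedC; exact: good_open.
    apply/seteqP; split=> x.
      by move=> h; split; [exact: good_sub h|move=> h'; exact: good_disj h h'].
    by move=> [Ox nx]; case: (good_cover x Ox).
exists c; apply: (open_cover_cubes oO) => a b r r1 abr abO.
have bE : b = bx a r by apply/rowP => i; rewrite mxE abr.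
rewrite bE in abO *; have [k hk] := loc a r r1 abO.
pose m : V := \row_i (a 0 i + r / 2).
have om : obox a (bx a r) m by move=> i; rewrite !mxE ltrDl ltrD2l; apply/andP; split; lra.
have Om_m : Om m by apply: abO; apply: hb_cbox; exact: obox_hb.
have kc : k = c.
  apply: contrapT => kc; have gm : good (eq c) m by rewrite all.
  by apply: (good_disj m gm); exists a, r, k; split.
by apply: filterS hk => x h /obox_hb hx; rewrite h.
Qed.

End local_constancy.

Section constancy.
Variables (R : realType) (N : nat) (Om : set 'rV[R]_N) (p : R).
Local Notation V := 'rV[R]_N.
Local Notation mu := (lebm R N).
Local Notation pd i u := ('D_(evec R i) u).
Local Notation L u := (Lp mu Om p u).
Local Notation d u v := (dist mu Om p u v).
Local Notation ae P := {ae mu, forall x, Om x -> P x}.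
Local Notation Sob := (Sob Om p).
Hypotheses (hN : (0 < N)%N) (oO : open Om) (cO : connected Om) (nO : Om !=set0).
Hypotheses (fO : (mu Om < +oo)%E) (p1 : 1 < p).

Let mO : measurable Om. Proof. exact: open_measurable_rV. Qed.
Let p1' : 1 <= p. Proof. exact: ltW. Qed.
Let p0 : 0 < p. Proof. exact: lt_trans p1. Qed.

Lemma dist_subset (D : set V) u v : measurable D -> D `<=` Om -> L u -> L v ->
  dist mu D p u v <= d u v.
Proof.
move=> mD DO Lu Lv; have := nrm_subset mD mO DO p0 (Lp_sub mO p1' Lu Lv).
exact.
Qed.

(** Gradients have to vanish in the limit only on compact sets: Poincaré's inequality is applied on
    cubes with closure in [Om], to test functions within 1/(n+1) of [zn n]. *)
Lemma Sob_const (zn : nat -> V -> R) (gn : nat -> V -> V) w :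
  (forall n, Sob (zn n) (gn n)) -> L w -> d (zn n) w @[n --> \oo] --> 0 ->
  (forall K, compact K -> K `<=` Om -> forall i, nrm mu K p (gco i (gn n)) @[n --> \oo] --> 0) ->
  exists c : R, ae (fun x => w x = c).
Proof.
move=> S Lw cz cg; apply: locally_constant => // a r r0 aO.
have /choice[phi phiP] : forall n : nat, exists phi, [/\ test_function Om phi,
    d (zn n) phi < n.+1%:R^-1 & forall i, d (gco i (gn n)) (pd i phi) < n.+1%:R^-1].
  by move=> n; have [_ _] := S n; apply; rewrite invr_gt0.
have t n : test_function Om (phi n) by case: (phiP n).
set b : V := \row_i (a 0 i + r) in aO.
have QK : hb r 0 a `<=` cbox a b by exact: hb_cbox.
have QO : hb r 0 a `<=` Om by exact: subset_trans aO.
have mQ : measurable (hb r 0 a) by exact: measurable_hb.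
have Lphi n : L (phi n) by exact: (test_Lp oO fO p1 (t n)).
have Lpd n i : L (pd i (phi n)) by exact: (test_Lp oO fO p1 (test_pd i (t n))).
apply: (poincare_cvg hN r0 (lexx N%:R) p1 t).
- exact: Lp_subset Lw.
- apply: (cvg0_le (g := fun n => n.+1%:R^-1 + d (zn n) w)); last first.
    by rewrite -[0]addr0; apply: cvgD; [exact: cvg_harmonic|exact: cz].
  move=> n; rewrite (ger0_norm (dist_ge0 _ _ _ _ _)).
  apply: (le_trans (dist_subset mQ QO (Lphi n) Lw)).
  apply: (le_trans (dist_tri mO p1' (Lphi n) (Sob_Lp (S n)) Lw)); rewrite lerD2r dist_sym.
  by have [_ h _] := phiP n; exact: ltW.
- move=> i; apply: (cvg0_le (g := fun n => nrm mu (cbox a b) p (gco i (gn n)) + n.+1%:R^-1)).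
    move=> n; rewrite ger0_norm ?nrm_ge0//.
    have Lg := Sob_Lpg i (S n).
    apply: (le_trans (nrm_le_dist mQ p1' (Lp_subset mQ mO QO (Lpd n i)) (Lp_subset mQ mO QO Lg))).
    apply: lerD.
      apply: nrm_subset => //; first exact: measurable_cbox.
      by apply: Lp_subset Lg => //; exact: measurable_cbox.
    apply: (le_trans (dist_subset mQ QO (Lpd n i) Lg)); rewrite dist_sym.
    by have [_ _ h] := phiP n; exact: ltW.
  rewrite -[0]addr0; apply: cvgD; last exact: cvg_harmonic.
  by apply: cg => //; exact: compact_cbox.
Qed.

End constancy.

(** * Compactness, embeddings and uniform integrability in W_0^{1,p} *)

Section sobolev_embedding.
Variables (R : realType) (N : nat) (Om : set 'rV[R]_N) (p : R).
Local Notation V := 'rV[R]_N.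
Local Notation mu := (lebm R N).
Local Notation pd i u := ('D_(evec R i) u).
Local Notation L u := (Lp mu Om p u).
Local Notation d u v := (dist mu Om p u v).
Local Notation n u := (nrm mu Om p u).
Local Notation ae P := {ae mu, forall x, Om x -> P x}.
Local Notation Sob := (Sob Om p).
Variables (hN : (0 < N)%N) (s0 : R) (a : V).
Hypotheses (s0p : 0 < s0) (oO : open Om) (OQ : Om `<=` hb s0 0 a) (p1 : 1 < p).
Local Notation I f := (\int[mu]_(x in Om) f x).
Local Notation intg f := (mu.-integrable Om (EFin \o f)).
Implicit Types (u v phi psi eta : V -> R) (g G : V -> V).
Local Notation Q := (hb s0 0 a).

Let mO : measurable Om. Proof. exact: open_measurable_rV. Qed.
Let mQ : measurable Q. Proof. exact: measurable_hb. Qed.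
Let fQ : (mu Q < +oo)%E. Proof. exact: (hb_fin hN s0p). Qed.
Let p0 : 0 < p. Proof. exact: lt_trans p1. Qed.
Let p1' : 1 <= p. Proof. exact: ltW. Qed.
Let fO : (mu Om < +oo)%E.
Proof. by apply: le_lt_trans fQ; apply: le_measure; rewrite ?inE. Qed.

Definition bnd (A : R) u g := n u <= A /\ forall i, n (gco i g) <= A.

Lemma test_bnd_Q (A : R) phi : test_function Om phi -> bnd A phi (tgrad phi) ->
  0 <= A -> nrm mu Q p phi <= N.+1%:R * A /\ nrm mu Q p (Gr phi) <= N.+1%:R * A.
Proof.
move=> tphi [h1 h2] A0; split.
  rewrite -(nrm_supp mO mQ OQ p0); last by move=> x; exact: test_out tphi.
  by apply: (le_trans h1); rewrite ler_peMl// ler1n.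
apply: (le_trans (nrm_Gr_le hN a s0p p1 tphi)).
apply: (@le_trans _ _ (\sum_(i < N) A)).
  apply: ler_sum => i _; rewrite -(nrm_supp mO mQ OQ p0); last first.
    by move=> x; exact: test_out (test_pd i tphi).
  by have := h2 i; rewrite gco_tgrad.
by rewrite sumr_const card_ord -[leLHS]mulr_natl ler_wpM2r// ler_nat.
Qed.

Lemma bnd_near (A e : R) u g phi : Sob u g -> bnd A u g -> test_function Om phi ->
  d u phi <= e -> (forall i, d (gco i g) (pd i phi) <= e) -> bnd (A + e) phi (tgrad phi).
Proof.
move=> [Lu Lg _] [h1 h2] tphi h3 h4; split.
  apply: (le_trans (nrm_le_dist mO p1' (test_Lp oO fO p1 tphi) Lu)).
  by apply: lerD h1 _; rewrite dist_sym.
move=> i; rewrite gco_tgrad.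
apply: (le_trans (nrm_le_dist mO p1' (test_Lp oO fO p1 (test_pd i tphi)) (Lg i))).
by apply: lerD (h2 i) _; rewrite dist_sym; exact: h4.
Qed.

Lemma Sob_rellich (un : nat -> V -> R) (gn : nat -> V -> V) (A : R) :
  (forall m, Sob (un m) (gn m)) -> (forall m, bnd A (un m) (gn m)) ->
  exists k : nat -> nat, (forall m, (k m < k m.+1)%N) /\
  exists2 u, L u & d (un (k m)) u @[m --> \oo] --> 0.
Proof.
move=> S B; have /choice[phi phiP] : forall m : nat, exists phi, [/\ test_function Om phi,
    d (un m) phi < m.+1%:R^-1 & forall i, d (gco i (gn m)) (pd i phi) < m.+1%:R^-1].
  by move=> m; have [_ _] := S m; apply; rewrite invr_gt0.
have t m : test_function Om (phi m) by case: (phiP m).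
have A0 : 0 <= A by apply: le_trans (B 0%N).1; exact: nrm_ge0.
have B' m : bnd (A + 1) (phi m) (tgrad (phi m)).
  have [_ h1 h2] := phiP m; have le1 : m.+1%:R^-1 <= 1 :> R by rewrite invf_le1// ler1n.
  apply: (bnd_near (S m) (B m) (t m)); first exact: ltW (lt_le_trans h1 le1).
  by move=> i; exact: ltW (lt_le_trans (h2 i) le1).
have A1 : 0 <= A + 1 by rewrite addr_ge0.
have [k [kS [u Lu cu]]] := rellich_test hN s0p (lexx N%:R) p1 t
  (fun m => (test_bnd_Q (t m) (B' m) A1).1) (fun m => (test_bnd_Q (t m) (B' m) A1).2).
exists k; split=> //; exists u; first exact: Lp_subset Lu.
have Lu' : L u by exact: Lp_subset Lu.
have kn := subseq_ge kS.
apply: (cvg0_le (g := fun m => m.+1%:R^-1 + dist mu Q p (phi (k m)) u)); last first.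
  by rewrite -[0]addr0; apply: cvgD; [exact: cvg_harmonic|exact: cu].
move=> m; rewrite (ger0_norm (dist_ge0 _ _ _ _ _)).
have Lphi : L (phi (k m)) by exact: (test_Lp oO fO p1 (t _)).
apply: (le_trans (dist_tri mO p1' (Sob_Lp (S (k m))) Lphi Lu')); apply: lerD.
  have [_ h1 _] := phiP (k m); apply: (le_trans (ltW h1)).
  by rewrite lef_pV2 ?posrE// ler_nat ltnS.
have LphiQ : Lp mu Q p (phi (k m)) by apply: (bm_Lp hN a s0p p1); exact: bm_test (t _).
have := nrm_subset mO mQ OQ p0 (Lp_sub mQ p1' LphiQ Lu).
exact.
Qed.

Lemma Sob_tests (A : R) u g : Sob u g -> bnd A u g -> exists phi : nat -> V -> R,
  [/\ forall m, test_function Om (phi m), ae (fun x => phi m x @[m --> \oo] --> u x) &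
    forall m, nrm mu Q p (phi m) <= N.+1%:R * (A + 1) /\
      nrm mu Q p (Gr (phi m)) <= N.+1%:R * (A + 1)].
Proof.
move=> S B; have [phi [t c1 c2 cae]] := Sob_seq oO fO p1 S.
have A0 : 0 <= A by apply: le_trans B.1; exact: nrm_ge0.
have near1 : \forall m \near \oo, `|d (phi m) u| < 1 by exact: cvg0_near c1 _.
have near2 : \forall m \near \oo, forall i, `|d (pd i (phi m)) (gco i g)| < 1.
  by apply: filter_forall => i; exact: cvg0_near (c2 i) _.
have [m0 _ hm0] := filterI near1 near2.
exists (fun m => phi (m + m0)%N); split=> [m||m]; first exact: t.
  by apply: filterS cae => x h Ox; exact: (subseq_cvg (k := fun m => (m + m0)%N) (fun m => leq_addr m0 m) (h Ox)).
have [h1 h2] := hm0 (m + m0)%N (leq_addl _ _).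
apply: test_bnd_Q; [exact: t| |by rewrite addr_ge0].
apply: (bnd_near S B (t _)).
  by rewrite dist_sym; apply: le_trans (ltW h1); exact: ler_norm.
by move=> i; rewrite dist_sym; apply: le_trans (ltW (h2 i)); exact: ler_norm.
Qed.

Let A1_gt0 (A : R) : 0 <= A -> 0 < N.+1%:R * (A + 1).
Proof. by move=> A0; rewrite mulr_gt0// ltr_wpDl. Qed.

Lemma Sob_morrey (A : R) : N%:R < p -> 0 <= A ->
  exists2 K : R, 0 <= K & forall u g, Sob u g -> bnd A u g -> ae (fun x => `|u x| <= K).
Proof.
move=> Np A0; have [K KP] := morrey_test hN Om a s0p (lexx N%:R) p1 Np (A1_gt0 A0).
exists `|K| => // u g S B; have [phi [t cae b]] := Sob_tests S B.
apply: filterS cae => x h Ox; have {}h := cvg_norm (h Ox).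
have hl : `|phi m x| @[m --> \oo] --> `|u x| by exact: h.
rewrite -(cvg_lim (@Rhausdorff R) hl); apply: limr_le; first exact: cvgP hl.
apply: nearW => m; have [b1 b2] := b m.
exact: le_trans (KP _ (t m) b1 b2 x (OQ Ox)) (ler_norm K).
Qed.

Lemma Sob_sobolev (A dd : R) : N%:R <= dd -> p < dd -> 0 <= A ->
  exists2 K : R, 0 <= K & forall u g, Sob u g -> bnd A u g ->
    Lp mu Om (p * dd / (dd - p)) u /\ nrm mu Om (p * dd / (dd - p)) u <= K.
Proof.
move=> Nd pd_ A0; have [K KP] := sobolev_test hN Om a s0p Nd p1 pd_ (A1_gt0 A0).
set q := p * dd / (dd - p).
have dp0 : 0 < dd - p by rewrite subr_gt0.
have q1 : 1 <= q.
  rewrite /q ler_pdivlMr// mul1r; apply: (@le_trans _ _ dd); first by rewrite gerBl ltW.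
  by rewrite ler_peMl// ltW// (lt_trans p0).
have q0 : 0 < q by exact: lt_le_trans q1.
exists `|K| => // u g S B; have [phi [t cae b]] := Sob_tests S B.
have LQ m : Lp mu Q q (phi m).
  have [mf [M fM]] := bm_test (t m).
  by apply: (Lp_bounded mQ q1 fQ (measurable_funTS mf)) => x _; exact: fM.
apply: (nrm_fatou mO q1 (fun m => Lp_subset mO mQ OQ (LQ m)) (Sob_Lp S).1 cae) => m.
have [b1 b2] := b m.
apply: (le_trans (nrm_subset mO mQ OQ q0 (LQ m))).
exact: le_trans (KP _ (t m) b1 b2) (ler_norm K).
Qed.

Definition tail (M : R) eta (x : V) : R := if M < `|eta x| then `|eta x| else 0.

Lemma tail_ge0 M eta x : 0 <= tail M eta x.
Proof. by rewrite /tail; case: ifP. Qed.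

Lemma tail_le M eta x : tail M eta x <= `|eta x|.
Proof. by rewrite /tail; case: ifP. Qed.

Lemma le_tail M eta x : 0 <= M -> `|eta x| <= M + tail M eta x.
Proof. by rewrite /tail; case: ltP => [_ M0|h _]; [rewrite lerDr|rewrite addr0]. Qed.

Lemma measurable_tail M eta : measurable_fun Om eta -> measurable_fun Om (tail M eta).
Proof.
move=> me; have ma : measurable_fun Om (fun x => `|eta x|) by exact: measurableT_comp.
apply: (measurable_fun_if mO).
- by apply: measurable_fun_ltr => //; exact: measurable_cst.
- by apply: measurable_funS ma => // x [].
- exact: measurable_cst.
Qed.

Lemma tail_nrm (q : R) eta (e : R) : 1 <= q -> Lp mu Om q eta -> 0 < e ->
  exists2 M : R, 0 <= M & Lp mu Om q (tail M eta) /\ nrm mu Om q (tail M eta) <= e.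
Proof.
move=> q1 Le e0; have q0 : 0 < q by exact: lt_le_trans q1.
have Lt M : Lp mu Om q (tail M eta).
  apply: (Lp_le mO (ltW q0) (measurable_tail M Le.1) _ Le).1 => x _.
  by rewrite ger0_norm ?tail_ge0// tail_le.
have L0 : Lp mu Om q (fun=> 0) by apply: Lp0; [exact: mO|rewrite gt_eqF].
have c : nrm mu Om q (fun x => tail n%:R eta x - 0) @[n --> \oo] --> 0.
  apply: (nrm_dct mO q1 (fun n => (Lt n%:R).1) L0.1 Le).
  - apply: nearW => x _; apply: cvg_near_cst.
    exists (Num.bound `|eta x|) => // n /= hn; rewrite /tail.
    have h : `|eta x| < n%:R.
      by apply: (lt_le_trans (archi_boundP (normr_ge0 _))); rewrite ler_nat.
    by rewrite ltNge (ltW h).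
  - by move=> n; apply: nearW => x _; rewrite subr0 ger0_norm ?tail_ge0// tail_le.
have [n hn] := filter_ex (cvg0_near c e0).
exists n%:R => //; split; first exact: Lt.
apply: (le_trans _ (ltW (le_lt_trans (ler_norm _) hn))).
rewrite le_eqVlt; apply/orP; left; apply/eqP; apply: nrm_eq => x _; by rewrite subr0.
Qed.

(* Uniform integrability of [eta * u] over bounded sets of the Sobolev space. *)
Definition tail_ok eta := measurable_fun Om eta /\
  forall A : R, 0 <= A -> forall e : R, 0 < e -> exists2 M : R, 0 <= M &
    forall u g, Sob u g -> bnd A u g ->
      intg (fun x => tail M eta x * `|u x|) /\ I (fun x => tail M eta x * `|u x|) <= e.

(** Above the dimension, Morrey's embedding bounds [u] by a constant a.e., so a small tail in L^1 is
    enough. *)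
Lemma tail_ok_L1 eta : N%:R < p -> Lp mu Om 1 eta -> tail_ok eta.
Proof.
move=> Np Le; split; first exact: Le.1.
move=> A A0 e e0; have [K K0 KP] := Sob_morrey Np A0.
have K1 : 0 < K + 1 by rewrite ltr_wpDl.
have e1 : 0 < e / (K + 1) by rewrite divr_gt0.
have [M M0 [LM nM]] := tail_nrm (lexx 1) Le e1.
have ti : intg (tail M eta) := Lp_intg mO (lexx 1) fO LM.
exists M => // u g Su B; have uK := KP u g Su B.
have mf : measurable_fun Om (fun x => tail M eta x * `|u x|).
  apply: measurable_funM; first exact: LM.1.
  by apply: measurableT_comp => //; exact: (Sob_Lp Su).1.
have tK := intg_scale mO (K + 1) ti.
have le x : `|u x| <= K -> tail M eta x * `|u x| <= (K + 1) * tail M eta x.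
  move=> h; rewrite mulrC; apply: ler_wpM2r; first exact: tail_ge0.
  by apply: (le_trans h); rewrite lerDl.
have fi : intg (fun x => tail M eta x * `|u x|).
  apply: (intg_le_ae mO mf _ tK); apply: filterS uK => x h Ox.
  by rewrite ger0_norm ?mulr_ge0 ?tail_ge0//; apply: le; exact: h.
split=> //; apply: (@le_trans _ _ ((K + 1) * I (tail M eta))).
  rewrite -(I_scale mO _ ti); apply: (I_le_ae mO fi tK).
  by apply: filterS uK => x h Ox; apply: le; exact: h.
rewrite mulrC -ler_pdivlMr//; apply: le_trans nM; rewrite nrm1E//.
rewrite le_eqVlt; apply/orP; left; apply/eqP/I_eq => x _.
by rewrite ger0_norm ?tail_ge0.
Qed.

(** The Sobolev embedding for the fictitious dimension [dd] bounds [u] in L^r, and the tail is small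
    in the conjugate space. *)
Lemma tail_ok_hoelder eta (dd r r' : R) : N%:R <= dd -> p < dd ->
  r = p * dd / (dd - p) -> 1 <= r' -> r'^-1 + r^-1 = 1 -> Lp mu Om r' eta -> tail_ok eta.
Proof.
move=> Nd pd_ rE r1 rr Le; split; first exact: Le.1.
move=> A A0 e e0; have [K K0 KP] := Sob_sobolev Nd pd_ A0.
rewrite -rE in KP.
have rp : 1 <= r.
  rewrite rE ler_pdivlMr ?subr_gt0// mul1r; apply: (@le_trans _ _ dd); first by rewrite gerBl ltW.
  by rewrite ler_peMl// ltW// (lt_trans p0).
have K1 : 0 < K + 1 by rewrite ltr_wpDl.
have e1 : 0 < e / (K + 1) by rewrite divr_gt0.
have [M M0 [LM nM]] := tail_nrm r1 Le e1.
exists M => // u g Su B; have [Lu nu] := KP u g Su B.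
have La : Lp mu Om r (fun x => `|u x|).
  apply: (Lp_le mO _ _ _ Lu).1.
  - exact: le_trans rp.
  - by apply: measurableT_comp => //; exact: Lu.1.
  - by move=> x _; rewrite normr_id.
have [fi fI] := mul_hoelder mO r1 rp rr LM La.
split=> //; apply: (@le_trans _ _ (I (fun x => `|tail M eta x * `|u x| |))).
  rewrite le_eqVlt; apply/orP; left; apply/eqP/I_eq => x _.
  by rewrite [RHS]ger0_norm// mulr_ge0// tail_ge0.
apply: (le_trans fI).
have na : nrm mu Om r (fun x => `|u x|) <= K.
  apply: le_trans nu; apply: (Lp_le mO _ La.1 _ Lu).2; first exact: le_trans rp.
  by move=> x _; rewrite normr_id.
apply: (@le_trans _ _ (e / (K + 1) * K)).
  by apply: ler_pM => //; exact: nrm_ge0.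
by rewrite mulrAC ler_pdivrMr// ler_wpM2l ?(ltW e0)// lerDl.
Qed.

Lemma Lp_exp_le (q r : R) u : 0 < r -> r <= q -> Lp mu Om q u -> Lp mu Om r u.
Proof.
move=> r0 rq [mu_ ui]; split=> //.
have i1 : intg (fun x => 1 + `|u x| `^ q).
  by apply: (intg_add mO _ ui); apply: intg_cst; [exact: mO|exact: fO].
apply: (intg_le mO _ _ i1); first exact: mpow.
move=> x _; rewrite ger0_norm ?powR_ge0//.
have [h|/ltW h] := leP `|u x| 1.
  have := powR_le (ltW r0) (normr_ge0 _) h; rewrite powR1 => h'.
  by apply: (le_trans h'); rewrite lerDl powR_ge0.
by apply: (@le_trans _ _ (`|u x| `^ q)); [exact: ler_powR|rewrite lerDr].
Qed.

Lemma inLp_Lp (q : R) eta : 0 < q -> inLp Om q%:E eta -> Lp mu Om q eta.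
Proof. by move=> q0; rewrite /inLp -lebmE => -[me he]; exact: Lnorm_Lp. Qed.

Lemma inY1_tail_ok eta : inY1 Om p eta -> tail_ok eta.
Proof.
move=> [h1 h2 h3]; have [pN|pN|pN] := ltgtP p N%:R.
- have Np : 0 < N%:R - p by rewrite subr_gt0.
  pose r : R := pstar N p.
  have r1 : 1 < r.
    rewrite /r /pstar ltr_pdivlMr// mul1r ltrBlDr.
    by apply: (@lt_le_trans _ _ (N%:R * p)); [rewrite ltr_pMr// (lt_trans p0)|rewrite lerDl ltW].
  have r0 : 0 < r by exact: lt_trans r1.
  have r10 : 0 < r - 1 by rewrite subr_gt0.
  have hc : hoelder_conjugate r%:E = (r / (r - 1))%:E.
    rewrite /hoelder_conjugate /= eqe gt_eqF//=.
    by rewrite -EFinB inver gt_eqF.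
  have := h3 pN; rewrite hc => /inLp_Lp Le.
  apply: (@tail_ok_hoelder eta N%:R r (r / (r - 1))) => //.
  + by rewrite /r /pstar [N%:R * p]mulrC.
  + by rewrite ler_pdivlMr// mul1r gerBl.
  + by rewrite invf_div; field; rewrite !gt_eqF.
  + by apply: Le; rewrite divr_gt0.
- by apply: tail_ok_L1 => //; apply: inLp_Lp => //; exact: h1.
- have [q q1 /inLp_Lp Lq] := h2 pN.
  have q0 : 0 < q by exact: lt_trans q1.
  have q10 : 0 < q - 1 by rewrite subr_gt0.
  (* For p = N every finite exponent is reached: r is at least the conjugate of q and larger than p,
     and [dd] solves p dd / (dd - p) = r. *)
  pose r : R := Num.max (q / (q - 1)) (p + 1).
  have rp : p < r by rewrite lt_max ltrDl ltr01 orbT.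
  have r1 : 1 < r by exact: lt_trans rp.
  have rp0 : 0 < r - p by rewrite subr_gt0.
  have r10 : 0 < r - 1 by rewrite subr_gt0.
  have r0 : 0 < r by exact: lt_trans r1.
  pose dd := p * r / (r - p).
  have dp : p < dd.
    by rewrite /dd ltr_pdivlMr// ltr_pM2l// gtrBl.
  apply: (@tail_ok_hoelder eta dd r (r / (r - 1))) => //.
  + by rewrite -pN ltW.
  + have -> : dd - p = p * p / (r - p) by rewrite /dd; field; rewrite gt_eqF.
    by rewrite invf_div /dd; field; rewrite !gt_eqF.
  + by rewrite ler_pdivlMr// mul1r gerBl.
  + by rewrite invf_div; field; rewrite !gt_eqF.
  + apply: (@Lp_exp_le q); [by rewrite divr_gt0| |exact: Lq].
    have : q / (q - 1) <= r by rewrite le_max lexx.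
    rewrite !ler_pdivrMr// => h; lra.
Qed.

Lemma bnd_sub (A : R) u v g G : Sob u g -> Sob v G -> bnd A u g -> bnd A v G ->
  bnd (A + A) (fun x => u x - v x) (fun x => g x - G x).
Proof.
move=> Su Sv [u1 u2] [v1 v2]; split.
  apply: (le_trans (nrm_sub mO p1' (Sob_Lp Su) (Sob_Lp Sv))); exact: lerD u1 v1.
move=> i; have -> : gco i (fun x => g x - G x) = (fun x => gco i g x - gco i G x).
  by apply/funext => x; rewrite /gco !mxE.
apply: (le_trans (nrm_sub mO p1' (Sob_Lpg i Su) (Sob_Lpg i Sv))).
exact: lerD (u2 i) (v2 i).
Qed.

Lemma tail_intg eta u g : tail_ok eta -> Sob u g -> intg (fun x => eta x * u x).
Proof.
move=> [me te] Su; pose A : R := nrm mu Om p u + \sum_i nrm mu Om p (gco i g).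
have A0 : 0 <= A by rewrite addr_ge0 ?nrm_ge0// sumr_ge0// => i _; exact: nrm_ge0.
have B : bnd A u g.
  split; first by rewrite lerDl sumr_ge0// => i _; exact: nrm_ge0.
  move=> i; rewrite /A (bigD1 i)//= addrCA lerDl addr_ge0 ?nrm_ge0// sumr_ge0// => j _.
  exact: nrm_ge0.
have [M M0 MP] := te A A0 1 ltr01; have [ti _] := MP u g Su B.
have ui := intg_abs (Lp_intg mO p1' fO (Sob_Lp Su)).
apply: (intg_le mO _ _ (intg_add mO (intg_scale mO M ui) ti)).
  by apply: measurable_funM => //; exact: (Sob_Lp Su).1.
by move=> x _; rewrite normrM -mulrDl ler_wpM2r// le_tail.
Qed.

(** |eta| is at most M plus its tail: the first part is controlled by the convergence in L^p, hence
    in L^1, and the tail is uniformly small. *)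
Lemma tail_cvg eta (un : nat -> V -> R) (gn : nat -> V -> V) u g (A : R) :
  tail_ok eta -> (forall n, Sob (un n) (gn n)) -> (forall n, bnd A (un n) (gn n)) ->
  Sob u g -> bnd A u g -> d (un n) u @[n --> \oo] --> 0 ->
  I (fun x => `|eta x * (un n x - u x)|) @[n --> \oo] --> 0.
Proof.
move=> te S B Su Bu cu; have [me te'] := te.
have A0 : 0 <= A by apply: le_trans Bu.1; exact: nrm_ge0.
have [C C0 CP] := I_dist mO p1' fO.
apply/cvgr0Pnorm_lt => e e0; have e2 : 0 < e / 2 by rewrite divr_gt0.
have [M M0 MP] := te' (A + A) (addr_ge0 A0 A0) (e / 2) e2.
have lim : M * (C * d (un n) u) @[n --> \oo] --> 0.
  rewrite -(mulr0 M); apply: cvgM; first exact: cvg_cst.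
  by rewrite -(mulr0 C); apply: cvgM; [exact: cvg_cst|exact: cu].
have := cvg0_near lim e2; apply: filterS => n hn.
have Sd := Sob_sub oO fO p1 (S n) Su.
have [ti tI] := MP _ _ Sd (bnd_sub (S n) Su (B n) Bu).
have ei := tail_intg te Sd.
have di := intg_abs (Lp_intg mO p1' fO (Sob_Lp Sd)).
have di' := intg_scale mO M di.
rewrite ger0_norm; last by apply: I_ge0 => x _; exact: normr_ge0.
rewrite (splitr e); apply: (@le_lt_trans _ _ (M * I (fun x => `|un n x - u x|) +
    I (fun x => tail M eta x * `|un n x - u x|))).
  rewrite -(I_scale mO M di) -(I_add mO di' ti).
  apply: (I_le mO (intg_abs ei) (intg_add mO di' ti)) => x _.
  by rewrite normrM -mulrDl ler_wpM2r// le_tail.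
apply: ltr_leD => //; apply: le_lt_trans hn; apply: le_trans (ler_norm _).
by apply: ler_wpM2l => //; exact: CP (Sob_Lp (S n)) (Sob_Lp Su).
Qed.

End sobolev_embedding.


(** * Weak convergence *)

Section euclidean.
Variables (R : realType) (N : nat).
Local Notation V := 'rV[R]_N.
Implicit Types (a b c : V).

Lemma dotvC a b : dotv a b = dotv b a.
Proof. by apply: eq_bigr => i _; rewrite mulrC. Qed.

Lemma dotvDl a b c : dotv (a + b) c = dotv a c + dotv b c.
Proof. by rewrite /dotv -big_split; apply: eq_bigr => i _; rewrite mxE mulrDl. Qed.

Lemma dotvZl (r : R) a b : dotv (r *: a) b = r * dotv a b.
Proof. by rewrite /dotv mulr_sumr; apply: eq_bigr => i _; rewrite mxE mulrA. Qed.

Lemma dotvDr a b c : dotv c (a + b) = dotv c a + dotv c b.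
Proof. by rewrite !(dotvC c) dotvDl. Qed.

Lemma dotvZr (r : R) a b : dotv a (r *: b) = r * dotv a b.
Proof. by rewrite !(dotvC a) dotvZl. Qed.

Lemma dotvNl a b : dotv (- a) b = - dotv a b.
Proof. by rewrite -scaleN1r dotvZl mulN1r. Qed.

Lemma dotvNr a b : dotv a (- b) = - dotv a b.
Proof. by rewrite dotvC dotvNl dotvC. Qed.

Lemma dotv_ge0 a : 0 <= dotv a a.
Proof. by apply: sumr_ge0 => i _; rewrite -expr2 sqr_ge0. Qed.

Lemma enorm_ge0 a : 0 <= enorm a. Proof. exact: sqrtr_ge0. Qed.

Lemma enorm_sq a : enorm a ^+ 2 = dotv a a.
Proof. by rewrite sqr_sqrtr// dotv_ge0. Qed.

Lemma coord_le_enorm a i : `|a 0 i| <= enorm a.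
Proof.
rewrite -sqrtr_sqr; apply: ler_wsqrtr; rewrite /dotv (bigD1 i)//= expr2 lerDl.
by apply: sumr_ge0 => j _; rewrite -expr2 sqr_ge0.
Qed.

Lemma enorm_eq0 a : enorm a = 0 -> a = 0.
Proof.
move=> a0; apply/rowP => i; rewrite mxE; apply/eqP; rewrite -normr_le0 -a0.
exact: coord_le_enorm.
Qed.

(** Cauchy-Schwarz, from the nonnegativity of the square of (b.b) a - (a.b) b. *)
Lemma dotv_le a b : `|dotv a b| <= enorm a * enorm b.
Proof.
have [b0|b0] := eqVneq (enorm b) 0.
  by rewrite (enorm_eq0 b0) -(scale0r 0) dotvZr mul0r normr0 mulr_ge0 ?enorm_ge0.
have bb : 0 < dotv b b by rewrite -enorm_sq exprn_gt0// lt0r b0 enorm_ge0.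
have h := dotv_ge0 (dotv b b *: a - dotv a b *: b).
have {h} h : 0 <= dotv b b * (dotv a a * dotv b b - dotv a b ^+ 2).
  move: h; rewrite dotvDl !dotvDr !dotvNl !dotvNr !dotvZl !dotvZr (dotvC b a).
  by move=> h; apply: (le_trans h); rewrite le_eqVlt; apply/orP; left; apply/eqP; ring.
rewrite -(ler_pXn2r (n := 2)) ?nnegrE ?mulr_ge0 ?enorm_ge0//.
rewrite real_normK ?num_real// exprMn !enorm_sq -subr_ge0.
by rewrite -(pmulr_rge0 _ bb).
Qed.

Lemma enormZ (r : R) a : enorm (r *: a) = `|r| * enorm a.
Proof. by rewrite /enorm dotvZl dotvZr mulrA -expr2 sqrtrM ?sqr_ge0// sqrtr_sqr. Qed.

Lemma enormN a : enorm (- a) = enorm a.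
Proof. by rewrite -scaleN1r enormZ normrN1 mul1r. Qed.

Lemma enorm0 : enorm (0 : V) = 0.
Proof. by rewrite -(scale0r 0) enormZ normr0 mul0r. Qed.

Lemma enormD a b : enorm (a + b) <= enorm a + enorm b.
Proof.
rewrite -(ler_pXn2r (n := 2)) ?nnegrE ?addr_ge0 ?enorm_ge0//.
rewrite enorm_sq dotvDl !dotvDr (dotvC b a) sqrrD !enorm_sq.
by have := le_trans (ler_norm _) (dotv_le a b); rewrite -mulr_natl; lra.
Qed.

Lemma enorm_dist a b : `|enorm a - enorm b| <= enorm (a - b).
Proof.
have h1 := enormD (a - b) b; have h2 := enormD (b - a) a.
rewrite subrK in h1; rewrite subrK -(opprB a b) enormN in h2.
by rewrite ler_norml; apply/andP; split; lra.
Qed.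

Lemma enorm_le_sum a : enorm a <= \sum_i `|a 0 i|.
Proof.
rewrite -(ler_pXn2r (n := 2)) ?nnegrE ?enorm_ge0 ?sumr_ge0// enorm_sq /dotv.
elim: (index_enum _) => [|i r IH]; first by rewrite !big_nil expr2 mulr0.
rewrite !big_cons sqrrD; set S := \sum_(j <- r) `|_| in IH *.
have S0 : 0 <= S by exact: sumr_ge0.
have h : a 0 i * a 0 i = `|a 0 i| ^+ 2 by rewrite real_normK ?num_real.
rewrite h -addrA; apply: lerD => //; apply: (le_trans IH).
by rewrite lerDr mulrn_wge0// mulr_ge0.
Qed.

Lemma enorm_continuous : continuous (@enorm R N).
Proof.
move=> a A /= /nbhs_ballP[e /= e0 eA]; apply/rV_nbhs.
exists (e / N.+1%:R); first by rewrite divr_gt0.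
move=> y ay; apply: eA; rewrite /ball /=; apply: (le_lt_trans (enorm_dist a y)).
apply: (le_lt_trans (enorm_le_sum _)).
apply: (@le_lt_trans _ _ (\sum_(i < N) (e / N.+1%:R))).
  by apply: ler_sum => i _; rewrite !mxE; exact: ltW (ay i).
rewrite sumr_const card_ord -[ltLHS]mulr_natl mulrA ltr_pdivrMr// mulrC.
by rewrite ltr_pM2l// ltr_nat.
Qed.

Lemma parallelogram a b : enorm (a - b) ^+ 2 + enorm (a + b) ^+ 2 =
  2 * (enorm a ^+ 2 + enorm b ^+ 2).
Proof. by rewrite !enorm_sq !dotvDl !dotvDr !dotvNl !dotvNr (dotvC b a); ring. Qed.

End euclidean.

Section strict_young.
Variables (R : realType) (p : R).
Hypothesis p1 : 1 < p.

Let p0 : 0 < p. Proof. exact: lt_trans p1. Qed.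
Let p10 : 0 < p - 1. Proof. by rewrite subr_gt0. Qed.

(** With a = e^s, b = e^t and x = s - t nonzero this reads p < e^((p-1)x) + (p-1) e^(-x), and both
    exponentials lie strictly above their tangents at 0. *)
Lemma strict_young (a b : R) : 0 <= a -> 0 <= b -> a != b ->
  p * (b `^ (p - 1) * a) < a `^ p + (p - 1) * b `^ p.
Proof.
move=> a0 b0 ab; have [bE|bn] := eqVneq b 0.
  rewrite bE !powR0 ?gt_eqF// mul0r !mulr0 addr0 powR_gt0// lt0r a0 andbT.
  by rewrite bE in ab.
have [aE|an] := eqVneq a 0.
  by rewrite aE mulr0 mulr0 powR0 ?gt_eqF// add0r mulr_gt0// powR_gt0// lt0r bn.
have a_gt0 : 0 < a by rewrite lt0r an.
have b_gt0 : 0 < b by rewrite lt0r bn.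
pose s := ln a; pose t := ln b.
have st : s - t != 0.
  rewrite subr_eq0; apply: contra ab => /eqP st.
  by rewrite -(lnK a_gt0) -(lnK b_gt0) -/s st.
have aE : a = expR s by rewrite /s lnK.
have bE : b = expR t by rewrite /t lnK.
have h1 := expR_gt1Dx (_ : (p - 1) * (s - t) != 0).
have {}h1 : 1 + (p - 1) * (s - t) < expR ((p - 1) * (s - t)).
  by apply: h1; rewrite mulf_neq0// gt_eqF.
have h2 : 1 - (s - t) < expR (- (s - t)) by apply: expR_gt1Dx; rewrite oppr_eq0.
have h3 : p < expR ((p - 1) * (s - t)) + (p - 1) * expR (- (s - t)).
  have := h2; rewrite -(ltr_pM2l p10) => h2'.
  by apply: le_lt_trans (ltrD h1 h2'); rewrite le_eqVlt; apply/orP; left; apply/eqP; ring.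
rewrite aE bE /powR !gt_eqF ?expR_gt0// !expRK -expRD.
have e0 := expR_gt0 ((p - 1) * t + s); rewrite -(ltr_pM2r e0) in h3.
apply: (lt_le_trans h3); rewrite mulrDl -mulrA -!expRD.
rewrite (_ : (p - 1) * (s - t) + ((p - 1) * t + s) = p * s); last by ring.
by rewrite (_ : - (s - t) + ((p - 1) * t + s) = p * t)//; ring.
Qed.

Lemma powR_mid (a b : R) : 0 <= a -> 0 <= b ->
  (2^-1 * (a + b)) `^ p <= 2^-1 * (a `^ p + b `^ p).
Proof.
move=> a0 b0; set f := 2^-1 * (a + b).
have f0 : 0 <= f by rewrite mulr_ge0 ?invr_ge0 ?addr_ge0.
have h1 := young_powR p1 a0 f0; have h2 := young_powR p1 b0 f0.
have h3 : f `^ (p - 1) * a + f `^ (p - 1) * b = 2 * f `^ p.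
  by rewrite -(powR_pred p1 f0) -mulrDr /f; field.
have h4 : p * (f `^ (p - 1) * a) + p * (f `^ (p - 1) * b) = p * (2 * f `^ p).
  by rewrite -mulrDr h3.
by lra.
Qed.

Lemma powR_mid_lt (a b : R) : 0 <= a -> 0 <= b -> a != b ->
  (2^-1 * (a + b)) `^ p < 2^-1 * (a `^ p + b `^ p).
Proof.
move=> a0 b0 ab; set f := 2^-1 * (a + b).
have f0 : 0 <= f by rewrite mulr_ge0 ?invr_ge0 ?addr_ge0.
have af : a != f.
  apply: contra ab => /eqP af; apply/eqP; have : a = 2^-1 * (a + b) by [].
  lra.
have h1 := strict_young a0 f0 af; have h2 := young_powR p1 b0 f0.
have h3 : f `^ (p - 1) * a + f `^ (p - 1) * b = 2 * f `^ p.
  by rewrite -(powR_pred p1 f0) -mulrDr /f; field.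
have h4 : p * (f `^ (p - 1) * a) + p * (f `^ (p - 1) * b) = p * (2 * f `^ p).
  by rewrite -mulrDr h3.
by lra.
Qed.

Lemma powR_lt (a b : R) : 0 <= a -> a < b -> a `^ p < b `^ p.
Proof.
move=> a0 ab; apply: gt0_ltr_powR => //; rewrite nnegrE//.
exact: le_trans (ltW ab).
Qed.

End strict_young.

(** * Uniform convexity of the p-th power of the Euclidean norm *)

Section uniform_convexity.
Variables (R : realType) (N : nat) (p : R).
Hypothesis p1 : 1 < p.
Local Notation V := 'rV[R]_N.
Implicit Types (a b : V).

Let p0 : 0 < p. Proof. exact: lt_trans p1. Qed.

Definition mid a b : V := 2^-1 *: (a + b).

(** The defect of midpoint convexity, homogeneous of degree p and positive off the diagonal. *)
Definition gap a b : R := 2^-1 * (enorm a `^ p + enorm b `^ p) - enorm (mid a b) `^ p.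

Lemma enorm_mid a b : enorm (mid a b) <= 2^-1 * (enorm a + enorm b).
Proof.
by rewrite /mid enormZ ger0_norm ?invr_ge0// ler_wpM2l ?invr_ge0// enormD.
Qed.

Let max_pow_le (x y : R) : 0 <= x -> 0 <= y -> (Num.max x y) `^ p <= x `^ p + y `^ p.
Proof. by move=> x0 y0; have [h|h] := leP x y; [rewrite lerDr|rewrite lerDl]; exact: powR_ge0. Qed.

Lemma gap_ge0 a b : 0 <= gap a b.
Proof.
rewrite subr_ge0; apply: le_trans (powR_mid p1 (enorm_ge0 a) (enorm_ge0 b)).
exact: powR_le (ltW p0) (enorm_ge0 _) (enorm_mid a b).
Qed.

Lemma gap_gt0 a b : a != b -> 0 < gap a b.
Proof.
move=> ab; rewrite subr_gt0; have [e|ne] := eqVneq (enorm a) (enorm b); last first.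
  apply: le_lt_trans (powR_mid_lt p1 (enorm_ge0 a) (enorm_ge0 b) ne).
  exact: powR_le (ltW p0) (enorm_ge0 _) (enorm_mid a b).
rewrite e (_ : 2^-1 * (enorm b `^ p + enorm b `^ p) = enorm b `^ p); last by field.
apply: powR_lt => //; first exact: enorm_ge0.
rewrite -(ltr_pXn2r (n := 2)) ?nnegrE ?enorm_ge0//.
have := parallelogram a b; rewrite e /mid enormZ ger0_norm ?invr_ge0// exprMn.
have : 0 < enorm (a - b) ^+ 2.
  rewrite exprn_gt0// lt0r enorm_ge0 andbT; apply: contra ab => /eqP /enorm_eq0 /eqP.
  by rewrite subr_eq0.
by rewrite exprVn; lra.
Qed.

Lemma gapZ (t : R) a b : 0 <= t -> gap (t *: a) (t *: b) = t `^ p * gap a b.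
Proof.
move=> t0; have h2 : `|2^-1 : R| = 2^-1 by rewrite ger0_norm ?invr_ge0.
rewrite /gap /mid -scalerDr scalerA mulrC -scalerA !enormZ (ger0_norm t0) !h2.
by rewrite !powRM ?mulr_ge0 ?enorm_ge0 ?invr_ge0//; ring.
Qed.

Let pow_cont : continuous (fun t : R => `|t| `^ p).
Proof.
move=> t; have [->|t0] := eqVneq t 0; last first.
  apply: (@continuous_comp _ _ _ (fun t : R => `|t|) (fun t : R => t `^ p)).
    exact: norm_continuous.
  apply: differentiable_continuous; apply/derivable1_diffP.
  by apply: derivable_powR; rewrite in_itv/= andbT normr_gt0.
apply/cvgrPdist_lt => e e0; rewrite normr0 powR0 ?gt_eqF//.
have e1 : 0 < e `^ p^-1 by exact: powR_gt0.
exists (e `^ p^-1) => //= s hs0.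
have hs : `|s| < e `^ p^-1 by move: hs0; rewrite /= sub0r normrN.
rewrite sub0r normrN ger0_norm ?powR_ge0//.
rewrite -[ltRHS](powRVK (lt0r_neq0 p0) (ltW e0)).
exact: powR_lt.
Qed.

Let enormp_cont (T : topologicalType) (f : T -> V) : continuous f ->
  continuous (fun x => enorm (f x) `^ p).
Proof.
move=> cf x; rewrite (_ : (fun x => _) = (fun t : R => `|t| `^ p) \o (@enorm R N \o f)).
  apply: continuous_comp; last exact: pow_cont.
  by apply: continuous_comp; [exact: cf|exact: enorm_continuous].
by apply/funext => y /=; rewrite ger0_norm ?enorm_ge0.
Qed.

(** On the compact set of pairs in the unit ball with |a - b|^p >= dl, [gap] has a positive minimum;
    homogeneity extends the estimate to all pairs. Closer pairs are absorbed by the term in dl. *)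
Lemma uniform_convexity (dl : R) : 0 < dl -> exists2 C : R, 0 <= C & forall a b,
  enorm (a - b) `^ p <= dl * (enorm a `^ p + enorm b `^ p) + C * gap a b.
Proof.
move=> dl0; pose K : set (V * V) := [set ab | [/\ enorm ab.1 <= 1, enorm ab.2 <= 1 &
  dl <= enorm (ab.1 - ab.2) `^ p]].
have c1 : continuous (fun ab : V * V => ab.1) by move=> x; exact: cvg_fst.
have c2 : continuous (fun ab : V * V => ab.2) by move=> x; exact: cvg_snd.
have cB : continuous (fun ab : V * V => ab.1 - ab.2).
  by move=> x; apply: cvgB; [exact: c1|exact: c2].
have cM : continuous (fun ab : V * V => mid ab.1 ab.2).
  by move=> x; apply: cvgZr; apply: cvgD; [exact: c1|exact: c2].
have cK : compact K.
  pose B := cbox (const_mx (-1) : V) (const_mx 1).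
  apply: (@subclosed_compact _ K (B `*` B)); last 2 first.
  - by apply: compact_setX; exact: compact_cbox.
  - move=> [x y] [/= h1 h2 _]; split=> i /=; rewrite !mxE -ler_norml.
      exact: le_trans (coord_le_enorm x i) h1.
    exact: le_trans (coord_le_enorm y i) h2.
  have -> : K = ((fun ab : V * V => enorm ab.1) @^-1` [set t | t <= 1]) `&`
     ((fun ab : V * V => enorm ab.2) @^-1` [set t | t <= 1]) `&`
     ((fun ab : V * V => enorm (ab.1 - ab.2) `^ p) @^-1` [set t | dl <= t]).
    by apply/seteqP; split=> x; [case|case=> [[]]].
  have ce1 : continuous (fun ab : V * V => enorm ab.1).
    by move=> x; apply: continuous_comp; [exact: c1|exact: enorm_continuous].
  have ce2 : continuous (fun ab : V * V => enorm ab.2).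
    by move=> x; apply: continuous_comp; [exact: c2|exact: enorm_continuous].
  apply: closedI; first apply: closedI.
  - by move/continuous_closedP: ce1; apply; exact: closed_le.
  - by move/continuous_closedP: ce2; apply; exact: closed_le.
  - by move/continuous_closedP: (enormp_cont cB); apply; exact: closed_ge.
have [K0|nK] := pselect (K !=set0); last first.
  exists 0 => // a b; rewrite mul0r addr0.
  pose t := Num.max (enorm a) (enorm b).
  have t0 : 0 <= t by rewrite le_max enorm_ge0.
  have tp : t `^ p <= enorm a `^ p + enorm b `^ p.
    exact: max_pow_le (enorm_ge0 a) (enorm_ge0 b).
  apply: le_trans (ler_wpM2l (ltW dl0) tp); rewrite leNgt; apply/negP => h.
  have [tE|tn] := eqVneq t 0.
    have at0 : enorm a <= t by rewrite le_max lexx.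
    have bt0 : enorm b <= t by rewrite le_max lexx orbT.
    rewrite tE in at0 bt0.
    have a0 : enorm a = 0 by apply/eqP; rewrite eq_le at0 enorm_ge0.
    have b0 : enorm b = 0 by apply/eqP; rewrite eq_le bt0 enorm_ge0.
    move: h; rewrite tE (enorm_eq0 a0) (enorm_eq0 b0) subr0 enorm0 powR0 ?gt_eqF//.
    by rewrite mulr0 ltxx.
  have tgt : 0 < t by rewrite lt0r tn.
  apply: nK; exists (t^-1 *: a, t^-1 *: b); split=> /=.
  - by rewrite enormZ ger0_norm ?invr_ge0// mulrC ler_pdivrMr// mul1r le_max lexx.
  - by rewrite enormZ ger0_norm ?invr_ge0// mulrC ler_pdivrMr// mul1r le_max lexx orbT.
  - rewrite -scalerBr enormZ ger0_norm ?invr_ge0// powRM ?invr_ge0 ?enorm_ge0//.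
    rewrite -(powR_inv1 t0) -powRrM mulN1r powRN mulrC ler_pdivlMr ?powR_gt0//.
    exact: ltW.
have cg : continuous (fun ab : V * V => gap ab.1 ab.2).
  move=> x; apply: cvgB; last exact: (enormp_cont cM).
  apply: cvgM; first exact: cvg_cst.
  by apply: cvgD; [exact: (enormp_cont c1)|exact: (enormp_cont c2)].
have [c cKc mP] := compact_EVT_min K0 cK (continuous_subspaceT cg).
have [_ _ ab0] := set_mem cKc.
set m := gap c.1 c.2 in mP.
have m0 : 0 < m.
  apply: gap_gt0; apply/eqP => ab; move: ab0; rewrite ab subrr enorm0 powR0 ?gt_eqF//.
  by rewrite leNgt dl0.
(* |a - b|^p is at most 2^p t^p with t the larger norm, and t^p is at most [gap] / m by
   homogeneity. *)
clearbody m; exists (2 `^ p / m); first by rewrite divr_ge0 ?powR_ge0// ltW.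
move=> a b; pose t := Num.max (enorm a) (enorm b).
have t0 : 0 <= t by rewrite le_max enorm_ge0.
have ta : enorm a <= t by rewrite le_max lexx.
have tb : enorm b <= t by rewrite le_max lexx orbT.
have tp : t `^ p <= enorm a `^ p + enorm b `^ p.
  exact: max_pow_le (enorm_ge0 a) (enorm_ge0 b).
clearbody t; have [h|h] := leP (enorm (a - b) `^ p) (dl * t `^ p).
  apply: (le_trans h); apply: (le_trans (ler_wpM2l (ltW dl0) tp)); rewrite lerDl.
  by rewrite mulr_ge0 ?gap_ge0// divr_ge0 ?powR_ge0// ltW.
have tgt : 0 < t.
  rewrite lt0r t0 andbT; apply: contraTN h => /eqP tE; rewrite tE in ta tb.
  have a0' : enorm a = 0 by apply/eqP; rewrite eq_le ta enorm_ge0.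
  have b0' : enorm b = 0 by apply/eqP; rewrite eq_le tb enorm_ge0.
  by rewrite tE (enorm_eq0 a0') (enorm_eq0 b0') subr0 enorm0 powR0 ?gt_eqF// mulr0 ltxx.
have tVp : t^-1 `^ p = (t `^ p)^-1 by rewrite -(powR_inv1 t0) -powRrM mulN1r powRN.
have hm : m <= gap (t^-1 *: a) (t^-1 *: b).
  have /mP : (t^-1 *: a, t^-1 *: b) \in K.
    apply/mem_set; split=> /=.
    - by rewrite enormZ ger0_norm ?invr_ge0// mulrC ler_pdivrMr// mul1r.
    - by rewrite enormZ ger0_norm ?invr_ge0// mulrC ler_pdivrMr// mul1r.
    - rewrite -scalerBr enormZ ger0_norm ?invr_ge0// powRM ?invr_ge0 ?enorm_ge0//.
      by rewrite tVp mulrC (ler_pdivlMr _ _ (powR_gt0 _ tgt)); exact: ltW h.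
  exact.
rewrite gapZ ?invr_ge0// tVp mulrC ler_pdivlMr ?powR_gt0// in hm.
have h2 : enorm (a - b) `^ p <= 2 `^ p * t `^ p.
  rewrite -powRM//; apply: powR_le; [exact: ltW|exact: enorm_ge0|].
  by apply: (le_trans (enormD a (- b))); rewrite enormN mulr_natl mulr2n; exact: lerD.
apply: (le_trans h2); apply: (@le_trans _ _ (2 `^ p / m * gap a b)).
  rewrite -mulrA; apply: ler_wpM2l; first exact: powR_ge0.
  by rewrite mulrC (ler_pdivlMr _ _ m0) mulrC.
by rewrite lerDr mulr_ge0 ?addr_ge0 ?powR_ge0// ltW.
Qed.

End uniform_convexity.


Lemma sum_le2 (R : realFieldType) (x y c : R) : x <= c -> y <= c -> x + y <= 2 * (c + 1).
Proof. by move=> xc yc; lra. Qed.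

Lemma near_min_gap (R : realFieldType) (x y z cm ck l a b s : R) : x < cm + a -> y < ck + b ->
  cm <= z -> ck <= l -> a < s / 2 -> l - cm < s / 2 -> b <= a -> 0 < s ->
  2^-1 * (x + y) - z <= s.
Proof. by move=> *; lra. Qed.

(** * Energy of gradients and weak convergence through convex combinations *)

Section energy_of_gradients.
Variables (R : realType) (N : nat) (Om : set 'rV[R]_N) (p : R).
Local Notation V := 'rV[R]_N.
Local Notation mu := (lebm R N).
Local Notation L u := (Lp mu Om p u).
Local Notation d u v := (dist mu Om p u v).
Local Notation nrm u := (nrm mu Om p u).
Local Notation I f := (\int[mu]_(x in Om) f x).
Local Notation intg f := (mu.-integrable Om (EFin \o f)).
Local Notation Sob := (Sob Om p).
Hypotheses (oO : open Om) (fO : (mu Om < +oo)%E) (p1 : 1 < p).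
Implicit Types (u v w : V -> R) (g G : V -> V).

Let mO : measurable Om. Proof. exact: open_measurable_rV. Qed.
Let p0 : 0 < p. Proof. exact: lt_trans p1. Qed.
Let p1' : 1 <= p. Proof. exact: ltW. Qed.

Definition En g : V -> R := fun x => enorm (g x).

Definition LpV g := forall i, L (gco i g).

Lemma measurable_sumI (F : 'I_N -> V -> R) : (forall i, measurable_fun Om (F i)) ->
  measurable_fun Om (fun x => \sum_i F i x).
Proof.
move=> mF; elim: (index_enum _) => [|i r IH].
  by under eq_fun do rewrite big_nil; exact: measurable_cst.
by under eq_fun do rewrite big_cons; apply: measurable_funD; [exact: mF|exact: IH].
Qed.

Lemma measurable_dotv g G : (forall i, measurable_fun Om (gco i g)) ->
  (forall i, measurable_fun Om (gco i G)) -> measurable_fun Om (fun x => dotv (g x) (G x)).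
Proof.
by move=> mg mG; apply: measurable_sumI => i; apply: measurable_funM; [exact: mg|exact: mG].
Qed.

Lemma measurable_En g : (forall i, measurable_fun Om (gco i g)) -> measurable_fun Om (En g).
Proof. by move=> mg; apply: (cont_meas (k := Num.sqrt)); [exact: sqrt_continuous|exact: measurable_dotv]. Qed.

Lemma LpV_meas g : LpV g -> forall i, measurable_fun Om (gco i g).
Proof. by move=> Lg i; exact: (Lg i).1. Qed.

Lemma LpV_add g G : LpV g -> LpV G -> LpV (fun x => g x + G x).
Proof.
move=> Lg LG i; have -> : gco i (fun x => g x + G x) = (fun x => gco i g x + gco i G x).
  by apply/funext => x; rewrite /gco mxE.
exact: (Lp_add mO p1' (Lg i) (LG i)).
Qed.

Lemma LpV_scale c g : LpV g -> LpV (fun x => c *: g x).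
Proof.
move=> Lg i; have -> : gco i (fun x => c *: g x) = (fun x => c * gco i g x).
  by apply/funext => x; rewrite /gco mxE.
exact: (Lp_scale mO c (Lg i)).
Qed.

Lemma LpV_sub g G : LpV g -> LpV G -> LpV (fun x => g x - G x).
Proof.
move=> Lg LG; have h := LpV_add Lg (LpV_scale (-1) LG).
by rewrite (_ : (fun x => _) = (fun x => g x + -1 *: G x))//; apply/funext => x; rewrite scaleN1r.
Qed.

Lemma En_Lp g : LpV g -> L (En g) /\ nrm (En g) <= \sum_i nrm (gco i g).
Proof.
move=> Lg; have mE := measurable_En (LpV_meas Lg).
have [LS nS] : L (fun x => \sum_i `|gco i g x|) /\
    nrm (fun x => \sum_i `|gco i g x|) <= \sum_i nrm (gco i g).
  elim: (index_enum _) => [|i r [Lr nr]].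
    under eq_fun do rewrite big_nil; rewrite big_nil; split.
      by apply: Lp0; [exact: mO|rewrite gt_eqF].
    by rewrite nrm0// gt_eqF.
  under eq_fun do rewrite big_cons; rewrite big_cons.
  have [La na] : L (fun x => `|gco i g x|) /\ nrm (fun x => `|gco i g x|) <= nrm (gco i g).
    apply: (Lp_le mO (ltW p0) _ _ (Lg i)); last by move=> x _; rewrite normr_id.
    by apply: measurableT_comp => //; exact: (Lg i).1.
  split; first exact: (Lp_add mO p1' La Lr).
  exact: (le_trans (nrm_add mO p1' La Lr) (lerD na nr)).
have le x : Om x -> `|En g x| <= `|\sum_i `|gco i g x| |.
  by move=> _; rewrite !ger0_norm ?sumr_ge0// ?enorm_ge0// enorm_le_sum.
have [LE nE] := Lp_le mO (ltW p0) mE le LS.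
split; [exact: LE|exact: le_trans nE nS].
Qed.

Lemma Lp_En g : LpV g -> L (En g). Proof. by move=> /En_Lp[]. Qed.

Lemma gco_le_En i g : LpV g -> nrm (gco i g) <= nrm (En g).
Proof.
move=> Lg; apply: (Lp_le mO (ltW p0) (Lg i).1 _ (Lp_En Lg)).2 => x _.
by rewrite [leRHS]ger0_norm ?enorm_ge0//; exact: coord_le_enorm.
Qed.

Definition J g : R := I (fun x => enorm (g x) `^ p).

Lemma J_E g : J g = I (fun x => enorm (g x) `^ p). Proof. by []. Qed.

Lemma J_nrm g : J g = nrm (En g) `^ p.
Proof.
apply: (etrans _ (esym (nrm_powR mu Om (En g) p0))).
by apply: I_eq => x _; rewrite ger0_norm ?enorm_ge0.
Qed.

Lemma J_ge0 g : 0 <= J g. Proof. by rewrite J_nrm powR_ge0. Qed.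

Opaque J.

Lemma J_le g (c : R) : 0 <= c -> J g <= c `^ p -> nrm (En g) <= c.
Proof.
by move=> c0 h; apply: (nrm_le p0 c0); rewrite -(nrm_powR mu Om _ p0) -J_nrm.
Qed.

Lemma le_J g (c : R) : nrm (En g) <= c -> J g <= c `^ p.
Proof. by move=> h; rewrite J_nrm; apply: powR_le => //; [exact: ltW|exact: nrm_ge0]. Qed.

Lemma intg_En g : LpV g -> intg (fun x => enorm (g x) `^ p).
Proof.
move=> Lg; have [_ h] := Lp_En Lg; apply: (intg_eq mO _ h) => x _.
by rewrite ger0_norm ?enorm_ge0.
Qed.

Lemma I_gap g G : LpV g -> LpV G ->
  intg (fun x => gap p (g x) (G x)) /\
  I (fun x => gap p (g x) (G x)) = 2^-1 * (J g + J G) - J (fun x => mid (g x) (G x)).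
Proof.
move=> Lg LG; have Lm : LpV (fun x => mid (g x) (G x)).
  exact: LpV_scale (LpV_add Lg LG).
have i1 := intg_En Lg; have i2 := intg_En LG; have i3 := intg_En Lm.
have i4 := intg_scale mO 2^-1 (intg_add mO i1 i2).
split; first exact: (intg_sub mO i4 i3).
by rewrite !J_E /gap (I_sub mO i4 i3) (I_scale mO _ (intg_add mO i1 i2)) (I_add mO i1 i2).
Qed.

Lemma J_mid_le g G : LpV g -> LpV G ->
  J (fun x => mid (g x) (G x)) <= 2^-1 * (J g + J G).
Proof.
move=> Lg LG; have [_ h] := I_gap Lg LG; rewrite -subr_ge0 -h.
by apply: I_ge0 => x _; exact: gap_ge0.
Qed.

(** Uniform convexity, integrated. The choice dl = e^p / (4 (c + 1)) makes the first term at most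
    e^p / 2, and s is such that the second is too. *)
Lemma J_uniform (e : R) (c : R) : 0 < e -> 0 <= c -> exists2 s : R, 0 < s & forall g G,
  LpV g -> LpV G -> J g <= c -> J G <= c ->
  2^-1 * (J g + J G) - J (fun x => mid (g x) (G x)) <= s ->
  nrm (En (fun x => g x - G x)) <= e.
Proof.
move=> e0 c0; have ep : 0 < e `^ p by exact: powR_gt0.
have cc : 0 < 4 * (c + 1) by rewrite mulr_gt0// ltr_wpDl.
have [C C0 CP] := @uniform_convexity R N p p1 (e `^ p / (4 * (c + 1))) (divr_gt0 ep cc).
have C1 : 0 < 2 * (C + 1) by rewrite mulr_gt0// ltr_wpDl.
exists (e `^ p / (2 * (C + 1))); first by rewrite divr_gt0.
move=> g G Lg LG Jg JG; have [gi gI] := I_gap Lg LG; rewrite -gI => gs.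
apply: J_le; first exact: ltW.
have i1 := intg_En Lg; have i2 := intg_En LG.
have i12 := intg_add mO i1 i2.
set dl := e `^ p / (4 * (c + 1)) in CP.
have i3 := intg_add mO (intg_scale mO dl i12) (intg_scale mO C gi).
apply: (@le_trans _ _ (dl * (J g + J G) + C * I (fun x => gap p (g x) (G x)))).
  rewrite !J_E -(I_add mO i1 i2) -(I_scale mO dl i12) -(I_scale mO C gi).
  rewrite -(I_add mO (intg_scale mO dl i12) (intg_scale mO C gi)).
  apply: (I_le mO (intg_En (LpV_sub Lg LG)) i3) => x _; exact: CP.
have h1 : dl * (J g + J G) <= e `^ p / 2.
  apply: (@le_trans _ _ (dl * (2 * (c + 1)))).
    apply: ler_wpM2l; first by rewrite divr_ge0// ltW.
    exact: sum_le2 Jg JG.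
  rewrite /dl le_eqVlt; apply/orP; left; apply/eqP; field.
  by rewrite gt_eqF// ltr_wpDl.
have h2 : C * I (fun x => gap p (g x) (G x)) <= e `^ p / 2.
  apply: (@le_trans _ _ ((C + 1) * (e `^ p / (2 * (C + 1))))).
    apply: ler_pM => //; last by rewrite lerDl.
    by apply: I_ge0 => x _; exact: gap_ge0.
  rewrite le_eqVlt; apply/orP; left; apply/eqP; field.
  by rewrite gt_eqF// ltr_wpDl.
by rewrite (splitr (e `^ p)); exact: lerD.
Qed.

Section hull.
Variables (un : nat -> V -> R) (gn : nat -> V -> V).

(** Iterated midpoints of terms of index at least [m]. Being an inductive family, it inherits by
    induction every property stable under midpoints. *)
Inductive hull (m : nat) : (V -> R) -> (V -> V) -> Prop :=
| hull_in n : (m <= n)%N -> hull m (un n) (gn n)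
| hull_mid w G w' G' : hull m w G -> hull m w' G' ->
    hull m (fun x => 2^-1 * (w x + w' x)) (fun x => mid (G x) (G' x)).

Lemma hull_mono m k w G : (m <= k)%N -> hull k w G -> hull m w G.
Proof.
move=> mk; elim=> [n kn|w1 G1 w2 G2 _ h1 _ h2]; last exact: hull_mid.
by apply: hull_in; exact: leq_trans kn.
Qed.

Hypothesis S : forall n, Sob (un n) (gn n).

Lemma hull_Sob m w G : hull m w G -> Sob w G.
Proof.
elim=> [n _|w1 G1 w2 G2 _ h1 _ h2]; first exact: S.
exact: (Sob_scale oO fO p1 2^-1 (Sob_add oO fO p1 h1 h2)).
Qed.

Lemma hull_dist m w G u (e : R) : L u -> (forall n, (m <= n)%N -> d (un n) u <= e) ->
  hull m w G -> d w u <= e.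
Proof.
move=> Lu he; elim=> [n mn|w1 G1 w2 G2 hh1 h1 hh2 h2]; first exact: he.
have L1 := Sob_Lp (hull_Sob hh1); have L2 := Sob_Lp (hull_Sob hh2).
have L12 := Lp_add mO p1' L1 L2; have Luu := Lp_add mO p1' Lu Lu.
have -> : d (fun x => 2^-1 * (w1 x + w2 x)) u =
    d (fun x => 2^-1 * (w1 x + w2 x)) (fun x => 2^-1 * (u x + u x)).
  by apply: dist_eq => // x _; field.
rewrite (dist_scale mO p1' 2^-1 L12 Luu) ger0_norm ?invr_ge0//.
have h := le_trans (dist_add mO p1' L1 L2 Lu Lu) (lerD h1 h2).
by rewrite mulrC ler_pdivrMr// mulr_natr mulr2n.
Qed.

Lemma hull_J m w G (c : R) : (forall n, (m <= n)%N -> J (gn n) <= c) -> hull m w G -> J G <= c.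
Proof.
move=> hc; elim=> [n mn|w1 G1 w2 G2 hh1 h1 hh2 h2]; first exact: hc.
have [_ L1 _] := hull_Sob hh1; have [_ L2 _] := hull_Sob hh2.
by move: (J_mid_le L1 L2) h1 h2; move: (J _) (J _) (J _) => x y z; lra.
Qed.

(** Mazur's lemma, by the argument for projections on convex sets: [w m] nearly minimizes the energy
    over the hull of the terms from m on. These infima increase and are bounded, and midpoints stay
    in the hull; so the energy gap of two far elements is small, and uniform convexity makes their
    gradients Cauchy. *)
Lemma weak_hull u (c : R) : L u -> (forall n, J (gn n) <= c) -> d (un n) u @[n --> \oo] --> 0 ->
  exists w : nat -> V -> R, exists G : nat -> V -> V, exists g,
  [/\ forall m, hull m (w m) (G m), Sob u g, d (w m) u @[m --> \oo] --> 0,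
    forall i, d (gco i (G m)) (gco i g) @[m --> \oo] --> 0 & J g <= c].
Proof.
move=> Lu Jc cu; have c0 : 0 <= c by exact: le_trans (J_ge0 _) (Jc 0%N).
pose A m : set R := [set J wG.2 | wG in [set wG | hull m wG.1 wG.2]].
have A0 m : A m !=set0 by exists (J (gn m)), (un m, gn m) => //=; exact: hull_in.
have lbA m : has_lbound (A m) by exists 0 => _ [wG _ <-]; exact: J_ge0.
pose cm m := inf (A m).
have cmle m w G : hull m w G -> cm m <= J G.
  by move=> h; apply: ge_inf; [exact: lbA|exists (w, G)].
have cmc m : cm m <= c by apply: le_trans (Jc m); apply: (cmle m (un m)); exact: hull_in.
have cmono m k : (m <= k)%N -> cm m <= cm k.
  move=> mk; apply: lb_le_inf; first exact: A0.
  by move=> _ [wG h <-]; apply: (cmle m wG.1); exact: hull_mono h.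
have /choice[wG wGP] : forall m : nat, exists wG : (V -> R) * (V -> V),
    hull m wG.1 wG.2 /\ J wG.2 < cm m + m.+1%:R^-1.
  move=> m; have e0 : 0 < m.+1%:R^-1 :> R by rewrite invr_gt0.
  have [_ [wG h <-] h2] := inf_adherent e0 (conj (A0 m) (lbA m)).
  by exists wG.
pose w m := (wG m).1; pose G m := (wG m).2.
have hw m : hull m (w m) (G m) by case: (wGP m).
have hJ m : J (G m) < cm m + m.+1%:R^-1 by case: (wGP m).
have Sw m : Sob (w m) (G m) by exact: hull_Sob (hw m).
have LG m : LpV (G m) by case: (Sw m).
have JG m : J (G m) <= c by apply: (hull_J _ (hw m)) => n _; exact: Jc.
have ccm : cvgn cm by apply: nondecreasing_is_cvgn; [exact: cmono|exists c => _ [n _ <-]].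
have cauchy (e : R) : 0 < e -> exists m0, forall m k, (m0 <= m)%N -> (m <= k)%N ->
    nrm (En (fun x => G m x - G k x)) <= e.
  move=> e0; have [s s_gt0 hs] := J_uniform e0 c0.
  have s2 : 0 < s / 2 by rewrite divr_gt0.
  have n1 := cvg0_near (@cvg_harmonic R) s2.
  have n2 : \forall m \near \oo, `|limn cm - cm m| < s / 2.
    by move/cvgrPdist_lt: ccm => /(_ _ s2).
  have [m0 _ hm0] := filterI n1 n2; exists m0 => m k mm mk.
  have [h1 h2] := hm0 m mm.
  apply: hs => //.
  have hm : cm m <= J (fun x => mid (G m x) (G k x)).
    apply: (cmle m (fun x => 2^-1 * (w m x + w k x))); apply: hull_mid; first exact: hw.
    exact: hull_mono mk (hw k).
  have ck : cm k <= limn cm by apply: nondecreasing_cvgn_le.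
  have h1' : m.+1%:R^-1 < s / 2 by exact: le_lt_trans (ler_norm _) h1.
  have h2' : limn cm - cm m < s / 2 by exact: le_lt_trans (ler_norm _) h2.
  have k1 : k.+1%:R^-1 <= m.+1%:R^-1 :> R by rewrite lef_pV2 ?posrE// ler_nat ltnS.
  exact: (near_min_gap (hJ m) (hJ k) hm ck h1' h2' k1 s_gt0).
have dG m k i : d (gco i (G m)) (gco i (G k)) <= nrm (En (fun x => G m x - G k x)).
  apply: le_trans (gco_le_En i (LpV_sub (LG m) (LG k))).
  have e : gco i (fun x => G m x - G k x) = fun x => gco i (G m) x - gco i (G k) x.
    by apply/funext => x; rewrite /gco !mxE.
  rewrite e; exact: lexx.
have /choice[gi giP] : forall i, exists gi, L gi /\ d (gco i (G m)) gi @[m --> \oo] --> 0.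
  move=> i.
  have [|gi [_ [Lgi _ cgi _]]] := @dist_complete _ _ _ mu Om mO p p1' (fun m => gco i (G m)) fO
      (fun m => LG m i).
    move=> e e0; have [m0 hm0] := cauchy e e0; exists m0 => m k mm mk.
    have [le|/ltnW le] := leqP m k; first exact: le_trans (dG _ _ _) (hm0 _ _ mm le).
    by rewrite dist_sym; exact: le_trans (dG _ _ _) (hm0 _ _ mk le).
  by exists gi.
have cw : d (w m) u @[m --> \oo] --> 0.
  apply/cvgr0Pnorm_lt => e e0; have e2 : 0 < e / 2 by rewrite divr_gt0.
  have [m0 _ hm0] := cvg0_near cu e2; exists m0 => // m /= mm.
  rewrite (ger0_norm (dist_ge0 _ _ _ _ _)); apply: (@le_lt_trans _ _ (e / 2)); last first.
    by rewrite ltr_pdivrMr// ltr_pMr// ltr1n.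
  apply: (hull_dist Lu _ (hw m)) => n mn.
  exact: ltW (le_lt_trans (ler_norm _) (hm0 n (leq_trans mm mn))).
have cG i : d (gco i (G m)) (gco i (vec gi)) @[m --> \oo] --> 0.
  by rewrite gco_vec; exact: (giP i).2.
have Sg : Sob u (vec gi).
  apply: (Sob_lim_seq oO fO p1 Lu _ Sw cw cG) => i; rewrite gco_vec; exact: (giP i).1.
have [_ Lg _] := Sg.
exists w, G, (vec gi); split=> //.
have cp0 : 0 <= c `^ p^-1 by exact: powR_ge0.
rewrite -[leRHS](powRVK (lt0r_neq0 p0) c0); apply: le_J.
have lim : c `^ p^-1 + \sum_i d (gco i (G m)) (gco i (vec gi)) @[m --> \oo] --> c `^ p^-1.
  rewrite -[X in _ --> X]addr0; apply: cvgD; first exact: cvg_cst.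
  have z : \sum_(i < N) (0 : R) = 0 by rewrite big1.
  rewrite -[X in _ --> X]z; elim: (index_enum _) => [|i r IHr].
    by under eq_fun do rewrite big_nil; rewrite big_nil; exact: cvg_cst.
  by under eq_fun do rewrite big_cons; rewrite big_cons; apply: cvgD; [exact: cG|exact: IHr].
rewrite -(cvg_lim (@Rhausdorff R) lim); apply: limr_ge; first exact: cvgP lim.
apply: nearW => m.
have LD := LpV_sub Lg (LG m).
have [LE nE] := En_Lp LD.
have step : nrm (En (vec gi)) <= nrm (fun x => En (G m) x + En (fun x => vec gi x - G m x) x).
  apply: (Lp_le mO (ltW p0) (Lp_En Lg).1 _ (Lp_add mO p1' (Lp_En (LG m)) LE)).2 => x _.
  rewrite !ger0_norm ?addr_ge0 ?enorm_ge0// /En -{1}(subrK (G m x) (vec gi x)) addrC.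
  exact: enormD.
apply: (le_trans step); apply: (le_trans (nrm_add mO p1' (Lp_En (LG m)) LE)).
apply: lerD.
  by apply: J_le => //; rewrite powRVK ?gt_eqF.
apply: (le_trans nE); apply: ler_sum => i _; rewrite dist_sym.
have e : gco i (fun x => vec gi x - G m x) = fun x => gco i (vec gi) x - gco i (G m) x.
  by apply/funext => x; rewrite /gco !mxE.
rewrite e; exact: lexx.
Qed.

End hull.

(** Continuity is expressed on pairs, by the sum of the norms of the components, so that limits do
    not go through the representative [grad]. *)
Definition blf (h : (V -> R) -> R) :=
  (forall (c : R) u v g G, Sob u g -> Sob v G -> h (fun x => c * u x + v x) = c * h u + h v) /\
  exists2 C : R, 0 <= C & forall u g, Sob u g -> `|h u| <= C * (nrm u + \sum_i nrm (gco i g)).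

Section functional.
Variable h : (V -> R) -> R.
Hypothesis bh : blf h.

Lemma blf_add u v g G : Sob u g -> Sob v G -> h (fun x => u x + v x) = h u + h v.
Proof.
move=> Su Sv; have := bh.1 1 _ _ _ _ Su Sv; rewrite mul1r => <-; congr h.
by apply/funext => x; rewrite mul1r.
Qed.

Lemma blf0 : h (fun=> 0) = 0.
Proof.
have S0 : Sob (fun=> 0) (tgrad (fun=> 0)) by apply: (Sob_test oO fO p1); exact: test0.
have h1 := bh.1 1 _ _ _ _ S0 S0.
have e : (fun x : V => 1 * 0 + 0 : R) = fun=> 0 by apply/funext => x; rewrite mulr0 addr0.
by rewrite e mul1r in h1; apply: (addrI (h (fun=> 0))); rewrite addr0 -h1.
Qed.

Lemma blf_scale c u g : Sob u g -> h (fun x => c * u x) = c * h u.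
Proof.
have S0 : Sob (fun=> 0) (tgrad (fun=> 0)) by apply: (Sob_test oO fO p1); exact: test0.
move=> Su; have := bh.1 c _ _ _ _ Su S0; rewrite blf0 addr0 => <-; congr h.
by apply/funext => x; rewrite addr0.
Qed.

Lemma blf_sub u v g G : Sob u g -> Sob v G -> h (fun x => u x - v x) = h u - h v.
Proof.
move=> Su Sv; have := bh.1 (-1) _ _ _ _ Sv Su; rewrite mulN1r addrC => <-; congr h.
by apply/funext => x; rewrite mulN1r addrC.
Qed.

Lemma blf_cvg (un : nat -> V -> R) (gn : nat -> V -> V) u g : (forall n, Sob (un n) (gn n)) ->
  Sob u g -> d (un n) u @[n --> \oo] --> 0 ->
  (forall i, d (gco i (gn n)) (gco i g) @[n --> \oo] --> 0) -> h (un n) @[n --> \oo] --> h u.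
Proof.
move=> S Su cu cg; have [C C0 CP] := bh.2.
apply: (cvg_bound (g := fun n => C * (d (un n) u + \sum_i d (gco i (gn n)) (gco i g)))).
  move=> n; rewrite -(blf_sub (S n) Su); apply: (le_trans (CP _ _ (Sob_sub oO fO p1 (S n) Su))).
  apply: (ler_wpM2l C0); apply: lerD; first exact: lexx.
  apply: ler_sum => i _.
  have e : gco i (fun x => gn n x - g x) = fun x => gco i (gn n) x - gco i g x.
    by apply/funext => x; rewrite /gco !mxE.
  rewrite e; exact: lexx.
rewrite -[X in _ --> X](mulr0 C); apply: cvgM; first exact: cvg_cst.
rewrite -[X in _ --> X]addr0; apply: cvgD; first exact: cu.
have z : \sum_(i < N) (0 : R) = 0 by rewrite big1.
rewrite -[X in _ --> X]z; elim: (index_enum _) => [|i r IHr].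
  by under eq_fun do rewrite big_nil; rewrite big_nil; exact: cvg_cst.
by under eq_fun do rewrite big_cons; rewrite big_cons; apply: cvgD; [exact: cg|exact: IHr].
Qed.

End functional.

(** Otherwise h (un n) >= h u + e along a subsequence. Linearity passes the inequality to midpoints,
    hence to the strongly convergent combinations, on which h tends to h u. *)
Lemma weak_le (h : (V -> R) -> R) (un : nat -> V -> R) (gn : nat -> V -> V) u (c e : R) :
  blf h -> (forall n, Sob (un n) (gn n)) -> L u -> (forall n, J (gn n) <= c) ->
  d (un n) u @[n --> \oo] --> 0 -> 0 < e -> \forall n \near \oo, h (un n) < h u + e.
Proof.
move=> bh S Lu Jc cu e0; apply: contrapT => nn.
have /choice[k kP] : forall m : nat, exists n, (m <= n)%N /\ h u + e <= h (un n).
  move=> m; apply: contrapT => H; apply: nn; exists m => // n /= mn.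
  by rewrite ltNge; apply/negP => h1; apply: H; exists n.
have ck := subseq_cvg (fun m => (kP m).1) cu.
have [w [G [g [hw Sg cw cG _]]]] :=
  weak_hull (fun n => S (k n)) Lu (fun n => Jc (k n)) ck.
have Sw m : Sob (w m) (G m) by exact: (hull_Sob (fun n => S (k n)) (hw m)).
have hw' m : h u + e <= h (w m).
  elim: (hw m) => [n _|w1 G1 w2 G2 h1 le1 h2 le2]; first exact: (kP n).2.
  have S1 := hull_Sob (fun n => S (k n)) h1; have S2 := hull_Sob (fun n => S (k n)) h2.
  rewrite (blf_scale bh _ (Sob_add oO fO p1 S1 S2)) (blf_add bh S1 S2).
  by rewrite mulrC ler_pdivlMr// mulr_natr mulr2n lerD.
have ch := blf_cvg bh Sw Sg cw cG.
have : h u + e <= h u.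
  rewrite -[leRHS](cvg_lim (@Rhausdorff R) ch); apply: limr_ge; first exact: cvgP ch.
  exact: nearW.
by rewrite gerDl leNgt e0.
Qed.

Lemma blf_opp h : blf h -> blf (fun u => - h u).
Proof.
move=> [hl [C C0 CP]]; split; first by move=> c u v g G Su Sv; rewrite (hl _ _ _ _ _ Su Sv); ring.
by exists C => // u g Su; rewrite normrN; exact: CP.
Qed.

Lemma weak_cvg (h : (V -> R) -> R) (un : nat -> V -> R) (gn : nat -> V -> V) u (c : R) :
  blf h -> (forall n, Sob (un n) (gn n)) -> L u -> (forall n, J (gn n) <= c) ->
  d (un n) u @[n --> \oo] --> 0 -> h (un n) @[n --> \oo] --> h u.
Proof.
move=> bh S Lu Jc cu; apply/cvgrPdist_lt => e e0.
have h1 := weak_le bh S Lu Jc cu e0.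
have h2 := weak_le (blf_opp bh) S Lu Jc cu e0.
by apply: filterS2 h1 h2 => n h1 h2; rewrite ltr_norml; apply/andP; split; lra.
Qed.

Lemma weak_lsc (un : nat -> V -> R) (gn : nat -> V -> V) u (c : R) :
  (forall n, Sob (un n) (gn n)) -> L u -> (forall n, J (gn n) <= c) ->
  d (un n) u @[n --> \oo] --> 0 -> exists2 g, Sob u g & J g <= c.
Proof.
by move=> S Lu Jc cu; have [w [G [g [_ Sg _ _ Jg]]]] := weak_hull S Lu Jc cu; exists g.
Qed.

End energy_of_gradients.

#[global] Opaque J.


(** * Picone's identity and simplicity *)

Section C1_functions.
Variable R : realType.
Implicit Types (f g F : R -> R) (r p q t l e : R).

Lemma is_derive_near (f g : R -> R) (t l e : R) : 0 < e -> (forall s, `|s - t| < e -> f s = g s) ->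
  is_derive t 1 g l -> is_derive t 1 f l.
Proof.
move=> e0 fg /is_derive_cvgP dg; apply/is_derive_cvgP; apply: cvg_trans dg.
apply: near_eq_cvg; exists e => //= h he _; move: he; rewrite /= sub0r normrN => he.
have h1 : h *: (1 : R) = h by rewrite /GRing.scale /= mulr1.
by rewrite h1 !fg// ?addrK// subrr normr0.
Qed.

Lemma powR_is_derive (r t : R) : 0 < t -> is_derive t 1 (fun x : R => x `^ r) (r * t `^ (r - 1)).
Proof.
move=> t0; have tin : t \in `]0, +oo[ by rewrite in_itv /= andbT.
split; first exact: derivable_powR.
by have := powR_derive1 r tin; rewrite derive1E.
Qed.

Lemma cvg_norm_dnbhs0 : (fun h : R => `|h|) @ 0^' --> (0 : R)^'.
Proof.
move=> A [e /= e0 eA]; exists e => //= h he h0; move: he; rewrite /= sub0r normrN => he.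
by apply: eA; rewrite ?normr_eq0//= sub0r normrN normr_id.
Qed.

(** The chain rule wants functions of class C^1 on the whole line; this produces them from formulas
    on t >= 0. *)
Lemma odd_ext_C1 (F F' : R -> R) : (forall t : R, 0 <= t -> is_derive t 1 F (F' t)) ->
  continuous (fun t : R => F' `|t|) ->
  C1 (fun t : R => Num.sg t * (F `|t| - F 0)) (fun t : R => F' `|t|).
Proof.
move=> dF cF; split=> //; set f := (fun t : R => _).
have pos (t : R) : 0 < t -> is_derive t 1 f (F' `|t|).
  move=> t0; rewrite gtr0_norm//.
  apply: (@is_derive_near _ (fun s => F s - F 0) _ _ t t0).
    move=> s; rewrite ltr_norml => /andP[h _].
    have s0 : 0 < s by lra.
    by rewrite /f gtr0_sg// mul1r gtr0_norm.
  rewrite -[X in is_derive _ _ _ X]subr0.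
  by apply: is_deriveB; apply: dF; exact: ltW.
move=> t; have [t0|t0|<-] := ltgtP 0 t; first exact: pos.
  have nt : 0 < - t by rewrite oppr_gt0.
  have d1 := pos _ nt; rewrite normrN in d1.
  have d2 : is_derive t 1 (fun s : R => - s) (-1) by apply: is_derive_eq.
  have d3 := is_derive1_comp d1 d2.
  have d4 : is_derive t 1 (fun s => - f (- s)) (- (F' `|t| * -1)) by apply: is_deriveN; exact: d3.
  have -> : F' `|t| = - (F' `|t| * -1) by rewrite mulrN1 opprK.
  rewrite (_ : f = fun s => - f (- s))//; apply/funext => s.
  by rewrite /f sgrN normrN mulNr opprK.
apply/is_derive_cvgP.
have d0 := dF 0 (lexx 0); move/is_derive_cvgP : d0 => d0.
have := cvg_comp _ _ cvg_norm_dnbhs0 d0; rewrite normr0; apply: cvg_trans.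
apply: near_eq_cvg; exists 1 => //= h _ h0.
rewrite /f /GRing.scale /= !mulr1 !addr0 sgr0 mul0r subr0 mulrA; congr (_ * _).
by rewrite {2}[h]numEsg invfM mulrAC mulVf ?mul1r// sgr_eq0.
Qed.

Lemma sgpow_continuous (q : R) : 0 < q -> continuous (fun t : R => Num.sg t * `|t| `^ q).
Proof.
move=> q0; have pos (t : R) : 0 < t -> (fun t : R => Num.sg t * `|t| `^ q) @ t --> Num.sg t * `|t| `^ q.
  move=> t0; have c : {for t, continuous (fun s : R => s `^ q)}.
    apply: differentiable_continuous; apply/derivable1_diffP.
    by have [] := powR_is_derive q t0.
  rewrite gtr0_sg// mul1r gtr0_norm//; apply: cvg_trans c; apply: near_eq_cvg.
  exists t => // s; rewrite /= ltr_norml => /andP[_ h].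
  have s0 : 0 < s by lra.
  by rewrite gtr0_sg// mul1r gtr0_norm.
move=> t; have [t0|t0|<-] := ltgtP 0 t; first exact: pos.
  have nt : 0 < - t by rewrite oppr_gt0.
  have c1 : (fun s : R => - s) @ t --> - t by apply: cvgN; exact: cvg_id.
  have c2 := cvg_comp _ _ c1 (pos _ nt).
  have c3 := cvgN c2.
  rewrite /continuous_at (_ : (fun t => _) = fun s => - ((fun t : R => Num.sg t * `|t| `^ q) \o (fun s => - s)) s).
    rewrite (_ : Num.sg t * _ = - (Num.sg (- t) * `|- t| `^ q)); first exact: c3.
    by rewrite sgrN normrN mulNr opprK.
  by apply/funext => s /=; rewrite sgrN normrN mulNr opprK.
apply/cvgrPdist_lt => e e0; have e1 : 0 < e `^ q^-1 by exact: powR_gt0.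
exists (e `^ q^-1) => //= s hs0; have hs : `|s| < e `^ q^-1 by move: hs0; rewrite /= sub0r normrN.
rewrite sgr0 mul0r sub0r normrN normrM [`|_ `^ _|]ger0_norm ?powR_ge0//.
have h : `|s| `^ q < e.
  rewrite -[ltRHS](powRVK (lt0r_neq0 q0) (ltW e0)); apply: gt0_ltr_powR => //.
  by rewrite nnegrE ltW.
apply: le_lt_trans h; rewrite -[leRHS]mul1r; apply: ler_wpM2r; first exact: powR_ge0.
by rewrite normr_sg; case: (_ != _).
Qed.

Lemma pow_C1 (p : R) : 1 < p ->
  C1 (fun t : R => `|t| `^ p) (fun t : R => p * (Num.sg t * `|t| `^ (p - 1))).
Proof.
move=> p1; have p0 : 0 < p by exact: lt_trans p1.
have p10 : 0 < p - 1 by rewrite subr_gt0.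
split; last first.
  by move=> t; apply: cvgM; [exact: cvg_cst|exact: sgpow_continuous].
set f := (fun t : R => _).
have pos (t : R) : 0 < t -> is_derive t 1 f (p * (Num.sg t * `|t| `^ (p - 1))).
  move=> t0; rewrite gtr0_sg// mul1r gtr0_norm//.
  apply: (@is_derive_near _ (fun s => s `^ p) _ _ t t0); last exact: powR_is_derive.
  move=> s; rewrite ltr_norml => /andP[h _].
  have s0 : 0 < s by lra.
  by rewrite /f gtr0_norm.
move=> t; have [t0|t0|<-] := ltgtP 0 t; first exact: pos.
  have nt : 0 < - t by rewrite oppr_gt0.
  have d1 := pos _ nt; rewrite normrN sgrN in d1.
  have d2 : is_derive t 1 (fun s : R => - s) (-1) by apply: is_derive_eq.
  have d3 := is_derive1_comp d1 d2.
  have -> : p * (Num.sg t * `|t| `^ (p - 1)) = p * (- Num.sg t * `|t| `^ (p - 1)) * -1 by ring.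
  by rewrite (_ : f = f \o -%R)//; apply/funext => s; rewrite /f /= normrN.
apply/is_derive_cvgP; rewrite sgr0 mul0r mulr0.
have c := @sgpow_continuous (p - 1) p10 0; rewrite /continuous_at sgr0 mul0r in c.
have c' : (fun t : R => Num.sg t * `|t| `^ (p - 1)) @ 0^' --> (0 : R).
  by move=> A /c; exact: nbhs_dnbhs.
apply: cvg_trans c'; apply: near_eq_cvg; exists 1 => //= h _ h0.
rewrite /f /GRing.scale /= mulr1 addr0 normr0 powR0 ?gt_eqF// subr0.
rewrite -(powR_pred p1 (normr_ge0 h)) mulrCA [LHS]mulrC; congr (_ * _).
by rewrite normrEsg mulrCA mulVf ?mulr1.
Qed.

(** On t >= 0 this is (t + e)^r minus its value at 0, since compositions require a function
    vanishing at 0. It is used with r = 1 - p. *)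
Lemma shift_pow_C1 (r e : R) : 0 < e ->
  C1 (fun t : R => Num.sg t * ((`|t| + e) `^ r - e `^ r)) (fun t : R => r * (`|t| + e) `^ (r - 1)).
Proof.
move=> e0; have te (t : R) : 0 < `|t| + e by rewrite ltr_wpDl.
have := @odd_ext_C1 (fun t : R => (t + e) `^ r) (fun t : R => r * (t + e) `^ (r - 1)).
rewrite add0r; apply.
  move=> t t0; have te0 : 0 < t + e by rewrite ltr_wpDl.
  have d1 := powR_is_derive r te0.
  have d2 : is_derive t 1 (fun s : R => s + e) 1.
    by apply: is_derive_eq; rewrite addr0.
  have d3 := @is_derive1_comp _ (fun x : R => x `^ r) (fun s : R => s + e) t _ _ d1 d2.
  by rewrite mulr1 in d3; exact: d3.
move=> t; apply: cvgM; first exact: cvg_cst.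
apply: (@continuous_cvg _ _ _ _ _ _ (fun s : R => s `^ (r - 1))).
  apply: differentiable_continuous; apply/derivable1_diffP.
  by have [] := powR_is_derive (r - 1) (te t).
apply: cvgD; last exact: cvg_cst.
by apply: cvg_norm; exact: cvg_id.
Qed.

(** A bounded function that tends to the sign of t as e tends to 0. *)
Lemma satur_C1 (e : R) : 0 < e -> C1 (fun t : R => t / (`|t| + e)) (fun t : R => e / (`|t| + e) ^+ 2).
Proof.
move=> e0; have te (t : R) : 0 < `|t| + e by rewrite ltr_wpDl.
have [||d c] := @odd_ext_C1 (fun t : R => - (e / (t + e))) (fun t : R => e / (t + e) ^+ 2).
- move=> t t0; have te0 : t + e != 0 by rewrite gt_eqF// ltr_wpDl.
  have d1 : is_derive t 1 (fun s : R => s + e) 1 by apply: is_derive_eq; rewrite addr0.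
  have d2 : is_derive t 1 (fun s : R => (s + e)^-1) (- (t + e) ^- 2 *: (1 : R)).
    exact: is_deriveV.
  have d3 : is_derive t 1 (fun s : R => - (e * (s + e)^-1)) (- (e *: (- (t + e) ^- 2 *: (1 : R)))).
    by apply: is_deriveN; exact: is_deriveZ.
  apply: (is_derive_eq d3); rewrite /GRing.scale /=; field.
  exact: te0.
- move=> t; apply: cvgM; first exact: cvg_cst.
  apply: cvgV; first by rewrite expf_neq0// gt_eqF.
  have c1 : (fun t : R => `|t| + e) @ t --> `|t| + e.
    by apply: cvgD; [apply: cvg_norm; exact: cvg_id|exact: cvg_cst].
  by rewrite expr2; under eq_fun do rewrite expr2; apply: cvgM.
rewrite (_ : (fun t => t / (`|t| + e)) =
  fun t => Num.sg t * (- (e / (`|t| + e)) - - (e / (0 + e)))); first by split.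
apply/funext => t; rewrite {1}[t]numEsg -mulrA; congr (_ * _).
by rewrite add0r; field; rewrite !gt_eqF.
Qed.

End C1_functions.

Lemma pic_arith (R : realFieldType) (B P A T : R) : B <= 2 * P + T * A ->
  0 <= T * P -> 0 <= T * A -> 0 <= A -> B <= 2 * ((T + 1) * (P + A)).
Proof. by move=> *; rewrite mulrDl mul1r mulrDr; lra. Qed.

(** * Picone's inequality for vectors *)

Section picone_pointwise.
Variables (R : realType) (N : nat) (p : R).
Hypothesis p1 : 1 < p.
Local Notation V := 'rV[R]_N.
Implicit Types (a b : V).

Let p0 : 0 < p. Proof. exact: lt_trans p1. Qed.
Let p10 : 0 < p - 1. Proof. by rewrite subr_gt0. Qed.

Definition pdot a b : R := enorm a `^ (p - 2) * dotv a b.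

Lemma powR_pred2 (x : R) : 0 <= x -> x `^ (p - 2) * x = x `^ (p - 1).
Proof.
move=> x0; have [->|xn0] := eqVneq x 0; first by rewrite mulr0 powR0// gt_eqF.
rewrite -[X in _ * X](powRr1 x0) -powRD; last by rewrite xn0 implybT.
by congr (_ `^ _); ring.
Qed.

Lemma pdotaa a : pdot a a = enorm a `^ p.
Proof.
by rewrite /pdot -enorm_sq expr2 mulrA powR_pred2 ?enorm_ge0// powR_pred// enorm_ge0.
Qed.

Lemma pdot_le a b : `|pdot a b| <= enorm a `^ (p - 1) * enorm b.
Proof.
rewrite /pdot normrM (ger0_norm (powR_ge0 _ _)) -powR_pred2 ?enorm_ge0// -mulrA.
by apply: ler_wpM2l; [exact: powR_ge0|exact: dotv_le].
Qed.

Lemma pdotDr a b c : pdot a (b + c) = pdot a b + pdot a c.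
Proof. by rewrite /pdot dotvDr mulrDr. Qed.

Lemma pdotZr a b t : pdot a (t *: b) = t * pdot a b.
Proof. by rewrite /pdot dotvZr mulrCA. Qed.

Lemma pdotZl a b t : pdot (t *: a) b = Num.sg t * `|t| `^ (p - 1) * pdot a b.
Proof.
rewrite /pdot enormZ dotvZl powRM ?enorm_ge0// -(powR_pred2 (normr_ge0 t)).
by rewrite {2}[t]numEsg; ring.
Qed.

(** The defect in the tangent inequality of |.|^p at [b]. Picone's identity integrates it with a =
    grad v and b = (v / phi) grad phi. *)
Definition pic a b : R := enorm a `^ p + (p - 1) * enorm b `^ p - p * pdot b a.

Lemma pic_ge0 a b : 0 <= pic a b.
Proof.
rewrite subr_ge0; apply: le_trans (young_powR p1 (enorm_ge0 a) (enorm_ge0 b)).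
apply: ler_wpM2l; first exact: ltW.
exact: le_trans (ler_norm _) (pdot_le b a).
Qed.

(** Equality holds in Young's inequality, whence |a| = |b|, and in that of Cauchy and Schwarz,
    whence |a - b| = 0. *)
Lemma pic_eq0 a b : pic a b = 0 -> a = b.
Proof.
move=> h; have h1 := le_trans (ler_norm _) (pdot_le b a).
have h2 : p * pdot b a = enorm a `^ p + (p - 1) * enorm b `^ p.
  by apply/eqP; rewrite eq_sym -subr_eq0; apply/eqP.
have ab : enorm a = enorm b.
  apply/eqP; apply: contrapT => /negP ab.
  have := strict_young p1 (enorm_ge0 a) (enorm_ge0 b) ab; rewrite -h2 ltr_pM2l//.
  by rewrite ltNge h1.
have [b0|b0] := eqVneq (enorm b) 0.
  by rewrite (enorm_eq0 b0); apply: enorm_eq0; rewrite ab.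
have bp : 0 < enorm b by rewrite lt0r b0 enorm_ge0.
have h3 : pdot b a = enorm b `^ p.
  apply: (@mulfI _ p); first by rewrite gt_eqF.
  by rewrite h2 ab; ring.
have h4 : dotv b a = enorm b ^+ 2.
  apply: (@mulfI _ (enorm b `^ (p - 2))); first by rewrite gt_eqF// powR_gt0.
  by rewrite -/(pdot b a) h3 -pdotaa /pdot enorm_sq.
apply/eqP; rewrite -subr_eq0; apply/eqP; apply: enorm_eq0; apply/eqP.
rewrite -sqrf_eq0 enorm_sq dotvDl !dotvDr !dotvNl !dotvNr -!enorm_sq (dotvC a b) h4 ab.
by apply/eqP; ring.
Qed.

(** Young's inequality with 2|a| in place of |a| leaves half of (p - 1)|b|^p over. *)
Lemma pic_coercive : exists2 C : R, 0 <= C & forall a b,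
  enorm b `^ p <= C * (pic a b + enorm a `^ p).
Proof.
have q0 : 0 < 2 / (p - 1) by rewrite divr_gt0.
exists (2 / (p - 1) * (2 `^ p + 1)).
  by rewrite mulr_ge0 ?(ltW q0)// addr_ge0 ?powR_ge0.
move=> a b; have h := young_powR p1 (mulr_ge0 (ler0n R 2) (enorm_ge0 a)) (enorm_ge0 b).
have h1 := ler_wpM2l (ltW p0) (le_trans (ler_norm _) (pdot_le b a)).
rewrite powRM ?enorm_ge0// in h.
have A0 : 0 <= enorm a `^ p by exact: powR_ge0.
have P0 := pic_ge0 a b.
have T0 : 0 <= 2 `^ p :> R by exact: powR_ge0.
have h3 : p * (enorm b `^ (p - 1) * (2 * enorm a)) =
    2 * (p * (enorm b `^ (p - 1) * enorm a)) by ring.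
rewrite h3 in h.
have h4 : (p - 1) * enorm b `^ p <= 2 * pic a b + 2 `^ p * enorm a `^ p.
  by rewrite /pic; lra.
have := pic_arith h4 (mulr_ge0 T0 P0) (mulr_ge0 T0 A0) A0.
rewrite mulrC -ler_pdivlMr// => h5; apply: (le_trans h5).
by rewrite le_eqVlt; apply/orP; left; apply/eqP; ring.
Qed.

End picone_pointwise.


(** A sum, over a finite subcover, of bumps scaled to exceed 1 around their centres. *)
Lemma cutoff (R : realType) (N : nat) (Om K : set 'rV[R]_N) : open Om -> compact K ->
  K `<=` Om -> exists psi : 'rV[R]_N -> R, [/\ test_function Om psi,
    forall x, 0 <= psi x & forall x, K x -> 1 <= psi x].
Proof.
move=> oO cK KO.
have /choice[tau tauP] : forall x, exists t : 'rV[R]_N -> R, K x ->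
    [/\ test_function Om t, forall y, 0 <= t y & 1 < t x].
  move=> x; have [Kx|nK] := pselect (K x); last by exists (fun=> 0).
  have [e e0 he] : exists2 e : R, 0 < e & forall y : 'rV[R]_N,
      (forall i, `|x 0 i - y 0 i| < e) -> Om y.
    by apply/rV_nbhs; apply: open_nbhs_nbhs; split => //; exact: KO.
  pose a : 'rV[R]_N := \row_i (x 0 i - e / 2); pose b : 'rV[R]_N := \row_i (x 0 i + e / 2).
  have xab : obox a b x by move=> i; rewrite !mxE; lra.
  have b0 := bump_gt0 xab.
  exists (fun y => 2 / bump a b x * bump a b y) => _; split.
  - apply: test_scale; split; first exact: smooth_bump.
    exists (cbox a b); split; first exact: compact_cbox.
      move=> y hy; apply: he => i; have := hy i; rewrite !mxE => /andP[h1 h2].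
      by rewrite ltr_norml; apply/andP; split; lra.
    by move=> y hy; apply: bump_out => h; apply: hy; exact: obox_cbox.
  - move=> y; apply: mulr_ge0; first by rewrite divr_ge0// ltW.
    by have [h|h] := pselect (obox a b y); [exact/ltW/bump_gt0|rewrite bump_out].
  - by rewrite divfK ?gt_eqF// ltr1n.
have := cK; rewrite compact_cover => /(_ _ K (fun x => [set y | 1 < tau x y])).
case=> [x Kx|x Kx|D DK KD].
- have [t _ _] := tauP x Kx.
  have ct : continuous (tau x) by have [s _] := t; have [] := s [::].
  by move/continuousP: ct => /(_ _ (@open_gt R 1)).
- by exists x => //=; have [] := tauP x Kx.
pose r := finmap.enum_fset D.
have rK : all (fun x => `[< K x >]) r by apply/allP => x /DK /set_mem h; apply/asboolP.
have [t s0 s1] : [/\ test_function Om (fun y => \sum_(x <- r) tau x y),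
    (forall y, 0 <= \sum_(x <- r) tau x y) &
    forall x y, x \in r -> tau x y <= \sum_(x <- r) tau x y].
  elim: r rK => [_|x r IHr /= /andP[/asboolP Kx /IHr [t t0 t1]]].
    split=> [|y|//]; last by rewrite big_nil.
    rewrite (_ : (fun _ => _) = fun=> 0); first exact: test0.
    by apply/funext => y; rewrite big_nil.
  have [tx tx0 _] := tauP x Kx; split.
  - rewrite (_ : (fun _ => _) = fun y => tau x y + \sum_(x <- r) tau x y).
      exact: test_add.
    by apply/funext => y; rewrite big_cons.
  - by move=> y; rewrite big_cons addr_ge0.
  - move=> z y; rewrite inE big_cons => /orP[/eqP ->|zr]; first by rewrite lerDl.
    by rewrite ler_wpDl ?t1.
exists (fun y => \sum_(x <- r) tau x y); split=> // y Ky.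
by have [x xD /ltW h] := KD _ Ky; exact: le_trans h (s1 _ _ xD).
Qed.

Section fatou_limit.
Context d (T : measurableType d) (R : realType) (mu : {measure set T -> \bar R}) (D : set T).
Hypothesis mD : measurable D.

Lemma I_fatou_lim (fn : (T -> R)^nat) (f : T -> R) (cn : nat -> R) (c : R) :
  (forall n, mu.-integrable D (EFin \o fn n)) -> (forall n x, D x -> 0 <= fn n x) ->
  measurable_fun D f -> {ae mu, forall x, D x -> fn n x @[n --> \oo] --> f x} ->
  (forall n, \int[mu]_(x in D) fn n x <= cn n) -> cn n @[n --> \oo] --> c ->
  mu.-integrable D (EFin \o f) /\ \int[mu]_(x in D) f x <= c.
Proof.
move=> fi f0 mf ff fc cc.
have step (e : R) : 0 < e -> mu.-integrable D (EFin \o f) /\ \int[mu]_(x in D) f x <= c + e.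
  move=> e0; have : \forall n \near \oo, `|c - cn n| < e by move/cvgrPdist_lt: cc; apply.
  move=> [n0 _ hn0].
  apply: (@I_fatou _ _ _ mu D mD (fun n => fn (n + n0)%N)).
  - by move=> n; exact: fi.
  - by move=> n x Dx; exact: f0.
  - exact: mf.
  - apply: filterS ff => x h Dx.
    exact: (subseq_cvg (k := fun n => (n + n0)%N) (fun n => leq_addr n0 n) (h Dx)).
  - move=> n; apply: (le_trans (fc _)); have := hn0 _ (leq_addl n n0).
    by rewrite /= ltr_norml => /andP[h _]; lra.
split; first by have [] := step 1 ltr01.
by apply/ler_addgt0Pr => e e0; have [] := step e e0.
Qed.

End fatou_limit.

(** * Picone's identity, Hardy's inequality and simplicity *)

Section picone.
Variables (R : realType) (N : nat) (Om : set 'rV[R]_N) (p : R).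
Local Notation V := 'rV[R]_N.
Local Notation mu := (lebm R N).
Local Notation pd i u := ('D_(evec R i) u).
Local Notation L u := (Lp mu Om p u).
Local Notation LV := (LpV Om p).
Local Notation d u v := (dist mu Om p u v).
Local Notation I f := (\int[mu]_(x in Om) f x).
Local Notation intg f := (mu.-integrable Om (EFin \o f)).
Local Notation ae P := {ae mu, forall x, Om x -> P x}.
Local Notation Sob := (Sob Om p).
Local Notation J := (J Om p).
Hypotheses (hN : (0 < N)%N) (oO : open Om) (cO : connected Om) (nO : Om !=set0).
Hypotheses (fO : (mu Om < +oo)%E) (p1 : 1 < p).
Implicit Types (u v w : V -> R) (g H : V -> V).

Let mO : measurable Om. Proof. exact: open_measurable_rV. Qed.
Let p0 : 0 < p. Proof. exact: lt_trans p1. Qed.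
Let p10 : 0 < p - 1. Proof. by rewrite subr_gt0. Qed.
Let p1' : 1 <= p. Proof. exact: ltW. Qed.

Lemma cvg_sum_ord (F : 'I_N -> nat -> R) (l : 'I_N -> R) :
  (forall i, F i n @[n --> \oo] --> l i) -> \sum_i F i n @[n --> \oo] --> \sum_i l i.
Proof.
move=> h; elim: (index_enum _) => [|i r IHr].
  by under eq_fun do rewrite big_nil; rewrite big_nil; exact: cvg_cst.
by under eq_fun do rewrite big_cons; rewrite big_cons; apply: cvgD; [exact: h|exact: IHr].
Qed.

Lemma enorm_cvg (an : nat -> V) (a : V) : (forall i, an n 0 i @[n --> \oo] --> a 0 i) ->
  enorm (an n) @[n --> \oo] --> enorm a.
Proof.
move=> ca; apply: (cvg_bound (g := fun n => \sum_i `|an n 0 i - a 0 i|)).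
  move=> n; apply: (le_trans (enorm_dist _ _)); apply: (le_trans (enorm_le_sum _)).
  by apply: ler_sum => i _; rewrite !mxE.
have z : \sum_(i < N) (0 : R) = 0 by rewrite big1.
rewrite -[X in _ --> X]z; apply: (cvg_sum_ord (F := fun i n => `|an n 0 i - a 0 i|)
  (l := fun=> 0)) => i.
rewrite -(normr0 R) -(subrr (a 0 i)).
by apply: cvg_norm; apply: cvgB; [exact: ca|exact: cvg_cst].
Qed.

Lemma measurable_powf (r : R) u : measurable_fun Om u -> measurable_fun Om (fun x => u x `^ r).
Proof.
move=> mu_; apply: (@measurableT_comp _ _ _ _ _ _ (fun t => t `^ r)) => //.
Qed.

Lemma measurable_pdot g H : LV g -> LV H -> measurable_fun Om (fun x => pdot p (g x) (H x)).
Proof.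
move=> Lg LH; apply: measurable_funM.
  by apply: measurable_powf; apply: measurable_En => //; exact: LpV_meas.
by apply: measurable_dotv => //; exact: LpV_meas.
Qed.

Lemma pow_mul_le (a b : R) : 0 <= a -> 0 <= b ->
  b `^ (p - 1) * a <= a `^ p + (p - 1) * b `^ p.
Proof.
move=> a0 b0; apply: le_trans (young_powR p1 a0 b0).
by rewrite ler_peMl// mulr_ge0 ?powR_ge0.
Qed.

Lemma pdot_intg g H : LV g -> LV H -> intg (fun x => pdot p (g x) (H x)).
Proof.
move=> Lg LH; have i1 := intg_En oO p1 LH; have i2 := intg_En oO p1 Lg.
apply: (intg_le mO _ _ (intg_add mO i1 (intg_scale mO (p - 1) i2))).
  exact: measurable_pdot.
move=> x _; apply: (le_trans (pdot_le p1 _ _)).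
exact: pow_mul_le (enorm_ge0 _) (enorm_ge0 _).
Qed.

Lemma J_cvg (gn : nat -> V -> V) g : (forall n, LV (gn n)) -> LV g ->
  (forall i, d (gco i (gn n)) (gco i g) @[n --> \oo] --> 0) -> J (gn n) @[n --> \oo] --> J g.
Proof.
move=> Ln Lg cg.
have cE : d (En (gn n)) (En g) @[n --> \oo] --> 0.
  apply: (cvg0_le (g := fun n => \sum_i d (gco i (gn n)) (gco i g))).
    move=> n; rewrite (ger0_norm (dist_ge0 _ _ _ _ _)).
    have LD := LpV_sub oO p1 (Ln n) Lg; have [LE nE] := En_Lp oO p1 LD.
    apply: (@le_trans _ _ (nrm mu Om p (En (fun x => gn n x - g x)))).
      have LEE := Lp_sub mO p1' (Lp_En oO p1 (Ln n)) (Lp_En oO p1 Lg).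
      apply: (Lp_le mO (ltW p0) LEE.1 _ LE).2 => x _.
      by rewrite [leRHS]ger0_norm ?enorm_ge0//; exact: enorm_dist.
    apply: (le_trans nE); apply: ler_sum => i _.
    have e : gco i (fun x => gn n x - g x) = fun x => gco i (gn n) x - gco i g x.
      by apply/funext => x; rewrite /gco !mxE.
    rewrite e; exact: lexx.
  have z : \sum_(i < N) (0 : R) = 0 by rewrite big1.
  by rewrite -[X in _ --> X]z; exact: cvg_sum_ord.
have c := dist_nrm_cvg mO p1' (fun n => Lp_En oO p1 (Ln n)) (Lp_En oO p1 Lg) cE.
have E h : J h = `|nrm mu Om p (En h)| `^ p by rewrite J_nrm// ger0_norm ?nrm_ge0.
rewrite E; under eq_fun do rewrite E.
apply: (@continuous_cvg _ _ _ _ _ _ (fun t : R => `|t| `^ p)); [exact: (C1_cont (pow_C1 p1))|exact: c].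
Qed.

Lemma Ipow_cvg (un : nat -> V -> R) u : (forall n, L (un n)) -> L u ->
  d (un n) u @[n --> \oo] --> 0 ->
  I (fun x => `|un n x| `^ p) @[n --> \oo] --> I (fun x => `|u x| `^ p).
Proof.
move=> Ln Lu cu; have c := dist_nrm_cvg mO p1' Ln Lu cu.
have E h : I (fun x => `|h x| `^ p) = `|nrm mu Om p h| `^ p.
  by rewrite (ger0_norm (nrm_ge0 _ _ _ _)) (nrm_powR mu Om h p0).
rewrite E; under eq_fun do rewrite E.
apply: (@continuous_cvg _ _ _ _ _ _ (fun t : R => `|t| `^ p)); [exact: (C1_cont (pow_C1 p1))|exact: c].
Qed.

(** Fatou's lemma for [pic] requires a.e. convergence of the gradients as well; subsequences are
    extracted one coordinate after the other. *)
Lemma Sob_seq_grad u g : Sob u g -> exists phi : nat -> V -> R,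
  [/\ forall n, test_function Om (phi n), d (phi n) u @[n --> \oo] --> 0,
      (forall i, d (pd i (phi n)) (gco i g) @[n --> \oo] --> 0),
      ae (fun x => phi n x @[n --> \oo] --> u x) &
      forall i, ae (fun x => pd i (phi n) x @[n --> \oo] --> gco i g x)].
Proof.
move=> Su; have [Lu Lg _] := Su; have [phi [t c1 c2 cae]] := Sob_seq oO fO p1 Su.
have [k [kS kP]] : exists k : nat -> nat, (forall n, (n <= k n)%N) /\ forall i,
    i \in index_enum 'I_N -> ae (fun x => pd i (phi (k n)) x @[n --> \oo] --> gco i g x).
  elim: (index_enum _) => [|i r [k [kn kP]]]; first by exists id.
  have [|k' k'S ck'] := dist_subseq_ae mO p1' fO
    (fun n => test_Lp oO fO p1 (test_pd i (t (k n)))) (Lg i).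
    exact: (subseq_cvg kn (c2 i)).
  have k'n := subseq_ge k'S.
  exists (fun n => k (k' n)); split=> [n|j]; first exact: leq_trans (k'n n) (kn _).
  rewrite inE => /orP[/eqP ->|jr]; first exact: ck'.
  by apply: filterS (kP j jr) => x h Ox; exact: (subseq_cvg k'n (h Ox)).
exists (fun n => phi (k n)); split.
- by move=> n; exact: t.
- exact: (subseq_cvg kS c1).
- by move=> i; exact: (subseq_cvg kS (c2 i)).
- by apply: filterS cae => x h Ox; exact: (subseq_cvg kS (h Ox)).
- by move=> i; apply: kP; rewrite mem_index_enum.
Qed.

Lemma pic_scale (a b : V) (c : R) : pic p a (c *: b) = enorm a `^ p +
  (p - 1) * (`|c| `^ p * enorm b `^ p) - p * (Num.sg c * `|c| `^ (p - 1) * pdot p b a).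
Proof. by rewrite /pic (pdotZl p1) enormZ powRM ?enorm_ge0. Qed.

Lemma pic_cvg (an : nat -> V) (a b : V) (cn : nat -> R) (c : R) :
  (forall i, an n 0 i @[n --> \oo] --> a 0 i) -> cn n @[n --> \oo] --> c ->
  pic p (an n) (cn n *: b) @[n --> \oo] --> pic p a (c *: b).
Proof.
move=> ca cc; rewrite pic_scale; under eq_fun do rewrite pic_scale.
have ce := enorm_cvg ca.
have cp : `|cn n| `^ p @[n --> \oo] --> `|c| `^ p.
  by apply: (@continuous_cvg _ _ _ _ _ _ (fun t : R => `|t| `^ p)); [exact: (C1_cont (pow_C1 p1))|exact: cc].
have cpe : enorm (an n) `^ p @[n --> \oo] --> enorm a `^ p.
  have E (h : V) : enorm h `^ p = `|enorm h| `^ p by rewrite ger0_norm ?enorm_ge0.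
  rewrite E; under eq_fun do rewrite E.
  by apply: (@continuous_cvg _ _ _ _ _ _ (fun t : R => `|t| `^ p)); [exact: (C1_cont (pow_C1 p1))|exact: ce].
have cs : Num.sg (cn n) * `|cn n| `^ (p - 1) @[n --> \oo] --> Num.sg c * `|c| `^ (p - 1).
  by apply: (@continuous_cvg _ _ _ _ _ _ (fun t : R => Num.sg t * `|t| `^ (p - 1)));
    [exact: (sgpow_continuous p10)|exact: cc].
have cpd : pdot p b (an n) @[n --> \oo] --> pdot p b a.
  apply: cvgM; first exact: cvg_cst.
  by apply: cvg_sum_ord => i; apply: cvgM; [exact: cvg_cst|exact: ca].
apply: cvgB.
  apply: cvgD; first exact: cpe.
  by apply: cvgM; [exact: cvg_cst|apply: cvgM; [exact: cp|exact: cvg_cst]].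
by apply: cvgM; [exact: cvg_cst|apply: cvgM; [exact: cs|exact: cpd]].
Qed.

Variables (phi : V -> R) (G : V -> V) (la : R).
Hypotheses (Sphi : Sob phi G) (phi0 : forall x, 0 < phi x).
Hypothesis EL : forall w H, Sob w H ->
  I (fun x => pdot p (G x) (H x)) = la * I (fun x => phi x `^ (p - 1) * w x).

Let LG : LV G. Proof. by case: Sphi. Qed.

Lemma powR_div (a b r : R) : 0 <= a -> 0 < b -> (a / b) `^ r = a `^ r * b `^ (- r).
Proof.
move=> a0 b0; rewrite powRM ?invr_ge0 ?(ltW b0)// -(powR_inv1 (ltW b0)) -powRrM.
by rewrite mulN1r.
Qed.

(** The equation of [phi] is tested with |v|^p (phi + e)^(1 - p), where e > 0 keeps the power and
    its derivative bounded. *)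
Lemma picone_eps v e : test_function Om v -> 0 < e ->
  let P x := pic p (tgrad v x) ((v x / (phi x + e)) *: G x) in
  intg P /\ I P = J (tgrad v) -
    la * I (fun x => `|v x| `^ p * (phi x / (phi x + e)) `^ (p - 1)).
Proof.
move=> tv e0 P; pose K (t : R) := Num.sg t * ((`|t| + e) `^ (1 - p) - e `^ (1 - p)).
pose K' (t : R) := (1 - p) * (`|t| + e) `^ (1 - p - 1).
have CK : C1 K K' by exact: shift_pow_C1.
have rE : 1 - p - 1 = - p by ring.
have K'b t : `|K' t| <= (p - 1) * (e `^ p)^-1.
  rewrite /K' rE normrM -normrN opprB (gtr0_norm p10) (ger0_norm (powR_ge0 _ _)).
  apply: ler_wpM2l; first exact: ltW.
  rewrite powRN lef_pV2 ?posrE ?powR_gt0//; last by rewrite ltr_wpDl.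
  by apply: powR_le; [exact: ltW|exact: ltW|rewrite lerDr].
have K0 : K 0 = 0 by rewrite /K sgr0 mul0r.
have SK := Sob_comp oO fO p1 CK K0 K'b Sphi.
have Ck := pow_C1 p1.
have k0 : `|0 : R| `^ p = 0 by rewrite normr0 powR0// gt_eqF.
have S1 := Sob_mul_comp_test oO fO p1 Ck k0 tv SK.
pose k' (t : R) := p * (Num.sg t * `|t| `^ (p - 1)).
have S2 : Sob (fun x => `|v x| `^ p) (fun x => k' (v x) *: tgrad v x).
  apply: (Sob_comp_test oO fO p1 Ck k0 tv) => i.
  by apply/funext => x; rewrite /gco !mxE.
(* [K] is the power minus its value e^(1 - p) at 0, so e^(1 - p) |v|^p is added back. *)
have S3 := Sob_add oO fO p1 S1 (Sob_scale oO fO p1 (e `^ (1 - p)) S2).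
have Ltv : LV (tgrad v) by case: (Sob_test oO fO p1 tv).
have i1 := intg_En oO p1 Ltv.
have [_ LH _] := S3; have i2 := pdot_intg LG LH.
have th0 x : 0 < phi x + e by rewrite addr_gt0.
have Pe x : P x = enorm (tgrad v x) `^ p - pdot p (G x)
    (`|v x| `^ p *: (K' (phi x) *: G x) + (K (phi x) * k' (v x)) *: tgrad v x +
     e `^ (1 - p) *: (k' (v x) *: tgrad v x)).
  rewrite /P pic_scale; rewrite !(pdotDr, pdotZr) pdotaa//.
  rewrite sgrM (gtr0_sg (_ : 0 < (phi x + e)^-1)) ?invr_gt0// mulr1 normrM.
  rewrite (gtr0_norm (_ : 0 < (phi x + e)^-1)) ?invr_gt0//.
  rewrite !(powR_div _ (normr_ge0 _) (th0 x)) opprB.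
  rewrite /K /K' /k' (gtr0_sg (phi0 x)) mul1r (gtr0_norm (phi0 x)) rE; ring.
split.
  by apply: (intg_eq mO _ (intg_sub mO i1 i2)) => x _; rewrite Pe.
rewrite (I_eq mu (fun x _ => Pe x)) (I_sub mO i1 i2) -J_E; congr (_ - _).
rewrite (EL S3); congr (_ * _); apply: I_eq => x _.
rewrite powR_div ?(ltW (phi0 x))// opprB /K (gtr0_sg (phi0 x)) mul1r (gtr0_norm (phi0 x)); ring.
Qed.

(** e tends to 0: Fatou's lemma on the left, dominated convergence on the right, since phi / (phi +
    e) lies in [0, 1] and tends to 1. *)
Lemma picone_test v : test_function Om v ->
  let P x := pic p (tgrad v x) ((v x / phi x) *: G x) in
  [/\ measurable_fun Om P, intg P & I P <= J (tgrad v) - la * I (fun x => `|v x| `^ p)].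
Proof.
move=> tv P; have Ltv : LV (tgrad v) by case: (Sob_test oO fO p1 tv).
have mv := test_meas mO tv.
have mphi : measurable_fun Om phi := (Sob_Lp Sphi).1.
pose e n : R := n.+1%:R^-1; have e0 n : 0 < e n by rewrite invr_gt0.
have ce x : v x / (phi x + e n) @[n --> \oo] --> v x / phi x.
  apply: cvgM; first exact: cvg_cst.
  apply: cvgV; first by rewrite gt_eqF.
  by rewrite -[X in _ --> X]addr0; apply: cvgD; [exact: cvg_cst|exact: cvg_harmonic].
have cP x : pic p (tgrad v x) ((v x / (phi x + e n)) *: G x) @[n --> \oo] --> P x.
  by apply: pic_cvg => // i; exact: cvg_cst.
have mP : measurable_fun Om P.
  apply: (measurable_lim (f := fun n x => pic p (tgrad v x) ((v x / (phi x + e n)) *: G x))).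
    by move=> n; have [ip _] := picone_eps tv (e0 n); exact: intg_meas ip.
  by move=> x _; exact: cP.
suff [iP IP] : intg P /\ I P <= J (tgrad v) - la * I (fun x => `|v x| `^ p) by split.
apply: (@I_fatou_lim _ _ _ mu Om mO
    (fun n x => pic p (tgrad v x) ((v x / (phi x + e n)) *: G x)) P
    (fun n => J (tgrad v) - la * I (fun x => `|v x| `^ p * (phi x / (phi x + e n)) `^ (p - 1)))
    (J (tgrad v) - la * I (fun x => `|v x| `^ p))).
- by move=> n; have [] := picone_eps tv (e0 n).
- by move=> n x _; exact: pic_ge0.
- exact: mP.
- by apply: aeW => x _; exact: cP.
- by move=> n; have [_ ->] := picone_eps tv (e0 n); exact: lexx.
have Lv := test_Lp oO fO p1 tv; have [_ iv] := Lv.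
have q01 n x : 0 <= phi x / (phi x + e n) <= 1.
  have h : 0 < phi x + e n by rewrite addr_gt0.
  by rewrite divr_ge0 ?(ltW (phi0 x)) ?(ltW h)// (ler_pdivrMr _ _ h) mul1r lerDl ltW.
apply: cvgB; first exact: cvg_cst.
apply: cvgM; first exact: cvg_cst.
have [] := @I_dct _ _ _ mu Om mO
  (fun n x => `|v x| `^ p * (phi x / (phi x + e n)) `^ (p - 1)) (fun x => `|v x| `^ p)
  (fun x => `|v x| `^ p); last by [].
- move=> n; apply: measurable_funM; first exact: (intg_meas iv).
  apply: measurable_powf.
  apply: (eq_measurable_fun (fun x => phi x / (`|phi x| + e n))) => [x _|].
    by rewrite (gtr0_norm (phi0 x)).
  exact: (cont_meas (C1_cont (satur_C1 (e0 n))) mphi).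
- exact: (intg_meas iv).
- exact: iv.
- apply: aeW => x _; rewrite -[X in _ --> X]mulr1.
  apply: cvgM; first exact: cvg_cst.
  rewrite [X in _ --> X](_ : _ = Num.sg (1 : R) * `|1 : R| `^ (p - 1)); last first.
    by rewrite sgr1 normr1 powR1 mulr1.
  have E n : (phi x / (phi x + e n)) `^ (p - 1) = Num.sg (phi x / (phi x + e n)) *
      `|phi x / (phi x + e n)| `^ (p - 1).
    have h : 0 < phi x / (phi x + e n) by rewrite divr_gt0 ?addr_gt0.
    by rewrite (gtr0_sg h) (gtr0_norm h) mul1r.
  under eq_fun do rewrite E.
  apply: (@continuous_cvg _ _ _ _ _ _ (fun t : R => Num.sg t * `|t| `^ (p - 1))).
    exact: (sgpow_continuous p10).
  rewrite -(divff (lt0r_neq0 (phi0 x))); apply: cvgM; first exact: cvg_cst.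
  apply: cvgV; first by rewrite gt_eqF.
  by rewrite -[X in _ --> X]addr0; apply: cvgD; [exact: cvg_cst|exact: cvg_harmonic].
- move=> n; apply: aeW => x _; have /andP[a b] := q01 n x.
  rewrite ger0_norm ?mulr_ge0 ?powR_ge0// ler_piMr ?powR_ge0//.
  by have := powR_le (ltW p10) a b; rewrite powR1.
Qed.

Let mphi : measurable_fun Om phi. Proof. exact: (Sob_Lp Sphi).1. Qed.

Lemma measurable_ratio v : measurable_fun Om v -> measurable_fun Om (fun x => v x / phi x).
Proof.
move=> mv; apply: measurable_funM; first exact: mv.
apply: (eq_measurable_fun (fun x => phi x `^ (-1))) => [x _|]; last exact: measurable_powf.
by rewrite powR_inv1// ltW.
Qed.

Lemma picone_sob v g : Sob v g ->
  let P x := pic p (g x) ((v x / phi x) *: G x) in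
  intg P /\ I P <= J g - la * I (fun x => `|v x| `^ p).
Proof.
move=> Sv P; have [psi [t c1 c2 a1 a2]] := Sob_seq_grad Sv.
have [Lv Lg _] := Sv.
have Lt n : LV (tgrad (psi n)) by case: (Sob_test oO fO p1 (t n)).
apply: (@I_fatou_lim _ _ _ mu Om mO
  (fun n x => pic p (tgrad (psi n) x) ((psi n x / phi x) *: G x)) P
  (fun n => J (tgrad (psi n)) - la * I (fun x => `|psi n x| `^ p))).
- by move=> n; have [_ h _] := picone_test (t n).
- by move=> n x _; exact: pic_ge0.
- have mr := measurable_ratio Lv.1.
  apply: (eq_measurable_fun (fun x => enorm (g x) `^ p +
    (p - 1) * (`|v x / phi x| `^ p * enorm (G x) `^ p) -
    p * (Num.sg (v x / phi x) * `|v x / phi x| `^ (p - 1) * pdot p (G x) (g x)))).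
    by move=> x _; rewrite /P (pic_scale).
  apply: measurable_funB; first apply: measurable_funD.
  + exact: (intg_meas (intg_En oO p1 Lg)).
  + apply: measurable_funM; first exact: measurable_cst.
    apply: measurable_funM; last exact: (intg_meas (intg_En oO p1 LG)).
    exact: (cont_meas (C1_cont (pow_C1 p1)) mr).
  + apply: measurable_funM; first exact: measurable_cst.
    apply: measurable_funM; last exact: (intg_meas (pdot_intg LG Lg)).
    apply: (cont_meas (k := fun t : R => Num.sg t * `|t| `^ (p - 1)) _ mr).
    by apply: sgpow_continuous; rewrite subr_gt0.
- have a3 : {ae mu, forall x, forall i, Om x -> pd i (psi n) x @[n --> \oo] --> gco i g x}.
    by apply: filter_forall => i; exact: a2.
  apply: filterS2 a1 a3 => x h1 h3 Ox; apply: (pic_cvg).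
    by move=> i; under eq_fun do rewrite mxE; exact: h3.
  by apply: cvgM; [exact: h1|exact: cvg_cst].
- by move=> n; have [_ _ h] := picone_test (t n).
- apply: cvgB.
    apply: (J_cvg Lt Lg) => i; under eq_fun do rewrite gco_tgrad.
    exact: (c2 i).
  apply: cvgM; first exact: cvg_cst.
  exact: (Ipow_cvg (fun n => test_Lp oO fO p1 (t n)) Lv c1).
Qed.

Lemma eigen_ratio v g : Sob v g -> J g <= la * I (fun x => `|v x| `^ p) ->
  ae (fun x => g x = (v x / phi x) *: G x).
Proof.
move=> Sv Jv; have [iP IP] := picone_sob Sv.
have h : ae (fun x => pic p (g x) ((v x / phi x) *: G x) = 0).
  apply: (I_eq0 mO iP); first by move=> x _; exact: pic_ge0.
  by apply: (le_trans IP); rewrite subr_le0.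
by apply: filterS h => x h Ox; exact: (pic_eq0 p1 (h Ox)).
Qed.

(** The coercivity of [pic] controls psi grad phi / phi by the energy of [psi]. This local
    integrability of grad log phi requires no lower bound on [phi]. *)
Lemma hardy psi : test_function Om psi -> LV (fun x => (psi x / phi x) *: G x).
Proof.
move=> t i; have St := Sob_test oO fO p1 t; have [iP _] := picone_sob St.
have [_ Lt _] := St; have [C C0 hC] := pic_coercive N p1.
have mi : measurable_fun Om (gco i (fun x => (psi x / phi x) *: G x)).
  apply: (eq_measurable_fun (fun x => psi x / phi x * gco i G x)) => [x _|].
    by rewrite /gco mxE.
  by apply: measurable_funM; [apply: measurable_ratio; exact: (test_meas mO t)|exact: (LG i).1].
split; first exact: mi.
apply: (intg_le mO _ _ (intg_scale mO C (intg_add mO iP (intg_En oO p1 Lt)))).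
  exact: mpow.
move=> x _; rewrite ger0_norm ?powR_ge0//; apply: (le_trans _ (hC _ _)).
by apply: powR_le; [exact: ltW|exact: normr_ge0|exact: coord_le_enorm].
Qed.

Lemma satur_le1 (t e : R) : 0 <= t -> 0 < e -> `|e / (`|t| + e) ^+ 2 * t| <= 1.
Proof.
move=> t0 e0; have h : 0 < t + e by rewrite ltr_wpDl.
rewrite (ger0_norm t0) ger0_norm; last first.
  by apply: mulr_ge0 => //; apply: divr_ge0; [exact: ltW|exact: sqr_ge0].
rewrite mulrAC ler_pdivrMr ?exprn_gt0// mul1r expr2; nra.
Qed.

(** The functions w_+ / (w_+ + e_n) tend to the indicator of {w > 0}. Where H = (w / phi) G their
    gradients are e_n w_+ / (w_+ + e_n)^2 times G / phi: the factor is at most 1 and tends to 0, and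
    [hardy] provides the majorant on compact sets. The indicator is then constant by [Sob_const]. *)
Lemma sign_const w H : Sob w H -> ae (fun x => H x = (w x / phi x) *: G x) ->
  exists k : R, ae (fun x => (0 < w x)%R%:R = k).
Proof.
move=> Sw hH; have [Lw LH _] := Sw.
pose e n : R := n.+1%:R^-1; have e0 n : 0 < e n by rewrite invr_gt0.
have ce : e n @[n --> \oo] --> 0 by exact: cvg_harmonic.
pose wp x := Num.max (w x) 0; pose Hp x := (2^-1 * (Num.sg (w x) + 1)) *: H x.
have wp0 x : 0 <= wp x by rewrite le_max lexx orbT.
have Swp : Sob wp Hp by exact: Sob_pos.
pose K n (t : R) := t / (`|t| + e n); pose K' n (t : R) := e n / (`|t| + e n) ^+ 2.
have K'b n t : `|K' n t| <= (e n)^-1.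
  have te : 0 < `|t| + e n by rewrite ltr_wpDl.
  rewrite ger0_norm; last by apply: divr_ge0; [exact: ltW|exact: sqr_ge0].
  rewrite ler_pdivrMr ?exprn_gt0// ler_pdivlMl// -expr2.
  by apply: lerXn2r; [rewrite nnegrE ltW|rewrite nnegrE ltW|rewrite lerDr].
have Sz n : Sob (fun x => K n (wp x)) (fun x => K' n (wp x) *: Hp x).
  by apply: (Sob_comp oO fO p1 (satur_C1 (e0 n)) _ (K'b n) Swp); rewrite /K mul0r.
have mK n : measurable_fun Om (fun x => K n (wp x)) := (Sob_Lp (Sz n)).1.
have K1 n x : `|K n (wp x)| <= 1.
  have h : 0 < wp x + e n by rewrite ltr_wpDl.
  by rewrite /K (ger0_norm (wp0 x)) ger0_norm ?divr_ge0 ?(ltW h)// ler_pdivrMr// mul1r lerDl ltW.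
have ck x : K n (wp x) @[n --> \oo] --> ((0 < w x)%R%:R : R).
  have [w0|w0] := ltP 0 (w x).
    have -> : wp x = w x by rewrite /wp max_l// ltW.
    rewrite /K (gtr0_norm w0) -(divff (lt0r_neq0 w0)).
    apply: cvgM; first exact: cvg_cst.
    apply: cvgV; first by rewrite gt_eqF.
    by rewrite -[X in _ --> X]addr0; apply: cvgD; [exact: cvg_cst|exact: ce].
  have -> : wp x = 0 by rewrite /wp max_r.
  by rewrite /K; under eq_fun do rewrite mul0r; exact: cvg_cst.
have m1 : measurable_fun Om (fun x => (0 < w x)%R%:R : R).
  by apply: (measurable_lim mK) => x _; exact: ck.
have i1 (x : V) : `|(0 < w x)%R%:R : R| <= 1 by case: (0 < w x); rewrite ?normr1 ?normr0.
apply: (Sob_const hN oO cO nO fO p1 Sz).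
- by apply: (Lp_bounded mO p1' fO m1 (c := 1)) => x _.
- apply: (dist_dct mO p1' (g := fun=> 2) mK m1).
  + by apply: (Lp_bounded mO p1' fO (c := 2)) => [|x _]; [exact: measurable_cst|rewrite ger0_norm].
  + by apply: aeW => x _; exact: ck.
  + move=> n; apply: aeW => x _; apply: (le_trans (ler_normB _ _)).
    by rewrite [leRHS]ger0_norm//; apply: (le_trans (lerD (K1 n x) (i1 x))).
move=> Q cQ QO i; have mQ := compact_measurable cQ.
have [psi [tp psi0 psi1]] := cutoff oO cQ QO.
have Lh := Lp_subset mQ mO QO (hardy tp i).
have E n x : H x = (w x / phi x) *: G x ->
    gco i (fun x => K' n (wp x) *: Hp x) x = K' n (wp x) * wp x * (gco i G x / phi x).
  move=> hx; rewrite /gco !mxE hx mxE.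
  have [w0|w0|w0] := ltgtP 0 (w x).
  - rewrite (gtr0_sg w0); have -> : wp x = w x by rewrite /wp max_l// ltW.
    by rewrite -[1 + 1]/(2 : R) mulVf// mul1r; ring.
  - rewrite (ltr0_sg w0); have -> : wp x = 0 by rewrite /wp max_r// ltW.
    by rewrite addNr; ring.
  - rewrite -w0 /wp -w0 maxxx; ring.
have hQ P : ae P -> {ae mu, forall x, Q x -> P x}.
  by apply: filterS => x h Qx; exact: h (QO _ Qx).
have mg n : measurable_fun Q (gco i (fun x => K' n (wp x) *: Hp x)).
  by apply: (measurable_funS mO QO); case: (Sz n) => _ /(_ i)[].
have E0 n : (fun x => gco i (fun x => K' n (wp x) *: Hp x) x - 0) =
    gco i (fun x => K' n (wp x) *: Hp x) by apply/funext => x; rewrite subr0.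
apply: (cvg0_le (g := fun n => nrm mu Q p (fun x => gco i (fun x => K' n (wp x) *: Hp x) x - 0))).
  by move=> n; rewrite E0 (ger0_norm (nrm_ge0 _ _ _ _)); exact: lexx.
apply: (@nrm_dct _ _ _ mu Q mQ p p1' (fun n => gco i (fun x => K' n (wp x) *: Hp x))
  (fun=> 0) (gco i (fun x => (psi x / phi x) *: G x)) mg (measurable_cst _) Lh).
- apply: hQ; apply: filterS hH => x hx Ox.
  apply: (cvg0_le (g := fun n => `|K' n (wp x) * wp x * (gco i G x / phi x)|)).
    by move=> n; rewrite E ?hx//; exact: lexx.
  rewrite -[X in _ --> X](normr0 R); apply: cvg_norm.
  rewrite -[X in _ --> X](mul0r (gco i G x / phi x)); apply: cvgM; last exact: cvg_cst.
  have [->|wn] := eqVneq (wp x) 0; first by under eq_fun do rewrite mulr0; exact: cvg_cst.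
  have w0 : 0 < wp x by rewrite lt_neqAle eq_sym wn wp0.
  rewrite -[X in _ --> X](mul0r (wp x)); apply: cvgM; last exact: cvg_cst.
  rewrite -[X in _ --> X](mul0r ((`|wp x| + 0) ^+ 2)^-1); apply: cvgM; first exact: ce.
  apply: cvgV; first by rewrite addr0 (gtr0_norm w0) expf_neq0.
  rewrite expr2; under eq_fun do rewrite expr2.
  by apply: cvgM; apply: cvgD; [exact: cvg_cst|exact: ce|exact: cvg_cst|exact: ce].
- move=> n; have hh : {ae mu, forall x, Q x -> H x = (w x / phi x) *: G x} := hQ _ hH.
  apply: filterS hh => x hx Qx; rewrite subr0 E ?hx// normrM.
  apply: (@le_trans _ _ (`|gco i G x / phi x|)).
    by rewrite ler_piMl ?normr_ge0//; exact: satur_le1.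
  rewrite /gco mxE mulrAC -mulrA [leRHS]normrM ler_peMl ?normr_ge0//.
  by rewrite ger0_norm ?psi0// psi1.
Qed.

(** c is such that w = v - c phi has zero integral. The relation g = (v / phi) G is linear, so w
    inherits it, has constant sign and therefore vanishes a.e. *)
Lemma eigen_simple v g : Sob v g -> J g <= la * I (fun x => `|v x| `^ p) ->
  exists c : R, ae (fun x => v x = c * phi x).
Proof.
move=> Sv Jv; have Lphi := Sob_Lp Sphi; have ip := Lp_intg mO p1' fO Lphi.
have [I0|I0] := leP (I phi) 0.
  exists 0; have := I_eq0 mO ip (fun x _ => ltW (phi0 x)) I0.
  by apply: filterS => x h Ox; have := phi0 x; rewrite h// ltxx.
pose c := I v / I phi; exists c.
have Sw := Sob_sub oO fO p1 Sv (Sob_scale oO fO p1 c Sphi).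
have iv := Lp_intg mO p1' fO (Sob_Lp Sv); have iw := Lp_intg mO p1' fO (Sob_Lp Sw).
have Iw : I (fun x => v x - c * phi x) = 0.
  by rewrite (I_sub mO iv (intg_scale mO c ip)) (I_scale mO c ip) divfK ?subrr// gt_eqF.
have [|k hk] := sign_const Sw.
  apply: filterS (eigen_ratio Sv Jv) => x h Ox; rewrite h// mulrBl mulfK ?gt_eqF//.
  by rewrite scalerBl.
suff h : ae (fun x => v x - c * phi x = 0).
  by apply: filterS h => x h Ox; apply/eqP; rewrite -subr_eq0 h.
have mw := intg_meas iw.
have abs0 : I (fun x => `|v x - c * phi x|) <= 0 -> ae (fun x => v x - c * phi x = 0).
  move=> h; have := I_eq0 mO (intg_abs iw) (fun x _ => normr_ge0 _) h.
  by apply: filterS => x h' Ox; apply/eqP; rewrite -normr_eq0 h'.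
have mabs := intg_meas (intg_abs iw).
have [k1|k1] := eqVneq k 1.
  apply: abs0; rewrite -Iw le_eqVlt; apply/orP; left; apply/eqP.
  apply: (I_eq_ae mO mabs mw); apply: filterS hk => x h Ox.
  rewrite ger0_norm// leNgt; apply/negP => w0; move: (h Ox) k1.
  by rewrite ltNge (ltW w0)/= => <- /eqP; rewrite eq_sym oner_eq0.
apply: abs0; rewrite -(oppr0 R) -Iw -(I_opp mO iw) le_eqVlt; apply/orP; left; apply/eqP.
have mo : measurable_fun Om (fun x => - (v x - c * phi x)) := intg_meas (intg_opp mO iw).
apply: (I_eq_ae mO mabs mo); apply: filterS hk => x h Ox.
rewrite ler0_norm// leNgt; apply/negP => w0; move: (h Ox) k1.
by rewrite w0 /= => <-; rewrite eqxx.
Qed.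

End picone.


(** * Representatives of the Sobolev classes *)

Section bridge.
Variables (R : realType) (N : nat) (Om : set 'rV[R]_N) (p : R).
Local Notation V := 'rV[R]_N.
Local Notation mu := (lebm R N).
Local Notation pd i u := ('D_(evec R i) u).
Local Notation L u := (Lp mu Om p u).
Local Notation LV := (LpV Om p).
Local Notation d u v := (dist mu Om p u v).
Local Notation nrm u := (nrm mu Om p u).
Local Notation I f := (\int[mu]_(x in Om) f x).
Local Notation ae P := {ae mu, forall x, Om x -> P x}.
Local Notation Sob := (Sob Om p).
Local Notation J := (J Om p).
Local Notation En g := (En g).
Hypotheses (oO : open Om) (fO : (mu Om < +oo)%E) (p1 : 1 < p).
Implicit Types (u v w : V -> R) (g H : V -> V).

Let mO : measurable Om. Proof. exact: open_measurable_rV. Qed.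
Let p0 : 0 < p. Proof. exact: lt_trans p1. Qed.
Let p1' : 1 <= p. Proof. exact: ltW. Qed.

Lemma Lp_inLp u : L u -> inLp Om p%:E u.
Proof.
move=> Lu; split; first exact: Lu.1.
by rewrite -lebmE (Lnorm_nrm mO p0 Lu) ltry.
Qed.

Lemma ae_gco g H i : ae (fun x => g x = H x) -> ae (fun x => gco i g x = gco i H x).
Proof. by apply: filterS => x h Ox; rewrite /gco h. Qed.

Lemma grad_ae u g : wgrad Om u g -> ae (fun x => grad Om u x = g x).
Proof.
move=> wg; have h : weak_gradient Om u (grad Om u) by apply: xgetI; apply/wgradE; exact: wg.
by move/wgradE: h => h; apply: (wgrad_unique oO h wg); apply: aeW.
Qed.

Lemma LV_ae g H : ae (fun x => g x = H x) -> LV g -> LV H.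
Proof.
move=> gH Lg i; apply: (Lp_ae mO _ (ae_gco i gH) (Lg i)).
exact: (lebm_ae_measurable mO (Lg i).1 (ae_gco i gH)).
Qed.

Lemma J_ae g H : LV g -> ae (fun x => g x = H x) -> J g = J H.
Proof.
move=> Lg gH; have LH := LV_ae gH Lg; rewrite !J_E.
apply: (I_eq_ae mO (intg_meas (intg_En oO p1 Lg)) (intg_meas (intg_En oO p1 LH))).
by apply: filterS gH => x h Ox; rewrite h.
Qed.

Lemma ae_sym (S : Type) (b c : V -> S) : ae (fun x => b x = c x) -> ae (fun x => c x = b x).
Proof. by apply: filterS => x h Ox; rewrite h. Qed.

Lemma norm1pE u g : L u -> LV g -> ae (fun x => grad Om u x = g x) ->
  norm1p Om p u = (I (fun x => `|u x| `^ p) + J g) `^ p^-1.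
Proof.
move=> Lu Lg gg; have LG := LV_ae (ae_sym gg) Lg.
rewrite -(J_ae LG gg) /norm1p -lebmE J_E; congr (_ `^ _).
by apply: (I_add mO); [exact: Lu.2|exact: intg_En].
Qed.

Lemma nrm_le_norm1p u g : nrm u <= (I (fun x => `|u x| `^ p) + J g) `^ p^-1.
Proof.
rewrite -(nrm_powR mu Om u p0) -[leLHS](powRK (lt0r_neq0 p0) (nrm_ge0 _ _ _ _)).
by apply: powR_le; rewrite ?invr_ge0 ?(ltW p0) ?powR_ge0// lerDl (J_ge0 Om p1).
Qed.

Lemma nrmEn_le_norm1p u g : nrm (En g) <= (I (fun x => `|u x| `^ p) + J g) `^ p^-1.
Proof.
rewrite (J_nrm Om p1) -[leLHS](powRK (lt0r_neq0 p0) (nrm_ge0 _ _ _ _)).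
by apply: powR_le; rewrite ?invr_ge0 ?(ltW p0) ?powR_ge0// lerDr Ipow_ge0.
Qed.

Lemma powR_superadd (a b : R) : 0 <= a -> 0 <= b -> a `^ p + b `^ p <= (a + b) `^ p.
Proof.
move=> a0 b0; have ab := addr_ge0 a0 b0.
rewrite -!(powR_pred p1)// mulrDr; have p10 : 0 <= p - 1 by rewrite subr_ge0.
by apply: lerD; apply: ler_wpM2r => //; apply: powR_le => //; rewrite ?lerDl ?lerDr.
Qed.

Lemma norm1p_le u g : LV g ->
  (I (fun x => `|u x| `^ p) + J g) `^ p^-1 <= nrm u + \sum_i nrm (gco i g).
Proof.
move=> Lg; have a0 := nrm_ge0 mu Om p u; have b0 := nrm_ge0 mu Om p (En g).
apply: (@le_trans _ _ (nrm u + nrm (En g))); last by rewrite lerD2l; have [] := En_Lp oO p1 Lg.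
rewrite -[leRHS](powRK (lt0r_neq0 p0) (addr_ge0 a0 b0)).
apply: powR_le; first by rewrite invr_ge0 ltW.
  by apply: addr_ge0; [exact: Ipow_ge0|exact: (J_ge0 Om p1)].
rewrite -(nrm_powR mu Om u p0) (J_nrm Om p1); exact: powR_superadd.
Qed.

Lemma grad_Sob u g : Sob u g -> ae (fun x => grad Om u x = g x).
Proof. by move=> Su; apply: grad_ae; exact: (Sob_wgrad oO fO p1 Su). Qed.

Lemma Sob_norm1p u g : Sob u g -> norm1p Om p u = (I (fun x => `|u x| `^ p) + J g) `^ p^-1.
Proof. by move=> Su; have [Lu Lg _] := Su; apply: norm1pE => //; exact: grad_Sob. Qed.

Lemma Sob_W01p u g : Sob u g -> W01p Om p u.
Proof.
move=> Su; have [Lu Lg dn] := Su; split.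
  split; first exact: Lp_inLp.
  exists g; split; first by apply/wgradE; exact: (Sob_wgrad oO fO p1 Su).
  by move=> i; exact: (Lp_inLp (Lg i)).
move=> e e0; pose k : R := N.+1%:R; have k0 : 0 < k by rewrite ltr0n.
have [phi [t d1 d2]] := dn (e / k) (divr_gt0 e0 k0); exists phi => //.
have S := Sob_sub oO fO p1 Su (Sob_test oO fO p1 t).
have [_ LS _] := S; rewrite (Sob_norm1p S); apply: (le_lt_trans (norm1p_le _ LS)).
have E i : gco i (fun x => g x - tgrad phi x) = fun x => gco i g x - pd i phi x.
  by apply/funext => x; rewrite /gco !mxE.
apply: (@lt_le_trans _ _ (e / k + \sum_(i < N) e / k)); last first.
  by rewrite sumr_const card_ord -[X in X + _]mulr1n -mulrnDr add1n -mulr_natr divfK ?gt_eqF.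
apply: ltr_leD; first exact: d1.
by apply: ler_sum => i _; rewrite E; exact: ltW (d2 i).
Qed.

Lemma W01p_Sob u : W01p Om p u -> Sob u (grad Om u).
Proof.
move=> [[iu [g [wg ig]] dn]]; have Lu := inLp_Lp p0 iu.
have {}wg : wgrad Om u g by apply/wgradE.
have Lg : LV g by move=> i; exact: (inLp_Lp p0 (ig i)).
have gg := grad_ae wg; have LG := LV_ae (ae_sym gg) Lg.
split=> // e e0; have [phi t h] := dn e e0; exists phi.
have wt := wgrad_test mO t; have Lt : LV (tgrad phi) by case: (Sob_test oO fO p1 t).
have Lup := Lp_sub mO p1' Lu (test_Lp oO fO p1 t).
have E i : gco i (fun x => grad Om u x - tgrad phi x) = fun x => gco i (grad Om u) x - pd i phi x.
  by apply/funext => x; rewrite /gco !mxE.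
have LD := LpV_sub oO p1 LG Lt.
have gd : ae (fun x => grad Om (u \- phi) x = grad Om u x - tgrad phi x).
  have := grad_ae (wgrad_sub mO wg wt); apply: filterS2 gg => x h1 h2 Ox.
  by rewrite h2// h1.
rewrite (norm1pE Lup LD gd) in h; split=> //.
  exact: le_lt_trans (nrm_le_norm1p _ _) h.
move=> i; apply: le_lt_trans h; apply: le_trans (nrmEn_le_norm1p _ _).
by have := gco_le_En oO p1 i LD; rewrite E; apply.
Qed.

Lemma Sob_grad u g : Sob u g -> Sob u (grad Om u).
Proof. by move=> Su; apply: W01p_Sob; exact: Sob_W01p Su. Qed.

Lemma energy_grad u g : Sob u g ->
  \int[lebesgue_rV]_(x in Om) (enorm (grad Om u x) `^ p) = J g.
Proof.
move=> Su; have [_ Lg _] := Su; have gg := grad_Sob Su.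
by rewrite -(J_ae (LV_ae (ae_sym gg) Lg) gg) J_E lebmE.
Qed.

Lemma neg_plaplacianE u v g H : Sob u g -> Sob v H ->
  neg_plaplacian Om p u v = I (fun x => pdot p (g x) (H x)).
Proof.
move=> Su Sv; have [_ Lg _] := Su; have [_ LH _] := Sv.
have gg := grad_Sob Su; have hH := grad_Sob Sv; rewrite /neg_plaplacian -lebmE.
have [_ Lg' _] := Sob_grad Su; have [_ LH' _] := Sob_grad Sv.
apply: (I_eq_ae mO (intg_meas (pdot_intg oO p1 Lg' LH')) (intg_meas (pdot_intg oO p1 Lg LH))).
by apply: filterS2 gg hH => x h1 h2 Ox; rewrite /pdot h1// h2.
Qed.

Lemma dual_blf h : dualW01p Om p h -> blf Om p h.
Proof.
move=> [hl [C hC]]; split=> [c u v g G Su Sv|]; first exact: (hl c u v (Sob_W01p Su) (Sob_W01p Sv)).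
exists `|C| => [|u g Su]; first exact: normr_ge0.
apply: (le_trans (hC u (Sob_W01p Su))).
apply: (@le_trans _ _ (`|C| * norm1p Om p u)).
  by apply: ler_wpM2r; [exact: powR_ge0|exact: ler_norm].
have [_ Lg _] := Su; apply: ler_wpM2l; first exact: normr_ge0.
by rewrite (Sob_norm1p Su); exact: norm1p_le.
Qed.

(** The constant sequence u is at distance 0 from v in L^p, so [weak_cvg] gives h u = h v. *)
Lemma blf_ae h u v g H : blf Om p h -> Sob u g -> Sob v H -> ae (fun x => u x = v x) -> h u = h v.
Proof.
move=> bh Su Sv uv; have [Lu _ _] := Su; have [Lv _ _] := Sv.
have d0 : d u v = 0.
  transitivity (d v v); last by rewrite dist_xx.
  by apply: (dist_ae mO); [exact: Lu.1|exact: Lv.1|exact: Lv.1|exact: Lv.1|exact: uv|apply: aeW].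
have c0 : d u v @[_ --> \oo] --> 0 by rewrite d0; exact: cvg_cst.
have := weak_cvg oO fO p1 bh (fun=> Su) Lv (fun=> lexx _) c0.
exact: (cvg_unique (@Rhausdorff R) (cvg_cst _)).
Qed.

Lemma first_eigenvalueP la : first_eigenvalue Om p la -> 0 <= la /\
  forall v g, Sob v g -> la * I (fun x => `|v x| `^ p) <= J g.
Proof.
move=> [[u [Wu _] <-] lb]; split.
  apply: divr_ge0; rewrite -lebmE; first by rewrite -J_E (J_ge0 Om p1).
  exact: Ipow_ge0.
move=> v g Sv; have Lv := Sob_Lp Sv.
have [I0|I0] := leP (I (fun x => `|v x| `^ p)) 0.
  have -> : I (fun x => `|v x| `^ p) = 0 by apply/eqP; rewrite eq_le I0 Ipow_ge0.
  by rewrite mulr0 (J_ge0 Om p1).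
rewrite -ler_pdivlMr//; suff -> : J g / I (fun x => `|v x| `^ p) = rayleigh Om p v.
  apply: lb; exists v; last exact: erefl.
  split; first exact: Sob_W01p Sv.
  move=> h; have {}h : ae (fun x => v x = 0) by rewrite lebmE; exact: h.
  move: I0; rewrite (I_eq_ae mO (intg_meas Lv.2) (measurable_cst (0 : R))) ?I_0 ?ltxx//.
  by apply: filterS h => x h Ox; rewrite h// normr0 powR0// gt_eqF.
by rewrite /rayleigh (energy_grad Sv) lebmE.
Qed.

Lemma eigenfunctionP la phi1 : normalized_positive_eigenfunction Om p la phi1 ->
  exists phi G, [/\ forall x, 0 < phi x, ae (fun x => phi1 x = phi x), Sob phi G,
    I (fun x => `|phi x| `^ p) = 1 & forall w H, Sob w H ->
      I (fun x => pdot p (G x) (H x)) = la * I (fun x => phi x `^ (p - 1) * w x)].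
Proof.
move=> [Wphi pos1 I1 el]; have S1 := W01p_Sob Wphi; have [L1 LG _] := S1.
(* Set to 1 where the eigenfunction is not positive, so that divisions by [phi] make sense at every
   point. *)
pose phi x := if 0 < phi1 x then phi1 x else 1.
have phi0 x : 0 < phi x by rewrite /phi; case: ifPn.
have pp : ae (fun x => phi1 x = phi x).
  by rewrite lebmE; apply: filterS pos1 => x h Ox; rewrite /phi h.
have mphi := lebm_ae_measurable mO L1.1 pp.
have Sphi : Sob phi (grad Om phi1).
  by apply: (Sob_ae oO mphi _ pp _ S1) => [i|]; [exact: (LG i).1|apply: aeW].
exists phi, (grad Om phi1); split=> //.
  rewrite -I1 -lebmE; have [_ i1] := L1; have [_ i2] := Sob_Lp Sphi.
  apply: (I_eq_ae mO (intg_meas i2) (intg_meas i1)).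
  by apply: filterS pp => x h Ox; rewrite h.
move=> w H Sw; have [Lw LH _] := Sw.
rewrite -(neg_plaplacianE S1 Sw) el; last exact: Sob_W01p Sw.
have mw : measurable_fun Om (fun x => phi x `^ (p - 1) * w x).
  by apply: measurable_funM; [exact: measurable_powf|exact: Lw.1].
have E : ae (fun x => phi x `^ (p - 1) * w x = `|phi1 x| `^ (p - 2) * phi1 x * w x).
  apply: filterS pp => x h Ox; rewrite h// (gtr0_norm (phi0 x)).
  by rewrite (powR_pred2 p1)// ltW.
rewrite -lebmE; congr (_ * _); symmetry.
exact: (I_eq_ae mO mw (lebm_ae_measurable mO mw E) E).
Qed.

End bridge.


(** * Existence of a minimizer *)

Section fatou_frequent.
Context d (T : measurableType d) (R : realType) (mu : {measure set T -> \bar R}) (D : set T).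
Hypothesis mD : measurable D.
Local Notation I f := (\int[mu]_(x in D) f x).
Local Notation intg f := (mu.-integrable D (EFin \o f)).

Lemma limn_einfE (u : (\bar R)^nat) : limn_einf u = ereal_sup (range (einfs u)).
Proof.
rewrite limn_einf_lim; apply/cvg_lim; first exact: ereal_hausdorff.
by apply: ereal_nondecreasing_cvgn => m n; exact: nondecreasing_einfs.
Qed.

Lemma limn_einf_ge (u : (\bar R)^nat) b n0 : (forall n, (n0 <= n)%N -> (b <= u n)%E) ->
  (b <= limn_einf u)%E.
Proof.
move=> h; rewrite limn_einfE; apply: (@le_trans _ _ (einfs u n0)).
  by apply/ereal_infP => _ [n /= n0n <-]; exact: h.
by apply: ereal_sup_ubound; exists n0.
Qed.

Lemma limn_einf_le (u : (\bar R)^nat) b : (forall n, exists2 m, (n <= m)%N & (u m <= b)%E) ->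
  (limn_einf u <= b)%E.
Proof.
move=> h; rewrite limn_einfE; apply/ereal_supP => _ [n _ <-].
have [m nm um] := h n; apply: le_trans um; apply: ereal_inf_lbound; by exists m.
Qed.

Lemma intg_fine (K : T -> \bar R) : mu.-integrable D K -> intg (fine \o K) /\
  {ae mu, forall x, D x -> K x = (EFin \o (fine \o K)) x}.
Proof.
move=> iK; have mK := measurable_int mu iK; have fK := integrable_ae mD iK.
have E : {ae mu, forall x, D x -> K x = (EFin \o (fine \o K)) x}.
  by apply: filterS fK => x h Dx; rewrite /= fineK// h.
have mk : measurable_fun D (EFin \o (fine \o K)) by apply/measurable_EFinP; exact: measurableT_comp.
split; last exact: E.
apply/integrableP; split; first exact: mk.
have ma : measurable_fun D (fun x => `|(EFin \o (fine \o K)) x|)%E by exact: measurableT_comp.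
have mK' : measurable_fun D (fun x => `|K x|)%E by exact: measurableT_comp.
rewrite -(@ae_eq_integral _ _ _ mu D _ _ mD mK' ma); first by have /integrableP[] := iK.
by apply: filterS E => x h Dx; rewrite -h.
Qed.

(* [k] is the lower limit of [psi], of which only this property is needed. *)
Lemma fatou_frequent (psi : (T -> R)^nat) (cn : nat -> R) (c : R) :
  (forall n, intg (psi n)) -> (forall n x, D x -> 0 <= psi n x) ->
  (forall n, I (psi n) <= cn n) -> cn n @[n --> \oo] --> c ->
  exists k : T -> R, [/\ intg k, I k <= c &
    {ae mu, forall x, D x -> forall e : R, 0 < e -> forall n0,
      exists2 n, (n0 <= n)%N & psi n x < k x + e}].
Proof.
move=> ip p0 pc cc; pose K x := limn_einf (fun n => (psi n x)%:E).
have mp n : measurable_fun D (EFin \o psi n) := measurable_int mu (ip n).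
have mK : measurable_fun D K.
  apply: measurableT_comp => //.
  apply: (@measurable_fun_limn_esup _ _ _ _ (fun n x => (- (psi n x)%:E)%E)) => n.
  exact: (measurable_int mu (intg_opp mD (ip n))).
have K0 x : D x -> (0 <= K x)%E.
  by move=> Dx; apply: (@limn_einf_ge _ _ 0%N) => n _; rewrite lee_fin p0.
have IK : (\int[mu]_(x in D) K x <= c%:E)%E.
  apply: (@le_trans _ _ (limn_einf (fun n => \int[mu]_(x in D) (psi n x)%:E)%E)).
    by apply: (@fatou _ _ _ mu D mD (fun n x => (psi n x)%:E)) => // n x Dx; rewrite lee_fin p0.
  apply/lee_addgt0Pr => e e0; apply: limn_einf_le => n.
  have : \forall m \near \oo, `|c - cn m| < e by move/cvgrPdist_lt: cc; apply.
  move=> [m _ hm]; exists (maxn n m); first exact: leq_maxl.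
  rewrite intg_fin// lee_fin; apply: (le_trans (pc _)).
  by have := hm (maxn n m) (leq_maxr _ _); rewrite /= ltr_norml => /andP[h _]; lra.
have iK : mu.-integrable D K.
  apply/integrableP; split=> //.
  rewrite (eq_integral K) => [|x]; last by rewrite inE => Dx; rewrite gee0_abs// K0.
  exact: le_lt_trans IK (ltry _).
have [ik E] := intg_fine iK; exists (fine \o K).
have mk' := measurable_int mu ik.
split; first exact: ik.
- by move: IK; rewrite (@ae_eq_integral _ _ _ mu D _ _ mD mK mk' E) (intg_fin mD ik) lee_fin.
- apply: filterS E => x h Dx e e0 n0; apply: contrapT => hn.
  have : ((fine (K x) + e)%:E <= K x)%E.
    apply: (@limn_einf_ge _ _ n0) => n n0n; rewrite lee_fin leNgt; apply/negP => lt.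
    by apply: hn; exists n.
  by rewrite (h Dx)/= lee_fin; lra.
Qed.

Lemma bounded_subseq (a : nat -> R) (M : R) : (forall n, 0 <= a n <= M) ->
  exists2 k : nat -> nat, (forall n, (n <= k n)%N) &
    exists2 l : R, 0 <= l & a (k n) @[n --> \oo] --> l.
Proof.
move=> aM; have [|k kS /cvg_ex[l hl]] := @bolzano_weierstrass R a.
  exists M; split=> [|y My n _]; first exact: num_real.
  by have /andP[h1 h2] := aM n; rewrite /= ger0_norm// (le_trans h2)// ltW.
exists k => [|]; first apply: subseq_ge => n.
  by have h : (k n.+1 <= k n)%N = (n.+1 <= n)%N := kS n.+1 n; rewrite ltnNge h ltnn.
exists l => //; rewrite -(cvg_lim (@Rhausdorff R) hl); apply: limr_ge; first exact: cvgP hl.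
by apply: nearW => n; have /andP[] := aM (k n).
Qed.

End fatou_frequent.

Section lower_integral.
Variables (R : realType) (N : nat) (Om : set 'rV[R]_N).
Local Notation mu := (lebm R N).
Hypothesis mO : measurable Om.

(* The suprema over simple functions that define the integral are monotone in any
   function, measurable or not. *)
Lemma le_integral_lower (g : 'rV[R]_N -> R) (f : 'rV[R]_N -> \bar R) :
  mu.-integrable Om (EFin \o g) -> {ae mu, forall x, Om x -> ((g x)%:E <= f x)%E} ->
  ((\int[mu]_(x in Om) g x)%:E <= \int[mu]_(x in Om) f x)%E.
Proof.
move=> ig gf; pose g' x := if `[< Om x -> ((g x)%:E <= f x)%E >] then (g x)%:E else -oo%E.
have E : {ae mu, forall x, Om x -> (EFin \o g) x = g' x}.
  by apply: filterS gf => x h Ox; rewrite /g'; case: asboolP.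
have mg := measurable_int mu ig.
have mg' := lebm_ae_measurable mO mg E.
rewrite -(intg_fin mO ig) (@ae_eq_integral _ _ _ mu Om _ _ mO mg mg' E).
have le x : ((g' \_ Om) x <= (f \_ Om) x)%E.
  by rewrite /patch; case: ifPn => // xO; rewrite /g'; case: asboolP => [|_];
    [apply; rewrite inE in xO|rewrite leNye].
rewrite /integral; apply: leeB; apply: ereal_sup_le => _ [h hh <-].
- exists h => // x; apply: (le_trans (hh x)).
  by apply: (@funepos_le _ _ setT) => [y _|]; [exact: le|rewrite inE].
- exists h => // x; apply: (le_trans (hh x)).
  by apply: (@funeneg_le _ _ setT) => [y _|]; [exact: le|rewrite inE].
Qed.

End lower_integral.


Lemma half_lt (R : realFieldType) (x a : R) : x - a < x / 2 -> x / 2 < a.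
Proof. lra. Qed.

Lemma slope_arith (R : realFieldType) (l yp A yw K g : R) :
  l - yp - (A - yw) < (l - K - yp) / 2 -> g <= yw -> A - g < K + (l - K - yp) / 2 -> False.
Proof. lra. Qed.

Lemma energy_arith (R : realFieldType) (j f h C l : R) :
  j - f - h <= C -> l <= j -> - C - h <= f - l.
Proof. lra. Qed.

Lemma lsc_arith (R : realFieldType) (j f h c l : R) :
  j - f - h <= c -> - f <= c + h - j.
Proof. lra. Qed.

Lemma lsc_arith2 (R : realFieldType) (l c h jp f j : R) :
  l - f <= l + (c + h - jp) -> j <= jp -> j - f - h <= c.
Proof. lra. Qed.

Lemma min_arith (R : realFieldType) (j f h m : R) :
  j - f - h <= - m -> 0 <= j -> m <= - (- f - h).
Proof. lra. Qed.

(** * Coercivity and minimization *)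

Section blowup.
Variables (R : realType) (N : nat) (Om : set 'rV[R]_N) (p : R).
Local Notation V := 'rV[R]_N.
Local Notation mu := (lebm R N).
Local Notation L u := (Lp mu Om p u).
Local Notation LV := (LpV Om p).
Local Notation d u v := (dist mu Om p u v).
Local Notation nrm u := (nrm mu Om p u).
Local Notation I f := (\int[mu]_(x in Om) f x).
Local Notation intg f := (mu.-integrable Om (EFin \o f)).
Local Notation ae P := {ae mu, forall x, Om x -> P x}.
Local Notation Sob := (Sob Om p).
Local Notation J := (J Om p).
Local Notation Ip u := (I (fun x => `|u x| `^ p)).
Variables (hN : (0 < N)%N) (s0 : R) (a : V).
Hypotheses (s0p : 0 < s0) (oO : open Om) (cO : connected Om) (nO : Om !=set0).
Hypotheses (OQ : Om `<=` hb s0 0 a) (p1 : 1 < p).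
Implicit Types (u v w : V -> R) (g H : V -> V).

Let mO : measurable Om. Proof. exact: open_measurable_rV. Qed.
Let p0 : 0 < p. Proof. exact: lt_trans p1. Qed.
Let p1' : 1 <= p. Proof. exact: ltW. Qed.
Let p10 : 0 < p - 1. Proof. by rewrite subr_gt0. Qed.
Let fO : (mu Om < +oo)%E.
Proof.
apply: le_lt_trans (hb_fin hN s0p 0 a); apply: le_measure; rewrite ?inE//.
exact: measurable_hb.
Qed.

Lemma J_scale c g : LV g -> J (fun x => c *: g x) = `|c| `^ p * J g.
Proof.
move=> Lg; rewrite !J_E -(I_scale mO _ (intg_En oO p1 Lg)); apply: I_eq => x _.
by rewrite enormZ powRM ?enorm_ge0.
Qed.

Lemma Ipow_scale c u : L u -> Ip (fun x => c * u x) = `|c| `^ p * Ip u.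
Proof. by move=> [_ iu]; rewrite -(I_scale mO _ iu); apply: I_eq => x _; rewrite normrM powRM. Qed.

Lemma bnd_energy (A : R) u g : LV g -> Ip u + J g <= A -> bnd Om p (A `^ p^-1) u g.
Proof.
move=> Lg hA; have h : (Ip u + J g) `^ p^-1 <= A `^ p^-1.
  apply: powR_le hA; first by rewrite invr_ge0 ltW.
  by apply: addr_ge0; [exact: Ipow_ge0|exact: (J_ge0 Om p1)].
split; first exact: le_trans (nrm_le_norm1p Om p1 u g) h.
move=> i; apply: (le_trans (gco_le_En oO p1 i Lg)).
exact: le_trans (nrmEn_le_norm1p Om p1 u g) h.
Qed.

(** [weak_lsc] on tails, with the bound c + e. The gradient found for one e serves for all, being
    unique a.e. *)
Lemma weak_lsc_lim (un : nat -> V -> R) (gn : nat -> V -> V) u (cn : nat -> R) (c : R) :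
  (forall n, Sob (un n) (gn n)) -> L u -> (forall n, J (gn n) <= cn n) ->
  cn n @[n --> \oo] --> c -> d (un n) u @[n --> \oo] --> 0 ->
  exists2 g, Sob u g & J g <= c.
Proof.
move=> S Lu Jc cc cu.
have step (e : R) : 0 < e -> exists2 g, Sob u g & J g <= c + e.
  move=> e0; have : \forall n \near \oo, `|c - cn n| < e by move/cvgrPdist_lt: cc; apply.
  move=> [n0 _ hn]; apply: (weak_lsc oO fO p1 (un := fun n => un (n0 + n)%N)
    (gn := fun n => gn (n0 + n)%N)) => [n||n|].
  - exact: S.
  - exact: Lu.
  - apply: (le_trans (Jc _)); have := hn (n0 + n)%N (leq_addr _ _).
    by rewrite /= ltr_norml => /andP[h _]; lra.
  - exact: (subseq_cvg (k := fun n => (n0 + n)%N) (fun n => leq_addl n0 n) cu).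
have [g Sg _] := step 1 ltr01; exists g => //.
apply/ler_addgt0Pr => e e0; have [H SH JH] := step e e0; have [_ Lg _] := Sg.
by rewrite (J_ae oO p1 Lg (Sob_unique oO fO p1 Sg SH _))//; exact: aeW.
Qed.

(** Normalization and the last hypothesis give 1 <= (1 + la) I |vn|^p + dn, so the strong limit in
    L^p cannot vanish. *)
Lemma blowup_profile (vn : nat -> V -> R) (gn : nat -> V -> V) v (la : R) (dn : nat -> R) :
  0 <= la -> (forall n, Sob (vn n) (gn n)) -> (forall n, Ip (vn n) + J (gn n) = 1) ->
  L v -> d (vn n) v @[n --> \oo] --> 0 -> dn n @[n --> \oo] --> 0 ->
  (forall n, J (gn n) <= la * Ip (vn n) + dn n) ->
  exists2 g, Sob v g & J g <= la * Ip v /\ 0 < Ip v.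
Proof.
move=> la0 S E Lv cv cd hJ; have ci := Ipow_cvg oO p1 (fun n => Sob_Lp (S n)) Lv cv.
have [g Sg Jg] : exists2 g, Sob v g & J g <= la * Ip v.
  apply: (weak_lsc_lim S Lv hJ _ cv); rewrite -[X in _ --> X]addr0.
  by apply: cvgD => //; apply: cvgM; [exact: cvg_cst|exact: ci].
exists g => //; split=> //.
have h : 1 <= (1 + la) * Ip v.
  have cc : (1 + la) * Ip (vn n) + dn n @[n --> \oo] --> (1 + la) * Ip v.
    rewrite -[X in _ --> X]addr0; apply: cvgD => //.
    by apply: cvgM; [exact: cvg_cst|exact: ci].
  rewrite -(cvg_lim (@Rhausdorff R) cc); apply: limr_ge; first exact: cvgP cc.
  by apply: nearW => n; rewrite mulrDl mul1r -addrA -[leLHS](E n) lerD2l.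
rewrite lt_neqAle Ipow_ge0 andbT eq_sym; apply/eqP => z; move: h.
by rewrite z mulr0 ler10.
Qed.

Variables (eta k : V -> R) (F : V -> R -> R) (la : R) (h : (V -> R) -> R).
Hypotheses (teta : tail_ok Om p eta) (ik : intg k) (la0 : 0 <= la) (bh : blf Om p h).
Hypothesis mF : forall u, measurable_fun Om u -> measurable_fun Om (fun x => F x (u x)).
Hypothesis ubF : ae (fun x => forall s, F x s <= la / p * `|s| `^ p + ((`|eta x| + 1) * `|s| + k x)).

(** The part of the bound [ubF] that is homogeneous of degree 1 in [u]; it survives the rescaling in
    the blow-up. *)
Definition lin u x : R := `|eta x * u x| + `|u x|.
Definition resF u x : R := F x (u x) - la / p * `|u x| `^ p.
Definition Phi u g : R := p^-1 * J g - I (fun x => F x (u x)) - h u.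

Lemma lin_scale c u x : lin (fun x => c * u x) x = `|c| * lin u x.
Proof. by rewrite /lin mulrDr !normrM mulrCA. Qed.

Lemma lin_intg u g : Sob u g -> intg (lin u).
Proof.
move=> Su; apply: (intg_add mO); last exact: (intg_abs (Lp_intg mO p1' fO (Sob_Lp Su))).
exact: (intg_abs (tail_intg hN s0p oO OQ p1 teta Su)).
Qed.

Lemma bnd_le (A B : R) u g : A <= B -> bnd Om p A u g -> bnd Om p B u g.
Proof. by move=> AB [b1 b2]; split=> [|i]; [exact: le_trans AB|exact: le_trans (b2 i) AB]. Qed.

Lemma lin_cvg (un : nat -> V -> R) (gn : nat -> V -> V) u g (A : R) :
  (forall n, Sob (un n) (gn n)) -> (forall n, Ip (un n) + J (gn n) <= A) -> Sob u g ->
  d (un n) u @[n --> \oo] --> 0 -> I (lin (un n)) @[n --> \oo] --> I (lin u).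
Proof.
move=> S TA Su cu; pose B := A `^ p^-1 + (Ip u + J g) `^ p^-1.
have LG n : LV (gn n) by case: (S n).
have Bn n : bnd Om p B (un n) (gn n).
  by apply: bnd_le (bnd_energy (LG n) (TA n)); rewrite lerDl powR_ge0.
have Lg : LV g by case: Su.
have Bu : bnd Om p B u g.
  by apply: bnd_le (bnd_energy Lg (lexx _)); rewrite lerDr powR_ge0.
have c1 := tail_cvg hN s0p oO OQ p1 teta S Bn Su Bu cu.
have [C C0 hC] := I_dist mO p1' fO.
apply: (cvg_bound (g := fun n => I (fun x => `|eta x * (un n x - u x)|) + C * d (un n) u)).
  move=> n; have Sd := Sob_sub oO fO p1 (S n) Su.
  have i1 := intg_abs (tail_intg hN s0p oO OQ p1 teta Sd).
  have i2 := intg_abs (Lp_intg mO p1' fO (Sob_Lp Sd)).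
  have in_ := lin_intg (S n); have iu := lin_intg Su.
  rewrite -(I_sub mO in_ iu).
  apply: (@le_trans _ _ (I (fun x => `|eta x * (un n x - u x)| + `|un n x - u x|))).
    apply: (I_abs_le mO (intg_meas (intg_sub mO in_ iu)) (intg_add mO i1 i2)) => x _.
    rewrite /lin opprD addrACA; apply: (le_trans (ler_normD _ _)).
    by apply: lerD; rewrite ?mulrBr; exact: ler_dist_dist.
  rewrite (I_add mO i1 i2) lerD2l; exact: (hC _ _ (Sob_Lp (S n)) (Sob_Lp Su)).
rewrite -[X in _ --> X]addr0; apply: cvgD; first exact: c1.
by apply: cvg0Ml; exact: cu.
Qed.

Lemma resF_le u : ae (fun x => resF u x <= lin u x + k x).
Proof.
apply: filterS ubF => x ub Ox; rewrite lerBlDl; apply: (le_trans (ub Ox (u x))).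
by rewrite lerD2l /lin normrM mulrDl mul1r.
Qed.

Lemma resF_intg u : L u -> intg (fun x => F x (u x)) -> intg (resF u).
Proof. by move=> [_ iu] iF; apply: (intg_sub mO iF); exact: intg_scale. Qed.

Variables (phi : V -> R) (G : V -> V).
Hypotheses (Sphi : Sob phi G) (phi0 : forall x, 0 < phi x).
Variable phi1 : V -> R.
Hypothesis phi1E : ae (fun x => phi1 x = phi x).

(** [th n] stands for 1 / (|c| t_n), so that [th n * un n x] tends to [sg * phi x]. The functions Q
    = lin + th k - th G(x, un) are nonnegative, and Fatou's lemma yields an integrable K whose
    integral is at most that of lin phi plus sg h(phi). If G(x, .) has slope at most y towards sg
    oo, then K >= lin phi - y phi at x; hence lin phi - K <= G_1 phi_1, and integration gives the
    claim. *)
Lemma blowup_slope (sg : R) (g1 : V -> \bar R) (un : nat -> V -> R) (gn : nat -> V -> V)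
    (th : nat -> R) (A C : R) : (sg = 1 \/ sg = -1) ->
  ae (fun x => forall y : R, (g1 x < y%:E)%E -> exists M, forall s, M <= sg * s ->
    F x s - la / p * `|s| `^ p <= y * `|s|) ->
  (forall n, Sob (un n) (gn n)) -> (forall n, intg (resF (un n))) ->
  (forall n, 0 < th n) -> th n @[n --> \oo] --> 0 ->
  (forall n, Ip (fun x => th n * un n x) + J (fun x => th n *: gn n x) <= A) ->
  d (fun x => th n * un n x) (fun x => sg * phi x) @[n --> \oo] --> 0 ->
  ae (fun x => th n * un n x @[n --> \oo] --> sg * phi x) ->
  (forall n, - C - h (un n) <= I (resF (un n))) ->
  ((- (sg * h phi))%:E <= \int[mu]_(x in Om) (g1 x * (phi1 x)%:E))%E.
Proof.
move=> sg1 slope S iG th0 cth TA cw cae hC; pose w n x := th n * un n x.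
have sgn : `|sg| = 1 by case: sg1 => ->; rewrite ?normrN normr1.
have sg2 : sg * sg = 1 by case: sg1 => ->; rewrite ?mulrNN mulr1.
have Sw n : Sob (w n) (fun x => th n *: gn n x) by exact: (Sob_scale oO fO p1 _ (S n)).
have Ssp := Sob_scale oO fO p1 sg Sphi.
have iw n := lin_intg (Sw n); have ip := lin_intg Sphi.
have ikt n := intg_scale mO (th n) ik; have iGt n := intg_scale mO (th n) (iG n).
pose Q n x := lin (w n) x + th n * k x - th n * resF (un n) x.
have iQ n : intg (Q n) := intg_sub mO (intg_add mO (iw n) (ikt n)) (iGt n).
have Q0 n : ae (fun x => `|Q n x| = Q n x).
  apply: filterS (resF_le (un n)) => x hx Ox; apply: ger0_norm.
  rewrite /Q subr_ge0 lin_scale (gtr0_norm (th0 n)) -mulrDr.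
  exact: (ler_wpM2l (ltW (th0 n)) (hx Ox)).
have Jw n : J (fun x => th n *: gn n x) <= A.
  by apply: le_trans (TA n); rewrite lerDr Ipow_ge0.
have chw := weak_cvg oO fO p1 bh Sw (Sob_Lp Ssp) Jw cw.
rewrite (blf_scale oO fO p1 bh sg Sphi) in chw.
have clw := lin_cvg Sw TA Ssp cw.
rewrite (I_eq mu (g := lin phi)) in clw; last by move=> x _; rewrite lin_scale sgn mul1r.
have [K [iK IK Kf]] : exists K, [/\ intg K, I K <= I (lin phi) + sg * h phi &
    ae (fun x => forall e : R, 0 < e -> forall n0, exists2 n, (n0 <= n)%N & `|Q n x| < K x + e)].
  apply: (@fatou_frequent _ _ _ mu Om mO (fun n x => `|Q n x|)
    (fun n => I (lin (w n)) + th n * I k + (th n * C + h (w n)))) => [n|n x _|n|].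
  - exact: (intg_abs (iQ n)).
  - exact: normr_ge0.
  - rewrite (I_eq_ae mO (intg_meas (intg_abs (iQ n))) (intg_meas (iQ n)) (Q0 n)).
    rewrite (I_sub mO (intg_add mO (iw n) (ikt n)) (iGt n)) (I_add mO (iw n) (ikt n)).
    rewrite (I_scale mO (th n) ik) (I_scale mO (th n) (iG n)) lerD2l.
    rewrite (blf_scale oO fO p1 bh (th n) (S n)) -mulrDr -mulrN.
    apply: (ler_wpM2l (ltW (th0 n))); have := hC n; rewrite lerBlDr -lerBlDl => hn.
    by rewrite -lerN2 opprK opprD.
  - rewrite -(addr0 (I (lin phi))); apply: cvgD.
      apply: cvgD; first exact: clw.
      by apply: cvg0Mr; exact: cth.
    rewrite -(add0r (sg * h phi)); apply: cvgD; last exact: chw.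
    by apply: cvg0Mr; exact: cth.
apply: (@le_trans _ _ (I (fun x => lin phi x - K x))%:E).
  by rewrite lee_fin (I_sub mO ip iK) lerBrDr addrC -lerBrDr opprK; exact: IK.
apply: (le_integral_lower mO (intg_sub mO ip iK)).
have Qe : {ae mu, forall x, forall n, Om x -> `|Q n x| = Q n x} by apply: ae_foralln.
have QK : ae (fun x => [/\ phi1 x = phi x, forall n, `|Q n x| = Q n x & forall e : R, 0 < e ->
    forall n0, exists2 n, (n0 <= n)%N & `|Q n x| < K x + e]).
  by apply: filterS3 phi1E Qe Kf => x h1 hq hf Ox; split=> [|n|]; [exact: h1|exact: hq|exact: hf].
apply: filterS3 slope cae QK => x sl cx QKx Ox; have [-> hq hf] := QKx Ox.
rewrite leNgt; apply/negP => lt.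
have f0 := phi0 x; set B := lin phi x - K x in lt.
(* A slope strictly between G_1 and (lin phi - K) / phi at x, where G_1 may be -oo. *)
have [y gy yB] : exists2 y : R, (g1 x < y%:E)%E & y * phi x < B.
  move: lt; case: (g1 x) => [r| |].
  - rewrite lte_fin -ltr_pdivlMr// => rB; exists ((r + B / phi x) / 2).
      by rewrite lte_fin midf_lt.
    by rewrite -ltr_pdivlMr// midf_lt.
  - by rewrite gt0_mulye ?lte_fin.
  - move=> _; exists (B / phi x - 1); first exact: ltNyr.
    by rewrite -ltr_pdivlMr// ltrBlDr ltrDl.
have [M hM] := sl Ox y gy; have {}cx := cx Ox.
have csw : sg * w n x @[n --> \oo] --> phi x.
  rewrite -[X in _ --> X]mul1r -sg2 -mulrA.
  by apply: cvgM; [exact: cvg_cst|exact: cx].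
have caw : `|w n x| @[n --> \oo] --> phi x.
  have -> : phi x = `|sg * phi x| by rewrite normrM sgn mul1r gtr0_norm.
  by apply: cvg_norm; exact: cx.
have cl : lin (w n) x + th n * k x - y * `|w n x| @[n --> \oo] --> lin phi x - y * phi x.
  apply: cvgB; last by apply: cvgM; [exact: cvg_cst|exact: caw].
  rewrite -(addr0 (lin phi x)); apply: cvgD; last first.
    by apply: cvg0Mr; exact: cth.
  rewrite /lin normrM (gtr0_norm f0); under eq_fun do rewrite normrM.
  apply: cvgD; last exact: caw.
  by apply: cvgM; [exact: cvg_cst|exact: caw].
have e0 : 0 < (B - y * phi x) / 2 by rewrite divr_gt0// subr_gt0.
have f2 : 0 < phi x / 2 by rewrite divr_gt0.
have n1 : \forall n \near \oo, `|phi x - sg * w n x| < phi x / 2 by move/cvgrPdist_lt: csw; apply.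
have cM : th n * M @[n --> \oo] --> 0.
  by apply: cvg0Mr; exact: cth.
have n2 : \forall n \near \oo, `|0 - th n * M| < phi x / 2 by move/cvgrPdist_lt: cM; apply.
have n3 : \forall n \near \oo, `|lin phi x - y * phi x - (lin (w n) x + th n * k x - y * `|w n x|)| <
    (B - y * phi x) / 2 by move/cvgrPdist_lt: cl; apply.
have [n0 _ hn0] : \forall n \near \oo, [/\ `|phi x - sg * w n x| < phi x / 2,
    `|0 - th n * M| < phi x / 2 & `|lin phi x - y * phi x -
    (lin (w n) x + th n * k x - y * `|w n x|)| < (B - y * phi x) / 2].
  by apply: filterS3 n1 n2 n3 => n q1 q2 q3.
have [n n0n] := hf _ e0 n0; rewrite hq; have [q1 q2 q3] := hn0 n n0n.
(* For these n, th M < phi / 2 < sg th un at x: the value of [un n] is already in the range where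
   the slope bound holds. *)
have Mu : M <= sg * un n x.
  rewrite -(ler_pM2l (th0 n)) mulrCA -/(w n x).
  move: q1 q2; rewrite sub0r normrN !ltr_norml => /andP[_ q1] /andP[_ q2].
  by apply: ltW; apply: (lt_trans q2); exact: half_lt q1.
have gle : th n * resF (un n) x <= y * `|w n x|.
  rewrite normrM (gtr0_norm (th0 n)) mulrCA.
  exact: (ler_wpM2l (ltW (th0 n)) (hM _ Mu)).
move: q3; rewrite ltr_norml => /andP[_ q3]; rewrite /B in q3 * => q4.
exact: slope_arith q3 gle q4.
Qed.

Hypothesis EL : forall w H, Sob w H ->
  I (fun x => pdot p (G x) (H x)) = la * I (fun x => phi x `^ (p - 1) * w x).
Hypothesis lb : forall v g, Sob v g -> la * Ip v <= J g.
Variables (gp gm : V -> \bar R).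
Hypothesis slope_p : ae (fun x => forall y : R, (gp x < y%:E)%E -> exists M, forall s,
  M <= 1 * s -> F x s - la / p * `|s| `^ p <= y * `|s|).
Hypothesis slope_m : ae (fun x => forall y : R, (gm x < y%:E)%E -> exists M, forall s,
  M <= -1 * s -> F x s - la / p * `|s| `^ p <= y * `|s|).
Hypothesis Hm : (\int[mu]_(x in Om) (gm x * (phi1 x)%:E) < (h phi)%:E)%E.
Hypothesis Hp : ((h phi)%:E < - \int[mu]_(x in Om) (gp x * (phi1 x)%:E))%E.

(* The inequality [Phi u g <= C] multiplied by [p * s `^ p]. *)
Lemma Phi_scaled (C s : R) u g : 0 < s -> Sob u g -> intg (fun x => F x (u x)) ->
  Phi u g <= C -> J (fun x => s *: g x) <= la * Ip (fun x => s * u x) +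
    p * (s `^ p * (C + I k) + s `^ (p - 1) * (I (lin (fun x => s * u x)) + h (fun x => s * u x))).
Proof.
move=> s0' Su iF PC; have [Lu Lg _] := Su; have iu := Lu.2; have il := lin_intg Su.
have IF : I (fun x => F x (u x)) <= la / p * Ip u + (I (lin u) + I k).
  rewrite -(I_scale mO _ iu) -(I_add mO il ik).
  rewrite -(I_add mO (intg_scale mO _ iu) (intg_add mO il ik)).
  apply: (I_le_ae mO iF); first exact: intg_add (intg_scale mO _ iu) (intg_add mO il ik).
  apply: filterS ubF => x ub Ox; apply: (le_trans (ub Ox (u x))).
  by rewrite lerD2l lerD2r /lin normrM mulrDl mul1r.
rewrite (J_scale _ Lg) (Ipow_scale _ Lu) (gtr0_norm s0') (blf_scale oO fO p1 bh s Su).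
have -> : I (lin (fun x => s * u x)) = s * I (lin u).
  by rewrite -(I_scale mO s il); apply: I_eq => x _; rewrite lin_scale gtr0_norm.
have -> : la * (s `^ p * Ip u) + p * (s `^ p * (C + I k) + s `^ (p - 1) * (s * I (lin u) + s * h u)) =
  s `^ p * (la * Ip u + p * (C + I k + (I (lin u) + h u))) by rewrite -(powR_pred p1 (ltW s0')); ring.
apply: ler_wpM2l; first exact: powR_ge0.
have : p^-1 * J g <= C + h u + (la / p * Ip u + (I (lin u) + I k)).
  move: PC; rewrite /Phi !lerBlDr => /le_trans; apply.
  by rewrite lerD2l.
rewrite ler_pdivrMl// => /le_trans; apply; rewrite le_eqVlt; apply/orP; left; apply/eqP.
field; exact: lt0r_neq0.
Qed.

Lemma coercive (C : R) : exists M : R, forall u g, Sob u g -> intg (fun x => F x (u x)) ->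
  Phi u g <= C -> Ip u + J g <= M.
Proof.
apply: contrapT => nM.
have /choice[ug ugP] : forall n : nat, exists ug : (V -> R) * (V -> V),
    [/\ Sob ug.1 ug.2, intg (fun x => F x (ug.1 x)), Phi ug.1 ug.2 <= C &
      n.+1%:R `^ p <= Ip ug.1 + J ug.2].
  move=> n; apply: contrapT => h'; apply: nM; exists (n.+1%:R `^ p) => u g Su iF PC.
  by rewrite leNgt; apply/negP => /ltW lt; apply: h'; exists (u, g).
pose u n := (ug n).1; pose g n := (ug n).2; pose T n := Ip (u n) + J (g n).
have S n : Sob (u n) (g n) by case: (ugP n).
have iF n : intg (fun x => F x (u n x)) by case: (ugP n).
have PC n : Phi (u n) (g n) <= C by case: (ugP n).
have hT n : n.+1%:R `^ p <= T n by case: (ugP n).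
have T0 n : 0 < T n by apply: lt_le_trans (hT n); rewrite powR_gt0.
(* The inverse of the Sobolev norm of u_n; T n >= (n + 1)^p makes it at most 1/(n + 1). *)
pose s n := (T n `^ p^-1)^-1; have s_gt0 n : 0 < s n by rewrite invr_gt0 powR_gt0.
have sT n : s n `^ p * T n = 1.
  rewrite /s -powRN -powRrM mulNr mulVf ?gt_eqF// powR_inv1 ?ltW// mulVf// gt_eqF//.
have s_le n : s n <= n.+1%:R^-1.
  rewrite lef_pV2 ?posrE ?powR_gt0//.
  rewrite -[leLHS](powRK (lt0r_neq0 p0)) ?ler0n//.
  by apply: powR_le (hT n); rewrite ?invr_ge0 ?(ltW p0) ?powR_ge0.
have cs : s n @[n --> \oo] --> 0.
  apply: (cvg0_le (g := fun n => n.+1%:R^-1)); last exact: cvg_harmonic.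
  by move=> n; rewrite gtr0_norm.
pose v n x := s n * u n x; pose gv n x := s n *: g n x.
have Sv n : Sob (v n) (gv n) by exact: (Sob_scale oO fO p1 (s n) (S n)).
have E1 n : Ip (v n) + J (gv n) = 1.
  have [Lu Lg _] := S n.
  by rewrite (Ipow_scale _ Lu) (J_scale _ Lg) (gtr0_norm (s_gt0 n)) -mulrDr sT.
have Lgv n : LV (gv n) by case: (Sv n).
have B n : bnd Om p (1 `^ p^-1) (v n) (gv n) by apply: bnd_energy => //; rewrite E1.
have [k1 [k1S [w Lw cw]]] := Sob_rellich hN s0p oO OQ p1 Sv B.
have [k2 k2S ae2] := dist_subseq_ae mO p1' fO (fun n => Sob_Lp (Sv (k1 n))) Lw cw.
pose kk n := k1 (k2 n).
have kkn n : (n <= kk n)%N := leq_trans (subseq_ge k2S n) (subseq_ge k1S _).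
have cw2 : d (v (kk n)) w @[n --> \oo] --> 0.
  exact: (subseq_cvg (k := k2) (subseq_ge k2S) cw).
have Jv n : J (gv n) <= 1 by rewrite -(E1 n) lerDr Ipow_ge0.
have [g0 Sw0 _] := weak_lsc oO fO p1 (fun n => Sv (kk n)) Lw (fun n => Jv (kk n)) cw2.
have csk : s (kk n) @[n --> \oo] --> 0 by exact: (subseq_cvg kkn cs).
have pw0 (q : R) : 0 < q -> s (kk n) `^ q @[n --> \oo] --> 0.
  move=> q0; have -> : 0 = Num.sg (0 : R) * `|0 : R| `^ q by rewrite sgr0 mul0r.
  have E n : s (kk n) `^ q = Num.sg (s (kk n)) * `|s (kk n)| `^ q.
    by rewrite (gtr0_sg (s_gt0 _)) (gtr0_norm (s_gt0 _)) mul1r.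
  under eq_fun do rewrite E.
  apply: (@continuous_cvg _ _ _ _ _ _ (fun t : R => Num.sg t * `|t| `^ q)).
    exact: (sgpow_continuous q0).
  exact: csk.
have chw := weak_cvg oO fO p1 bh (fun n => Sv (kk n)) Lw (fun n => Jv (kk n)) cw2.
have T1 n : Ip (v (kk n)) + J (gv (kk n)) <= 1 by rewrite E1.
have clw := lin_cvg (fun n => Sv (kk n)) T1 Sw0 cw2.
have [||gw Sw [Jw Iw]] := @blowup_profile (fun n => v (kk n)) (fun n => gv (kk n)) w la
  (fun n => p * (s (kk n) `^ p * (C + I k) + s (kk n) `^ (p - 1) *
    (I (lin (v (kk n))) + h (v (kk n))))) la0 (fun n => Sv (kk n)) (fun n => E1 (kk n)) Lw cw2.
- rewrite -[X in _ --> X](mulr0 p); apply: cvgM; first exact: cvg_cst.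
  rewrite -[X in _ --> X]addr0; apply: cvgD.
    by apply: cvg0Mr; exact: pw0.
  rewrite -[X in _ --> X](mul0r (I (lin w) + h w)); apply: cvgM; first exact: pw0.
  by apply: cvgD; [exact: clw|exact: chw].
- by move=> n; exact: (Phi_scaled (s_gt0 _) (S _) (iF _) (PC _)).
have [c hc] := eigen_simple hN oO cO nO fO p1 Sphi phi0 EL Sw Jw.
have c0 : c != 0.
  apply/eqP => z; move: Iw; suff -> : Ip w = 0 by rewrite ltxx.
  rewrite -(I_0 mu Om); apply: (I_eq_ae mO (intg_meas Lw.2) (measurable_cst (0 : R))).
  by apply: filterS hc => x hx Ox; rewrite hx// z mul0r normr0 powR0// gt_eqF.
have nc0 : 0 < `|c| by rewrite normr_gt0.
pose th n := `|c|^-1 * s (kk n); have th0 n : 0 < th n by apply: mulr_gt0; [rewrite invr_gt0|exact: s_gt0].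
have cth : th n @[n --> \oo] --> 0.
  by apply: cvg0Ml; exact: csk.
pose sg := Num.sg c; have sgc : `|c|^-1 * c = sg.
  by rewrite /sg {2}(numEsg c) mulrCA mulVf ?mulr1// gt_eqF.
have sg1 : sg = 1 \/ sg = -1.
  rewrite /sg; have [cp|cn|cz] := ltgtP c 0; first by right; rewrite ltr0_sg.
    by left; rewrite gtr0_sg.
  by move: c0; rewrite cz eqxx.
have Eth n : (fun x => th n * u (kk n) x) = fun x => `|c|^-1 * v (kk n) x.
  by apply/funext => x; rewrite /th /v mulrA.
have iR n := resF_intg (Sob_Lp (S (kk n))) (iF (kk n)).
have TA n : Ip (fun x => th n * u (kk n) x) + J (fun x => th n *: g (kk n) x) <= `|c|^-1 `^ p.
  have [Lu Lg _] := S (kk n).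
  rewrite (Ipow_scale _ Lu) (J_scale _ Lg) -mulrDr (gtr0_norm (th0 n)) /th.
  have c' : 0 <= `|c|^-1 by rewrite invr_ge0 ltW.
  by rewrite (powRM _ c' (ltW (s_gt0 _))) -mulrA sT mulr1.
have wE : ae (fun x => `|c|^-1 * w x = sg * phi x).
  by apply: filterS hc => x hx Ox; rewrite hx// mulrA sgc.
have Lsp := Lp_scale mO sg (Sob_Lp Sphi).
have cd : d (fun x => th n * u (kk n) x) (fun x => sg * phi x) @[n --> \oo] --> 0.
  have E n : d (fun x => th n * u (kk n) x) (fun x => sg * phi x) = `|c|^-1 * d (v (kk n)) w.
    have Lc := Lp_scale mO `|c|^-1 Lw; have Lvc := Lp_scale mO `|c|^-1 (Sob_Lp (Sv (kk n))).
    transitivity (d (fun x => `|c|^-1 * v (kk n) x) (fun x => `|c|^-1 * w x)).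
      rewrite Eth; symmetry; apply: (dist_ae mO); [exact: Lvc.1|exact: Lc.1|exact: Lvc.1|
        exact: Lsp.1| |exact: wE].
      by apply: aeW.
    rewrite (dist_scale mO p1' _ (Sob_Lp (Sv (kk n))) Lw).
    by rewrite gtr0_norm ?invr_gt0.
  have cc : `|c|^-1 * d (v (kk n)) w @[n --> \oo] --> 0.
    by apply: cvg0Ml; exact: cw2.
  under eq_fun do rewrite E.
  exact: cc.
have cae : ae (fun x => th n * u (kk n) x @[n --> \oo] --> sg * phi x).
  apply: filterS2 ae2 wE => x h1 h2 Ox; rewrite -(h2 Ox).
  under eq_fun do rewrite /th -mulrA.
  by apply: cvgM; [exact: cvg_cst|exact: h1].
have hC n : - C - h (u (kk n)) <= I (resF (u (kk n))).
  have [_ iu] := Sob_Lp (S (kk n)).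
  rewrite (I_sub mO (iF _) (intg_scale mO _ iu)) (I_scale mO _ iu).
  have := PC (kk n); rewrite /Phi => P1.
  have P2 : la / p * Ip (u (kk n)) <= p^-1 * J (g (kk n)).
    rewrite [la / p]mulrC -mulrA; apply: ler_wpM2l; first by rewrite invr_ge0 ltW.
    exact: (lb (S (kk n))).
  exact: energy_arith P1 P2.
have main (g1 : V -> \bar R) : ae (fun x => forall y : R, (g1 x < y%:E)%E -> exists M, forall s,
    M <= sg * s -> F x s - la / p * `|s| `^ p <= y * `|s|) ->
    ((- (sg * h phi))%:E <= \int[mu]_(x in Om) (g1 x * (phi1 x)%:E))%E.
  move=> sl; apply: (@blowup_slope sg g1 (fun n => u (kk n)) (fun n => g (kk n)) th
    (`|c|^-1 `^ p) C sg1 sl).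
  - by move=> n; exact: S.
  - exact: iR.
  - exact: th0.
  - exact: cth.
  - exact: TA.
  - exact: cd.
  - exact: cae.
  - exact: hC.
(* c > 0 contradicts the right inequality of (2), and c < 0 the left one. *)
case: sg1 => sgE; rewrite sgE in main.
  have := main gp slope_p; rewrite mul1r leNgt => /negP; apply.
  by rewrite -lteN2 EFinN oppeK.
by have := main gm slope_m; rewrite mulN1r opprK leNgt Hm.
Qed.

Hypothesis cF : ae (fun x => continuous (F x)).
Hypothesis F0 : forall x, F x 0 = 0.

(** A majorant of F(x, u) whose integral converges along the sequences considered, so that Fatou's
    lemma applies to U - F >= 0. *)
Let U u x : R := la / p * `|u x| `^ p + (lin u x + k x).

Let U_intg u g : Sob u g -> intg (U u).
Proof.
move=> Su; have [_ iu] := Sob_Lp Su.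
exact: (intg_add mO (intg_scale mO _ iu) (intg_add mO (lin_intg Su) ik)).
Qed.

Let U_I u g : Sob u g -> I (U u) = la / p * Ip u + (I (lin u) + I k).
Proof.
move=> Su; have [_ iu] := Sob_Lp Su; have il := lin_intg Su.
by rewrite (I_add mO (intg_scale mO _ iu) (intg_add mO il ik)) (I_scale mO _ iu) (I_add mO il ik).
Qed.

Let U_ge u : ae (fun x => 0 <= U u x - F x (u x)).
Proof.
apply: filterS ubF => x ub Ox; rewrite subr_ge0; apply: (le_trans (ub Ox (u x))).
by rewrite lerD2l lerD2r /lin normrM mulrDl mul1r.
Qed.

Let U_abs u g : Sob u g -> intg (fun x => F x (u x)) ->
  intg (fun x => `|U u x - F x (u x)|) /\
  I (fun x => `|U u x - F x (u x)|) = I (U u) - I (fun x => F x (u x)).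
Proof.
move=> Su iF; have iU := U_intg Su; have id := intg_sub mO iU iF.
have ia := intg_abs id; split; first exact: ia.
rewrite -(I_sub mO iU iF); apply: (I_eq_ae mO (intg_meas ia) (intg_meas id)).
by apply: filterS (U_ge u) => x hx Ox; rewrite ger0_norm// hx.
Qed.

(** The gradient energies are first made to converge along a subsequence. Fatou's lemma for U - F
    then gives both the integrability of F(x, u) and the upper semicontinuity of its integral. *)
Lemma Phi_lsc (un : nat -> V -> R) (gn : nat -> V -> V) u (A : R) (cn : nat -> R) (c : R) :
  (forall n, Sob (un n) (gn n)) -> (forall n, intg (fun x => F x (un n x))) ->
  (forall n, Ip (un n) + J (gn n) <= A) -> L u -> d (un n) u @[n --> \oo] --> 0 ->
  ae (fun x => un n x @[n --> \oo] --> u x) ->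
  (forall n, Phi (un n) (gn n) <= cn n) -> cn n @[n --> \oo] --> c ->
  exists g, [/\ Sob u g, intg (fun x => F x (u x)) & Phi u g <= c].
Proof.
move=> S iF TA Lu cu cae PC cc.
have JA n : 0 <= J (gn n) <= A.
  by rewrite (J_ge0 Om p1) (le_trans _ (TA n))// lerDr Ipow_ge0.
have [kk kkn [j j0 cj]] := bounded_subseq JA.
have cuk : d (un (kk n)) u @[n --> \oo] --> 0 by exact: (subseq_cvg kkn cu).
have [g Sg Jg] := weak_lsc_lim (fun n => S (kk n)) Lu (fun n => lexx _) cj cuk.
have Jk n : J (gn (kk n)) <= A by have /andP[] := JA (kk n).
have ch := weak_cvg oO fO p1 bh (fun n => S (kk n)) Lu Jk cuk.
have cl := lin_cvg (fun n => S (kk n)) (fun n => TA (kk n)) Sg cuk.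
have ci := Ipow_cvg oO p1 (fun n => Sob_Lp (S (kk n))) Lu cuk.
have iU := U_intg Sg; have mFu := mF Lu.1.
have mB : measurable_fun Om (fun x => U u x - F x (u x)).
  by apply: measurable_funB; [exact: (intg_meas iU)|exact: mFu].
have [iB IB] : intg (fun x => `|U u x - F x (u x)|) /\ I (fun x => `|U u x - F x (u x)|) <=
    la / p * Ip u + (I (lin u) + I k) + (c + h u - p^-1 * j).
  apply: (@I_fatou_lim _ _ _ mu Om mO (fun n x => `|U (un (kk n)) x - F x (un (kk n) x)|)
    _ (fun n => la / p * Ip (un (kk n)) + (I (lin (un (kk n))) + I k) +
      (cn (kk n) + h (un (kk n)) - p^-1 * J (gn (kk n))))).
  - by move=> n; have [] := U_abs (S (kk n)) (iF (kk n)).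
  - by move=> n x _; exact: normr_ge0.
  - exact: (cont_meas (@norm_continuous R R) mB).
  - apply: filterS2 cF cae => x hF hu Ox; apply: cvg_norm.
    have {}hu : un (kk n) x @[n --> \oo] --> u x by exact: (subseq_cvg kkn (hu Ox)).
    apply: cvgB; last by apply: continuous_cvg; [exact: hF|exact: hu].
    apply: cvgD.
      apply: cvgM; first exact: cvg_cst.
      apply: (@continuous_cvg _ _ _ _ _ _ (fun t : R => `|t| `^ p)); last exact: hu.
      exact: (C1_cont (pow_C1 p1)).
    apply: cvgD; last exact: cvg_cst.
    apply: cvgD; apply: cvg_norm; last exact: hu.
    by apply: cvgM; [exact: cvg_cst|exact: hu].
  - move=> n; have [_ ->] := U_abs (S (kk n)) (iF (kk n)).
    rewrite (U_I (S (kk n))) lerD2l; have := PC (kk n); rewrite /Phi.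
    exact: lsc_arith.
  - apply: cvgD.
      apply: cvgD; first by apply: cvgM; [exact: cvg_cst|exact: ci].
      by apply: cvgD; [exact: cl|exact: cvg_cst].
    apply: cvgB; last by apply: cvgM; [exact: cvg_cst|exact: cj].
    by apply: cvgD; [exact: (subseq_cvg kkn cc)|exact: ch].
have iB' : intg (fun x => U u x - F x (u x)).
  by apply: (intg_le mO mB _ iB) => x _; exact: lexx.
have iFu : intg (fun x => F x (u x)).
  by apply: (intg_eq mO _ (intg_sub mO iU iB')) => x _; rewrite opprB addrCA subrr addr0.
exists g; split=> //.
have [_ E] := U_abs Sg iFu; move: IB; rewrite E (U_I Sg) /Phi => IB.
have Jp : p^-1 * J g <= p^-1 * j by apply: ler_wpM2l => //; rewrite invr_ge0 ltW.
exact: lsc_arith2 IB Jp.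
Qed.

Lemma Phi_compact (C : R) (un : nat -> V -> R) (gn : nat -> V -> V) :
  (forall n, Sob (un n) (gn n)) -> (forall n, intg (fun x => F x (un n x))) ->
  (forall n, Phi (un n) (gn n) <= C) -> exists (A : R) (kk : nat -> nat) u,
    [/\ forall n, Ip (un n) + J (gn n) <= A, forall n, (n <= kk n)%N, L u,
    d (un (kk n)) u @[n --> \oo] --> 0 &
    ae (fun x => un (kk n) x @[n --> \oo] --> u x)].
Proof.
move=> S iF PC; have [A hA] := coercive C.
have TA n := hA _ _ (S n) (iF n) (PC n).
have B n : bnd Om p (A `^ p^-1) (un n) (gn n) by apply: bnd_energy => //; case: (S n).
have [k1 [k1S [u Lu cu]]] := Sob_rellich hN s0p oO OQ p1 S B.
have [k2 k2S ae2] := dist_subseq_ae mO p1' fO (fun n => Sob_Lp (S (k1 n))) Lu cu.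
exists A, (fun n => k1 (k2 n)), u; split.
- exact: TA.
- by move=> n; exact: leq_trans (subseq_ge k2S n) (subseq_ge k1S _).
- exact: Lu.
- exact: (subseq_cvg (k := k2) (subseq_ge k2S) cu).
- exact: ae2.
Qed.

Lemma minimizer : exists u g, [/\ Sob u g, intg (fun x => F x (u x)) &
  forall v H, Sob v H -> intg (fun x => F x (v x)) -> Phi u g <= Phi v H].
Proof.
have S0 := Sob_test oO fO p1 (test0 Om); set z := tgrad _ in S0.
have iF0 : intg (fun x => F x ((fun=> 0) x : R)).
  by apply: (intg_eq mO (f := fun=> 0) _ (intg_cst mO fO 0)) => x _; rewrite F0.
(* Only competitors with energy at most that of 0 matter, and these are bounded by [coercive]. *)
pose C := Phi (fun=> 0) z.
pose P r := exists u g, [/\ Sob u g, intg (fun x => F x (u x)), Phi u g <= C & r = Phi u g].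
have PC : P C by exists (fun=> 0), z.
(* Energies at most -n along a sequence would give, by compactness and semicontinuity, a limit u
   with energy at most -m for each m. The m chosen below exceeds what the terms of u other than its
   gradient energy allow. *)
have [b hb] : has_lbound [set r | P r].
  apply: contrapT => nb.
  have /choice[ug ugP] : forall n : nat, exists ug : (V -> R) * (V -> V),
      [/\ Sob ug.1 ug.2, intg (fun x => F x (ug.1 x)), Phi ug.1 ug.2 <= C &
        Phi ug.1 ug.2 <= - n%:R].
    move=> n; apply: contrapT => h'; apply: nb; exists (- n%:R) => r [u [g [Su iF PuC ->]]].
    by rewrite leNgt; apply/negP => /ltW lt; apply: h'; exists (u, g).
  have S n : Sob (ug n).1 (ug n).2 by case: (ugP n).
  have iF n : intg (fun x => F x ((ug n).1 x)) by case: (ugP n).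
  have PuC n : Phi (ug n).1 (ug n).2 <= C by case: (ugP n).
  have Pn n : Phi (ug n).1 (ug n).2 <= - n%:R by case: (ugP n).
  have [A [kk [u [TA kkn Lu cu cae]]]] := Phi_compact S iF PuC.
  pose m := (Num.truncn `|- I (fun x => F x (u x)) - h u|).+1.
  have mn n : (n <= m + n)%N by exact: leq_addl.
  have Pm n : Phi (ug (kk (m + n)%N)).1 (ug (kk (m + n)%N)).2 <= - m%:R.
    apply: (le_trans (Pn _)); rewrite lerN2 ler_nat.
    exact: leq_trans (leq_addr n m) (kkn _).
  have [g [Su iFu Pu]] := @Phi_lsc (fun n => (ug (kk (m + n)%N)).1) (fun n => (ug (kk (m + n)%N)).2)
    u A (fun=> - m%:R) (- m%:R) (fun n => S _) (fun n => iF _) (fun n => TA _) Lu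
    (subseq_cvg mn cu) (filterS (fun x hx Ox => subseq_cvg mn (hx Ox)) cae) Pm (cvg_cst _).
  have J0 : 0 <= p^-1 * J g by rewrite mulr_ge0 ?(J_ge0 Om p1)// invr_ge0 ltW.
  have lm : `|- I (fun x => F x (u x)) - h u| < m%:R.
    by have /andP[_] := Num.Theory.truncn_itv (normr_ge0 (- I (fun x => F x (u x)) - h u)).
  move: lm; rewrite ltNge => /negP; apply; rewrite -normrN; apply: le_trans (ler_norm _).
  exact: min_arith Pu J0.
pose m := inf [set r | P r].
have hi : has_inf [set r | P r] by split; [exists C|exists b].
have /choice[ug ugP] : forall n : nat, exists ug : (V -> R) * (V -> V),
    [/\ Sob ug.1 ug.2, intg (fun x => F x (ug.1 x)), Phi ug.1 ug.2 <= C &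
      Phi ug.1 ug.2 <= m + n.+1%:R^-1].
  move=> n; have e0 : 0 < n.+1%:R^-1 :> R by rewrite invr_gt0.
  have [r [u [g [Su iF PuC ->]]] lt] := inf_adherent e0 hi.
  by exists (u, g); split=> //; exact: ltW.
have S n : Sob (ug n).1 (ug n).2 by case: (ugP n).
have iF n : intg (fun x => F x ((ug n).1 x)) by case: (ugP n).
have PuC n : Phi (ug n).1 (ug n).2 <= C by case: (ugP n).
have Pn n : Phi (ug n).1 (ug n).2 <= m + n.+1%:R^-1 by case: (ugP n).
have [A [kk [u [TA kkn Lu cu cae]]]] := Phi_compact S iF PuC.
have cm : m + (kk n).+1%:R^-1 @[n --> \oo] --> m.
  rewrite -[X in _ --> X]addr0; apply: cvgD; first exact: cvg_cst.
  have ch : n.+1%:R^-1 @[n --> \oo] --> (0 : R) by exact: cvg_harmonic.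
  exact: (subseq_cvg kkn ch).
have [g [Su iFu Pu]] := @Phi_lsc (fun n => (ug (kk n)).1) (fun n => (ug (kk n)).2)
  u A _ m (fun n => S _) (fun n => iF _) (fun n => TA _) Lu cu cae (fun n => Pn (kk n)) cm.
exists u, g; split; [exact: Su|exact: iFu|] => v H Sv iFv; apply: (le_trans Pu).
have [vC|/ltW Cv] := leP (Phi v H) C; first by apply: ge_inf; [exists b|exists v, H].
by apply: le_trans Cv; apply: ge_inf; [exists b|].
Qed.

End blowup.


(** * Caratheodory functions and their primitives *)

Section nonlinearity.
Variables (R : realType) (N : nat) (Om : set 'rV[R]_N).
Local Notation V := 'rV[R]_N.
Local Notation mu := (lebm R N).
Local Notation ae P := {ae mu, forall x, Om x -> P x}.
Hypothesis mO : measurable Om.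
Implicit Types (u : V -> R) (f : V -> R -> R).

Lemma primitive0 f x : primitive f x 0 = 0.
Proof. by rewrite /primitive lexx set_itv1 Rintegral_set1. Qed.

Lemma primitive_is_derive f x (s : R) : continuous (f x) ->
  is_derive s 1 (primitive f x) (f x s).
Proof.
(* [a] lies to the left of 0 and of every t with |t - s| < 1, so that there [primitive] is a
   difference of integrals from [a], whatever the sign of t. *)
move=> cf; set a : R := - (`|s| + 1).
have fi b c : (@lebesgue_measure R).-integrable `[b, c] (EFin \o f x).
  apply: continuous_compact_integrable; first exact: segment_compact.
  exact: continuous_subspaceT.
have a0 : a <= 0 by rewrite oppr_le0 addr_ge0.
pose G t := \int[lebesgue_measure]_(r in `[a, t]) f x r.
have E t : `|t - s| < 1 -> primitive f x t = G t - G 0.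
  rewrite ltr_distlC => /andP[_ ts].
  have at_ : a <= t.
    by have := ler_norm (- s); rewrite normrN /a => h; lra.
  have half b c : b <= c -> \int[lebesgue_measure]_(r in `[b, c]) f x r =
      \int[lebesgue_measure]_(r in `]b, c]) f x r.
    move=> bc; rewrite -Rintegral_itv_obnd_cbnd//.
    by apply: (integrableS _ _ _ (fi b c)) => //; exact: subset_itv_oc_cc.
  rewrite /primitive; case: leP => [t0|t0].
    by rewrite half// -(@Rintegral_itvB _ _ (BLeft a) (BRight t) 0 (fi a t)) ?bnd_simp.
  by rewrite half ?(ltW t0)// -(@Rintegral_itvB _ _ (BLeft a) (BRight 0) t (fi a 0)) ?bnd_simp ?opprB// ltW.
apply: (is_derive_near ltr01 E).
have [dG GE] := @continuous_FTC1_closed R (f x) a s (s + 1) (ltac:(by rewrite ltrDl))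
  (fi a (s + 1)) (ltac:(by have := ler_norm (- s); rewrite normrN /a => h; lra)) (cf s).
rewrite -[X in is_derive _ _ _ X]subr0; apply: is_deriveB.
by apply: DeriveDef => //; rewrite -derive1E.
Qed.

Lemma primitive_mvt f x (a b : R) : continuous (f x) ->
  exists2 c, `|c - a| <= `|b - a| & primitive f x b - primitive f x a = f x c * (b - a).
Proof.
move=> cf; have D s := primitive_is_derive s cf.
have cF (c d : R) : {within `[c, d], continuous primitive f x}.
  apply: continuous_subspaceT => s; apply: differentiable_continuous.
  by apply/derivable1_diffP; case: (D s).
have [ab|/ltW ba] := leP a b.
  have [c] := MVT_segment ab (fun s _ => D s) (@cF a b).
  rewrite in_itv /= => /andP[ac cb] ->; exists c => //.
  by rewrite !ger0_norm ?subr_ge0// lerD2r.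
have [c] := MVT_segment ba (fun s _ => D s) (@cF b a).
rewrite in_itv /= => /andP[bc ca] E; exists c; last by rewrite -opprB E -mulrN opprB.
by rewrite !ler0_norm ?subr_le0// lerN2 lerD2r.
Qed.

Lemma primitive_continuous f x : continuous (f x) -> continuous (primitive f x).
Proof.
move=> cf s; apply: differentiable_continuous; apply/derivable1_diffP.
by case: (primitive_is_derive s cf).
Qed.

Lemma primitive_le f x (s r K : R) : continuous (f x) -> `|s| <= r ->
  (forall t, `|t| <= r -> `|f x t| <= K) -> `|primitive f x s| <= r * K.
Proof.
move=> cf sr fK; have [c] := primitive_mvt 0 s cf.
rewrite primitive0 !subr0 => cs ->; rewrite normrM mulrC.
by apply: ler_pM => //; apply: fK; exact: le_trans sr.
Qed.

(** [u] is approximated by functions that are constant on the countably many sets where the integer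
    part of (n + 1) u is fixed; on each of these a single function [f ^~ s] is involved. *)
Lemma caratheodory_comp f u : (forall s, measurable_fun Om (f ^~ s)) ->
  (forall x, continuous (f x)) -> measurable_fun Om u ->
  measurable_fun Om (fun x => f x (u x)).
Proof.
move=> mf cf mu_; pose q n x : int := Num.floor (n.+1%:R * u x).
have mq n (z : int) : measurable (Om `&` [set x | q n x = z]).
  rewrite (_ : [set x | q n x = z] =
    (fun x => n.+1%:R * u x) @^-1` `[z%:~R, (z + 1)%:~R[%classic); last first.
    apply/seteqP; split=> x /=; rewrite in_itv /=.
      by move=> <-; rewrite floor_le floorD1_gt.
    by move=> /andP[h1 h2]; apply: floor_def; rewrite h1 h2.
  by apply: measurable_funM => //; exact: measurable_cst.
apply: (measurable_lim (f := fun n x => f x ((q n x)%:~R / n.+1%:R))).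
  move=> n _ Y mY; rewrite (_ : _ `&` _ = \bigcup_(z in [set: int])
    ((Om `&` [set x | q n x = z]) `&` (Om `&` (f ^~ (z%:~R / n.+1%:R)) @^-1` Y))).
    apply: countable_bigcupT_measurable => [|z]; first exact: countableP.
    apply: measurableI; first exact: mq.
    exact: mf.
  apply/seteqP; split=> [x [Ox Yx]|x [z _ [[Ox /= qz] [_ /= Yx]]]].
    by exists (q n x) => //; split.
  by split=> //=; rewrite qz.
move=> x _; apply: (@continuous_cvg _ _ _ _ _ _ (f x)); first exact: cf.
apply: (cvg_bound (g := fun n => n.+1%:R^-1)); last exact: cvg_harmonic.
move=> n; have n0 : (0 : R) < n.+1%:R by rewrite ltr0n.
rewrite distrC ger0_norm.
  rewrite lerBlDr -(ler_pM2l n0) mulrDr mulfV ?gt_eqF// [n.+1%:R * (_ / _)]mulrC divfK ?gt_eqF//.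
  by rewrite addrC ltW// -[1]/(1%:~R) -intrD floorD1_gt.
by rewrite subr_ge0 ler_pdivrMr// mulrC floor_le.
Qed.

(** Riemann sums exhibit [primitive] as a limit of finite combinations of values of [f], whence the
    measurability of [primitive f x (u x)]. *)
Lemma primitive_riemann f x (s : R) : continuous (f x) ->
  \sum_(i < n.+1) f x (i%:R * (s / n.+1%:R)) * (s / n.+1%:R) @[n --> \oo] --> primitive f x s.
Proof.
move=> cf; apply/cvgrPdist_le => e e0; have s1 : 0 < `|s| + 1 by rewrite ltr_wpDl.
(* The intermediate points are within |h| <= |s| of points of modulus at most |s|, hence the radius
   2 |s|. *)
have [d d0 dP] := itv_unif_continuous (- (`|s| + `|s|)) (`|s| + `|s|) cf (divr_gt0 e0 s1).
have : \forall n \near \oo, `|0 - `|s| * n.+1%:R^-1| < d.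
  have c : `|s| * n.+1%:R^-1 @[n --> \oo] --> 0.
    rewrite -[X in _ --> X](mulr0 `|s|); apply: cvgM; first exact: cvg_cst.
    exact: cvg_harmonic.
  by move/cvgrPdist_lt: c; apply.
apply: filterS => n; rewrite sub0r normrN; set h := s / n.+1%:R => hd.
have nh : `|h| = `|s| * n.+1%:R^-1 by rewrite normrM normfV normr_nat.
have hd' : `|h| <= d by rewrite ltW// nh -[X in X < _]ger0_norm// mulr_ge0 ?invr_ge0.
have sE : n.+1%:R * h = s by rewrite mulrC divfK.
have -> : primitive f x s = \sum_(i < n.+1) (primitive f x (i.+1%:R * h) - primitive f x (i%:R * h)).
  rewrite -(big_mkord xpredT (fun i => primitive f x (i.+1%:R * h) - primitive f x (i%:R * h))).
  by rewrite (telescope_sumr (fun i => primitive f x (i%:R * h)))// mul0r primitive0 subr0 sE.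
rewrite -sumrB; apply: (le_trans (ler_norm_sum _ _ _)).
have iP (i : 'I_n.+1) : `|i%:R * h| <= `|s|.
  by rewrite -sE !normrM ler_wpM2r// !normr_nat ler_nat ltnW.
have hs : `|h| <= `|s|.
  by rewrite nh ler_piMr// invf_le1 ?ler1n ?ltr0n.
apply: (@le_trans _ _ (\sum_(i < n.+1) (e / (`|s| + 1) * `|h|))).
  apply: ler_sum => i _; have [c] := primitive_mvt (i%:R * h) (i.+1%:R * h) cf.
  have -> : i.+1%:R * h - i%:R * h = h by rewrite -mulrBl -natr1 addrAC subrr add0r mul1r.
  move=> ch ->; rewrite -mulrBl normrM; apply: ler_wpM2r => //; apply: dP.
  - have ci : `|c| <= `|s| + `|s|.
      by rewrite -(subrK (i%:R * h) c) (le_trans (ler_normD _ _))// lerD// (le_trans ch).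
    by rewrite -ler_norml.
  - by rewrite -ler_norml; apply: (le_trans (iP i)); rewrite lerDl.
  - exact: le_trans ch hd'.
have nE : n.+1%:R * `|h| = `|s| by rewrite nh mulrC divfK.
rewrite sumr_const card_ord -[leLHS]mulr_natl mulrCA nE mulrAC ler_pdivrMr//.
by rewrite ler_pM2l// lerDl.
Qed.

Lemma primitive_comp f u : (forall s, measurable_fun Om (f ^~ s)) ->
  (forall x, continuous (f x)) -> measurable_fun Om u ->
  measurable_fun Om (fun x => primitive f x (u x)).
Proof.
move=> mf cf mu_; apply: (measurable_lim (f := fun n x =>
  \sum_(i < n.+1) f x (i%:R * (u x / n.+1%:R)) * (u x / n.+1%:R))); last first.
  by move=> x _; exact: primitive_riemann.
move=> n; have m1 : measurable_fun Om (fun x => u x / n.+1%:R).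
  by apply: measurable_funM => //; exact: measurable_cst.
apply: measurable_sum => i; apply: measurable_funM; last exact: m1.
apply: (@caratheodory_comp f (fun x => i%:R * (u x / n.+1%:R)) mf cf).
by apply: measurable_funM; [exact: measurable_cst|exact: m1].
Qed.

(** Setting [f] to 0 over the null set of points where it is not continuous in s gives continuity at
    every x; measurability in x survives by completeness of the measure. *)
Lemma caratheodory_continuous f : caratheodory_function Om f ->
  exists f', [/\ forall s, measurable_fun Om (f' ^~ s), forall x, continuous (f' x) &
    ae (fun x => f x = f' x)].
Proof.
move=> [mf cf]; pose f' x := if `[< continuous (f x) >] then f x else fun=> 0.
have E : ae (fun x => f x = f' x).
  by rewrite lebmE; apply: filterS cf => x h Ox; rewrite /f'; case: asboolP => // /(_ (h Ox)).
exists f'; split=> [s|x|]; last exact: E.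
  apply: (lebm_ae_measurable mO (mf s)).
  by apply: filterS E => x h Ox; rewrite h.
by rewrite /f'; case: asboolP => // _; exact: cst_continuous.
Qed.

Lemma sup_bound f (r : R) : mu.-integrable Om
    (fun x => ereal_sup [set (`|f x s|)%:E | s in [set s | `|s| <= r]]) ->
  exists K : V -> R, mu.-integrable Om (EFin \o K) /\
    ae (fun x => forall s, `|s| <= r -> `|f x s| <= K x).
Proof.
move=> /(intg_fine mO)[ik kE]; eexists; split; first exact: ik.
apply: filterS kE => x /[apply] h s sr; rewrite -lee_fin.
by rewrite -[leRHS]h; apply: ereal_sup_ubound; exists s.
Qed.

Lemma G1plus_slope (G : V -> R -> R) x (y : R) : (G1plus G x < y%:E)%E ->
  exists M, forall s, M <= 1 * s -> G x s <= y * `|s|.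
Proof.
rewrite /G1plus limf_esupE => /ereal_inf_lt[_ [A [M [_ hM]] <-] lt].
exists (Num.max (M + 1) 1) => s; rewrite mul1r ge_max => /andP[Ms s1].
have s0 : 0 < `|s| by rewrite normr_gt0 gt_eqF// (lt_le_trans ltr01).
rewrite -ler_pdivrMr// -lee_fin; apply: le_trans (ltW lt).
by apply: ereal_sup_ubound; exists s => //; apply: hM; rewrite (lt_le_trans _ Ms)// ltrDl.
Qed.

Lemma G1minus_slope (G : V -> R -> R) x (y : R) : (G1minus G x < y%:E)%E ->
  exists M, forall s, M <= -1 * s -> G x s <= y * `|s|.
Proof.
rewrite /G1minus limf_esupE => /ereal_inf_lt[_ [A [M [_ hM]] <-] lt].
exists (Num.max (- M + 1) 1) => s; rewrite mulN1r ge_max => /andP[Ms s1].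
have s0 : 0 < `|s| by rewrite normr_gt0 lt_eqF// -oppr_gt0 (lt_le_trans ltr01).
rewrite -ler_pdivrMr// -lee_fin; apply: le_trans (ltW lt).
apply: ereal_sup_ubound; exists s => //; apply: hM.
by rewrite -ltrN2 (lt_le_trans _ Ms)// ltrDl.
Qed.

(** Hypothesis (1) with epsilon = 1 covers |s| >= r, and integrating the bound K covers |s| <= r.
    The sum of the two majorants serves for all s, each being completed by nonnegative terms. *)
Lemma resonant_bound (p la r : R) (eta K : V -> R) f : (forall x, continuous (f x)) ->
  0 <= la -> 0 < p -> 0 < r ->
  ae (fun x => forall s, r <= `|s| -> resonant_primitive f p la x s <= (eta x + 1) * `|s|) ->
  ae (fun x => forall s, `|s| <= r -> `|f x s| <= K x) ->
  ae (fun x => forall s, primitive f x s <=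
    la / p * `|s| `^ p + ((`|eta x| + 1) * `|s| + r * K x)).
Proof.
move=> cf la0 p0 r0; apply: filterS2 => x h1 h2 Ox s; have {}h1 := h1 Ox; have {}h2 := h2 Ox.
have K0 : 0 <= r * K x.
  by rewrite mulr_ge0 ?(ltW r0)// (le_trans _ (h2 0 _)) ?normr0// ltW.
have e0 : 0 <= (`|eta x| + 1) * `|s| by rewrite mulr_ge0// addr_ge0.
have [sr|/ltW sr] := leP r `|s|.
  rewrite -lerBlDl; apply: (le_trans (h1 s sr)).
  by rewrite ler_wpDr// ler_wpM2r// lerD2r ler_norm.
apply: (le_trans (ler_norm _)); apply: (le_trans (primitive_le (cf x) sr h2)).
by rewrite ler_wpDl ?ler_wpDl// mulr_ge0 ?powR_ge0// divr_ge0// ltW.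
Qed.

End nonlinearity.


(** * The Euler-Lagrange equation *)

Lemma el_arith (R : realFieldType) (p t q j j' b fu hu hv : R) : 0 < p ->
  j' <= j + p * (t * b) -> p^-1 * j - fu - hu <= p^-1 * j' - (fu + t * q) - (t * hv + hu) ->
  0 <= t * b - t * (q + hv).
Proof.
move=> p0 h1 h2; have h3 : p^-1 * j' <= p^-1 * j + t * b.
  by rewrite ler_pdivrMl// mulrDr mulVKf// gt_eqF.
by rewrite mulrDr; lra.
Qed.

Section euler_lagrange.
Variables (R : realType) (N : nat) (Om : set 'rV[R]_N) (p : R).
Local Notation V := 'rV[R]_N.
Local Notation mu := (lebm R N).
Local Notation L u := (Lp mu Om p u).
Local Notation LV := (LpV Om p).
Local Notation d u v := (dist mu Om p u v).
Local Notation I f := (\int[mu]_(x in Om) f x).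
Local Notation intg f := (mu.-integrable Om (EFin \o f)).
Local Notation ae P := {ae mu, forall x, Om x -> P x}.
Local Notation Sob := (Sob Om p).
Local Notation J := (J Om p).
Hypotheses (oO : open Om) (fO : (mu Om < +oo)%E) (p1 : 1 < p).
Implicit Types (u v w : V -> R) (g H : V -> V).

Let mO : measurable Om. Proof. exact: open_measurable_rV. Qed.
Let p0 : 0 < p. Proof. exact: lt_trans p1. Qed.
Let p1' : 1 <= p. Proof. exact: ltW. Qed.
Let p10 : 0 < p - 1. Proof. by rewrite subr_gt0. Qed.

(** Where b = 0 the factor |b|^(p-2) may be singular, and the bound |b|^(p-1) |a| on the product is
    used instead. *)
Lemma pdot_cvg (bn : nat -> V) (b a : V) : (forall i, bn n 0 i @[n --> \oo] --> b 0 i) ->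
  pdot p (bn n) a @[n --> \oo] --> pdot p b a.
Proof.
move=> cb; have ce := enorm_cvg cb.
have [b0|bn0] := eqVneq (enorm b) 0.
  have -> : pdot p b a = 0.
    apply/eqP; rewrite -normr_le0; apply: (le_trans (pdot_le p1 _ _)).
    by rewrite b0 powR0 ?mul0r// gt_eqF.
  pose sp (t : R) := Num.sg t * `|t| `^ (p - 1).
  have cs : sp (enorm (bn n)) @[n --> \oo] --> sp (enorm b).
    by apply: (@continuous_cvg _ _ _ _ _ _ sp); [exact: (sgpow_continuous p10)|exact: ce].
  rewrite b0 {2}/sp sgr0 mul0r in cs.
  apply: (cvg0_le (g := fun n => sp (enorm (bn n)) * enorm a)).
    move=> n; apply: (le_trans (pdot_le p1 _ _)); apply: ler_wpM2r; first exact: enorm_ge0.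
    rewrite /sp (ger0_norm (enorm_ge0 _)); have [->|n0] := eqVneq (enorm (bn n)) 0.
      by rewrite sgr0 mul0r powR0// gt_eqF.
    by rewrite gtr0_sg ?mul1r// lt_neqAle eq_sym n0 enorm_ge0.
  by apply: cvg0Mr; exact: cs.
have bp : 0 < enorm b by rewrite lt_neqAle eq_sym bn0 enorm_ge0.
apply: cvgM; last by apply: cvg_sum_ord => i; apply: cvgM; [exact: cb|exact: cvg_cst].
apply: (@continuous_cvg _ _ _ _ _ _ (fun t : R => t `^ (p - 2))); last exact: ce.
apply: differentiable_continuous; apply/derivable1_diffP.
by case: (powR_is_derive (p - 2) bp).
Qed.

Lemma dual_bound g : LV g -> exists2 C : R, 0 <= C & forall H, LV H ->
  `|I (fun x => pdot p (g x) (H x))| <= C * nrm mu Om p (En H).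
Proof.
move=> Lg; pose q := p / (p - 1); pose e x := En g x `^ (p - 1).
have qE x : `|e x| `^ q = enorm (g x) `^ p.
  by rewrite ger0_norm ?powR_ge0// /e -powRrM /q mulrCA mulfV ?mulr1// gt_eqF.
have ie := intg_En oO p1 Lg.
have Le : Lp mu Om q e.
  split; first by apply: measurable_powf; exact: (Lp_En oO p1 Lg).1.
  by apply: (intg_eq mO _ ie) => x _; rewrite qE.
have q1 : 1 <= q by rewrite ler_pdivlMr// mul1r gerBl.
have pq : p^-1 + q^-1 = 1.
  by rewrite /q invf_div -[X in X + _]mul1r -mulrDl addrC subrK mulfV// gt_eqF.
exists (nrm mu Om q e) => [|H LH]; first exact: nrm_ge0.
have LE := Lp_En oO p1 LH; have [ih hh] := mul_hoelder mO p1' q1 pq LE Le.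
rewrite mulrC; apply: le_trans hh; apply: (I_abs_le mO).
- exact: (intg_meas (pdot_intg oO p1 Lg LH)).
- exact: (intg_abs ih).
move=> x _; apply: (le_trans (pdot_le p1 _ _)).
by rewrite ger0_norm ?mulr_ge0 ?enorm_ge0 ?powR_ge0// mulrC.
Qed.

Variables (h : (V -> R) -> R) (f : V -> R -> R) (u : V -> R) (g : V -> V).
Hypotheses (hh : dualW01p Om p h) (mf : forall s, measurable_fun Om (f ^~ s)).
Hypotheses (cf : forall x, continuous (f x)) (Su : Sob u g).
Hypothesis fK : forall r : R, 0 < r -> exists K : V -> R, intg K /\
  ae (fun x => forall s, `|s| <= r -> `|f x s| <= K x).
Local Notation F v := (fun x => primitive f x (v x)).
Hypotheses (iF : intg (F u)) (Fmin : forall v H, Sob v H -> intg (F v) ->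
  Phi Om p (primitive f) h u g <= Phi Om p (primitive f) h v H).

Let bh : blf Om p h. Proof. exact: dual_blf. Qed.
Let Lg : LV g. Proof. by case: Su. Qed.
Let mu_ : measurable_fun Om u. Proof. exact: (Sob_Lp Su).1. Qed.

(** The tangent inequality [pic_ge0] taken at the displaced point g + t H. After division by t the
    limit t = 0 then requires only the continuity of [pdot]. *)
Lemma convex_step (t : R) H : LV H ->
  J (fun x => t *: H x + g x) <= J g + p * (t * I (fun x => pdot p (t *: H x + g x) (H x))).
Proof.
move=> LH; have Lt := LpV_add oO p1 (LpV_scale oO t LH) Lg.
have ip := pdot_intg oO p1 Lt LH; have ig := intg_En oO p1 Lg.
rewrite -(I_scale mO _ ip) -(I_scale mO _ (intg_scale mO _ ip)) !J_E.
have ipp := intg_scale mO p (intg_scale mO t ip).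
rewrite -(I_add mO ig ipp); apply: (I_le mO (intg_En oO p1 Lt) (intg_add mO ig ipp)) => x _.
have := pic_ge0 p1 (g x) (t *: H x + g x); rewrite /pic.
have -> : pdot p (t *: H x + g x) (g x) = enorm (t *: H x + g x) `^ p -
    t * pdot p (t *: H x + g x) (H x).
  rewrite -(pdotaa p1 (t *: H x + g x)).
  set b := t *: H x + g x; have -> : pdot p b b = pdot p b (t *: H x) + pdot p b (g x).
    by rewrite -pdotDr.
  by rewrite pdotZr addrAC subrr add0r.
move: (enorm _ `^ p) (enorm _ `^ p) (pdot _ _ _) => a b c; nra.
Qed.

Lemma el_le v H (B : R) : Sob v H -> 0 <= B ->
  ae (fun x => `|v x| <= B /\ (v x != 0 -> `|u x| <= B)) ->
  intg (fun x => f x (u x) * v x) /\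
  I (fun x => f x (u x) * v x) + h v <= I (fun x => pdot p (g x) (H x)).
Proof.
move=> Sv B0 vB; have [Lv LH _] := Sv.
(* Points c between u and u + t v satisfy |c| <= B + B where v is nonzero, since t <= 1. *)
have r0 : 0 < B + B + 1 by rewrite ltr_wpDl// addr_ge0.
have [K [iK hK]] := fK r0.
pose t n : R := n.+1%:R^-1; have t0 n : 0 < t n by rewrite invr_gt0.
have t1 n : `|t n| <= 1 by rewrite gtr0_norm// invf_le1 ?ler1n.
have ct : t n @[n --> \oo] --> 0 by exact: cvg_harmonic.
pose w n x := t n * v x + u x; pose G n x := t n *: H x + g x.
have Sw n : Sob (w n) (G n) by exact: (Sob_add oO fO p1 (Sob_scale oO fO p1 (t n) Sv) Su).
pose Q n x := (t n)^-1 * (primitive f x (w n x) - primitive f x (u x)).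
have mw n : measurable_fun Om (F (w n)) := primitive_comp mO mf cf (Sob_Lp (Sw n)).1.
have mQ n : measurable_fun Om (Q n).
  apply: measurable_funM; first exact: measurable_cst.
  by apply: measurable_funB; [exact: mw|exact: intg_meas iF].
have QE n x : exists2 c, `|c - u x| <= `|t n * v x| & Q n x = f x c * v x.
  have [c hc E] := @primitive_mvt R N f x (u x) (w n x) (@cf x).
  rewrite /w addrK in hc E; exists c; first exact: hc.
  by rewrite /Q /w E mulrCA mulKf// gt_eqF.
have iBK := intg_scale mO B iK.
have Qb n : ae (fun x => `|Q n x| <= B * K x).
  apply: filterS2 vB hK => x hv hKx Ox; have [vb ub] := hv Ox; have [c cu ->] := QE n x.
  have K0 : 0 <= K x by apply: le_trans (hKx Ox 0 _) => //; rewrite normr0 ltW.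
  have [->|v0] := eqVneq (v x) 0; first by rewrite mulr0 normr0 mulr_ge0.
  rewrite normrM mulrC; apply: ler_pM => //; apply: (hKx Ox).
  rewrite -(subrK (u x) c); apply: (le_trans (ler_normD _ _)).
  apply: ler_wpDr => //; apply: lerD; last exact: ub.
  by apply: (le_trans cu); rewrite normrM (le_trans _ vb)// ler_piMl.
have iQ n : intg (Q n) := intg_le_ae mO (mQ n) (Qb n) iBK.
have [ifv _ cQ] : [/\ intg (fun x => f x (u x) * v x),
    I (fun x => `|Q n x - f x (u x) * v x|) @[n --> \oo] --> 0 &
    I (Q n) @[n --> \oo] --> I (fun x => f x (u x) * v x)].
  apply: (I_dct mO mQ _ iBK _ Qb).
    by apply: measurable_funM; [exact: caratheodory_comp|exact: Lv.1].
  apply: aeW => x _; have /choice[c hc] : forall n, exists c,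
      `|c - u x| <= `|t n * v x| /\ Q n x = f x c * v x.
    by move=> n; have [c c1 c2] := QE n x; exists c.
  have E n : Q n x = f x (c n) * v x by case: (hc n).
  under eq_fun do rewrite E; apply: cvgM; last exact: cvg_cst.
  apply: (@continuous_cvg _ _ _ _ _ _ (f x)); first exact: cf.
  apply: (cvg_bound (g := fun n => `|t n * v x|)); first by move=> n; case: (hc n).
  rewrite -[X in _ --> X](normr0 R); apply: cvg_norm.
  by apply: cvg0Mr; exact: ct.
split; first exact: ifv.
have iFw n : intg (F (w n)).
  apply: (intg_eq mO _ (intg_add mO iF (intg_scale mO (t n) (iQ n)))) => x _.
  by rewrite /Q mulrA mulfV ?gt_eqF// mul1r addrC subrK.
have IFw n : I (F (w n)) = I (F u) + t n * I (Q n).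
  rewrite -(I_scale mO _ (iQ n)) -(I_add mO iF (intg_scale mO (t n) (iQ n))).
  by apply: I_eq => x _; rewrite /Q mulrA mulfV ?gt_eqF// mul1r addrC subrK.
have step n : I (Q n) + h v <= I (fun x => pdot p (G n x) (H x)).
  have := Fmin (Sw n) (iFw n); rewrite /Phi IFw (bh.1 (t n) v u H g Sv Su).
  have := convex_step (t n) LH; rewrite -/(G n).
  move=> h1 h2; rewrite -(ler_pM2l (t0 n)) -subr_ge0; exact: (el_arith p0 h1 h2).
have LG n : LV (G n) by case: (Sw n).
pose D x := enorm (H x) `^ p + (p - 1) * `|En H x + En g x| `^ p.
have [_ iHg] := Lp_add mO p1' (Lp_En oO p1 LH) (Lp_En oO p1 Lg).
have iD : intg D by exact: intg_add (intg_En oO p1 LH) (intg_scale mO _ iHg).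
have [_ _ cp] : [/\ intg (fun x => pdot p (g x) (H x)),
    I (fun x => `|pdot p (G n x) (H x) - pdot p (g x) (H x)|) @[n --> \oo] --> 0 &
    I (fun x => pdot p (G n x) (H x)) @[n --> \oo] --> I (fun x => pdot p (g x) (H x))].
  apply: (I_dct mO _ (intg_meas (pdot_intg oO p1 Lg LH)) iD).
  - by move=> n; exact: (intg_meas (pdot_intg oO p1 (LG n) LH)).
  - apply: aeW => x _; apply: pdot_cvg => i.
    have c : t n * H x 0 i + g x 0 i @[n --> \oo] --> g x 0 i.
      rewrite -[X in _ --> X]add0r; apply: cvgD; last exact: cvg_cst.
      by apply: cvg0Mr; exact: ct.
    by under eq_fun do rewrite !mxE; exact: c.
  - move=> n; apply: aeW => x _; apply: (le_trans (pdot_le p1 _ _)).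
    apply: (le_trans (pow_mul_le p1 (enorm_ge0 _) (enorm_ge0 _))).
    rewrite lerD2l; apply: ler_wpM2l; first exact: ltW.
    apply: powR_le; [exact: ltW|exact: enorm_ge0|].
    rewrite ger0_norm ?addr_ge0 ?enorm_ge0//; apply: (le_trans (enormD _ _)).
    by rewrite lerD2r enormZ ler_piMl ?enorm_ge0.
rewrite -(cvg_lim (@Rhausdorff R) cp).
have cl : I (Q n) + h v @[n --> \oo] --> I (fun x => f x (u x) * v x) + h v.
  by apply: cvgD; [exact: cQ|exact: cvg_cst].
rewrite -(cvg_lim (@Rhausdorff R) cl).
by apply: ler_lim; [exact: cvgP cl|exact: cvgP cp|exact: nearW].
Qed.

(** The functional with which f(x, u) is to be identified. *)
Definition dual_T v : R := neg_plaplacian Om p u v - h v.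

(** The one-sided estimate [el_le] is applied to v and to -v. *)
Lemma el_eq v H (B : R) : Sob v H -> 0 <= B ->
  ae (fun x => `|v x| <= B /\ (v x != 0 -> `|u x| <= B)) ->
  intg (fun x => f x (u x) * v x) /\ dual_T v = I (fun x => f x (u x) * v x).
Proof.
move=> Sv B0 vB; have [ifv le1] := el_le Sv B0 vB; split; first exact: ifv.
have Sn := Sob_scale oO fO p1 (-1) Sv.
have [|_ le2] := el_le Sn B0.
  by apply: filterS vB => x h' Ox; rewrite normrM normrN1 mul1r mulN1r oppr_eq0; exact: h'.
have E1 : I (fun x => f x (u x) * (-1 * v x)) = - I (fun x => f x (u x) * v x).
  by rewrite -(I_opp mO ifv); apply: I_eq => x _; rewrite mulN1r mulrN.
have E2 : I (fun x => pdot p (g x) (-1 *: H x)) = - I (fun x => pdot p (g x) (H x)).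
  have [_ LH _] := Sv.
  by rewrite -(I_opp mO (pdot_intg oO p1 Lg LH)); apply: I_eq => x _; rewrite pdotZr mulN1r.
rewrite E1 E2 (blf_scale oO fO p1 bh (-1) Sv) mulN1r -opprD lerN2 in le2.
by rewrite /dual_T (neg_plaplacianE oO fO p1 Su Sv) -(le_anti (introT andP (conj le1 le2))) addrK.
Qed.

Lemma dual_TP : dualW01p Om p dual_T.
Proof.
have [hl [C hC]] := hh; split=> [a v w Wv Ww|].
  have Sv := W01p_Sob oO fO p1 Wv; have Sw := W01p_Sob oO fO p1 Ww.
  have [_ Lv _] := Sv; have [_ Lw _] := Sw.
  have Svw := Sob_add oO fO p1 (Sob_scale oO fO p1 a Sv) Sw.
  rewrite /dual_T hl// (neg_plaplacianE oO fO p1 Su Svw) (neg_plaplacianE oO fO p1 Su Sv).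
  rewrite (neg_plaplacianE oO fO p1 Su Sw).
  have i1 := pdot_intg oO p1 Lg Lv; have i2 := pdot_intg oO p1 Lg Lw.
  have -> : I (fun x => pdot p (g x) (a *: grad Om v x + grad Om w x)) =
      a * I (fun x => pdot p (g x) (grad Om v x)) + I (fun x => pdot p (g x) (grad Om w x)).
    rewrite -(I_scale mO a i1) -(I_add mO (intg_scale mO a i1) i2).
    by apply: I_eq => x _; rewrite pdotDr pdotZr.
  by rewrite opprD addrACA -mulrBr.
have [C' C0' hC'] := dual_bound Lg; exists (C' + C) => v Wv.
have Sv := W01p_Sob oO fO p1 Wv; have [_ Lv _] := Sv.
rewrite /dual_T (neg_plaplacianE oO fO p1 Su Sv) mulrDl; apply: (le_trans (ler_normB _ _)).
apply: lerD; last exact: hC; apply: (le_trans (hC' _ Lv)); apply: ler_wpM2l => //.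
by rewrite (Sob_norm1p oO fO p1 Sv); exact: nrmEn_le_norm1p.
Qed.

Let bT : blf Om p dual_T. Proof. exact: dual_blf dual_TP. Qed.

Lemma el_pos v H : Sob v H -> (forall x, 0 <= v x) ->
  intg (fun x => f x (u x) * v x) -> dual_T v = I (fun x => f x (u x) * v x).
Proof.
move=> Sv v0 ifv; have [Lv LH _] := Sv; have m0 n : (0 : R) <= n.+1%:R by [].
(* [w n] is at most n + 1 and vanishes where |u| >= n + 1, as [el_eq] requires. The left side passes
   to the limit by weak convergence, the right one by domination by |f(x, u) v|. *)
pose w (n : nat) x := Num.max (Num.min (v x) (n.+1%:R - `|u x|)) 0.
have /choice[G hG] : forall n, exists G, Sob (w n) G /\
    forall i x, `|gco i G x| <= `|gco i H x| + `|gco i g x|.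
  by move=> n; have [G S' hG] := Sob_min_cap oO fO p1 Sv Su (m0 n) v0; exists G.
have Sw n : Sob (w n) (G n) by case: (hG n).
have w0 n x : 0 <= w n x by rewrite le_max lexx orbT.
have wv n x : w n x <= v x by rewrite ge_max ge_min lexx v0.
have cw x : w n x @[n --> \oo] --> v x.
  apply: cvg_near_cst; exists (Num.truncn (v x + `|u x|)) => // n /= hn.
  have h1 : v x + `|u x| < n.+1%:R.
    have /andP[_ lt] := Num.Theory.truncn_itv (addr_ge0 (v0 x) (normr_ge0 (u x))).
    by apply: (lt_le_trans lt); rewrite ler_nat ltnS.
  by rewrite /w min_l ?max_l// lerBrDr ltW.
have eq n : dual_T (w n) = I (fun x => f x (u x) * w n x).
  have [|_ ->//] := el_eq (Sw n) (m0 n); apply: aeW => x _.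
  have le1 : w n x <= n.+1%:R.
    by rewrite ge_max m0 andbT ge_min lerBlDr lerDl normr_ge0 orbT.
  split=> [|wn]; first by rewrite ger0_norm.
  rewrite leNgt; apply/negP => lt; move: wn; rewrite /w max_r ?eqxx//.
  by rewrite ge_min subr_le0 (ltW lt) orbT.
have Lwn n := Sob_Lp (Sw n).
have wvn n x : `|w n x - v x| <= `|v x|.
  by rewrite ler0_norm ?subr_le0// opprB ger0_norm// gerBl.
have cd : d (w n) v @[n --> \oo] --> 0.
  apply: (dist_dct mO p1' (fun n => (Lwn n).1) Lv.1 Lv); first by apply: aeW => x _; exact: cw.
  by move=> n; apply: aeW => x _; exact: wvn.
pose S x := N%:R * (En H x + En g x).
have [mS iS] : L S by exact: (Lp_scale mO N%:R (Lp_add mO p1' (Lp_En oO p1 LH) (Lp_En oO p1 Lg))).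
have Jb n : J (G n) <= I (fun x => `|S x| `^ p).
  have [_ LG _] := Sw n; rewrite J_E.
  apply: (I_le mO (intg_En oO p1 LG) iS) => x _; apply: powR_le; [exact: ltW|exact: enorm_ge0|].
  rewrite ger0_norm; last by rewrite mulr_ge0 ?addr_ge0 ?enorm_ge0.
  apply: (le_trans (enorm_le_sum _)).
  apply: (@le_trans _ _ (\sum_(i < N) (En H x + En g x))); last first.
    by rewrite sumr_const card_ord /S mulr_natl.
  apply: ler_sum => i _; have [_ h'] := hG n; apply: (le_trans (h' i x)).
  by apply: lerD; exact: coord_le_enorm.
have cT := weak_cvg oO fO p1 bT Sw Lv Jb cd.
have [_ _ cI] : [/\ intg (fun x => f x (u x) * v x),
    I (fun x => `|f x (u x) * w n x - f x (u x) * v x|) @[n --> \oo] --> 0 &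
    I (fun x => f x (u x) * w n x) @[n --> \oo] --> I (fun x => f x (u x) * v x)].
  apply: (I_dct mO _ (intg_meas ifv) (intg_abs ifv)).
  - by move=> n; apply: measurable_funM; [exact: caratheodory_comp|exact: (Lwn n).1].
  - by apply: aeW => x _; apply: cvgM; [exact: cvg_cst|exact: cw].
  - move=> n; apply: aeW => x _; rewrite !normrM; apply: ler_wpM2l; first exact: normr_ge0.
    by rewrite !ger0_norm.
move: cT; under eq_fun do rewrite eq.
by move=> cT; exact: (cvg_unique (@Rhausdorff R) cT cI).
Qed.

Lemma el_Aspace v H : Sob v H -> intg (fun x => f x (u x) * v x) ->
  dual_T v = I (fun x => f x (u x) * v x).
Proof.
move=> Sv ifv; have Sn := Sob_scale oO fO p1 (-1) Sv.
have Sp := Sob_pos oO fO p1 Sv; have Sm := Sob_pos oO fO p1 Sn.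
have pos x : 0 <= Num.max (v x) 0 by rewrite le_max lexx orbT.
have neg x : 0 <= Num.max (-1 * v x) 0 by rewrite le_max lexx orbT.
have part w G : Sob w G -> (forall x, `|w x| <= `|v x|) -> intg (fun x => f x (u x) * w x).
  move=> Sw wv; apply: (intg_le mO _ _ (intg_abs ifv)).
    by apply: measurable_funM; [exact: caratheodory_comp|exact: (Sob_Lp Sw).1].
  by move=> x _; rewrite !normrM; apply: ler_wpM2l; [exact: normr_ge0|exact: wv].
have ip := part _ _ Sp (fun x => ltac:(by rewrite ger0_norm// ge_max ler_norm normr_ge0)).
have im := part _ _ Sm (fun x => ltac:(by rewrite ger0_norm// ge_max mulN1r -normrN ler_norm normr_ge0)).
have E x : v x = -1 * Num.max (-1 * v x) 0 + Num.max (v x) 0.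
  rewrite !mulN1r; have [v0|v0] := leP (v x) 0.
    by rewrite max_l ?oppr_ge0// opprK addr0.
  by rewrite max_r ?oppr_le0 ?(ltW v0)// oppr0 add0r.
have Ev : v = fun x => -1 * Num.max (-1 * v x) 0 + Num.max (v x) 0 by apply/funext.
rewrite [in LHS]Ev (bT.1 _ _ _ _ _ Sm Sp) (el_pos Sp pos ip) (el_pos Sm neg im) mulN1r addrC.
by rewrite -(I_sub mO ip im); apply: I_eq => x _; rewrite -mulrBr [in RHS]E mulN1r addrC.
Qed.

End euler_lagrange.


(** * Essential bounds and infinite energies *)

Section transfer.
Variables (R : realType) (N : nat) (Om : set 'rV[R]_N).
Local Notation V := 'rV[R]_N.
Local Notation mu := (lebm R N).
Local Notation I f := (\int[mu]_(x in Om) f x).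
Local Notation intg f := (mu.-integrable Om (EFin \o f)).
Local Notation ae P := {ae mu, forall x, Om x -> P x}.
Hypothesis mO : measurable Om.

Lemma lebm_fun : @lebesgue_rV R N = mu :> (set V -> \bar R).
Proof. by rewrite lebmE. Qed.

Lemma inLp_oo_bounded (E : set V) (u : V -> R) : inLp E +oo%E u ->
  exists2 B : R, 0 <= B & {ae mu, forall x, E x -> `|u x| <= B}.
Proof.
(* The norm of order +oo is an essential supremum only if the whole space has positive measure;
   otherwise every property holds a.e. *)
move=> [_]; rewrite -lebmE unlock /=; have [_ lt|m0 _] := ltP 0%E (mu setT).
  exists `|fine (ess_sup mu (abse \o (EFin \o (u \_ E))))| => //.
  apply: filterS (ess_sup_ge mu (abse \o (EFin \o (u \_ E)))) => x h Ex.
  move: h lt; case: (ess_sup _ _) => [r||] //=; rewrite patchT ?inE//.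
  by rewrite lee_fin => h _; exact: le_trans h (ler_norm r).
exists 0 => //; exists setT; split; [exact: measurableT| |by []].
by apply/eqP; rewrite eq_le m0 measure_ge0.
Qed.

Lemma max_part_intg (w : V -> R) : measurable_fun Om w ->
  intg (fun x => Num.max (w x) 0) -> intg (fun x => Num.max (- w x) 0) -> intg w.
Proof.
move=> mw i1 i2; apply: (intg_eq mO _ (intg_sub mO i1 i2)) => x _.
have [w0|/ltW w0] := leP (w x) 0; first by rewrite max_l ?oppr_ge0// sub0r opprK.
by rewrite max_r ?oppr_le0// subr0.
Qed.

Lemma intg_max (w : V -> R) : intg w -> intg (fun x => Num.max (w x) 0).
Proof.
move=> iw; apply: (intg_le mO _ _ (intg_abs iw)) => [|x _].
  exact: measurable_maxr (intg_meas iw) (measurable_cst _).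
by rewrite ger0_norm ?le_max ?lexx ?orbT// ge_max ler_norm normr_ge0.
Qed.

Lemma integralN_cvt_fin (w : V -> R) : intg w -> integralN_cvt Om w = (- I w)%:E.
Proof.
move=> iw; have i1 := intg_max iw; have i2 := intg_max (intg_opp mO iw).
rewrite /integralN_cvt lebm_fun (intg_fin mO i1) (intg_fin mO i2) /= -EFinB.
congr _%:E; rewrite -(I_sub mO i2 i1) -(I_opp mO iw); apply: I_eq => x _.
have [w0|/ltW w0] := leP (w x) 0; first by rewrite max_l ?oppr_ge0// subr0.
by rewrite max_r ?oppr_le0// sub0r.
Qed.

(** The integrable [U] controls the positive part of [w], so failure of integrability comes from the
    negative part alone. *)
Lemma integralN_cvt_oo (w U : V -> R) : measurable_fun Om w -> ~ intg w -> intg U ->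
  ae (fun x => w x <= U x) -> integralN_cvt Om w = +oo%E.
Proof.
move=> mw nw iU wU; have mp (v : V -> R) : measurable_fun Om v ->
    measurable_fun Om (fun x => Num.max (v x) 0).
  by move=> mv; exact: measurable_maxr mv (measurable_cst _).
have i1 : intg (fun x => Num.max (w x) 0).
  apply: (intg_le_ae mO (mp w mw) _ (intg_abs iU)); apply: filterS wU => x h Ox.
  rewrite ger0_norm ?le_max ?lexx ?orbT// ge_max normr_ge0 andbT.
  exact: le_trans (h Ox) (ler_norm _).
have mN : measurable_fun Om (fun x => - w x).
  apply: (eq_measurable_fun (fun x => -1 * w x)) => [x _|]; first by rewrite mulN1r.
  by apply: measurable_funM; [exact: measurable_cst|exact: mw].
rewrite /integralN_cvt lebm_fun (intg_fin mO i1) /=.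
suff -> : (\int[mu]_(x in Om) (Num.max (- w x) 0)%:E = +oo)%E by [].
apply/eqP; rewrite -leye_eq leNgt; apply/negP => lt; apply: nw.
apply: (max_part_intg mw i1); apply/integrableP; split; first exact/measurable_EFinP/mp.
under eq_integral => x _ do rewrite /= ger0_norm ?le_max ?lexx ?orbT//.
exact: lt.
Qed.

End transfer.



Unset Implicit Arguments.

Theorem theorem8 (R : realType) (N : nat) (hN : (0 < N)%N)
  (Omega : set 'rV[R]_N) (hOmega : domain Omega) (bOmega : bounded_set Omega)
  (p : R) (hp : 1 < p)
  (lambda1 : R) (hlambda1 : first_eigenvalue Omega p lambda1)
  (phi1 : 'rV[R]_N -> R)
  (hphi1 : normalized_positive_eigenfunction Omega p lambda1 phi1)
  (h : ('rV[R]_N -> R) -> R) (hh : dualW01p Omega p h)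
  (f : 'rV[R]_N -> R -> R) (hf : caratheodory_function Omega f)
  (hfL1 : forall r : R, 0 < r ->
    (@lebesgue_rV R N).-integrable Omega
      (fun x => ereal_sup [set (`|f x s|)%:E | s in [set s | `|s| <= r]]))
  (eta : 'rV[R]_N -> R) (heta : inY1 Omega p eta)
  (H1 : G1_le_unif Omega (resonant_primitive f p lambda1) eta)
  (H2m : (\int[lebesgue_rV]_(x in Omega)
            (G1minus (resonant_primitive f p lambda1) x * (phi1 x)%:E)
          < (h phi1)%:E)%E)
  (H2p : ((h phi1)%:E
          < - \int[lebesgue_rV]_(x in Omega)
            (G1plus (resonant_primitive f p lambda1) x * (phi1 x)%:E))%E) :
  exists u : 'rV[R]_N -> R,
    [/\ W01p Omega p u,
        (forall v, W01p Omega p v ->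
           (energy Omega p f h u <= energy Omega p f h v)%E),
        (@lebesgue_rV R N).-integrable Omega
          (fun x => (primitive f x (u x))%:E) &
        weak_solution Omega p f h u].
Proof.
have [nO oO cO] := hOmega; have mO := open_measurable_rV oO.
have [s0 [a [s0p OQ]]] := bounded_in_hb bOmega.
have fO : (lebm R N Omega < +oo)%E.
  apply: le_lt_trans (hb_fin hN s0p 0 a); apply: le_measure; rewrite ?inE//.
  exact: measurable_hb.
have p0 : 0 < p := lt_trans ltr01 hp.
have [la0 lb] := first_eigenvalueP oO fO hp hlambda1.
have [phi [G [phi0 phE Sphi _ EL]]] := eigenfunctionP oO fO hp hphi1.
have bh := dual_blf oO fO hp hh.
have hE : h phi1 = h phi.
  have [W1 _ _ _] := hphi1.
  exact: (blf_ae oO fO hp bh (W01p_Sob oO fO hp W1) Sphi phE).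
have teta := inY1_tail_ok hN s0p oO OQ hp heta.
(* From here on the analysis is carried out for [f'] and transferred to [f], which agrees with it
   for a.e. x. *)
have [f' [mf cf ff]] := caratheodory_continuous mO hf.
have prE x : f x = f' x -> primitive f x = primitive f' x.
  by move=> E; apply/funext => s; rewrite /primitive E.
have fK r : 0 < r -> exists K : 'rV[R]_N -> R, (lebm R N).-integrable Omega (EFin \o K) /\
    {ae lebm R N, forall x, Omega x -> forall s, `|s| <= r -> `|f' x s| <= K x}.
  move=> r0; have := hfL1 r r0; rewrite lebm_fun => /(sup_bound mO)[K [iK hK]].
  exists K; split; first exact: iK.
  by apply: filterS2 ff hK => x e h' Ox s; rewrite -(e Ox); exact: h'.
have [r r0 Hr] := H1 1 ltr01; have [K [iK hK]] := fK r r0.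
have Hr' : {ae lebm R N, forall x, Omega x -> forall s, r <= `|s| ->
    resonant_primitive f' p lambda1 x s <= (eta x + 1) * `|s|}.
  move: Hr; rewrite lebm_fun; apply: filterS2 ff => x e h' Ox s.
  by rewrite /resonant_primitive -(prE x (e Ox)); exact: h'.
have ubF := resonant_bound cf la0 p0 r0 Hr' hK.
have ik := intg_scale mO r iK.
have mF u := @primitive_comp R N Omega mO f' u mf cf.
have slp : {ae lebm R N, forall x, Omega x -> forall y : R,
    (G1plus (resonant_primitive f p lambda1) x < y%:E)%E -> exists M, forall s,
    M <= 1 * s -> primitive f' x s - lambda1 / p * `|s| `^ p <= y * `|s|}.
  apply: filterS ff => x e Ox y /G1plus_slope [M hM]; exists M => s Ms; have := hM s Ms.
  by rewrite /resonant_primitive (prE x (e Ox)).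
have slm : {ae lebm R N, forall x, Omega x -> forall y : R,
    (G1minus (resonant_primitive f p lambda1) x < y%:E)%E -> exists M, forall s,
    M <= -1 * s -> primitive f' x s - lambda1 / p * `|s| `^ p <= y * `|s|}.
  apply: filterS ff => x e Ox y /G1minus_slope [M hM]; exists M => s Ms; have := hM s Ms.
  by rewrite /resonant_primitive (prE x (e Ox)).
rewrite lebm_fun hE in H2m; rewrite lebm_fun hE in H2p.
have cF : {ae lebm R N, forall x, Omega x -> continuous (primitive f' x)}.
  by apply: aeW => x _; exact: primitive_continuous.
have [u [g [Su iFu Fmin]]] := minimizer hN s0p oO cO nO OQ hp teta ik la0 bh mF ubF
  Sphi phi0 phE EL lb slp slm H2m H2p cF (fun x => primitive0 f' x).
have aeF v : {ae lebm R N, forall x, Omega x -> primitive f' x (v x) = primitive f x (v x)}.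
  by apply: filterS ff => x e Ox; rewrite (prE x (e Ox)).
have mFf v H : Sob Omega p v H -> measurable_fun Omega (fun x => primitive f x (v x)).
  move=> Sv; exact: (lebm_ae_measurable mO (mF v (Sob_Lp Sv).1) (aeF v)).
have iFf v H : Sob Omega p v H ->
    (lebm R N).-integrable Omega (EFin \o (fun x => primitive f' x (v x))) ->
    (lebm R N).-integrable Omega (EFin \o (fun x => primitive f x (v x))).
  by move=> Sv; exact: (intg_eq_ae mO (mFf v H Sv) (aeF v)).
have enF v H : Sob Omega p v H ->
    (lebm R N).-integrable Omega (EFin \o (fun x => primitive f' x (v x))) ->
    energy Omega p f h v = (Phi Omega p (primitive f') h v H)%:E.
  move=> Sv iv; have iv' := iFf v H Sv iv.
  rewrite /energy (energy_grad oO fO hp Sv) (integralN_cvt_fin mO iv') /Phi.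
  by rewrite -(I_eq_ae mO (intg_meas iv) (intg_meas iv') (aeF v)).
have Wu := Sob_W01p oO fO hp Su.
exists u; split.
- exact: Wu.
- move=> v Wv; have Sv := W01p_Sob oO fO hp Wv.
  have [iv|niv] := pselect ((lebm R N).-integrable Omega (EFin \o (fun x => primitive f' x (v x)))).
    by rewrite (enF u g Su iFu) (enF v _ Sv iv) lee_fin; exact: Fmin.
  (* A competitor v for which F(x, v) is not integrable has energy +oo, as F(x, v) is bounded above
     by an integrable function. *)
  have [[_ iLv] iEv] := conj (Sob_Lp Sv) (lin_intg hN s0p oO OQ hp teta Sv).
  rewrite /energy (integralN_cvt_oo mO (mFf v _ Sv) _
    (intg_add mO (intg_scale mO (lambda1 / p) iLv) (intg_add mO iEv ik))).
  + by rewrite addeC leey.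
  + move=> iv; apply: niv; apply: (intg_eq_ae mO (mF v (Sob_Lp Sv).1) _ iv).
    exact: (ae_sym (aeF v)).
  + apply: filterS2 ubF (aeF v) => x ub e Ox; rewrite -(e Ox).
    apply: (le_trans (ub Ox (v x))); by rewrite lerD2l lerD2r /lin normrM mulrDl mul1r.
- by rewrite lebm_fun; exact: (iFf u g Su iFu).
have aef v : {ae lebm R N, forall x, Omega x -> f' x (u x) * v x = f x (u x) * v x}.
  by apply: filterS ff => x e Ox; rewrite (e Ox).
have [Tlin [C hC]] := dual_TP oO fO hp hh Su.
have mfv v : measurable_fun Omega v -> measurable_fun Omega (fun x => f' x (u x) * v x).
  move=> mv; apply: measurable_funM; last exact: mv.
  exact: (@caratheodory_comp R N Omega mO f' u mf cf (Sob_Lp Su).1).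
have If v : measurable_fun Omega v -> \int[lebesgue_rV]_(x in Omega) (f x (u x) * v x) =
    \int[lebm R N]_(x in Omega) (f' x (u x) * v x).
  move=> mv; rewrite -lebmE; symmetry; apply: (I_eq_ae mO (mfv v mv)); last exact: aef.
  exact: (lebm_ae_measurable mO (mfv v mv) (aef v)).
split; first exact: Wu.
(* On A_u the integral is the value of [dual_T], bounded on the unit ball by the constant of
   [dual_TP]. *)
- apply: (@le_lt_trans _ _ (`|C|)%:E); last exact: ltry.
  apply/ereal_supP => _ [v [[Wv iv] nv] <-]; have Sv := W01p_Sob oO fO hp Wv.
  have mv := (Sob_Lp Sv).1; rewrite (If v mv) lee_fin.
  rewrite lebm_fun in iv.
  have iv' : (lebm R N).-integrable Omega (EFin \o (fun x => f' x (u x) * v x)).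
    exact: (intg_eq_ae mO (mfv v mv) (ae_sym (aef v)) iv).
  rewrite -(el_Aspace oO fO hp hh mf cf Su fK iFu Fmin Sv iv').
  apply: (le_trans (ler_norm _)); apply: (le_trans (hC v Wv)).
  apply: (@le_trans _ _ (`|C| * norm1p Omega p v)).
    by apply: ler_wpM2r; [exact: powR_ge0|exact: ler_norm].
  by rewrite ler_piMr.
exists (dual_T Omega p h u) => [|v Wv]; last by rewrite /dual_T subrK.
split; first exact: (dual_TP oO fO hp hh Su).
move=> v [Wv [vB _] uB]; have Sv := W01p_Sob oO fO hp Wv.
have [B1 B10 h1] := inLp_oo_bounded vB; have [B2 B20 h2] := inLp_oo_bounded uB.
rewrite (If v (Sob_Lp Sv).1).
(* For v in V_u both v and, where v is nonzero, u are essentially bounded; the sum of the two bounds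
   serves as [B]. *)
have [|_ ->//] := el_eq oO fO hp hh mf cf Su fK iFu Fmin Sv (addr_ge0 B10 B20).
apply: filterS2 h1 h2 => x h1 h2 Ox; split=> [|vn]; first by rewrite ler_wpDr// h1.
by rewrite ler_wpDl// h2.
Qed.
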